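(* The reduced HOMFLY homology of the negative torus link $T(3,-3)$, presented as the closure of the three-strand braid $(\sigma_1^{-1}\sigma_2^{-1})^3$, is given as follows, as graded right $R$-modules, with all other groups zero: $$\overline{\mathrm{HHH}}^{A=0}:\quad T=0:\ R;$$ $$\overline{\mathrm{HHH}}^{A=1}:\quad T=0:\ R(6)\oplus R(4),\qquad T=-1:\ \Big(\frac{R\oplus R}{R\,(\alpha_t,-\alpha_s)+R\,(0,\alpha_s\alpha_t+\alpha_s^2)}\Big)(4),\qquad T=-2:\ \Bbbk(2);$$ $$\overline{\mathrm{HHH}}^{A=2}:\quad T=0:\ R(10),\qquad T=-1:\ \Big(\frac{R\oplus R}{R\,(\alpha_t,-\alpha_s)+R\,(\alpha_s\alpha_t+\alpha_t^2,0)}\Big)(8),\qquad T=-2:\ \Bbbk(6),\qquad T=-4:\ \Bbbk(2).$$ Its Poincaré series is $$\frac{1}{(1-Q^2)^2}+A\Big(T^{-2}Q^{-2}+\frac{T^{-1}Q^{-4}(2+Q^2)}{1-Q^2}+\frac{Q^{-6}+Q^{-4}}{(1-Q^2)^2}\Big)+A^2\Big(T^{-4}Q^{-2}+T^{-2}Q^{-6}+\frac{T^{-1}Q^{-8}(2+Q^2)}{1-Q^2}+\frac{Q^{-10}}{(1-Q^2)^2}\Big).$$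
   Context: $\Bbbk$ is a field of characteristic $0$, $R=\Bbbk[\alpha_s,\alpha_t]$ with $\deg\alpha_s=\deg\alpha_t=2$, on which $S_3=\langle s,t\rangle$ acts by the geometric (reflection) representation: $s(\alpha_s)=-\alpha_s$, $s(\alpha_t)=\alpha_s+\alpha_t$, and symmetrically for $t$. $R^e=R\otimes_\Bbbk R$; $M(1)_d=M_{d+1}$; $\Bbbk=R/(\alpha_s,\alpha_t)$. $B_i=R\otimes_{R^i}R(1)$. Rouquier complexes (bounded complexes of graded bimodules up to homotopy): $F(\sigma_1)=(B_s\to R(1))$ with differential $f\otimes g\mapsto fg$ and $F(\sigma_1^{-1})=(R(-1)\to B_s)$ with differential $1\mapsto\frac12(\alpha_s\otimes1+1\otimes\alpha_s)$, with $B_s$ in cohomological degree $0$ in both; $F(\sigma_2^{\pm1})$ is the same with $t$; $F$ of a product is the tensor product over $R$. $\mathrm{HH}^k(M)=\bigoplus_\ell\mathrm{Ext}^k_{R^e}(R,M(\ell))$ (graded bimodules), with internal grading by $\ell$ and right $R$-action through $M$. $\overline{\mathrm{HHH}}^{A=k}(\beta)$ is the cohomology of the complex $\mathrm{HH}^k(F(\beta))$ obtained by applying $\mathrm{HH}^k$ termwise; its part in cohomological degree $j$ is the part $T=j$. The Poincaré series is $\sum A^kT^jQ^d\dim_\Bbbk(\overline{\mathrm{HHH}}^{A=k,T=j})_d$. *)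

(* Defs.v *)
From HB Require Import structures.
From mathcomp Require Import all_boot all_order all_algebra.
From mathcomp Require Import generic_quotient ring_quotient.
From mathcomp Require Import boolp functions.
From mathcomp.multinomials Require Import freeg mpoly.

Set Implicit Arguments.
Unset Strict Implicit.
Unset Printing Implicit Defensive.

Import GRing.Theory.

Local Open Scope ring_scope.

Definition homog_span (V : zmodType) (h : int -> V -> Prop) (x : V) : Prop :=
  exists (s : seq int) (f : int -> V),
    [/\ uniq s, forall i, h i (f i) & x = \sum_(i <- s) f i].

(* [h d x] reads "x is homogeneous of degree d"; the record says that V is the
   direct sum of its homogeneous parts. *)
Record is_grading (V : zmodType) (h : int -> V -> Prop) : Prop := IsGrading {
  gr0 : forall d, h d 0;
  grB : forall d x y, h d x -> h d y -> h d (x - y);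
  gr_indep : forall (s : seq int) (f : int -> V), uniq s ->
    (forall i, h i (f i)) -> \sum_(i <- s) f i = 0 ->
    forall i, i \in s -> f i = 0;
  gr_span : forall x, homog_span h x }.

Section SumExt.
Variables (V : zmodType).

Lemma sum_supp (s t : seq int) (f : int -> V) : uniq s -> uniq t ->
  {subset s <= t} -> (forall i, i \notin s -> f i = 0) ->
  \sum_(i <- s) f i = \sum_(i <- t) f i.
Proof.
move=> us ut st f0; rewrite [RHS](bigID (mem s)) /= [X in _ + X]big1 ?addr0 //.
rewrite -[RHS]big_filter; apply: perm_big; apply: uniq_perm => //.
  exact: filter_uniq.
move=> i; rewrite mem_filter /=.
by case: (boolP (i \in s)) => // /st ->.
Qed.

End SumExt.

Section Span.
Variables (V : zmodType) (h : int -> V -> Prop).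
Hypothesis h0 : forall d, h d 0.
Hypothesis hB : forall d x y, h d x -> h d y -> h d (x - y).

Lemma homog_opp d x : h d x -> h d (- x).
Proof. by move=> hx; rewrite -sub0r; apply: hB. Qed.

Lemma homog_add d x y : h d x -> h d y -> h d (x + y).
Proof. by move=> hx hy; rewrite -[y]opprK; apply: hB => //; apply: homog_opp. Qed.

Lemma homog_sum d (I : Type) (r : seq I) (F : I -> V) :
  (forall i, h d (F i)) -> h d (\sum_(i <- r) F i).
Proof. by move=> hF; elim/big_ind: _ => //; apply: homog_add. Qed.

Lemma homog_spanP x : homog_span h x -> exists (s : seq int) (f : int -> V),
  [/\ uniq s, forall i, h i (f i), forall i, i \notin s -> f i = 0
    & x = \sum_(i <- s) f i].
Proof.
case=> s [f [us hf ->]]; exists s, (fun i => if i \in s then f i else 0).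
split=> // [i|i /negbTE -> //|]; first by case: ifP.
by apply: eq_big_seq => i ->.
Qed.

Lemma homog_span0 : homog_span h 0.
Proof. by exists [::], (fun=> 0); rewrite big_nil; split. Qed.

Lemma homog_spanB x y : homog_span h x -> homog_span h y -> homog_span h (x - y).
Proof.
move=> /homog_spanP[s [f [us hf f0 ->]]] /homog_spanP[t [g [ut hg g0 ->]]].
exists (undup (s ++ t)), (fun i => f i - g i); split=> [|i|]; first exact: undup_uniq.
  exact: hB.
rewrite sumrB; congr (_ - _); apply: sum_supp; rewrite ?undup_uniq // => i;
  by rewrite mem_undup mem_cat => ->; rewrite ?orbT.
Qed.

Lemma homog_spanD x y : homog_span h x -> homog_span h y -> homog_span h (x + y).
Proof.
move=> hx hy; rewrite -[y]opprK; apply: homog_spanB => //.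
by rewrite -sub0r; apply: homog_spanB => //; apply: homog_span0.
Qed.

Lemma homog_span1 d x : h d x -> homog_span h x.
Proof.
move=> hx; exists [:: d], (fun i => if i == d then x else 0).
by rewrite big_seq1 eqxx; split=> // i; case: eqP => // ->.
Qed.

Lemma homog_span_sum (I : Type) (r : seq I) (F : I -> V) :
  (forall i, homog_span h (F i)) -> homog_span h (\sum_(i <- r) F i).
Proof.
move=> hF; elim/big_ind: _ => //; first exact: homog_span0.
exact: homog_spanD.
Qed.

End Span.

Section GradingTheory.
Variables (V : zmodType) (h : int -> V -> Prop) (H : is_grading h).

Lemma gcomp_ex (x : V) : exists sf : seq int * (int -> V),
  [/\ uniq sf.1, forall i, h i (sf.2 i), forall i, i \notin sf.1 -> sf.2 i = 0
    & x = \sum_(i <- sf.1) sf.2 i].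
Proof.
have [s [f [? ? ? ?]]] := homog_spanP (gr0 H) (gr_span H x).
by exists (s, f).
Qed.

Definition gsupp (x : V) : seq int := (sval (cid (gcomp_ex x))).1.
Definition gcomp (x : V) : int -> V := (sval (cid (gcomp_ex x))).2.

Lemma gsupp_uniq x : uniq (gsupp x).
Proof. by rewrite /gsupp; case: cid => -[s f] []. Qed.

Lemma gcomp_homog x i : h i (gcomp x i).
Proof. by rewrite /gcomp; case: cid => -[s f] []. Qed.

Lemma gcomp_out x i : i \notin gsupp x -> gcomp x i = 0.
Proof. by rewrite /gcomp /gsupp; case: cid => -[s f] [] /= _ _ + _; apply. Qed.

Lemma gcomp_sum x : x = \sum_(i <- gsupp x) gcomp x i.
Proof. by rewrite /gcomp /gsupp; case: cid => -[s f] []. Qed.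

Lemma gcompP x s f : uniq s -> (forall i, h i (f i)) ->
  (forall i, i \notin s -> f i = 0) -> x = \sum_(i <- s) f i -> gcomp x =1 f.
Proof.
move=> us hf f0 xE i.
pose t := undup (gsupp x ++ s).
have ut : uniq t by exact: undup_uniq.
have E : \sum_(i <- t) (gcomp x i - f i) = 0.
  have st : {subset gsupp x <= t} by move=> j js; rewrite mem_undup mem_cat js.
  have tt : {subset s <= t} by move=> j js; rewrite mem_undup mem_cat js orbT.
  rewrite sumrB -(sum_supp us ut tt f0) -xE.
  rewrite -(sum_supp (gsupp_uniq x) ut st (@gcomp_out x)).
  by rewrite -gcomp_sum subrr.
case: (boolP (i \in t)) => it.
  apply/eqP; rewrite -subr_eq0; apply/eqP; move: i it.
  apply: (gr_indep H ut _ E) => i; apply: (grB H) => //; exact: gcomp_homog.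
move: it; rewrite mem_undup mem_cat negb_or => /andP[i1 i2].
by rewrite gcomp_out // f0.
Qed.

Lemma gcompB x y i : gcomp (x - y) i = gcomp x i - gcomp y i.
Proof.
apply: (@gcompP _ (undup (gsupp x ++ gsupp y)) (fun i => gcomp x i - gcomp y i)).
- exact: undup_uniq.
- by move=> j; apply: (grB H); apply: gcomp_homog.
- move=> j; rewrite mem_undup mem_cat negb_or => /andP[? ?].
  by rewrite !gcomp_out // subrr.
rewrite sumrB {1}[x]gcomp_sum {1}[y]gcomp_sum; congr (_ - _);
  apply: sum_supp; rewrite ?undup_uniq ?gsupp_uniq //; try exact: gcomp_out;
  by move=> j; rewrite mem_undup mem_cat => ->; rewrite ?orbT.
Qed.

Lemma gcomp1 d x i : h d x -> gcomp x i = if i == d then x else 0.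
Proof.
move=> hx; apply: (@gcompP _ [:: d] (fun i => if i == d then x else 0)) => //.
- by move=> j; case: eqP => [-> //|_]; apply: (gr0 H).
- by move=> j; rewrite inE => /negbTE ->.
- by rewrite big_seq1 eqxx.
Qed.

End GradingTheory.

(* The variables of R have degree 2. *)
Definition pdeg (k : fieldType) (d : int) (p : {mpoly k[2]}) : Prop :=
  forall m, m \in msupp p -> ((2 * mdeg m)%N : int) = d.

Section PolyGrading.
Variable k : fieldType.
Local Notation R := {mpoly k[2]}.

Lemma pdeg0 d : pdeg d (0 : R).
Proof. by move=> m; rewrite msupp0. Qed.

Lemma pdegB d (p q : R) : pdeg d p -> pdeg d q -> pdeg d (p - q).
Proof.
by move=> hp hq m /msuppB_le; rewrite mem_cat => /orP[/hp|/hq].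
Qed.

Lemma pdegM d e (p q : R) : pdeg d p -> pdeg e q -> pdeg (d + e) (p * q).
Proof.
move=> hp hq m /msuppM_le /allpairsP[[m1 m2] /= [/hp <- /hq <- ->]].
by rewrite mdegD mulnDr PoszD.
Qed.

Lemma pdegC (c : k) : pdeg 0 (c%:MP : R).
Proof. by move=> m; rewrite msuppC; case: ifP => // _; rewrite inE => /eqP ->; rewrite mdeg0. Qed.

Lemma pdegX (i : 'I_2) : pdeg 2 ('X_i : R).
Proof. by move=> m; rewrite msuppX inE => /eqP ->; rewrite mdeg1. Qed.

Lemma pdegXm (m : 'X_{1..2}) : pdeg (2 * mdeg m)%N ('X_[m] : R).
Proof. by move=> m'; rewrite msuppX inE => /eqP ->. Qed.

Lemma pdegZ d c (p : R) : pdeg d p -> pdeg d (c *: p).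
Proof. by move=> hp m /msuppZ_le /hp. Qed.

Lemma pdeg_grading : is_grading (@pdeg k).
Proof.
split=> [d|d p q|s f us hf /mpolyP E i si|p]; first exact: pdeg0.
- exact: pdegB.
- apply/mpolyP => m; rewrite mcoeff0.
  case: (boolP (m \in msupp (f i))) => [mi|]; last by move/memN_msupp_eq0.
  have := E m; rewrite mcoeff0 raddf_sum /= (bigD1_seq i) //= big1 ?addr0 //.
  move=> j ji; apply: memN_msupp_eq0; apply/negP => /hf mj.
  by move: ji; rewrite -mj (hf _ _ mi) eqxx.
- elim/mpolyind: p => [|c m p _ _ hp]; first exact: (homog_span0 pdeg0).
  apply: (homog_spanD pdeg0 pdegB) => //.
  by apply: (homog_span1 pdeg0 (d := (2 * mdeg m)%N)); apply/pdegZ/pdegXm.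
Qed.

End PolyGrading.

Record gmod (k : fieldType) := Gmod {
  gmod_car :> lmodType {mpoly k[2]};
  gdeg : int -> gmod_car -> Prop;
  gdeg_grading : is_grading gdeg;
  gdegZ : forall e d (a : {mpoly k[2]}) x,
    pdeg e a -> gdeg d x -> gdeg (e + d) (a *: x) }.

(* Graded R-bimodules on which the two actions of k agree, that is, graded
   modules over R^e = R (x)_k R. *)
Record grbimod (k : fieldType) := Grbimod {
  bim_car :> zmodType;
  lact : {mpoly k[2]} -> bim_car -> bim_car;
  ract : bim_car -> {mpoly k[2]} -> bim_car;
  lactA : forall a b x, lact a (lact b x) = lact (a * b) x;
  lact1 : forall x, lact 1 x = x;
  lactDr : forall a x y, lact a (x + y) = lact a x + lact a y;
  lactDl : forall a b x, lact (a + b) x = lact a x + lact b x;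
  ractA : forall x a b, ract (ract x a) b = ract x (a * b);
  ract1 : forall x, ract x 1 = x;
  ractDl : forall x y a, ract (x + y) a = ract x a + ract y a;
  ractDr : forall x a b, ract x (a + b) = ract x a + ract x b;
  lractA : forall a x b, ract (lact a x) b = lact a (ract x b);
  lractC : forall (c : k) x, lact c%:MP x = ract x c%:MP;
  bdeg : int -> bim_car -> Prop;
  bdeg_grading : is_grading bdeg;
  bdeg_lact : forall e d a x, pdeg e a -> bdeg d x -> bdeg (e + d) (lact a x);
  bdeg_ract : forall e d a x, pdeg e a -> bdeg d x -> bdeg (e + d) (ract x a) }.

Record ghom (k : fieldType) (M N : grbimod k) := Ghom {
  ghom_fun :> M -> N;
  ghomB : forall x y, ghom_fun (x - y) = ghom_fun x - ghom_fun y;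
  ghom_lact : forall a x, ghom_fun (lact a x) = lact a (ghom_fun x);
  ghom_ract : forall x a, ghom_fun (ract x a) = ract (ghom_fun x) a;
  ghom_deg : forall d x, bdeg d x -> bdeg d (ghom_fun x) }.

Section GhomTheory.
Variables (k : fieldType) (M N : grbimod k) (f : ghom M N).
Lemma ghom0 : f 0 = 0. Proof. by rewrite -(subrr 0) ghomB subrr. Qed.
Lemma ghomN x : f (- x) = - f x. Proof. by rewrite -sub0r ghomB ghom0 sub0r. Qed.
Lemma ghomD x y : f (x + y) = f x + f y.
Proof. by rewrite -[y]opprK ghomB ghomN !opprK. Qed.
Lemma ghom_sum (I : Type) (r : seq I) (F : I -> M) :
  f (\sum_(i <- r) F i) = \sum_(i <- r) f (F i).
Proof. by apply: big_morph; [exact: ghomD | exact: ghom0]. Qed.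
End GhomTheory.

Section BimTheory.
Variables (k : fieldType) (M : grbimod k).
Lemma lact0r a : lact a (0 : M) = 0.
Proof. by apply: (addrI (lact a 0)); rewrite -lactDr !addr0. Qed.
Lemma ract0l a : ract (0 : M) a = 0.
Proof. by apply: (addrI (ract 0 a)); rewrite -ractDl !addr0. Qed.
Lemma lact0l (x : M) : lact 0 x = 0.
Proof. by apply: (addrI (lact 0 x)); rewrite -lactDl !addr0. Qed.
Lemma ract0r (x : M) : ract x 0 = 0.
Proof. by apply: (addrI (ract x 0)); rewrite -ractDr !addr0. Qed.
Lemma lactN a (x : M) : lact a (- x) = - lact a x.
Proof. by apply: (addrI (lact a x)); rewrite -lactDr !subrr lact0r. Qed.
Lemma ractN a (x : M) : ract (- x) a = - ract x a.
Proof. by apply: (addrI (ract x a)); rewrite -ractDl !subrr ract0l. Qed.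
Lemma lactBr a (x y : M) : lact a (x - y) = lact a x - lact a y.
Proof. by rewrite lactDr lactN. Qed.
Lemma ractBl a (x y : M) : ract (x - y) a = ract x a - ract y a.
Proof. by rewrite ractDl ractN. Qed.
Lemma lactNl a (x : M) : lact (- a) x = - lact a x.
Proof. by apply: (addrI (lact a x)); rewrite -lactDl !subrr lact0l. Qed.
Lemma ractNr a (x : M) : ract x (- a) = - ract x a.
Proof. by apply: (addrI (ract x a)); rewrite -ractDr !subrr ract0r. Qed.
End BimTheory.

Lemma shift_grading (V : zmodType) (h : int -> V -> Prop) (n : int) :
  is_grading h -> is_grading (fun d => h (d + n)).
Proof.
move=> H; split=> [d|d x y|s f us hf E i si|x]; first exact: (gr0 H).
- exact: (grB H).
- have inj : injective (fun i : int => i + n) by exact: addIr.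
  have us' : uniq (map (fun i => i + n) s) by rewrite map_inj_uniq.
  have hf' j : h j (f (j - n)) by have := hf (j - n); rewrite subrK.
  rewrite -[i](addrK n); apply: (gr_indep H us' hf' _ (map_f _ si)).
  by rewrite big_map -[RHS]E; apply: eq_bigr => j _; rewrite addrK.
have [s [f [us hf ->]]] := gr_span H x.
exists (map (fun i => i - n) s), (fun i => f (i + n)); split=> [|i|//].
- by rewrite map_inj_uniq //; exact: addIr.
- exact: hf.
- by rewrite big_map; apply: eq_bigr => j _; rewrite subrK.
Qed.

Lemma prod_grading (V W : zmodType) (h : int -> V -> Prop) (g : int -> W -> Prop) :
  is_grading h -> is_grading g ->
  is_grading (fun d (x : V * W) => h d x.1 /\ g d x.2).
Proof.
move=> H G.
have P0 d : h d (0 : V * W).1 /\ g d (0 : V * W).2.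
  by split; [exact: (gr0 H) | exact: (gr0 G)].
have PB d (x y : V * W) : h d x.1 /\ g d x.2 -> h d y.1 /\ g d y.2 ->
    h d (x - y).1 /\ g d (x - y).2.
  by case=> ? ? [? ?]; split; [apply: (grB H) | apply: (grB G)].
split=> [d|d x y|s f us hf E i si|[x y]]; [exact: P0 | exact: PB | | ].
- rewrite [f i]surjective_pairing.
  have E1 : \sum_(i <- s) (f i).1 = 0 by rewrite -(raddf_sum fst) /= E.
  have E2 : \sum_(i <- s) (f i).2 = 0 by rewrite -(raddf_sum snd) /= E.
  rewrite (gr_indep H us (fun j => (hf j).1) E1 si).
  by rewrite (gr_indep G us (fun j => (hf j).2) E2 si).
have -> : (x, y) = (x, 0) + (0, y) :> V * W.
  by rewrite [RHS]surjective_pairing /= addr0 add0r.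
apply: (homog_spanD P0 PB).
  have [s [f [us hf ->]]] := gr_span H x.
  exists s, (fun i => (f i, 0)); split=> // [i|]; first by split=> //; exact: (gr0 G).
  rewrite [RHS]surjective_pairing (raddf_sum fst) (raddf_sum snd) /=.
  by congr pair; rewrite big1.
have [s [f [us hf ->]]] := gr_span G y.
exists s, (fun i => (0, f i)); split=> // [i|]; first by split=> //; exact: (gr0 H).
rewrite [RHS]surjective_pairing (raddf_sum fst) (raddf_sum snd) /=.
by congr pair; rewrite big1.
Qed.

Section BasicBimodules.
Variable k : fieldType.
Local Notation R := {mpoly k[2]}.

(* M(n) with M(n)_d = M_{d+n}. *)
Definition bshift (n : int) (M : grbimod k) : grbimod k.
Proof.
refine (@Grbimod k M (@lact k M) (@ract k M) (@lactA k M) (@lact1 k M)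
  (@lactDr k M) (@lactDl k M) (@ractA k M) (@ract1 k M) (@ractDl k M)
  (@ractDr k M) (@lractA k M) (@lractC k M) (fun d => @bdeg k M (d + n))
  (shift_grading n (bdeg_grading M)) _ _) => e d a x ha hx; rewrite -addrA.
- exact: bdeg_lact.
- exact: bdeg_ract.
Defined.

Definition bsum (M N : grbimod k) : grbimod k.
Proof.
refine (@Grbimod k (M * N)%type (fun a x => (lact a x.1, lact a x.2))
  (fun x a => (ract x.1 a, ract x.2 a)) _ _ _ _ _ _ _ _ _ _
  (fun d x => bdeg d x.1 /\ bdeg d x.2)
  (prod_grading (bdeg_grading M) (bdeg_grading N)) _ _).
- by move=> a b x /=; rewrite !lactA.
- by case=> x y; rewrite /= !lact1.
- by move=> a x y; rewrite /= !lactDr.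
- by move=> a b x; rewrite /= !lactDl.
- by move=> x a b; rewrite /= !ractA.
- by case=> x y; rewrite /= !ract1.
- by move=> x y a; rewrite /= !ractDl.
- by move=> x a b; rewrite /= !ractDr.
- by move=> a x b; rewrite /= !lractA.
- by move=> c x; rewrite /= !lractC.
- by move=> e d a x ha [h1 h2]; split; apply: bdeg_lact.
- by move=> e d a x ha [h1 h2]; split; apply: bdeg_ract.
Defined.

Definition breg : grbimod k.
Proof.
refine (@Grbimod k R (fun a x => a * x) (fun x a => x * a) _ _ _ _ _ _ _ _ _ _
  (@pdeg k) (pdeg_grading k) _ _).
- by move=> a b x; rewrite mulrA.
- by move=> x; rewrite mul1r.
- by move=> a x y; rewrite mulrDr.
- by move=> a b x; rewrite mulrDl.
- by move=> x a b; rewrite mulrA.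
- by move=> x; rewrite mulr1.
- by move=> x y a; rewrite mulrDl.
- by move=> x a b; rewrite mulrDr.
- by move=> a x b; rewrite mulrA.
- by move=> c x; rewrite mulrC.
- by move=> e d a x; exact: pdegM.
- by move=> e d a x ha hx; rewrite addrC; apply: pdegM.
Defined.

Lemma zero_grading : is_grading (fun (_ : int) (_ : 'rV[k]_0) => True).
Proof.
split=> // [s f _ _ _ i _|x]; first by rewrite [f i]thinmx0.
by exists [::], (fun=> 0); rewrite [x]thinmx0 big_nil.
Qed.

Definition bzero : grbimod k.
Proof.
by refine (@Grbimod k 'rV[k]_0 (fun _ x => x) (fun x _ => x) _ _ _ _ _ _ _ _ _ _
  (fun _ _ => True) zero_grading _ _) => // *; rewrite [LHS]thinmx0 [RHS]thinmx0.
Defined.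

End BasicBimodules.

Record grsubalg (k : fieldType) := Grsubalg {
  sa_mem :> {mpoly k[2]} -> Prop;
  sa_C : forall c : k, sa_mem c%:MP;
  sa_D : forall a b, sa_mem a -> sa_mem b -> sa_mem (a + b);
  sa_M : forall a b, sa_mem a -> sa_mem b -> sa_mem (a * b);
  sa_span : forall a, sa_mem a -> exists (s : seq int) (f : int -> {mpoly k[2]}),
    [/\ uniq s, forall i, pdeg i (f i), forall i, sa_mem (f i)
      & a = \sum_(i <- s) f i] }.

Section FreeExt.
Variables (K : choiceType) (W : zmodType).

Definition fext (f : K -> W) (D : {freeg K / int}) : W :=
  fglift (f : K -> zmodule W) D.

Lemma fext_sub f D E : fext f (D - E) = fext f D - fext f E.
Proof. exact: (@lift_is_additive int K (zmodule W) f D E). Qed.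

Lemma fextU f x : fext f << x >> = f x.
Proof. by rewrite /fext liftU scale1r. Qed.

End FreeExt.

Section AddFun.
Variables (V W : zmodType) (f : V -> W).
Hypothesis fB : forall x y, f (x - y) = f x - f y.
Lemma subf0 : f 0 = 0. Proof. by rewrite -(subrr 0) fB subrr. Qed.
Lemma subfN x : f (- x) = - f x. Proof. by rewrite -sub0r fB subf0 sub0r. Qed.
Lemma subfD x y : f (x + y) = f x + f y.
Proof. by rewrite -[y]opprK fB subfN !opprK. Qed.
Lemma subf_sum (I : Type) (r : seq I) (F : I -> V) :
  f (\sum_(i <- r) F i) = \sum_(i <- r) f (F i).
Proof. by apply: big_morph; [exact: subfD | exact: subf0]. Qed.
Lemma subfMz x n : f (x *~ n) = f x *~ n.
Proof.
have P m : f (x *+ m) = f x *+ m.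
  by elim: m => [|m IH]; rewrite ?mulr0n ?subf0 // !mulrS subfD IH.
by case: n => n; rewrite ?NegzE ?mulrNz ?subfN -!pmulrn P.
Qed.
End AddFun.

Lemma freeg_add_ext (K : choiceType) (W : zmodType) (f g : {freeg K / int} -> W) :
  (forall x y, f (x - y) = f x - f y) -> (forall x y, g (x - y) = g x - g y) ->
  (forall z, f << z >> = g << z >>) -> f =1 g.
Proof.
move=> fB gB fg D; rewrite -(freeg_sumE D) (subf_sum fB) (subf_sum gB).
apply: eq_bigr => z _.
have -> : << coeff z D *g z >> = << z >> *~ coeff z D :> {freeg K / int}.
  by rewrite freeg_mulz intz.
by rewrite (subfMz fB) (subfMz gB) fg.
Qed.

Section Tensor.
Variables (k : fieldType) (A : grsubalg k) (M N : grbimod k).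
Local Notation R := {mpoly k[2]}.
Local Notation F := {freeg (M * N) / int}.

Inductive tens_rel : F -> Prop :=
| TR0 : tens_rel 0
| TRB D E : tens_rel D -> tens_rel E -> tens_rel (D - E)
| TRl x y z : tens_rel (<< (x + y, z) >> - << (x, z) >> - << (y, z) >>)
| TRr x y z : tens_rel (<< (x, y + z) >> - << (x, y) >> - << (x, z) >>)
| TRb x a y : A a -> tens_rel (<< (ract x a, y) >> - << (x, lact a y) >>).

Definition tens_pred : {pred F} := fun D => `[< tens_rel D >].

Lemma tens_pred_closed : zmod_closed tens_pred.
Proof.
split=> [|D E]; first by apply/asboolP; exact: TR0.
by move=> /asboolP hD /asboolP hE; apply/asboolP; exact: TRB.
Qed.

HB.instance Definition _ := GRing.isZmodClosed.Build F tens_pred tens_pred_closed.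

Definition tens_car : zmodType := Quotient.quot tens_pred.

Definition tproj (D : F) : tens_car := \pi_(Quotient.quot tens_pred)%qT D.

Definition tens (x : M) (y : N) : tens_car := tproj << (x, y) >>.

Lemma tprojB D E : tproj (D - E) = tproj D - tproj E.
Proof. by rewrite /tproj -(raddfB (\pi_(Quotient.quot tens_pred)%qT)). Qed.

Lemma tproj_surj (x : tens_car) : exists D, x = tproj D.
Proof. by exists (repr x); rewrite /tproj reprK. Qed.

Lemma tproj_eq D E : tproj D = tproj E <-> tens_rel (D - E).
Proof.
rewrite -[tens_rel _]asboolE -/(tens_pred (D - E)); split.
  by move/eqP; rewrite /tproj -Quotient.idealrBE.
by move=> h; apply/eqP; rewrite /tproj -Quotient.idealrBE.
Qed.

Lemma tensDl x y z : tens (x + y) z = tens x z + tens y z.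
Proof.
apply/eqP; rewrite -subr_eq0 opprD addrA -!tprojB; apply/eqP.
by rewrite -(subrr (tproj 0)) -tprojB; apply/tproj_eq; rewrite !subr0; exact: TRl.
Qed.

Lemma tensDr x y z : tens x (y + z) = tens x y + tens x z.
Proof.
apply/eqP; rewrite -subr_eq0 opprD addrA -!tprojB; apply/eqP.
by rewrite -(subrr (tproj 0)) -tprojB; apply/tproj_eq; rewrite !subr0; exact: TRr.
Qed.

Lemma tens_bal x a y : A a -> tens (ract x a) y = tens x (lact a y).
Proof. by move=> Aa; apply/tproj_eq; exact: TRb. Qed.

Lemma tensBl x y z : tens (x - y) z = tens x z - tens y z.
Proof. by apply/eqP; rewrite eq_sym subr_eq -tensDl subrK. Qed.
Lemma tensBr x y z : tens x (y - z) = tens x y - tens x z.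
Proof. by apply/eqP; rewrite eq_sym subr_eq -tensDr subrK. Qed.
Lemma tens0l z : tens 0 z = 0.
Proof. by rewrite -(subrr 0) tensBl subrr. Qed.
Lemma tens0r x : tens x 0 = 0.
Proof. by rewrite -(subrr 0) tensBr subrr. Qed.

Definition balanced (W : zmodType) (f : M -> N -> W) : Prop :=
  [/\ forall x y z, f (x + y) z = f x z + f y z,
      forall x y z, f x (y + z) = f x y + f x z
    & forall x a y, A a -> f (ract x a) y = f x (lact a y)].

Definition tlift (W : zmodType) (f : M -> N -> W) (x : tens_car) : W :=
  fext (fun z => f z.1 z.2) (repr x).

Section Lift.
Variables (W : zmodType) (f : M -> N -> W).
Hypothesis hf : balanced f.

Lemma tliftP D : tlift f (tproj D) = fext (fun z => f z.1 z.2) D.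
Proof.
pose L := fext (fun z : M * N => f z.1 z.2); rewrite -/(L D).
have LB X Y : L (X - Y) = L X - L Y by exact: fext_sub.
have LU x y : L << (x, y) >> = f x y by rewrite /L fextU.
have ker X : tens_rel X -> L X = 0.
  case: hf => f1 f2 f3.
  elim=> [|X1 X2 _ E1 _ E2|x y z|x y z|x a y Aa]; rewrite ?LB ?LU.
  - exact: subf0 LB.
  - by rewrite E1 E2 subrr.
  - by rewrite f1 -addrA -opprD subrr.
  - by rewrite f2 -addrA -opprD subrr.
  - by rewrite f3 // subrr.
apply/eqP; rewrite -subr_eq0 -LB ker //.
by apply/tproj_eq; rewrite /tproj reprK.
Qed.

Lemma tliftE x y : tlift f (tens x y) = f x y.
Proof. by rewrite tliftP fextU. Qed.

Lemma tliftB X Y : tlift f (X - Y) = tlift f X - tlift f Y.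
Proof.
have [D ->] := tproj_surj X; have [E ->] := tproj_surj Y.
by rewrite -tprojB !tliftP fext_sub.
Qed.
End Lift.

Lemma tens_ext (W : zmodType) (f g : tens_car -> W) :
  (forall x y, f (x - y) = f x - f y) -> (forall x y, g (x - y) = g x - g y) ->
  (forall x y, f (tens x y) = g (tens x y)) -> f =1 g.
Proof.
move=> fB gB fg X; have [D ->] := tproj_surj X.
apply: (freeg_add_ext (f := f \o tproj) (g := g \o tproj)) => [E E'|E E'|[x y]] /=.
- by rewrite tprojB fB.
- by rewrite tprojB gB.
- exact: fg.
Qed.

Definition tlact (a : R) : tens_car -> tens_car := tlift (fun x y => tens (lact a x) y).
Definition tract (X : tens_car) (a : R) : tens_car := tlift (fun x y => tens x (ract y a)) X.

Lemma tlact_bal a : balanced (fun x y => tens (lact a x) y).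
Proof.
split=> [x y z|x y z|x b y Ab]; first by rewrite lactDr tensDl.
  by rewrite tensDr.
by rewrite -lractA tens_bal.
Qed.

Lemma tract_bal a : balanced (fun x y => tens x (ract y a)).
Proof.
split=> [x y z|x y z|x b y Ab]; first by rewrite tensDl.
  by rewrite ractDl tensDr.
by rewrite lractA tens_bal.
Qed.

Lemma tlactE a x y : tlact a (tens x y) = tens (lact a x) y.
Proof. exact: (tliftE (tlact_bal a)). Qed.
Lemma tractE x y a : tract (tens x y) a = tens x (ract y a).
Proof. exact: (tliftE (tract_bal a)). Qed.
Lemma tlactB a X Y : tlact a (X - Y) = tlact a X - tlact a Y.
Proof. exact: (tliftB (tlact_bal a)). Qed.
Lemma tractB X Y a : tract (X - Y) a = tract X a - tract Y a.
Proof. exact: (tliftB (tract_bal a)). Qed.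

(* Degree d is spanned by the x (x) y with deg x + deg y = d. *)
Inductive tdeg (d : int) : tens_car -> Prop :=
| TD0 : tdeg d 0
| TDB X Y : tdeg d X -> tdeg d Y -> tdeg d (X - Y)
| TDt i j x y : i + j = d -> bdeg i x -> bdeg j y -> tdeg d (tens x y).

Let MG := bdeg_grading M.
Let NG := bdeg_grading N.

(* The projection onto degree d, on pure tensors. *)
Let phi (d : int) (x : M) (y : N) : tens_car :=
  \sum_(i <- gsupp MG x) tens (gcomp MG x i) (gcomp NG y (d - i)).

Let phiE d x y (t : seq int) : uniq t -> {subset gsupp MG x <= t} ->
  phi d x y = \sum_(i <- t) tens (gcomp MG x i) (gcomp NG y (d - i)).
Proof.
move=> ut st; rewrite /phi; apply: (sum_supp (gsupp_uniq MG x) ut st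
  (f := fun i => tens (gcomp MG x i) (gcomp NG y (d - i)))) => i.
by move/(gcomp_out) => ->; rewrite tens0l.
Qed.

Let phiBl d x x' y : phi d (x - x') y = phi d x y - phi d x' y.
Proof.
pose t := undup (gsupp MG (x - x') ++ gsupp MG x ++ gsupp MG x').
have ut : uniq t by exact: undup_uniq.
rewrite !(phiE _ _ ut); try by
  move=> i hi; rewrite mem_undup !mem_cat hi ?orbT.
by rewrite -sumrB; apply: eq_bigr => i _; rewrite gcompB tensBl.
Qed.

Let phiBr d x y y' : phi d x (y - y') = phi d x y - phi d x y'.
Proof. by rewrite /phi -sumrB; apply: eq_bigr => i _; rewrite gcompB tensBr. Qed.

Let gcomp_ract e (a : R) x i : pdeg e a ->
  gcomp MG (ract x a) i = ract (gcomp MG x (i - e)) a.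
Proof.
move=> ha.
apply: (@gcompP _ _ MG _ (map (fun i => i + e) (gsupp MG x)) (fun i => ract (gcomp MG x (i - e)) a)).
- by rewrite map_inj_uniq ?gsupp_uniq //; exact: addIr.
- move=> j; rewrite -[j in bdeg j](subrK e) addrC; apply: bdeg_ract => //.
  exact: gcomp_homog.
- move=> j hj; rewrite gcomp_out ?ract0l //; apply: contra hj => hj.
  by apply/mapP; exists (j - e); rewrite ?subrK.
rewrite big_map {1}[x](gcomp_sum MG) (subf_sum (f := fun x => ract x a)).
  by apply: eq_bigr => j _; rewrite addrK.
by move=> *; rewrite ractBl.
Qed.

Let gcomp_lact e (a : R) y i : pdeg e a ->
  gcomp NG (lact a y) i = lact a (gcomp NG y (i - e)).
Proof.
move=> ha.
apply: (@gcompP _ _ NG _ (map (fun i => i + e) (gsupp NG y)) (fun i => lact a (gcomp NG y (i - e)))).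
- by rewrite map_inj_uniq ?gsupp_uniq //; exact: addIr.
- move=> j; rewrite -[j in bdeg j](subrK e) addrC; apply: bdeg_lact => //.
  exact: gcomp_homog.
- move=> j hj; rewrite gcomp_out ?lact0r //; apply: contra hj => hj.
  by apply/mapP; exists (j - e); rewrite ?subrK.
rewrite big_map {1}[y](gcomp_sum NG) (subf_sum (f := fun y => lact a y)).
  by apply: eq_bigr => j _; rewrite addrK.
by move=> *; rewrite lactBr.
Qed.

Let phi_bal1 d e x (a : R) y : pdeg e a -> A a -> phi d (ract x a) y = phi d x (lact a y).
Proof.
move=> ha Aa.
pose t := undup (gsupp MG (ract x a) ++ map (fun i => i + e) (gsupp MG x)).
have ut : uniq t by exact: undup_uniq.
rewrite (phiE _ _ ut); last by move=> i hi; rewrite mem_undup mem_cat hi.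
have inj : injective (fun i : int => i - e) by exact: addIr.
rewrite (@phiE _ _ _ (map (fun i => i - e) t)) ?map_inj_uniq //; last first.
  move=> i hi; apply/mapP; exists (i + e); last by rewrite addrK.
  by rewrite mem_undup mem_cat (map_f (fun i => i + e) hi) orbT.
rewrite big_map; apply: eq_bigr => i _.
have E : d - (i - e) - e = d - i by rewrite opprB addrA addrAC addrK.
by rewrite (gcomp_ract _ _ ha) (gcomp_lact _ _ ha) tens_bal // E.
Qed.

Let phi_bal d : balanced (phi d).
Proof.
have Bl y := subfD (fun x x' => phiBl d x x' y).
have Br x := subfD (phiBr d x).
split=> // x a y /sa_span[s [f [us hf Af ->]]].
have Sr x' : ract x' (\sum_(i <- s) f i) = \sum_(i <- s) ract x' (f i).
  by apply: big_morph; [exact: ractDr | exact: ract0r].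
have Sl y' : lact (\sum_(i <- s) f i) y' = \sum_(i <- s) lact (f i) y'.
  by apply: (big_morph (fun a => lact a y')) => [b c|]; rewrite ?lactDl ?lact0l.
rewrite Sr Sl (subf_sum (fun x x' => phiBl d x x' y)) (subf_sum (phiBr d x)).
by apply: eq_bigr => i _; apply: phi_bal1 (hf i) (Af i).
Qed.

Let tpr (d : int) : tens_car -> tens_car := tlift (phi d).

Let tpr_deg d e X : tdeg e X -> tpr d X = if d == e then X else 0.
Proof.
have B := tliftB (phi_bal d).
elim=> [|{}X Y _ EX _ EY|i j x y ij hx hy].
- by rewrite /tpr (subf0 B); case: ifP.
- by rewrite /tpr B -/(tpr d X) -/(tpr d Y) EX EY; case: ifP; rewrite ?subr0.
rewrite /tpr (tliftE (phi_bal d)).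
pose t := undup (i :: gsupp MG x).
have ut : uniq t by exact: undup_uniq.
have it : i \in t by rewrite mem_undup inE eqxx.
rewrite (phiE _ _ ut); last by move=> l hl; rewrite mem_undup inE hl orbT.
rewrite (bigD1_seq i) //= big1 ?addr0 => [|l li].
  rewrite !(gcomp1 _ _ hx) eqxx (gcomp1 _ _ hy) subr_eq [j + i]addrC ij.
  by case: ifP; rewrite ?tens0r.
by rewrite (gcomp1 _ _ hx) (negbTE li) tens0l.
Qed.

Lemma tdeg_span X : homog_span tdeg X.
Proof.
have [D ->] := tproj_surj X; rewrite -(freeg_sumE D) (subf_sum tprojB).
apply: (homog_span_sum TD0 TDB) => z.
have -> : << coeff z D *g z >> = << z >> *~ coeff z D :> F.
  by rewrite freeg_mulz intz.
rewrite (subfMz tprojB).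
have hz : homog_span tdeg (tproj << z >>).
  case: z => x y; rewrite -/(tens x y) (gcomp_sum MG x).
  rewrite (subf_sum (fun x x' => tensBl x x' y)).
  apply: (homog_span_sum TD0 TDB) => i.
  rewrite (gcomp_sum NG y) (subf_sum (tensBr _)).
  apply: (homog_span_sum TD0 TDB) => j.
  apply: (homog_span1 TD0 (d := i + j)).
  by apply: (TDt (erefl _)); exact: gcomp_homog.
case: (coeff z D) => n; rewrite ?NegzE ?mulrNz -?pmulrn.
  elim: n => [|n IH]; first by rewrite mulr0n; exact: (homog_span0 TD0).
  by rewrite mulrS; apply: (homog_spanD TD0 TDB).
rewrite -sub0r; apply: (homog_spanB TD0 TDB); first exact: (homog_span0 TD0).
elim: n.+1 => [|{}n IH]; first by rewrite mulr0n; exact: (homog_span0 TD0).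
by rewrite mulrS; apply: (homog_spanD TD0 TDB).
Qed.

Lemma tdeg_grading : is_grading tdeg.
Proof.
split=> [d|d X Y|s f us hf E i si|X]; [exact: TD0 | exact: TDB | | exact: tdeg_span].
have B := tliftB (phi_bal i).
have : tpr i (\sum_(j <- s) f j) = 0 by rewrite E; exact: subf0 B.
rewrite /tpr (subf_sum B) (bigD1_seq i) //= big1 => [|j ji].
  by rewrite addr0 -/(tpr i (f i)) (tpr_deg i (hf i)) eqxx.
by rewrite -/(tpr i (f j)) (tpr_deg i (hf j)) eq_sym (negbTE ji).
Qed.

Lemma tlactA a b X : tlact a (tlact b X) = tlact (a * b) X.
Proof.
apply: (tens_ext (f := fun X => tlact a (tlact b X)) (g := tlact (a * b)))
  => [Y Z|Y Z|x y]; rewrite ?tlactB //.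
by rewrite !tlactE lactA.
Qed.

Lemma tlact1 X : tlact 1 X = X.
Proof.
apply: (tens_ext (g := id)) => [Y Z|Y Z|x y]; rewrite ?tlactB //.
by rewrite !tlactE lact1.
Qed.

Lemma tlactDr a X Y : tlact a (X + Y) = tlact a X + tlact a Y.
Proof. exact: (subfD (tlactB a)). Qed.

Lemma tlactDl a b X : tlact (a + b) X = tlact a X + tlact b X.
Proof.
apply: (tens_ext (g := fun X => tlact a X + tlact b X)) => [Y Z|Y Z|x y];
  rewrite ?tlactB //; first by rewrite opprD addrACA.
by rewrite !tlactE lactDl tensDl.
Qed.

Lemma tractA X a b : tract (tract X a) b = tract X (a * b).
Proof.
apply: (tens_ext (f := fun X => tract (tract X a) b) (g := tract^~ (a * b)))
  => [Y Z|Y Z|x y] /=; rewrite ?tractB //.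
by rewrite !tractE ractA.
Qed.

Lemma tract1 X : tract X 1 = X.
Proof.
apply: (tens_ext (f := tract^~ 1) (g := id)) => [Y Z|Y Z|x y] /=; rewrite ?tractB //.
by rewrite !tractE ract1.
Qed.

Lemma tractDl X Y a : tract (X + Y) a = tract X a + tract Y a.
Proof. exact: (subfD (f := tract^~ a) (fun X Y => tractB X Y a)). Qed.

Lemma tract0l a : tract 0 a = 0.
Proof. exact: (subf0 (f := tract^~ a) (fun X Y => tractB X Y a)). Qed.

Lemma tractDr X a b : tract X (a + b) = tract X a + tract X b.
Proof.
apply: (tens_ext (f := tract^~ (a + b)) (g := fun X => tract X a + tract X b))
  => [Y Z|Y Z|x y] /=; rewrite ?tractB //; first by rewrite opprD addrACA.
by rewrite !tractE ractDr tensDr.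
Qed.

Lemma tlractA a X b : tract (tlact a X) b = tlact a (tract X b).
Proof.
apply: (tens_ext (f := fun X => tract (tlact a X) b)
  (g := fun X => tlact a (tract X b))) => [Y Z|Y Z|x y].
- by rewrite tlactB tractB.
- by rewrite tractB tlactB.
- by rewrite !(tractE, tlactE).
Qed.

Lemma tlractC (c : k) X : tlact c%:MP X = tract X c%:MP.
Proof.
apply: (tens_ext (g := tract^~ c%:MP)) => [Y Z|Y Z|x y] /=;
  rewrite ?tlactB ?tractB //.
by rewrite tlactE tractE lractC tens_bal ?lractC //; exact: sa_C.
Qed.

Lemma tdeg_lact e d a X : pdeg e a -> tdeg d X -> tdeg (e + d) (tlact a X).
Proof.
move=> ha; elim=> [|{}X Y _ EX _ EY|i j x y ij hx hy].
- by rewrite (subf0 (tlactB a)); exact: TD0.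
- by rewrite tlactB; apply: TDB.
- rewrite tlactE; apply: (TDt (i := e + i) (j := j)) => //; first by rewrite -addrA ij.
  exact: bdeg_lact.
Qed.

Lemma tdeg_ract e d a X : pdeg e a -> tdeg d X -> tdeg (e + d) (tract X a).
Proof.
move=> ha; elim=> [|{}X Y _ EX _ EY|i j x y ij hx hy].
- by rewrite tract0l; exact: TD0.
- by rewrite tractB; apply: TDB.
- rewrite tractE; apply: (TDt (i := i) (j := e + j)) => //; first by rewrite addrCA ij.
  exact: bdeg_ract.
Qed.

(* The left action on M (x)_A N is that on M, the right action that on N. *)
Definition btens : grbimod k :=
  Grbimod tlactA tlact1 tlactDr tlactDl tractA tract1 tractDl tractDr tlractA
    tlractC tdeg_grading tdeg_lact tdeg_ract.

End Tensor.

Section TensorMap.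
Variables (k : fieldType) (A : grsubalg k) (M M' N N' : grbimod k).
Variables (f : ghom M M') (g : ghom N N').

Definition tmap_fun : btens A M N -> btens A M' N' :=
  @tlift _ A M N _ (fun x y => tens A (f x) (g y)).

Lemma tmap_bal : balanced A (fun x y => tens A (f x) (g y)).
Proof.
split=> [x y z|x y z|x a y Aa]; first by rewrite ghomD tensDl.
  by rewrite ghomD tensDr.
by rewrite ghom_ract ghom_lact tens_bal.
Qed.

Lemma tmapE x y : tmap_fun (tens A x y) = tens A (f x) (g y).
Proof. exact: (tliftE tmap_bal). Qed.

Lemma tmap_lact a X : tmap_fun (lact a X) = lact a (tmap_fun X).
Proof.
apply: (@tens_ext _ A M N _ (fun X => tmap_fun (tlact a X))
  (fun X => tlact a (tmap_fun X))) => [Y Z|Y Z|x y].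
- by rewrite tlactB /tmap_fun (tliftB tmap_bal).
- by rewrite /tmap_fun (tliftB tmap_bal) tlactB.
- by rewrite tlactE !tmapE tlactE ghom_lact.
Qed.

Lemma tmap_ract X a : tmap_fun (ract X a) = ract (tmap_fun X) a.
Proof.
apply: (@tens_ext _ A M N _ (fun X => tmap_fun (tract X a))
  (fun X => tract (tmap_fun X) a)) => [Y Z|Y Z|x y].
- by rewrite tractB /tmap_fun (tliftB tmap_bal).
- by rewrite /tmap_fun (tliftB tmap_bal) tractB.
- by rewrite tractE !tmapE tractE ghom_ract.
Qed.

Lemma tmap_deg d X : bdeg d X -> bdeg d (tmap_fun X).
Proof.
elim=> [|{}X Y _ EX _ EY|i j x y ij hx hy].
- by rewrite /tmap_fun (subf0 (tliftB tmap_bal)); exact: TD0.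
- by rewrite /tmap_fun (tliftB tmap_bal); exact: TDB.
- by rewrite tmapE; apply: (@TDt _ _ _ _ _ i j) => //; exact: ghom_deg.
Qed.

Definition tmap : ghom (btens A M N) (btens A M' N') :=
  @Ghom _ (btens A M N) (btens A M' N') tmap_fun (tliftB tmap_bal)
    tmap_lact tmap_ract tmap_deg.

End TensorMap.

(* Like [is_grading], without requiring that V be the sum of its homogeneous
   parts: the case of all maps between two graded bimodules. *)
Record is_pregrading (k : fieldType) (V : lmodType {mpoly k[2]})
    (h : int -> V -> Prop) : Prop := IsPregrading {
  pg0 : forall d, h d 0;
  pgB : forall d x y, h d x -> h d y -> h d (x - y);
  pg_indep : forall (s : seq int) (f : int -> V), uniq s ->
    (forall i, h i (f i)) -> \sum_(i <- s) f i = 0 ->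
    forall i, i \in s -> f i = 0;
  pgZ : forall e d (a : {mpoly k[2]}) x, pdeg e a -> h d x -> h (e + d) (a *: x) }.

Lemma gmod_pregrading (k : fieldType) (V : gmod k) : is_pregrading (@gdeg k V).
Proof. by case: V => V h [? ? ? ?] /= ?; split. Qed.

Record gsubmod (k : fieldType) (V : lmodType {mpoly k[2]}) (h : int -> V -> Prop) :=
  Gsubmod {
  sm_mem :> V -> Prop;
  sm0 : sm_mem 0;
  smB : forall x y, sm_mem x -> sm_mem y -> sm_mem (x - y);
  smZ : forall a x, sm_mem x -> sm_mem (a *: x);
  sm_span : forall x, sm_mem x -> exists (s : seq int) (f : int -> V),
    [/\ uniq s, forall i, h i (f i), forall i, sm_mem (f i)
      & x = \sum_(i <- s) f i] }.

Section SubQuotient.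
Variables (k : fieldType) (V : lmodType {mpoly k[2]}) (h : int -> V -> Prop).
Hypothesis H : is_pregrading h.
Variables Z B : gsubmod h.
Local Notation R := {mpoly k[2]}.

Definition sq_pred : {pred V} := fun x => `[< Z x >].

Lemma smD x y : Z x -> Z y -> Z (x + y).
Proof.
move=> hx hy; rewrite -[y]opprK; apply: smB => //.
by rewrite -sub0r; apply: smB => //; exact: sm0.
Qed.

Lemma sq_pred_closed : submod_closed sq_pred.
Proof.
split=> [|a x y /asboolP hx /asboolP hy]; apply/asboolP; first exact: sm0.
by apply: smD => //; exact: smZ.
Qed.

HB.instance Definition _ := GRing.isSubmodClosed.Build R V sq_pred
  (GRing.submod_closed_semi sq_pred_closed).

Record sq_sub : Type := SqSub { sq_val : V; _ : sq_val \in sq_pred }.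
HB.instance Definition _ := [isSub for sq_val].
HB.instance Definition _ := [Choice of sq_sub by <:].
HB.instance Definition _ := [SubChoice_isSubLmodule of sq_sub by <:].

Definition sq_ker : {pred sq_sub} := fun x => `[< B (val x) >].

Lemma sq_ker_closed : zmod_closed sq_ker.
Proof.
split=> [|x y /asboolP hx /asboolP hy]; apply/asboolP.
  by rewrite raddf0; exact: sm0.
by rewrite raddfB; exact: smB.
Qed.

HB.instance Definition _ := GRing.isZmodClosed.Build sq_sub sq_ker sq_ker_closed.

(* Z / (Z :&: B) *)
Definition subquot : Type := Quotient.quot sq_ker.
HB.instance Definition _ := GRing.Zmodule.on subquot.

Definition sq_pi (x : sq_sub) : subquot := \pi_(Quotient.quot sq_ker)%qT x.

Lemma sq_piB x y : sq_pi (x - y) = sq_pi x - sq_pi y.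
Proof. exact: (raddfB (\pi_(Quotient.quot sq_ker)%qT)). Qed.
Lemma sq_piD x y : sq_pi (x + y) = sq_pi x + sq_pi y.
Proof. exact: (raddfD (\pi_(Quotient.quot sq_ker)%qT)). Qed.

Lemma sq_pi_eq x y : sq_pi x = sq_pi y <-> B (val x - val y).
Proof.
rewrite -raddfB -[B _]asboolE -/(sq_ker (x - y)); split.
  by move/eqP; rewrite /sq_pi -Quotient.idealrBE.
by move=> hb; apply/eqP; rewrite /sq_pi -Quotient.idealrBE.
Qed.

Lemma sq_pi_surj (x : subquot) : exists y, x = sq_pi y.
Proof. by exists (repr x); rewrite /sq_pi reprK. Qed.

Definition sq_scale (a : R) (x : subquot) : subquot := sq_pi (a *: repr x).

Lemma sq_scaleE a x : sq_scale a (sq_pi x) = sq_pi (a *: x).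
Proof.
apply/sq_pi_eq; have /sq_pi_eq/(smZ a) : sq_pi (repr (sq_pi x)) = sq_pi x.
  by rewrite /sq_pi reprK.
by rewrite scalerBr.
Qed.

Lemma sq_scaleA a b x : sq_scale a (sq_scale b x) = sq_scale (a * b) x.
Proof. by have [y ->] := sq_pi_surj x; rewrite !sq_scaleE scalerA. Qed.
Lemma sq_scale1 : left_id 1 sq_scale.
Proof. by move=> x; have [y ->] := sq_pi_surj x; rewrite !sq_scaleE scale1r. Qed.
Lemma sq_scaleDr : right_distributive sq_scale +%R.
Proof.
move=> a x x'; have [y ->] := sq_pi_surj x; have [y' ->] := sq_pi_surj x'.
by rewrite -sq_piD !sq_scaleE scalerDr sq_piD.
Qed.
Lemma sq_scaleDl x : {morph sq_scale^~ x : a b / a + b}.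
Proof.
by move=> a b; have [y ->] := sq_pi_surj x; rewrite !sq_scaleE scalerDl sq_piD.
Qed.

HB.instance Definition _ := GRing.Zmodule_isLmodule.Build R subquot
  sq_scaleA sq_scale1 sq_scaleDr sq_scaleDl.

(* Junk value 0 outside Z. *)
Definition cls (x : V) : subquot := sq_pi (insubd 0 x).
Definition rep (x : subquot) : V := val (repr x).

Lemma rep_mem x : Z (rep x).
Proof. by rewrite /rep; case: (repr x) => y /= /asboolP. Qed.

Lemma insubd_val x : Z x -> val (insubd (0 : sq_sub) x) = x.
Proof. by move=> hx; apply: insubdK; apply/asboolP. Qed.

Lemma repK x : cls (rep x) = x.
Proof. by rewrite /cls /rep valKd /sq_pi reprK. Qed.

Lemma clsB x y : Z x -> Z y -> cls (x - y) = cls x - cls y.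
Proof.
move=> hx hy; rewrite -sq_piB; apply/sq_pi_eq.
have hxy := smB hx hy.
by rewrite raddfB /= !insubd_val // -opprD subrr; exact: sm0.
Qed.

Lemma clsZ a x : Z x -> cls (a *: x) = a *: cls x.
Proof.
move=> hx; rewrite [RHS]sq_scaleE; apply/sq_pi_eq.
have hax := smZ a hx.
by rewrite linearZ /= !insubd_val // -scalerDr subrr scaler0; exact: sm0.
Qed.

Lemma cls_eq x y : Z x -> Z y -> (cls x = cls y <-> B (x - y)).
Proof. by move=> hx hy; rewrite sq_pi_eq !insubd_val. Qed.

Lemma cls0 : cls 0 = 0.
Proof. by rewrite -(subrr 0) clsB ?subrr //; exact: sm0. Qed.

Lemma clsD x y : Z x -> Z y -> cls (x + y) = cls x + cls y.
Proof.
move=> hx hy; have h0 := sm0 Z; have h0y := smB h0 hy.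
have -> : x + y = x - (0 - y) by rewrite sub0r opprK.
by rewrite clsB // clsB // cls0 sub0r opprK.
Qed.

Lemma cls_sum (s : seq int) (f : int -> V) : (forall i, Z (f i)) ->
  cls (\sum_(i <- s) f i) = \sum_(i <- s) cls (f i).
Proof.
move=> hf; elim: s => [|i s IH]; first by rewrite !big_nil cls0.
rewrite !big_cons clsD // ?IH //.
by elim/big_ind: _ => //; [exact: sm0 | exact: smD].
Qed.

Definition sq_deg (d : int) (x : subquot) : Prop :=
  exists z, [/\ Z z, h d z & x = cls z].

Lemma sq_deg_grading : is_grading sq_deg.
Proof.
split=> [d|d _ _ [x [hx dx ->]] [y [hy dy ->]]|s f us hf E i si|x].
- by exists 0; rewrite cls0; split=> //; [exact: sm0 | exact: (pg0 H)].
- exists (x - y); rewrite clsB //; split=> //; [exact: smB | exact: (pgB H)].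
- have [g hg] := choice hf.
  have gZ j : Z (g j) by case: (hg j).
  have gd j : h j (g j) by case: (hg j).
  have gE j : f j = cls (g j) by case: (hg j).
  have: cls (\sum_(j <- s) g j) = cls 0.
    by rewrite cls0 cls_sum // -[RHS]E; apply: eq_bigr.
  have Zs : Z (\sum_(j <- s) g j).
    by elim/big_ind: _ => //; [exact: sm0 | exact: smD].
  move/(cls_eq Zs (sm0 Z)); rewrite subr0 => /sm_span[t [b [ut hb Bb E']]].
  pose g' j := if j \in s then g j else 0.
  pose b' j := if j \in t then b j else 0.
  pose u := undup (s ++ t).
  have uu : uniq u by exact: undup_uniq.
  have E1 : \sum_(j <- u) (g' j - b' j) = 0.
    rewrite sumrB -(sum_supp us uu) => [|j hj|j /negbTE hj]; last 2 first.
    + by rewrite mem_undup mem_cat hj.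
    + by rewrite /g' hj.
    rewrite -(sum_supp ut uu) => [|j hj|j /negbTE hj]; last 2 first.
    + by rewrite mem_undup mem_cat hj orbT.
    + by rewrite /b' hj.
    rewrite (eq_big_seq g) => [|j hj]; last by rewrite /g' hj.
    rewrite E'; apply/eqP; rewrite subr_eq0; apply/eqP.
    by apply: eq_big_seq => j hj; rewrite /b' hj.
  have hgb j : h j (g' j - b' j).
    apply: (pgB H); rewrite /g' /b'; by case: ifP => // _; apply: (pg0 H).
  have iu : i \in u by rewrite mem_undup mem_cat si.
  have := pg_indep H uu hgb E1 iu; rewrite /g' si => /eqP; rewrite subr_eq0 => /eqP gb.
  rewrite gE -cls0; apply/(cls_eq (gZ i) (sm0 Z)); rewrite subr0 gb /b'.
  by case: ifP => _ //; exact: sm0.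
- have [s [f [us hf Zf E]]] := sm_span (rep_mem x).
  exists s, (fun i => cls (f i)); split=> // [i|]; first by exists (f i).
  by rewrite -cls_sum // -E repK.
Qed.

Lemma sq_degZ e d (a : R) x : pdeg e a -> sq_deg d x -> sq_deg (e + d) (a *: x).
Proof.
move=> ha [z [hz dz ->]]; exists (a *: z); rewrite clsZ //.
by split=> //; [exact: smZ | exact: (pgZ H)].
Qed.

Definition gsubquot : gmod k := Gmod sq_deg_grading sq_degZ.

End SubQuotient.

Record gmhom (k : fieldType) (V W : gmod k) := Gmhom {
  gmhom_fun :> {linear V -> W};
  gmhom_deg : forall d x, gdeg d x -> gdeg d (gmhom_fun x) }.

Section KerIm.
Variables (k : fieldType) (V W : gmod k) (f : gmhom V W).

Definition gker : gsubmod (@gdeg k V).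
Proof.
apply: (@Gsubmod _ _ _ (fun x => f x = 0)) => [|x y hx hy|a x hx|x hx].
- exact: linear0.
- by rewrite linearB hx hy subrr.
- by rewrite linearZ /= hx scaler0.
have G := gdeg_grading V; have GW := gdeg_grading W.
have [s [g [us hg g0 E]]] := homog_spanP (gr0 G) (gr_span G x).
exists s, g; split=> // i; case: (boolP (i \in s)) => [si|/g0 ->]; last exact: linear0.
apply: (gr_indep GW us (f := fun i => f (g i))) => //.
  by move=> j; exact: gmhom_deg.
by rewrite -linear_sum -E hx.
Defined.

Definition gim : gsubmod (@gdeg k W).
Proof.
apply: (@Gsubmod _ _ _ (fun y => exists x, y = f x)) => [|_ _ [x ->] [y ->]|a _ [x ->]|_ [x ->]].
- by exists 0; rewrite linear0.
- by exists (x - y); rewrite linearB.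
- by exists (a *: x); rewrite linearZ.
have [s [g [us hg ->]]] := gr_span (gdeg_grading V) x.
exists s, (fun i => f (g i)); split=> // [i|i|].
- exact: gmhom_deg.
- by exists (g i).
- by rewrite linear_sum.
Defined.

End KerIm.

Section StandardModules.
Variable k : fieldType.
Local Notation R := {mpoly k[2]}.

Definition gfree : gmod k :=
  @Gmod k (R^o : lmodType R) (@pdeg k) (pdeg_grading k) (@pdegM k).

Definition gshift (n : int) (V : gmod k) : gmod k.
Proof.
refine (@Gmod k V (fun d => @gdeg k V (d + n)) (shift_grading n (gdeg_grading V)) _).
by move=> e d a x ha hx; rewrite -addrA; exact: gdegZ.
Defined.

Definition gsum (V W : gmod k) : gmod k.
Proof.
refine (@Gmod k ((V : lmodType R) * (W : lmodType R))%type _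
  (prod_grading (gdeg_grading V) (gdeg_grading W)) _).
by move=> e d a x ha [h1 h2]; split; exact: gdegZ.
Defined.

Definition gtot (V : gmod k) : gsubmod (@gdeg k V).
Proof.
apply: (@Gsubmod _ _ _ (fun _ => True)) => // x _.
by have [s [f [? ? ?]]] := gr_span (gdeg_grading V) x; exists s, f.
Defined.

(* The submodule spanned by homogeneous elements v_0, ..., v_(n-1). *)
Definition gspan (V : gmod k) (n : nat) (v : 'I_n -> V) (e : 'I_n -> int)
  (hv : forall i, gdeg (e i) (v i)) : gsubmod (@gdeg k V).
Proof.
apply: (@Gsubmod _ _ _ (fun x => exists c : 'I_n -> R, x = \sum_i c i *: v i))
  => [|_ _ [c ->] [c' ->]|a _ [c ->]|_ [c ->]].
- by exists (fun=> 0); rewrite big1 // => i _; rewrite scale0r.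
- by exists (fun i => c i - c' i); rewrite -sumrB; apply: eq_bigr => i _; rewrite scalerBl.
- by exists (fun i => a * c i); rewrite scaler_sumr; apply: eq_bigr => i _; rewrite scalerA.
pose P (x : V) := exists c : 'I_n -> R, x = \sum_i c i *: v i.
pose h d (x : V) := gdeg d x /\ P x.
have P0 : P 0 by exists (fun=> 0); rewrite big1 // => i _; rewrite scale0r.
have h0 d : h d 0 by split=> //; exact: (gr0 (gdeg_grading V)).
have hB d x y : h d x -> h d y -> h d (x - y).
  case=> dx [c1 e1] [dy [c2 e2]]; split; first exact: (grB (gdeg_grading V)).
  by rewrite e1 e2; exists (fun i => c1 i - c2 i); rewrite -sumrB; apply: eq_bigr => i _; rewrite scalerBl.
suff [s [f [us hf E]]] : homog_span h (\sum_i c i *: v i).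
  by exists s, f; split=> // i; case: (hf i).
apply: (homog_span_sum h0 hB) => i.
have [s [f [us hf ->]]] := gr_span (pdeg_grading k) (c i).
rewrite scaler_suml; apply: (homog_span_sum h0 hB) => j.
apply: (homog_span1 h0 (d := j + e i)); split; first exact: gdegZ.
exists (fun l => if l == i then f j else 0); rewrite (bigD1 i) //= eqxx big1 ?addr0 //.
by move=> l /negbTE ->; rewrite scale0r.
Defined.

(* V / (R v_0 + ... + R v_(n-1)) *)
Definition gquot (V : gmod k) (n : nat) (v : 'I_n -> V) (e : 'I_n -> int)
  (hv : forall i, gdeg (e i) (v i)) : gmod k :=
  gsubquot (gmod_pregrading V) (gtot V) (gspan hv).

End StandardModules.

Definition projective (k : fieldType) (P : grbimod k) : Prop :=
  forall (M N : grbimod k) (f : ghom M N) (g : ghom P N),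
    (forall y, exists x, f x = y) ->
    exists h : ghom P M, forall p, f (h p) = g p.

(* Graded projective resolutions  ... -> P_1 -> P_0 -> R -> 0  of the regular
   bimodule R. *)
Record resolution (k : fieldType) := Resolution {
  res :> nat -> grbimod k;
  res_d : forall n, ghom (res n.+1) (res n);
  res_aug : ghom (res 0) (breg k);
  res_proj : forall n, projective (res n);
  res_aug_surj : forall r, exists p, res_aug p = r;
  res_exact0 : forall p, res_aug p = 0 <-> exists q, p = res_d 0 q;
  res_exactS : forall n p, res_d n p = 0 <-> exists q, p = res_d n.+1 q }.

Definition rmod (k : fieldType) (M : grbimod k) : Type := M.

Section RightModule.
Variables (k : fieldType) (M : grbimod k).
Local Notation R := {mpoly k[2]}.

HB.instance Definition _ := GRing.Zmodule.on (rmod M).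

Definition rscale (a : R) (x : rmod M) : rmod M := ract (x : M) a.

Lemma rscaleA a b x : rscale a (rscale b x) = rscale (a * b) x.
Proof. by rewrite /rscale ractA mulrC. Qed.
Lemma rscale1 : left_id 1 rscale.
Proof. by move=> x; rewrite /rscale ract1. Qed.
Lemma rscaleDr : right_distributive rscale +%R.
Proof. by move=> a x y; rewrite /rscale ractDl. Qed.
Lemma rscaleDl x : {morph rscale^~ x : a b / a + b}.
Proof. by move=> a b; rewrite /rscale ractDr. Qed.

HB.instance Definition _ := GRing.Zmodule_isLmodule.Build R (rmod M)
  rscaleA rscale1 rscaleDr rscaleDl.

End RightModule.

Section HomModule.
Variables (k : fieldType) (P M : grbimod k).
Local Notation R := {mpoly k[2]}.

(* Bimodule maps P -> M of degree l, i.e. graded bimodule maps P -> M(l). *)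
Definition hom_deg (l : int) (f : P -> rmod M) : Prop :=
  [/\ forall x y, f (x - y) = f x - f y,
      forall a x, f (lact a x) = lact a (f x : M),
      forall x a, f (ract x a) = ract (f x : M) a
    & forall d x, bdeg d x -> bdeg (d + l) (f x : M)].

Lemma hom_deg_pregrading : is_pregrading hom_deg.
Proof.
split=> [l|l f g [f1 f2 f3 f4] [g1 g2 g3 g4]|s f us hf E i si|e l a f ha [f1 f2 f3 f4]].
- split=> [x y|a x|x a|d x hx]; rewrite ?subr0 //.
  + by rewrite lact0r.
  + by rewrite ract0l.
  + exact: (gr0 (bdeg_grading M)).
- split=> [x y|a x|x a|d x hx].
  + by rewrite !fctE f1 g1 !opprD addrACA.
  + by rewrite !fctE f2 g2 lactBr.
  + by rewrite !fctE f3 g3 ractBl.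
  + by apply: (grB (bdeg_grading M)); [exact: f4 | exact: g4].
- have f0 j : f j 0 = 0 by case: (hf j) => fB _ _ _; exact: (subf0 fB).
  apply/funext => x; rewrite (gcomp_sum (bdeg_grading P) x).
  case: (hf i) => fB _ _ _; rewrite (subf_sum fB) big1 // => d _.
  set y := gcomp _ x d; have hy : bdeg d y by exact: gcomp_homog.
  have us' : uniq (map (fun j => d + j) s) by rewrite map_inj_uniq //; exact: addrI.
  have hf' j : bdeg j (f (j - d) y : M).
    by case: (hf (j - d)) => _ _ _ /(_ d y hy); rewrite addrC subrK.
  have E' : \sum_(j <- map (fun j => d + j) s) (f (j - d) y : M) = 0.
    rewrite big_map; transitivity ((\sum_(j <- s) f j) y); last by rewrite E.
    by rewrite fct_sumE; apply: eq_bigr => j _; rewrite addrC addKr.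
  have := gr_indep (bdeg_grading M) us' hf' E' (map_f (fun j => d + j) si).
  by rewrite addrC addKr.
- split=> [x y|b x|x b|d x hx]; rewrite ?fctE.
  + by rewrite f1 scalerBr.
  + by rewrite f2 /GRing.scale /= /rscale lractA.
  + by rewrite f3 /GRing.scale /= /rscale !ractA mulrC.
  + by rewrite addrCA; apply: bdeg_ract => //; exact: f4.
Qed.

Let H0 := pg0 hom_deg_pregrading.
Let HB := pgB hom_deg_pregrading.

Lemma hom_spanZ a f : homog_span hom_deg f -> homog_span hom_deg (a *: f).
Proof.
case=> s [F [us hF ->]]; rewrite scaler_sumr; apply: (homog_span_sum H0 HB) => i.
have [t [b [ut hb ->]]] := gr_span (pdeg_grading k) a.
rewrite scaler_suml; apply: (homog_span_sum H0 HB) => j.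
apply: (homog_span1 H0 (d := j + i)); exact: (pgZ hom_deg_pregrading).
Qed.

Lemma hom_spanB f x y : homog_span hom_deg f -> f (x - y) = f x - f y.
Proof.
case=> s [F [us hF ->]]; rewrite fct_sumE -sumrB; apply: eq_bigr => i _.
by case: (hF i).
Qed.

End HomModule.

Section HH.
Variables (k : fieldType) (P : resolution k).
Local Notation R := {mpoly k[2]}.

Section Object.
Variables (n : nat) (M : grbimod k).
Local Notation hdeg := (@hom_deg k (P n) M).

(* The elements of (+)_l Hom(P_n, M(l)) that vanish on the image of P_(n+1). *)
Definition cocycles : gsubmod hdeg.
Proof.
refine (@Gsubmod _ _ _
  (fun f => homog_span hdeg f /\ forall q, f (res_d P n q) = 0) _ _ _ _).
- by split=> //; exact: (homog_span0 (pg0 (hom_deg_pregrading _ _))).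
- move=> f g [sf zf] [sg zg]; split.
    by apply: homog_spanB => //; [apply: pg0 | apply: pgB]; exact: hom_deg_pregrading.
  by move=> q; rewrite !fctE zf zg subr0.
- move=> a f [sf zf]; split; first exact: hom_spanZ.
  by move=> q; rewrite !fctE zf scaler0.
move=> f [sf zf]; have H0 := pg0 (hom_deg_pregrading (P n) M).
have [s [F [us hF F0 E]]] := homog_spanP H0 sf.
have H' := hom_deg_pregrading (P n.+1) M.
exists s, F; split=> // i; split; first exact: (homog_span1 H0 (hF i)).
have hd j : @hom_deg k (P n.+1) M j (fun q => F j (res_d P n q)).
  case: (hF j) => F1 F2 F3 F4.
  split=> [x y|a x|x a|d x hx]; rewrite ?ghomB ?ghom_lact ?ghom_ract ?F1 ?F2 ?F3 //.
  by apply: F4; exact: ghom_deg.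
case: (boolP (i \in s)) => [si|/F0 -> //] q.
have E' : \sum_(j <- s) (fun p => F j (res_d P n p) : rmod M) = 0.
  apply/funext => q'; rewrite fct_sumE; transitivity (f (res_d P n q')); last exact: zf.
  by rewrite E fct_sumE.
exact: (congr1 (fun u => u q) (pg_indep H' us hd E' si)).
Defined.

(* The image of (+)_l Hom(P_(n-1), M(l)), with P_(-1) = 0. *)
Definition is_coboundary : forall m : nat, (P m -> rmod M) -> Prop := fun m =>
  match m return (P m -> rmod M) -> Prop with
  | 0 => fun f => f = 0
  | m'.+1 => fun f => exists2 g : P m' -> rmod M,
      homog_span (@hom_deg k (P m') M) g & f = (fun q => g (res_d P m' q))
  end.

Definition coboundaries : gsubmod hdeg.
Proof.
refine (@Gsubmod _ _ _ (@is_coboundary n) _ _ _ _); case: n => [|m] /=.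
- by [].
- exists 0 => //; exact: (homog_span0 (pg0 (hom_deg_pregrading (P m) M))).
- by move=> f g -> ->; rewrite subr0.
- have H' := hom_deg_pregrading (P m) M.
  move=> _ _ [f sf ->] [g sg ->]; exists (f - g) => //.
  by apply: homog_spanB => //; [exact: (pg0 H') | exact: (pgB H')].
- by move=> a f ->; rewrite scaler0.
- by move=> a _ [f sf ->]; exists (a *: f) => //; exact: hom_spanZ.
- move=> f ->; exists [::], (fun=> 0); rewrite big_nil; split=> // i.
  exact: (pg0 (hom_deg_pregrading _ _)).
move=> _ [g [s [F [us hF ->]]] ->].
have H' := hom_deg_pregrading (P m) M.
exists s, (fun i q => F i (res_d P m q)); split=> // [j|j|].
- case: (hF j) => F1 F2 F3 F4.
  split=> [x y|a x|x a|d x hx]; rewrite ?ghomB ?ghom_lact ?ghom_ract ?F1 ?F2 ?F3 //.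
  by apply: F4; exact: ghom_deg.
- by exists (F j) => //; exact: (homog_span1 (pg0 H') (hF j)).
- by apply/funext => q; rewrite !fct_sumE.
Defined.

(* HH^n(M) = (+)_l Ext^n(R, M(l)), with the class of a cocycle of degree l in
   internal degree l. *)
Definition HH : gmod k :=
  gsubquot (hom_deg_pregrading (P n) M) cocycles coboundaries.

End Object.

Section Map.
Variables (n : nat) (M N : grbimod k) (f : ghom M N).

Definition post (m : nat) (u : P m -> rmod M) : P m -> rmod N := fun p => f (u p).

Lemma post_deg m l (u : P m -> rmod M) : hom_deg l u -> hom_deg l (post u).
Proof.
case=> u1 u2 u3 u4; split=> [x y|a x|x a|d x hx]; rewrite /post.
- by rewrite u1 ghomB.
- by rewrite u2 ghom_lact.
- by rewrite u3 ghom_ract.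
- by apply: ghom_deg; exact: u4.
Qed.

Lemma post_span m (u : P m -> rmod M) :
  homog_span (@hom_deg k (P m) M) u -> homog_span (@hom_deg k (P m) N) (post u).
Proof.
case=> s [F [us hF ->]]; exists s, (fun i => post (F i)); split=> // [i|].
  exact: post_deg.
by apply/funext => p; rewrite /post !fct_sumE ghom_sum.
Qed.

Lemma post_coc u : cocycles n M u -> cocycles n N (post u).
Proof.
case=> su zu; split; first exact: post_span.
by move=> q; rewrite /post zu ghom0.
Qed.

Lemma post_cob u : coboundaries n M u -> coboundaries n N (post u).
Proof.
rewrite /=; case: n u => [|m] u /=.
  by move=> ->; apply/funext => p; rewrite /post ghom0.
by case=> g sg ->; exists (post g) => //; exact: post_span.
Qed.

Definition HHmap_fun (x : HH n M) : HH n N :=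
  cls (cocycles n N) (coboundaries n N) (post (rep x)).

Lemma HHmapE u : cocycles n M u ->
  HHmap_fun (cls (cocycles n M) (coboundaries n M) u)
  = cls (cocycles n N) (coboundaries n N) (post u).
Proof.
move=> hu; set x := cls _ _ u; have hr := rep_mem x.
apply/cls_eq; [exact: post_coc | exact: post_coc |].
have -> : post (rep x) - post u = post (rep x - u).
  by apply/funext => p; rewrite /post !fctE ghomB.
by apply: post_cob; apply/(cls_eq _ hr hu); rewrite repK.
Qed.

Lemma HHmap_linear : linear HHmap_fun.
Proof.
move=> a x y.
have hx := rep_mem x; have hy := rep_mem y.
rewrite -{1}[x]repK -{1}[y]repK -clsZ // -clsD //; last exact: smZ.
rewrite HHmapE; last by apply: smD => //; exact: smZ.
rewrite /HHmap_fun -clsZ; last exact: post_coc.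
rewrite -clsD; [| exact/smZ/post_coc | exact: post_coc].
congr cls; apply/funext => p; rewrite /post !fctE ghomD; congr (_ + _).
by rewrite /GRing.scale /= /rscale ghom_ract.
Qed.

HB.instance Definition _ :=
  GRing.isLinear.Build R (HH n M) (HH n N) _ HHmap_fun HHmap_linear.

Lemma HHmap_deg d (x : HH n M) : gdeg d x -> gdeg d (HHmap_fun x).
Proof.
case=> u [hu du ->]; exists (post u); split; first exact: post_coc.
  exact: post_deg.
exact: HHmapE.
Qed.

Definition HHmap : gmhom (HH n M) (HH n N) :=
  @Gmhom _ (HH n M) (HH n N) HHmap_fun HHmap_deg.

End Map.

End HH.

(* Cohomological convention: [cpx_d] raises the degree by one. *)
Record cpx (k : fieldType) := Cpx {
  cpx_ob :> int -> grbimod k;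
  cpx_d : forall n, ghom (cpx_ob n) (cpx_ob (n + 1));
  cpx_dd : forall n x, cpx_d (n + 1) (cpx_d n x) = 0 }.

(* The differential ending in degree j. *)
Definition cpx_to (k : fieldType) (C : cpx k) (j : int) : ghom (C (j - 1)) (C j) :=
  eq_rect _ (fun i => ghom (C (j - 1)) (C i)) (cpx_d C (j - 1)) j (subrK 1 j).

Section HHH.
Variables (k : fieldType) (P : resolution k) (C : cpx k).

(* The cohomology in degree j of
   ... -> HH^n(C^(j-1)) -> HH^n(C^j) -> HH^n(C^(j+1)) -> ... *)
Definition HHH (n : nat) (j : int) : gmod k :=
  gsubquot (gmod_pregrading (HH P n (C j)))
    (gker (HHmap P n (cpx_d C j))) (gim (HHmap P n (cpx_to C j))).

End HHH.

Section Constructions.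
Variable k : fieldType.
Local Notation R := {mpoly k[2]}.

Definition zero_hom (M N : grbimod k) : ghom M N.
Proof.
refine (@Ghom k M N (fun _ => 0) _ _ _ _) => *.
- by rewrite subr0.
- by rewrite lact0r.
- by rewrite ract0l.
- exact: (gr0 (bdeg_grading N)).
Defined.

Definition cpx_unit : cpx k :=
  @Cpx k (fun n => if n == 0 then breg k else bzero k)
    (fun n => zero_hom _ _) (fun n x => erefl).

(* Complexes D^(-1) -> D^0 concentrated in degrees -1 and 0. *)
Record two_term := TwoTerm {
  tt_m1 : grbimod k;
  tt_0 : grbimod k;
  tt_d : ghom tt_m1 tt_0 }.

Definition id_hom (M : grbimod k) : ghom M M :=
  @Ghom k M M id (fun _ _ => erefl) (fun _ _ => erefl) (fun _ _ => erefl)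
    (fun _ _ => id).

Definition fullR : grsubalg k.
Proof.
refine (@Grsubalg k (fun _ => True) _ _ _ _) => // a _.
by have [s [f [? ? ?]]] := gr_span (pdeg_grading k) a; exists s, f.
Defined.

Local Notation "M (x) N" := (btens fullR M N) (at level 40, left associativity).

Definition sgn (V : zmodType) (n : int) (z : V) : V := if odd `|n|%N then - z else z.

Section TensorComplex.
Variables (C : cpx k) (D : two_term).

(* (C (x)_R D)^n = C^(n+1) (x) D^(-1)  (+)  C^n (x) D^0. *)
Definition tcpx_ob (n : int) : grbimod k :=
  bsum (C (n + 1) (x) tt_m1 D) (C n (x) tt_0 D).

(* d(x (x) y) = dx (x) y + (-1)^|x| x (x) dy *)
Definition tcpx_d_fun (n : int) (z : tcpx_ob n) : tcpx_ob (n + 1) :=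
  (tmap fullR (cpx_d C (n + 1)) (id_hom (tt_m1 D)) z.1,
   sgn (n + 1) (tmap fullR (id_hom (C (n + 1))) (tt_d D) z.1)
   + tmap fullR (cpx_d C n) (id_hom (tt_0 D)) z.2).

Lemma sgnB (V : zmodType) n (x y : V) : sgn n (x - y) = sgn n x - sgn n y.
Proof. by rewrite /sgn; case: ifP; rewrite ?opprD. Qed.

Lemma tcpx_dB n (x y : tcpx_ob n) : tcpx_d_fun (x - y) = tcpx_d_fun x - tcpx_d_fun y.
Proof.
rewrite [RHS]surjective_pairing /tcpx_d_fun; congr pair; first exact: ghomB.
by rewrite [in LHS]ghomB sgnB [in LHS]ghomB /= opprD addrACA.
Qed.

Lemma tcpx_d_lact n a (x : tcpx_ob n) : tcpx_d_fun (lact a x) = lact a (tcpx_d_fun x).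
Proof.
congr pair; first exact: ghom_lact.
rewrite [in RHS]lactDr; congr (_ + _); last exact: ghom_lact.
by rewrite /sgn; case: ifP => _; rewrite ?[in RHS]lactN [in LHS]ghom_lact.
Qed.

Lemma tcpx_d_ract n (x : tcpx_ob n) a : tcpx_d_fun (ract x a) = ract (tcpx_d_fun x) a.
Proof.
congr pair; first exact: ghom_ract.
rewrite [in RHS]ractDl; congr (_ + _); last exact: ghom_ract.
by rewrite /sgn; case: ifP => _; rewrite ?[in RHS]ractN [in LHS]ghom_ract.
Qed.

Lemma tcpx_d_deg n d (x : tcpx_ob n) : bdeg d x -> bdeg d (tcpx_d_fun x).
Proof.
case=> h1 h2; split; first exact: ghom_deg.
have G := bdeg_grading (C (n + 1) (x) tt_0 D).
apply: (homog_add (gr0 G) (grB G)); last exact: ghom_deg.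
by rewrite /sgn; case: ifP => _; [apply: (homog_opp (gr0 G) (grB G)) |];
  exact: ghom_deg.
Qed.

Definition tcpx_d (n : int) : ghom (tcpx_ob n) (tcpx_ob (n + 1)) :=
  Ghom (@tcpx_dB n) (@tcpx_d_lact n) (@tcpx_d_ract n) (@tcpx_d_deg n).

Lemma sgnS (V : zmodType) n (x : V) : sgn (n + 1) x = - sgn n x.
Proof.
rewrite /sgn; case: n => n.
  by rewrite -PoszD addn1 /=; case: odd; rewrite ?opprK.
rewrite NegzE abszN -[n.+1]addn1 PoszD opprD subrK abszN.
by rewrite !absz_nat addn1 /=; case: odd; rewrite ?opprK.
Qed.

Lemma tmap_comp (M1 M2 M3 N1 N2 N3 : grbimod k) (f : ghom M1 M2) (f' : ghom M2 M3)
    (g : ghom N1 N2) (g' : ghom N2 N3) (X : M1 (x) N1) (W : M1 (x) N1 -> M3 (x) N3) :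
  (forall Y Z, W (Y - Z) = W Y - W Z) ->
  (forall x y, W (tens fullR x y) = tens fullR (f' (f x)) (g' (g y))) ->
  tmap fullR f' g' (tmap fullR f g X) = W X.
Proof.
move=> WB WE; apply: (@tens_ext _ fullR M1 N1 _
  (fun X => tmap fullR f' g' (tmap fullR f g X))) => [Y Y'|Y Y'|y y'].
- by rewrite !ghomB.
- exact: WB.
- by rewrite WE /= !tmapE.
Qed.

Lemma tcpx_dd n x : tcpx_d (n + 1) (tcpx_d n x) = 0.
Proof.
have dd m (M : grbimod k) (X : C m (x) M) :
    tmap fullR (cpx_d C (m + 1)) (id_hom M) (tmap fullR (cpx_d C m) (id_hom M) X) = 0.
  apply: (@tmap_comp _ _ _ _ _ _ _ _ _ _ X (fun=> 0)) => [Y Y'|y y'].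
    by rewrite subr0.
  by rewrite cpx_dd tens0l.
pose m := tmap fullR (cpx_d C (n + 1)) (tt_d D) x.1.
have E1 : tmap fullR (cpx_d C (n + 1)) (id_hom (tt_0 D))
    (tmap fullR (id_hom (C (n + 1))) (tt_d D) x.1) = m.
  by apply: tmap_comp => [Y Y'|y y']; rewrite ?ghomB //= tmapE.
have E2 : tmap fullR (id_hom (C (n + 1 + 1))) (tt_d D)
    (tmap fullR (cpx_d C (n + 1)) (id_hom (tt_m1 D)) x.1) = m.
  by apply: tmap_comp => [Y Y'|y y']; rewrite ?ghomB //= tmapE.
have E3 : tmap fullR (cpx_d C (n + 1)) (id_hom (tt_0 D))
    (sgn (n + 1) (tmap fullR (id_hom (C (n + 1))) (tt_d D) x.1)) = sgn (n + 1) m.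
  by rewrite /sgn; case: ifP => _; rewrite ?ghomN E1.
transitivity ((0, sgn (n + 1 + 1) m + (sgn (n + 1) m + 0)) : tcpx_ob (n + 1 + 1)).
  congr pair; first exact: dd.
  congr (_ + _); first by rewrite E2.
  by rewrite [LHS]ghomD E3 dd.
by rewrite addr0 sgnS addNr.
Qed.

Definition tcpx : cpx k := Cpx tcpx_dd.

End TensorComplex.
End Constructions.

Section Rouquier.
Variable k : fieldType.
Local Notation R := {mpoly k[2]}.

(* 'X_0 = alpha_s and 'X_1 = alpha_t; the reflection indexed by i sends 'X_i to
   - 'X_i and the other variable to 'X_0 + 'X_1. *)
Definition refl_img (i j : 'I_2) : R := if j == i then - 'X_i else 'X_0 + 'X_1.

Definition refl (i : 'I_2) (p : R) : R := p \mPo [tuple refl_img i j | j < 2].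

Lemma reflX i j : refl i 'X_j = refl_img i j.
Proof. by rewrite /refl comp_mpolyXU -tnth_nth tnth_mktuple. Qed.

Lemma pdeg_refl_img i j : pdeg 2 (refl_img i j).
Proof.
rewrite /refl_img; case: ifP => _.
  by rewrite -sub0r; apply: pdegB; [exact: pdeg0 | exact: pdegX].
by apply: (homog_add (@pdeg0 k) (@pdegB k)); exact: pdegX.
Qed.

Lemma pdeg_refl i d p : pdeg d p -> pdeg d (refl i p).
Proof.
move=> hp; rewrite /refl comp_mpolyE big_seq.
elim/big_ind: _ => [|x y hx hy|m hm]; first exact: pdeg0.
  exact: (homog_add (@pdeg0 k) (@pdegB k)).
apply: pdegZ; rewrite -(hp _ hm) big_ord_recl big_ord1.
have X2 n (q : R) : pdeg 2 q -> pdeg (2 * n)%N (q ^+ n).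
  move=> hq; elim: n => [|n IH]; first by rewrite expr0 -mpolyC1; exact: pdegC.
  by rewrite exprS mulnS PoszD; exact: pdegM.
rewrite mdegE big_ord_recl big_ord1 mulnDr PoszD !tnth_mktuple.
by apply: pdegM; apply: X2; exact: pdeg_refl_img.
Qed.

Definition invariants (i : 'I_2) : grsubalg k.
Proof.
refine (@Grsubalg k (fun p => refl i p = p) _ _ _ _).
- by move=> c; rewrite /refl comp_mpolyC.
- by move=> a b ha hb; rewrite /refl comp_mpolyD; congr (_ + _).
- by move=> a b ha hb; rewrite /refl rmorphM; congr (_ * _).
move=> a ha.
have [s [f [us hf f0 E]]] := homog_spanP (@pdeg0 k) (gr_span (pdeg_grading k) a).
exists s, f; split=> // j; case: (boolP (j \in s)) => [js|/f0 ->]; last first.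
  by rewrite /refl comp_mpoly0.
have E0 : \sum_(l <- s) (refl i (f l) - f l) = 0.
  by rewrite sumrB -E /refl -raddf_sum -E /= -/(refl i a) ha subrr.
apply/eqP; rewrite -subr_eq0; apply/eqP.
apply: (gr_indep (pdeg_grading k) us (f := fun l => refl i (f l) - f l)) => // l.
by apply: pdegB => //; exact: pdeg_refl.
Defined.

(* B_i = R (x)_(R^i) R (1) *)
Definition Bbim (i : 'I_2) : grbimod k :=
  bshift 1 (btens (invariants i) (breg k) (breg k)).

Definition btn (i : 'I_2) (x y : R) : Bbim i :=
  tens (invariants i) (x : breg k) (y : breg k).

Section PureTensors.
Variable i : 'I_2.
Lemma btnDl x x' y : btn i (x + x') y = btn i x y + btn i x' y.
Proof. exact: tensDl. Qed.
Lemma btnDr x y y' : btn i x (y + y') = btn i x y + btn i x y'.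
Proof. exact: tensDr. Qed.
Lemma btnBl x x' y : btn i (x - x') y = btn i x y - btn i x' y.
Proof. exact: tensBl. Qed.
Lemma btnBr x y y' : btn i x (y - y') = btn i x y - btn i x y'.
Proof. exact: tensBr. Qed.
Lemma btn_lact a x y : lact a (btn i x y) = btn i (a * x) y.
Proof. exact: tlactE. Qed.
Lemma btn_ract a x y : ract (btn i x y) a = btn i x (y * a).
Proof. exact: tractE. Qed.
Lemma btn_bal x p y : refl i p = p -> btn i (x * p) y = btn i x (p * y).
Proof. by move=> hp; exact: (@tens_bal k (invariants i) (breg k) (breg k) x p y hp). Qed.
Lemma btn_inv p : refl i p = p -> btn i p 1 = btn i 1 p.
Proof. by move=> hp; rewrite -[p in LHS]mul1r btn_bal // mulr1. Qed.
End PureTensors.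

(* 1/2 (alpha_i (x) 1 + 1 (x) alpha_i) *)
Definition rou_elt (i : 'I_2) : Bbim i :=
  lact (2%:R^-1 : k)%:MP (btn i 'X_i 1 + btn i 1 'X_i).

Lemma rou_central_var i j :
  lact 'X_j (btn i 'X_i 1 + btn i 1 'X_i) = ract (btn i 'X_i 1 + btn i 1 'X_i) 'X_j.
Proof.
rewrite lactDr ractDl !btn_lact !btn_ract !mul1r !mulr1.
case: (eqVneq j i) => [->|ji].
  rewrite addrC; congr (_ + _); apply: btn_inv.
  by rewrite /refl rmorphM /= -/(refl i 'X_i) reflX /refl_img eqxx mulrNN.
pose v : R := 'X_j; pose u : R := 'X_i + v.
have uE : 'X_0 + 'X_1 = u.
  rewrite /u /v; case: i ji {u v} => -[|[|//]] hi; case: j => -[|[|//]] hj //= _;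
    rewrite 1?[RHS]addrC; by congr ('X__ + 'X__); apply: val_inj.
have rv : refl i v = u by rewrite reflX /refl_img (negbTE ji) uE.
have ru : refl i u = v.
  rewrite /u /refl comp_mpolyD -/(refl i 'X_i) -/(refl i v) rv reflX.
  by rewrite /refl_img eqxx addrA addNr add0r.
have rP : refl i (v * u) = v * u by rewrite /refl rmorphM /= -!/(refl i _) rv ru mulrC.
have rS : refl i (v + u) = v + u by rewrite /refl comp_mpolyD -!/(refl i _) rv ru addrC.
have e1 : v * 'X_i = v * u - v * v by rewrite /u mulrDr addrK.
have e2 : 'X_i = (v + u) - v - v :> R by rewrite /u [v + _]addrC addrK addrK.
have e3 : btn i v 'X_i = btn i (v * v) 1 + btn i (v * u) 1 - btn i v v - btn i v v.
  by rewrite {1}e2 !btnBr -[v + u]mulr1 -btn_bal // mulrDr btnDl.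
have e4 : btn i 'X_i v = btn i 1 (v * v) + btn i 1 (v * u) - btn i v v - btn i v v.
  by rewrite {1}e2 !btnBl -[v + u]mul1r btn_bal // [(v + u) * v]mulrC mulrDr btnDr.
rewrite -/v e3 e4 ['X_i * v]mulrC e1 btnBl btnBr (btn_inv rP).
have E (p c x : Bbim i) : p - x + (x + p - c - c) = p + p - c - c.
  by rewrite !addrA subrK.
by rewrite E [RHS]addrC E.
Qed.

Lemma rou_elt_central i (a : R) : lact a (rou_elt i) = ract (rou_elt i) a.
Proof.
rewrite /rou_elt lractA !lactA mulrC -lactA; congr lact.
set c := _ + _.
elim/mpolyind: a => [|b m p _ _ IH]; first by rewrite lact0l ract0r.
rewrite lactDl ractDr IH; congr (_ + _).
have cM (p1 p2 : R) : lact p1 c = ract c p1 -> lact p2 c = ract c p2 ->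
    lact (p1 * p2) c = ract c (p1 * p2).
  by move=> h1 h2; rewrite -lactA h2 -lractA h1 ractA.
have cn (q : R) n : lact q c = ract c q -> lact (q ^+ n) c = ract c (q ^+ n).
  move=> hq; elim: n => [|n IHn]; first by rewrite expr0 lact1 ract1.
  by rewrite exprS; exact: cM.
rewrite -mul_mpolyC mpolyXE_id big_ord_recl big_ord1.
apply: (cM); first exact: lractC.
by apply: (cM); apply: (cn); exact: rou_central_var.
Qed.

Lemma rou_elt_deg i : bdeg 1 (rou_elt i).
Proof.
apply: (@bdeg_lact k (Bbim i) 0 1); first exact: pdegC.
have G := bdeg_grading (Bbim i).
have h1 : pdeg 0 (1 : R) by rewrite -mpolyC1; exact: pdegC.
apply: (homog_add (gr0 G) (grB G)).
  by apply: (@TDt _ _ _ _ _ 2 0) => //; exact: pdegX.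
by apply: (@TDt _ _ _ _ _ 0 2) => //; exact: pdegX.
Qed.

(* R(-1) -> B_i, 1 |-> 1/2 (alpha_i (x) 1 + 1 (x) alpha_i) *)
Definition rou_map (i : 'I_2) : ghom (bshift (-1) (breg k)) (Bbim i).
Proof.
refine (@Ghom k (bshift (-1) (breg k)) (Bbim i) (fun a => lact (a : R) (rou_elt i)) _ _ _ _).
- by move=> x y; rewrite lactDl lactNl.
- by move=> a x; rewrite lactA.
- by move=> x a; rewrite lractA -rou_elt_central lactA.
move=> d x /= hx; have := bdeg_lact hx (rou_elt_deg i).
by rewrite subrK.
Defined.

(* F(sigma_i^-1) = (R(-1) -> B_i), with B_i in degree 0. *)
Definition rou_neg (i : 'I_2) : two_term k := TwoTerm (rou_map i).

(* The Rouquier complex of sigma_(i_1)^-1 ... sigma_(i_n)^-1 for w = i_1 ... i_n. *)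
Definition rouquier_neg (w : seq 'I_2) : cpx k :=
  foldl (fun C i => tcpx C (rou_neg i)) (cpx_unit k) w.

End Rouquier.

Section Target.
Variable k : fieldType.
Local Notation R := {mpoly k[2]}.
Local Notation as_ := ('X_0 : R).
Local Notation at_ := ('X_1 : R).

Definition giso (V W : gmod k) : Prop :=
  exists f : {linear V -> W}, bijective f /\ forall d x, gdeg d x <-> gdeg d (f x).

Definition gtrivial (V : gmod k) : Prop := forall x : V, x = 0.

Lemma gens_k_deg (i : 'I_2) : @gdeg k (gfree k) 2 ('X_i : R).
Proof. exact: pdegX. Qed.

(* k = R / (alpha_s, alpha_t) *)
Definition gresidue : gmod k := gquot gens_k_deg.

Definition rels1 (i : 'I_2) : gsum (gfree k) (gfree k) :=
  if i == 0 then (at_, - as_) else (0, as_ * at_ + as_ ^+ 2).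

Definition rels2 (i : 'I_2) : gsum (gfree k) (gfree k) :=
  if i == 0 then (at_, - as_) else (as_ * at_ + at_ ^+ 2, 0).

Definition rels_deg (i : 'I_2) : int := if i == 0 then 2 else 4.

Lemma pdegNX (i : 'I_2) : pdeg 2 (- 'X_i : R).
Proof. by rewrite -sub0r; apply: pdegB; [exact: pdeg0 | exact: pdegX]. Qed.

Lemma pdeg_quad (i j l m : 'I_2) : pdeg 4 ('X_i * 'X_j + 'X_l * 'X_m : R).
Proof.
by apply: (homog_add (@pdeg0 k) (@pdegB k)); apply: (@pdegM _ 2 2); exact: pdegX.
Qed.

Lemma rels1_deg i : gdeg (rels_deg i) (rels1 i).
Proof.
rewrite /rels_deg /rels1; case: ifP => _; split.
- exact: pdegX.
- exact: pdegNX.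
- exact: pdeg0.
- exact: pdeg_quad.
Qed.

Lemma rels2_deg i : gdeg (rels_deg i) (rels2 i).
Proof.
rewrite /rels_deg /rels2; case: ifP => _; split.
- exact: pdegX.
- exact: pdegNX.
- exact: pdeg_quad.
- exact: pdeg0.
Qed.

(* (R (+) R) / (R (alpha_t, - alpha_s) + R (0, alpha_s alpha_t + alpha_s^2)) *)
Definition gcoker1 : gmod k := gquot rels1_deg.
(* (R (+) R) / (R (alpha_t, - alpha_s) + R (alpha_s alpha_t + alpha_t^2, 0)) *)
Definition gcoker2 : gmod k := gquot rels2_deg.

(* The part of V in degree d has dimension m over k. *)
Definition has_dim (V : gmod k) (d : int) (m : nat) : Prop :=
  exists b : 'I_m -> V,
    [/\ forall i, gdeg d (b i),
        forall c : 'I_m -> k, \sum_i (c i)%:MP *: b i = 0 -> forall i, c i = 0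
      & forall x, gdeg d x -> exists c : 'I_m -> k, x = \sum_i (c i)%:MP *: b i].

End Target.

(* Laurent series in Q, as coefficient functions. *)
Definition qseries := int -> int.
(* Series in A, T, Q: [S a t q] is the coefficient of A^a T^t Q^q. *)
Definition series := nat -> int -> qseries.

Definition q1 : qseries := fun d => (d == 0)%:R.
(* Q^e f *)
Definition qX (e : int) (f : qseries) : qseries := fun d => f (d - e).
(* 1 / (1 - Q^2) *)
Definition qgeom : qseries :=
  fun d => if d is Posz n then (~~ odd n)%:R else 0.
(* 1 / (1 - Q^2)^2 *)
Definition qgeom2 : qseries :=
  fun d => if d is Posz n then (if odd n then 0 else n./2.+1%:R) else 0.

Lemma qgeomE : qgeom - qX 2 qgeom = q1.
Proof.
apply/funext => d; rewrite /qX !fctE /q1; case: d => [[|[|n]]|n] //.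
have -> : n.+2%:Z - 2 = n by rewrite -addn2 PoszD addrK.
by rewrite /qgeom /= negbK; case: odd; rewrite ?subrr.
Qed.

Lemma qgeom2E : qgeom2 - qX 2 qgeom2 = qgeom.
Proof.
apply/funext => d; rewrite /qX !fctE; case: d => [[|[|n]]|n] //.
have -> : n.+2%:Z - 2 = n by rewrite -addn2 PoszD addrK.
rewrite /qgeom /qgeom2 /= negbK.
by case: odd; rewrite ?subrr // -[X in X - _]natr1 addrAC subrr add0r.
Qed.

(* A^a T^t f *)
Definition AT (a : nat) (t : int) (f : qseries) : series :=
  fun a' t' => if (a' == a) && (t' == t) then f else 0.

Definition has_poincare (k : fieldType) (H : nat -> int -> gmod k) (S : series) : Prop :=
  forall a t d, exists2 m : nat, has_dim (H a t) d m & S a t d = m%:Z.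

(* Main.v *)
(* On graded R-bimodules, - (x)_R B_i is M (+) M with a twisted right action, so every term of the
   Rouquier complex is free as a left module, and right multiplication is given by integer
   matrices. Tensoring with the six factors one at a time and cancelling contractible summands
   after each yields a complex of bimodules of total rank 61; the homotopy equivalences, whose
   matrices are integral, are verified by computation with sparse integer matrices.

   An arbitrary projective resolution of R over R (x)_k R is compared with the Koszul resolution on
   the elements 1 (x) alpha - alpha (x) 1, which identifies HH^n(M) with the cohomology of the
   Koszul cochains of M; these vanish for n > 2. For n = 0, 1, 2 an explicit contraction, defined
   over Z[1/3], transfers the complex of the HH^n to a small complex of free right R-modules. Its
   differentials have the entries 0, alpha_s, alpha_t, -alpha_s, alpha_s alpha_t + alpha_s^2 and
   alpha_s alpha_t + alpha_t^2, and its cohomology is read off because alpha_s, alpha_t is a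
   regular sequence. *)
From Stdlib Require Import ZArith.
Require Import Defs.
From HB Require Import structures.
From mathcomp Require Import all_boot all_order all_algebra.
From mathcomp Require Import boolp functions.
From mathcomp.multinomials Require Import ssrcomplements freeg mpoly.
From mathcomp Require Import zify ssrZ ring.

Set Implicit Arguments.
Unset Strict Implicit.
Unset Printing Implicit Defensive.

Import GRing.Theory.

Local Open Scope ring_scope.

(** * Isomorphisms out of subquotients *)

(** Two mismatches shape the proof. First, R acts on HH through the right action, but on the matrix
    bimodules only the left action is by scalars, so the contractions of the Koszul cochains are
    linear for the left action alone. The two actions agree on cohomology, because 1 (x) a - a (x) 1
    sends Koszul cocycles to coboundaries; this is what allows left-linear maps to compute right
    modules. Second, tensoring with one factor triples the total rank, so that six factors without
    cancellation would give rank 729; cancelling after each factor keeps all matrices small enough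
    to be checked by evaluation. Every identity between the data is an identity over the integers,
    carried to k along the ring map from Z. Characteristic 0 enters through three integers that must
    be invertible: 2, for splitting B_i, and 9 and 81, the common denominators of the
    contractions. *)

Section GisoSubquot.
Variables (k : fieldType) (V : lmodType {mpoly k[2]}) (h : int -> V -> Prop).
Variables (H : is_pregrading h) (Z B : gsubmod h) (W : gmod k) (f : V -> W).
Hypothesis fL : forall a x y, Z x -> Z y -> f (a *: x + y) = a *: f x + f y.
Hypothesis fB : forall x, Z x -> (f x = 0 <-> B x).
Hypothesis fdeg : forall d x, Z x -> h d x -> gdeg d (f x).
Hypothesis fsurj : forall d w, gdeg d w -> exists x, [/\ Z x, h d x & f x = w].

Let F (x : gsubquot H Z B) : W := f (rep x).

Let f0 : f 0 = 0.
Proof. by apply/(fB (sm0 Z)); exact: sm0. Qed.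

Let fsub x y : Z x -> Z y -> f (x - y) = f x - f y.
Proof.
move=> hx hy; have := fL (-1) hy hx.
by rewrite !scaleN1r addrC => ->; rewrite addrC.
Qed.

Let FE x : Z x -> F (cls Z B x) = f x.
Proof.
move=> hx; have hr := rep_mem (cls Z B x); apply/eqP; rewrite -subr_eq0 -fsub //.
by apply/eqP/(fB (smB hr hx))/(cls_eq _ hr hx); rewrite repK.
Qed.

Let F_linear : linear F.
Proof.
move=> a x y; have hx := rep_mem x; have hy := rep_mem y.
rewrite -{1}[x]repK -{1}[y]repK -clsZ // -clsD //; last exact: smZ.
by rewrite FE ?fL //; apply: smD => //; exact: smZ.
Qed.

(** This is the first isomorphism theorem; [f] matters only on Z, and [F] evaluates it at a chosen
    representative. Homogeneous elements of W have homogeneous preimages of the same degree, so by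
    injectivity the inverse preserves degrees too. *)
Lemma giso_gsubquot : giso (gsubquot H Z B) W.
Proof.
pose L := GRing.isLinear.Build {mpoly k[2]} (gsubquot H Z B) W _ F F_linear.
pose F' : {linear gsubquot H Z B -> W} := HB.pack F L.
have Finj : injective F.
  move=> x y /eqP; rewrite -subr_eq0 -fsub; [|exact: rep_mem..].
  move=> /eqP/fB hB; rewrite -[x]repK -[y]repK.
  apply/(cls_eq _ (rep_mem x) (rep_mem y))/hB.
  by apply: smB; exact: rep_mem.
have Fs w : exists x, F x = w.
  have [s [g [us hg ->]]] := gr_span (gdeg_grading W) w.
  have [x hx] := choice (fun i => fsurj (hg i)).
  exists (cls Z B (\sum_(i <- s) x i)); rewrite cls_sum => [|i]; last by case: (hx i).
  rewrite -[LHS]/(F' _) raddf_sum; apply: eq_bigr => i _ /=.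
  by case: (hx i) => hZ _ <-; exact: FE.
have [G FG] := choice Fs.
exists F'; split; first by exists G => [x|w] //; apply: Finj; rewrite FG.
move=> d x; split=> [[z [hz dz ->]]|dx]; first by rewrite /= FE //; exact: fdeg.
have [z [hz dz zE]] := fsurj dx; exists z; split=> //.
by apply: Finj; rewrite FE.
Qed.

End GisoSubquot.

Section GisoTheory.
Variable k : fieldType.

Lemma giso_trans (U V W : gmod k) : giso U V -> giso V W -> giso U W.
Proof.
case=> f [fb fd] [g [gb gd]]; exists (g \o f : {linear U -> W}); split.
  exact: bij_comp.
by move=> d x; rewrite fd gd.
Qed.

Lemma giso_gtrivial (V W : gmod k) : giso V W -> gtrivial W -> gtrivial V.
Proof.
by case=> f [fb _] W0 x; apply: (bij_inj fb); rewrite linear0; exact: W0.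
Qed.

Lemma giso_has_dim (V W : gmod k) d m : giso V W -> has_dim W d m -> has_dim V d m.
Proof.
case=> f [[g fK gK] fd] [b [bd bfree bspan]].
exists (fun i => g (b i)); split=> [i|c E i|x /fd/bspan[c E]].
- by apply/fd; rewrite gK.
- apply: bfree i; rewrite -[RHS](linear0 f) -E linear_sum.
  by apply: eq_bigr => i _; rewrite linearZ /= gK.
- exists c; apply: (can_inj fK); rewrite E linear_sum.
  by apply: eq_bigr => i _; rewrite linearZ /= gK.
Qed.

Lemma gtrivial_has_dim (V : gmod k) d : gtrivial V -> has_dim V d 0.
Proof.
move=> V0; exists (fun=> 0); split=> [[]//|c _ [] //|x _].
by exists (fun=> 0); rewrite big_ord0; exact: V0.
Qed.

End GisoTheory.

(** * Homotopy equivalences and HHH *)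

Section BimoduleMaps.
Variable k : fieldType.

Definition ghom_comp (L M N : grbimod k) (g : ghom M N) (f : ghom L M) : ghom L N.
Proof.
refine (@Ghom k L N (fun x => g (f x)) _ _ _ _).
- by move=> x y; rewrite !ghomB.
- by move=> a x; rewrite !ghom_lact.
- by move=> x a; rewrite !ghom_ract.
- by move=> d x hx; do 2!apply: ghom_deg.
Defined.

Definition ghom_sub (M N : grbimod k) (f g : ghom M N) : ghom M N.
Proof.
refine (@Ghom k M N (fun x => f x - g x) _ _ _ _).
- by move=> x y; rewrite !ghomB !opprD addrACA.
- by move=> a x; rewrite !ghom_lact lactBr.
- by move=> x a; rewrite !ghom_ract ractBl.
- by move=> d x hx; apply: (grB (bdeg_grading N)); exact: ghom_deg.
Defined.

Definition ghom_add (M N : grbimod k) (f g : ghom M N) : ghom M N.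
Proof.
refine (@Ghom k M N (fun x => f x + g x) _ _ _ _).
- by move=> x y; rewrite !ghomB opprD addrACA.
- by move=> a x; rewrite !ghom_lact lactDr.
- by move=> x a; rewrite !ghom_ract ractDl.
- move=> d x hx; have G := bdeg_grading N.
  by apply: (homog_add (gr0 G) (grB G)); exact: ghom_deg.
Defined.

Definition chain_map (C D : cpx k) (f : forall n, ghom (C n) (D n)) :=
  forall n x, f (n + 1) (cpx_d C n x) = cpx_d D n (f n x).

(** The identity is stated in degree n + 1 rather than n: the composite d s then needs no transport
    along n - 1 + 1 = n, and no degree is lost because n runs over all integers. *)
Definition homotopic_id (C : cpx k) (f : forall n, ghom (C n) (C n)) :=
  exists s : forall n : int, ghom (C (n + 1)) (C n),
    forall (n : int) x, f (n + 1) x - x = cpx_d C n (s n x) + s (n + 1) (cpx_d C (n + 1) x).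

Definition heq (C D : cpx k) : Prop :=
  exists (f : forall n, ghom (C n) (D n)) (g : forall n, ghom (D n) (C n)),
    [/\ chain_map f, chain_map g,
        homotopic_id (fun n => ghom_comp (g n) (f n))
      & homotopic_id (fun n => ghom_comp (f n) (g n))].

Lemma heq_trans (C D E : cpx k) : heq C D -> heq D E -> heq C E.
Proof.
case=> f [g [fc gc [s hs] [t ht]]] [f' [g' [fc' gc' [s' hs'] [t' ht']]]].
have comp (A B : cpx k) (u : forall n, ghom (A n) (B n)) (v : forall n, ghom (B n) (A n))
    (r : forall n : int, ghom (B (n + 1)) (B n)) (w : forall n, ghom (B n) (B n)) :
    chain_map u -> chain_map v -> homotopic_id (fun n => ghom_comp (v n) (u n)) ->
    (forall n x, w (n + 1) x - x = cpx_d B n (r n x) + r (n + 1) (cpx_d B (n + 1) x)) ->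
    homotopic_id (fun n => ghom_comp (v n) (ghom_comp (w n) (u n))).
  move=> uc vc [q hq] hr.
  (* If q is a homotopy for v u and r one for w, then q + v r u is a homotopy for v w u; the two
     subtractions produce the plus sign. *)
  exists (fun n => ghom_sub (q n) (ghom_comp (ghom_comp (v n) (ghom_sub (zero_hom _ _) (r n)))
    (u (n + 1)))) => n x /=.
  have -> : w (n + 1) (u (n + 1) x) = u (n + 1) x + (cpx_d B n (r n (u (n + 1) x))
      + r (n + 1) (u (n + 1 + 1) (cpx_d A (n + 1) x))).
    by rewrite uc -hr [RHS]addrC subrK.
  rewrite (ghomD (v (n + 1))) [LHS]addrAC; have /= -> := hq n x.
  rewrite !sub0r !ghomN !opprK (ghomD (v (n + 1))) vc.
  by rewrite (ghomD (cpx_d A n)) [LHS]addrACA.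
exists (fun n => ghom_comp (f' n) (f n)), (fun n => ghom_comp (g n) (g' n)); split.
- by move=> n x /=; rewrite fc fc'.
- by move=> n x /=; rewrite gc' gc.
- by have := comp _ _ _ _ s' (fun n => ghom_comp (g' n) (f' n)) fc gc (ex_intro _ s hs) hs'.
- have ht2 : homotopic_id (fun n => ghom_comp (f' n) (g' n)) by exists t'.
  by have := comp _ _ _ _ t (fun n => ghom_comp (f n) (g n)) gc' fc' ht2 ht.
Qed.

Lemma heq_iso (C D : cpx k) (f : forall n, ghom (C n) (D n))
    (g : forall n, ghom (D n) (C n)) :
  chain_map f -> (forall n, cancel (f n) (g n)) -> (forall n, cancel (g n) (f n)) ->
  heq C D.
Proof.
move=> fc fK gK; exists f, g; split=> //.
- by move=> n x; apply: (can_inj (fK _)); rewrite gK fc gK.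
- by exists (fun n => zero_hom _ _) => n x /=; rewrite fK subrr ghom0 addr0.
- by exists (fun n => zero_hom _ _) => n x /=; rewrite gK subrr ghom0 addr0.
Qed.

End BimoduleMaps.

Section CohomologyOfHH.
Variables (k : fieldType) (P : resolution k).

(** [cpx_to] is a transport along j - 1 + 1 = j. For j = n + 1, once n + 1 - 1 is identified with n,
    the transport is along a loop, and it disappears because proofs of equality in [int] are
    unique. *)
Lemma gim_cpx_to (C : cpx k) (i : nat) (n : int) (y : HH P i (C (n + 1))) :
  gim (HHmap P i (cpx_to C (n + 1))) y <->
  exists x, y = HHmap P i (cpx_d C n) x.
Proof.
rewrite /cpx_to; move: (n + 1 - 1) (subrK 1 (n + 1)) => m e.
have emn := addIr _ e; case: _ / emn e y => e y.
by rewrite (eq_irrelevance e erefl).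
Qed.

Section Functor.
Variable i : nat.

Lemma HHmap_cls (M N : grbimod k) (f : ghom M N) u : cocycles P i M u ->
  HHmap P i f (cls (cocycles P i M) (coboundaries P i M) u)
  = cls (cocycles P i N) (coboundaries P i N) (post f u).
Proof. exact: HHmapE. Qed.

Lemma HHmap_eq (M N : grbimod k) (f g : ghom M N) x : f =1 g -> HHmap P i f x = HHmap P i g x.
Proof.
move=> fg; rewrite -[x]repK !HHmap_cls; try exact: rep_mem.
by congr cls; apply/funext => p; rewrite /post fg.
Qed.

Lemma HHmap_comp (L M N : grbimod k) (g : ghom M N) (f : ghom L M) x :
  HHmap P i (ghom_comp g f) x = HHmap P i g (HHmap P i f x).
Proof.
rewrite -[x]repK !HHmap_cls //; try exact: rep_mem.
by apply: post_coc; exact: rep_mem.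
Qed.

Lemma HHmap_sub (M N : grbimod k) (f g : ghom M N) x :
  HHmap P i (ghom_sub f g) x = HHmap P i f x - HHmap P i g x.
Proof.
rewrite -[x]repK !HHmap_cls; try exact: rep_mem.
by rewrite -clsB //; apply: post_coc; exact: rep_mem.
Qed.

Lemma HHmap_add (M N : grbimod k) (f g : ghom M N) x :
  HHmap P i (ghom_add f g) x = HHmap P i f x + HHmap P i g x.
Proof.
rewrite -[x]repK !HHmap_cls; try exact: rep_mem.
by rewrite -clsD //; apply: post_coc; exact: rep_mem.
Qed.

Lemma HHmap_id (M : grbimod k) x : HHmap P i (id_hom M) x = x.
Proof. by rewrite -[x]repK HHmap_cls //; exact: rep_mem. Qed.

Lemma HHmap0 (M N : grbimod k) x : HHmap P i (zero_hom M N) x = 0.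
Proof.
rewrite (@HHmap_eq _ _ _ (ghom_sub (zero_hom M N) (zero_hom M N))) => [|y /=].
  by rewrite HHmap_sub subrr.
by rewrite subrr.
Qed.

End Functor.

(** Additivity and functoriality of [HHmap] carry the homotopy identity to HH; on a cycle the
    summand s d vanishes. *)
Lemma HHmap_homotopy (C : cpx k) (f : forall n, ghom (C n) (C n)) i :
  homotopic_id f -> forall n x, HHmap P i (cpx_d C (n + 1)) x = 0 ->
  exists y, HHmap P i (f (n + 1)) x = x + HHmap P i (cpx_d C n) y.
Proof.
case=> s hs n x dx.
have E : HHmap P i (f (n + 1)) x - x =
    HHmap P i (cpx_d C n) (HHmap P i (s n) x) +
    HHmap P i (s (n + 1)) (HHmap P i (cpx_d C (n + 1)) x).
  rewrite -{2}[x](HHmap_id (M := C (n + 1))) -HHmap_sub -!HHmap_comp.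
  rewrite -HHmap_add; apply: HHmap_eq => y /=; exact: hs.
exists (HHmap P i (s n) x).
by rewrite -[LHS](subrK x) E dx linear0 addr0 [LHS]addrC.
Qed.

Lemma giso_HHH_heq (C D : cpx k) i j : heq C D -> giso (HHH P C i j) (HHH P D i j).
Proof.
(* Writing j as n + 1 puts the homotopies and [gim_cpx_to] into the form in which they are
   stated. *)
case=> f [g [fc gc hC hD]]; rewrite -(subrK 1 j); move: (j - 1) => n.
have fd m x : HHmap P i (cpx_d D m) (HHmap P i (f m) x)
    = HHmap P i (f (m + 1)) (HHmap P i (cpx_d C m) x).
  by rewrite -!HHmap_comp; apply: HHmap_eq => y /=; rewrite fc.
have gd m x : HHmap P i (cpx_d C m) (HHmap P i (g m) x)
    = HHmap P i (g (m + 1)) (HHmap P i (cpx_d D m) x).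
  by rewrite -!HHmap_comp; apply: HHmap_eq => y /=; rewrite gc.
have fK x : HHmap P i (cpx_d C (n + 1)) x = 0 ->
    gker (HHmap P i (cpx_d D (n + 1))) (HHmap P i (f (n + 1)) x).
  by move=> dx /=; rewrite fd dx linear0.
apply: (@giso_gsubquot k _ _ _ _ _ (HHH P D i (n + 1)) (fun x : HH P i (C (n + 1)) =>
  cls (gker (HHmap P i (cpx_d D (n + 1)))) (gim (HHmap P i (cpx_to D (n + 1))))
    (HHmap P i (f (n + 1)) x))).
- move=> a x y hx hy; rewrite linearP clsD; [| | exact: fK].
    by rewrite clsZ; [| exact: fK].
  by apply: smZ; exact: fK.
- move=> x hx; have := fK _ hx => hfx.
  rewrite -[X in _ = X](cls0 (gker (HHmap P i (cpx_d D (n + 1)))) (gim (HHmap P i (cpx_to D (n + 1))))).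
  split.
    move/(cls_eq _ hfx (sm0 _)); rewrite subr0 => /gim_cpx_to[y hy].
    have [z hz] := HHmap_homotopy (i := i) hC hx.
    apply/gim_cpx_to; exists (HHmap P i (g n) y - z).
    rewrite linearB /= gd -hy -HHmap_comp.
    by rewrite [X in _ = X - _]hz addrK.
  move/gim_cpx_to=> [y ->].
  apply/(cls_eq _ _ (sm0 _)); first by apply: fK; rewrite -HHmap_comp (@HHmap_eq _ _ _ _ (zero_hom _ _)) ?HHmap0 // => z /=; exact: cpx_dd.
  by rewrite subr0; apply/gim_cpx_to; exists (HHmap P i (f n) y); rewrite fd.
- move=> d x hx dx; exists (HHmap P i (f (n + 1)) x); split=> //; first exact: fK.
  exact: HHmap_deg.
move=> d _ [y [hy dy ->]]; exists (HHmap P i (g (n + 1)) y); split.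
- by rewrite /= gd hy linear0.
- exact: HHmap_deg.
have hgy : gker (HHmap P i (cpx_d C (n + 1))) (HHmap P i (g (n + 1)) y).
  by rewrite /= gd hy linear0.
apply/(cls_eq _ (fK _ hgy) hy); apply/gim_cpx_to.
have [z hz] := HHmap_homotopy (i := i) hD hy.
by exists z; rewrite -HHmap_comp hz [LHS]addrC addKr.
Qed.

End CohomologyOfHH.

(** * Tensoring with B_i *)

Section Demazure.
Variable k : fieldType.
Local Notation R := {mpoly k[2]}.

Lemma mpoly_alg_ind n (Q : {mpoly k[n]} -> Prop) :
  (forall c, Q c%:MP) -> (forall j, Q 'X_j) ->
  (forall p q, Q p -> Q q -> Q (p + q)) -> (forall p q, Q p -> Q q -> Q (p * q)) ->
  forall p, Q p.
Proof.
move=> QC QX QD QM; elim/mpolyind => [|c m p _ _ hp]; first by rewrite -mpolyC0.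
apply: QD => //; rewrite -mul_mpolyC mpolyXE_id; apply: (QM) => //.
elim/big_ind: _ => [|p1 p2 h1 h2|j _]; [by rewrite -mpolyC1 | exact: QM |].
elim: (m j) => [|e he]; first by rewrite expr0 -mpolyC1.
by rewrite exprS; apply: QM.
Qed.

Variable i : 'I_2.

Lemma reflD p q : refl i (p + q) = refl i p + refl i q :> R.
Proof. exact: comp_mpolyD. Qed.
Lemma reflM p q : refl i (p * q) = refl i p * refl i q :> R.
Proof. exact: rmorphM. Qed.
Lemma reflC c : refl i c%:MP = c%:MP :> R.
Proof. exact: comp_mpolyC. Qed.

Lemma mpolyX_neq0 n (j : 'I_n) : 'X_j != 0 :> {mpoly k[n]}.
Proof.
apply/eqP => /(congr1 (fun p : {mpoly k[n]} => p@_(U_(j)))) /eqP.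
by rewrite mcoeffX eqxx mcoeff0 oner_eq0.
Qed.

(** The p for which alpha_i divides p - s(p) are closed under products, since p q - s(p) s(q) = (p -
    s(p)) q + s(p) (q - s(q)). *)
Lemma dem_ex (p : R) : exists q, p - refl i p = 'X_i * q.
Proof.
elim/mpoly_alg_ind: p => [c|j|p q [p' hp] [q' hq]|p q [p' hp] [q' hq]].
- by exists 0; rewrite reflC subrr mulr0.
- rewrite reflX /refl_img; case: (eqVneq j i) => [->|ji].
    by exists 2; rewrite opprK -mulr2n mulr_natr.
  exists (-1); rewrite mulrN1.
  suff -> : 'X_0 + 'X_1 = 'X_i + 'X_j :> R by rewrite opprD addrA addrAC subrr add0r.
  case: i j ji => -[|[|//]] hi [] [|[|//]] hj //= _; rewrite 1?[RHS]addrC;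
    by congr ('X__ + 'X__); apply: val_inj.
- by exists (p' + q'); rewrite reflD opprD addrACA hp hq mulrDr.
- exists (p' * q + refl i p * q').
  by rewrite reflM mulrDr mulrA mulrCA -hp -hq mulrBl mulrBr addrA subrK.
Qed.

Definition dem (p : R) : R := sval (cid (dem_ex p)).

Lemma demP p : p - refl i p = 'X_i * dem p.
Proof. by rewrite /dem; case: cid. Qed.

Lemma demU p q : p - refl i p = 'X_i * q -> dem p = q.
Proof. by rewrite demP; apply: mulfI; exact: mpolyX_neq0. Qed.

Lemma demD p q : dem (p + q) = dem p + dem q.
Proof. by apply: demU; rewrite reflD opprD addrACA !demP mulrDr. Qed.

(** The twisted Leibniz rule; it is exactly the associativity of the right action on [theta]. *)
Lemma demM p q : dem (p * q) = dem p * q + refl i p * dem q.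
Proof.
apply: demU.
by rewrite reflM mulrDr mulrA mulrCA -!demP mulrBl mulrBr addrA subrK.
Qed.

Lemma dem_inv p : refl i p = p -> dem p = 0.
Proof. by move=> hp; apply: demU; rewrite hp subrr mulr0. Qed.

Lemma demC c : dem c%:MP = 0.
Proof. by apply: dem_inv; rewrite reflC. Qed.

Lemma demXX : dem 'X_i = 2%:R.
Proof. by apply: demU; rewrite reflX /refl_img eqxx opprK -mulr2n mulr_natr. Qed.

Lemma dem_neq j : j != i -> dem 'X_j = -1.
Proof.
move=> ji; apply: demU; rewrite reflX /refl_img (negbTE ji) mulrN1.
suff -> : 'X_0 + 'X_1 = 'X_i + 'X_j :> R by rewrite opprD addrA addrAC subrr add0r.
case: i j ji => -[|[|//]] hi [] [|[|//]] hj //= _; rewrite 1?[RHS]addrC;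
  by congr ('X__ + 'X__); apply: val_inj.
Qed.

(** As s is an involution, it negates p - s(p); it also negates alpha_i, so the quotient is
    fixed. *)
Lemma refl_dem p : refl i (dem p) = dem p.
Proof.
have rr (q : R) : refl i (refl i q) = q.
  elim/mpoly_alg_ind: q => [c|j|p1 p2 h1 h2|p1 p2 h1 h2]; last 2 first.
  - by rewrite !reflD h1 h2.
  - by rewrite !reflM h1 h2.
  - by rewrite !reflC.
  have E := demP 'X_j; have [ji|ji] := eqVneq j i.
    by rewrite ji !reflX /refl_img eqxx -mulN1r -mpolyC1 -mpolyCN reflM reflC
      reflX /refl_img eqxx mpolyCN mpolyC1 !mulN1r opprK.
  have e : refl i 'X_j = 'X_j + 'X_i :> R.
    by move/eqP: E; rewrite dem_neq // mulrN1 subr_eq addrC => /eqP E2; rewrite [X in _ = X + _]E2 subrK.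
  by rewrite e reflD e reflX /refl_img eqxx addrK.
apply: (mulfI (mpolyX_neq0 i)); rewrite -demP.
have /(congr1 (fun q => - refl i q)) := demP p.
by rewrite reflM reflX /refl_img eqxx mulNr opprK /refl raddfB /= -!/(refl i _) rr opprB.
Qed.

Lemma pdeg_dem d p : pdeg (d + 2) p -> pdeg d (dem p).
Proof.
move=> hp m hm.
have: pdeg (d + 2) ('X_i * dem p) by rewrite -demP; apply: pdegB => //; exact: pdeg_refl.
move/(_ (U_(i) + m)%MM); rewrite mdegD mdeg1 mulnDr PoszD addrC.
move=> E; apply: (addIr (2 : int)); apply: E.
by rewrite mcoeff_msupp mulrC mcoeffMX -mcoeff_msupp.
Qed.

End Demazure.

(** * A twisted double of M as a model of M (x)_R B_i *)

Section Theta.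
Variables (k : fieldType) (i : 'I_2).
Local Notation R := {mpoly k[2]}.

(* The pair (x, y) stands for x (x) (1 (x) 1) + y (x) c in M (x)_R B_i, with
   c = 1/2 (alpha_i (x) 1 + 1 (x) alpha_i) central. *)
Definition theta (M : grbimod k) : grbimod k.
Proof.
refine (@Grbimod k (M * M)%type (fun a x => (lact a x.1, lact a x.2))
  (fun x a => (ract x.1 (refl i a), ract x.1 (dem i a) + ract x.2 a))
  _ _ _ _ _ _ _ _ _ _ (fun d x => bdeg (d + 1) x.1 /\ bdeg (d - 1) x.2)
  (prod_grading (shift_grading 1 (bdeg_grading M)) (shift_grading (-1) (bdeg_grading M)))
  _ _).
- by move=> a b x /=; rewrite !lactA.
- by case=> x y; rewrite /= !lact1.
- by move=> a x y; rewrite /= !lactDr.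
- by move=> a b x; rewrite /= !lactDl.
- by move=> x a b; rewrite /= !ractA reflM demM ractDl ractDr !ractA addrA [X in X + _]addrC.
- move=> [x y]; rewrite /= -mpolyC1 reflC demC mpolyC1 !ract1.
  by rewrite ract0r add0r.
- by move=> x y a; rewrite /= !ractDl; congr pair; rewrite addrACA.
- by move=> x a b; rewrite /= reflD demD !ractDr; congr pair; rewrite addrACA.
- by move=> a x b; rewrite /= !lractA lactDr.
- by move=> c x; rewrite /= !lractC reflC demC ract0r add0r.
- by move=> e d a x ha [h1 h2]; split; rewrite /= -addrA; apply: bdeg_lact.
move=> e d a x ha [h1 h2]; split; rewrite /= -addrA.
  by apply: bdeg_ract => //; exact: pdeg_refl.
apply: (homog_add (gr0 (bdeg_grading M)) (grB (bdeg_grading M))); last exact: bdeg_ract.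
have -> : e + (d - 1) = (e - 2) + (d + 1).
  by lia.
by apply: bdeg_ract => //; apply: pdeg_dem; rewrite subrK.
Defined.

Definition theta_map (M N : grbimod k) (f : ghom M N) : ghom (theta M) (theta N).
Proof.
refine (@Ghom k (theta M) (theta N) (fun x => (f x.1, f x.2)) _ _ _ _).
- by move=> x y; rewrite /= !ghomB.
- by move=> a x; rewrite /= !ghom_lact.
- by move=> x a; rewrite /= ghomD !ghom_ract.
- by move=> d x [h1 h2]; split; exact: ghom_deg.
Defined.

(** In terms of M (x)_R B_i this is x |-> x (x) c, which is M tensored with the differential of
    F(sigma_i^-1). *)
Definition theta_unit (M : grbimod k) : ghom (bshift (-1) M) (theta M).
Proof.
refine (@Ghom k (bshift (-1) M) (theta M) (fun x => (0, x)) _ _ _ _).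
- by move=> x y; rewrite -[RHS]/(0 - 0, x - y) subrr.
- by move=> a x; rewrite /= lact0r.
- by move=> x a; rewrite /= !ract0l add0r.
- by move=> d x hx; split=> //=; exact: (gr0 (bdeg_grading M)).
Defined.

Hypothesis two_neq0 : 2%:R != 0 :> k.

(** Write r = p + alpha_i d / 2 with p = (r + s(r)) / 2 and d = dem(r). Both p and d are invariant
    and cross the tensor sign, and the remaining 1 (x) alpha_i equals 2 c - alpha_i (x) 1. This
    leaves (p - alpha_i d / 2) (x) 1 = s(r) (x) 1 together with d c. *)
Lemma btn_dem (r : R) :
  btn i 1 r = lact (refl i r) (btn i 1 1) + lact (dem i r) (rou_elt k i).
Proof.
have h2 : (2%:R^-1 : k)%:MP *+ 2 = 1 :> R.
  by rewrite -mpolyCMn -[_ *+ 2]mulr_natr mulVf // mpolyC1.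
set h : R := (2%:R^-1)%:MP in h2 *; set d := dem i r; set a : R := 'X_i.
have hd : refl i d = d by exact: refl_dem.
have hh : refl i h = h by rewrite reflC.
have E := demP i r; rewrite -/d -/a in E.
pose p := h * (r + refl i r).
have hp : refl i p = p.
  rewrite /p !reflM hh; congr (_ * _).
  have ra : refl i a = - a by rewrite reflX /refl_img eqxx.
  have rr : refl i r = r - a * d by rewrite -E; ring.
  have -> : refl i (r + refl i r) = r + refl i r; last by [].
  rewrite reflD {2}rr -[- (a * d)]mulN1r -mpolyC1 -mpolyCN !(reflD, reflM) reflC hd ra rr.
  by rewrite mpolyCN mpolyC1; ring.
have rE : r = p + h * (a * d).
  by rewrite -E /p -[LHS]mul1r -h2; ring.
have sE : refl i r = p - h * (a * d).
  by rewrite -E /p -[LHS]mul1r -h2; ring.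
rewrite [in LHS]rE [in RHS]sE btnDr /rou_elt lactA -/h -/a !btn_lact !mulr1.
rewrite btnBl (btn_inv hp) lactDr !btn_lact mulr1 -addrA; congr (_ + _).
have -> : d * h * a = h * (a * d) by ring.
rewrite addKr -[X in btn i X a]mul1r btn_bal ?reflM ?hd ?hh //.
by congr btn; ring.
Qed.

End Theta.

Section Inverse.
Variables (k : fieldType) (M N : grbimod k) (f : ghom M N) (g : N -> M).
Hypotheses (fK : cancel f g) (gK : cancel g f).
Hypothesis gdeg : forall d x, bdeg d x -> bdeg d (g x).

Definition ghom_inv : ghom N M.
Proof.
refine (@Ghom k N M g _ _ _ _) => //.
- by move=> x y; apply: (can_inj fK); rewrite ghomB !gK.
- by move=> a x; apply: (can_inj fK); rewrite ghom_lact !gK.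
- by move=> x a; apply: (can_inj fK); rewrite ghom_ract !gK.
Defined.

End Inverse.

Section ThetaTensor.
Variables (k : fieldType) (i : 'I_2) (M : grbimod k).
Hypothesis two_neq0 : 2%:R != 0 :> k.
Local Notation R := {mpoly k[2]}.
Local Notation F := (fullR k).
Local Notation A := (invariants k i).
Local Notation MB := (btens F M (Bbim k i)).
Local Notation TM := (theta i M).

(** This stands for m (x) (1 (x) 1). A pure tensor m (x) (x (x) y) must therefore go to
    [base (ract m x)] multiplied by y on the right, which is how the inverse [phi] is built. *)
Let base (m : M) : TM := (m, 0).

Let baseD m m' : base (m + m') = base m + base m'.
Proof. by rewrite /base -[RHS]/(m + m', 0 + 0) addr0. Qed.

(** This makes [phi0] balanced over the invariants: [dem] kills them, so no second component
    appears. *)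
Let base_inv m a : refl i a = a -> ract (base m) a = base (ract m a).
Proof. by move=> ha; rewrite /base /= ha (dem_inv ha) ract0r ract0l addr0. Qed.

Let phi0 (m : M) (b : Bbim k i) : TM :=
  @tlift _ A (breg k) (breg k) _ (fun x y : R => ract (base (ract m x)) y) b.

Let phi0_bal m : @balanced _ A (breg k) (breg k) TM
  (fun x y : R => ract (base (ract m x)) y).
Proof.
split=> [x y z|x y z|x a y Aa]; first by rewrite ractDr baseD ractDl.
  by rewrite ractDr.
by rewrite -ractA -(base_inv _ Aa) ractA.
Qed.

Let phi0E m x y : phi0 m (btn i x y) = ract (base (ract m x)) y.
Proof. exact: (tliftE (phi0_bal m)). Qed.

Let phi0B m b b' : phi0 m (b - b') = phi0 m b - phi0 m b'.
Proof. exact: (tliftB (phi0_bal m)). Qed.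

Let phi (X : MB) : TM := @tlift _ F M (Bbim k i) _ phi0 X.

Let phi_bal : balanced F phi0.
Proof.
split=> [x y b|x b b'|x a b _].
- apply: (@tens_ext _ A (breg k) (breg k) _ (phi0 (x + y)) (fun b => phi0 x b + phi0 y b))
    => [b1 b2|b1 b2|r r'].
  + exact: phi0B.
  + by rewrite !phi0B opprD addrACA.
  + by rewrite -/(btn i r r') !phi0E ractDl baseD ractDl.
- exact: (subfD (phi0B x)).
- apply: (@tens_ext _ A (breg k) (breg k) _ (phi0 (ract x a)) (fun b => phi0 x (tlact a b)))
    => [b1 b2|b1 b2|r r'].
  + exact: phi0B.
  + by rewrite tlactB phi0B.
  + by rewrite tlactE -/(btn i r r') -/(btn i (a * r) r') !phi0E ractA.
Qed.

Let phiE m b : phi (tens F m b) = phi0 m b.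
Proof. exact: (tliftE phi_bal). Qed.

Let phiB X Y : phi (X - Y) = phi X - phi Y.
Proof. exact: (tliftB phi_bal). Qed.

Let theta_tens_ract (x y : M) a :
  tens F (ract x (refl i a)) (btn i 1 1)
    + tens F (ract x (dem i a) + ract y a) (rou_elt k i)
  = tract (tens F x (btn i 1 1) + tens F y (rou_elt k i)) a.
Proof.
rewrite tractDl !tractE btn_ract mul1r (btn_dem i two_neq0 a) -rou_elt_central.
by rewrite tensDl tensDr addrA !(@tens_bal _ F M (Bbim k i)) //; exact: I.
Qed.

Definition theta_tens : ghom TM MB.
Proof.
refine (@Ghom k TM MB (fun x => tens F x.1 (btn i 1 1) + tens F x.2 (rou_elt k i)) _ _ _ _).
- by move=> x y; rewrite !tensBl opprD addrACA.
- by move=> a x; rewrite lactDr; congr (_ + _); rewrite [RHS]tlactE.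
- by move=> [x y] a; exact: theta_tens_ract.
move=> d x [h1 h2]; have G := bdeg_grading MB; apply: (homog_add (gr0 G) (grB G)).
  apply: (@TDt _ _ _ _ _ (d + 1) (-1)) => //; first by rewrite addrK.
  have h0 : pdeg 0 (1 : R) by rewrite -mpolyC1; exact: pdegC.
  by apply: (@TDt _ _ _ _ _ 0 0).
apply: (@TDt _ _ _ _ _ (d - 1) 1) => //; first by rewrite subrK.
exact: rou_elt_deg.
Defined.

Let phiD X Y : phi (X + Y) = phi X + phi Y.
Proof. exact: (subfD phiB). Qed.

(** Only the image of c needs computing. Its two halves contribute y alpha_i / 2 and - y alpha_i / 2
    to the first component, which cancel, and dem(alpha_i) = 2 turns y / 2 into y in the second. *)
Lemma theta_tensK : cancel theta_tens phi.
Proof.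
move=> [x y]; rewrite phiD !phiE phi0E !ract1 /rou_elt.
rewrite lactDr !btn_lact mulr1 (subfD (phi0B y)) !phi0E ract1 /base /=.
rewrite ract0l addr0 reflX /refl_img eqxx demXX ractNr !ractA.
set z := ract y (_ * 'X_i); set w := ract y _.
rewrite -[LHS]/(x + (z - z), 0 + (0 + w)) subrr addr0 !add0r.
by rewrite /w -mpolyC1 -mpolyCMn -mpolyCM mulVf // mpolyC1 ract1.
Qed.

Lemma tens_thetaK : cancel phi theta_tens.
Proof.
apply: (@tens_ext _ F M (Bbim k i) _ (fun X => theta_tens (phi X)) id) => // [X Y|m b].
  by rewrite phiB ghomB.
suff H : (fun b => theta_tens (phi0 m b)) =1 tens F m by rewrite phiE; exact: H.
move=> {}b; move: b; apply: (@tens_ext _ A (breg k) (breg k) MB) => [X Y|X Y|x y].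
- by rewrite phi0B ghomB.
- exact: tensBr.
rewrite -/(btn i x y) phi0E ghom_ract.
transitivity (tract (tens F (ract m x) (btn i 1 1) + tens F 0 (rou_elt k i)) y) => //.
rewrite tens0l addr0 tractE btn_ract mul1r (@tens_bal _ F M (Bbim k i)); last exact: I.
by rewrite btn_lact mulr1.
Qed.

Lemma phi_deg d X : bdeg d X -> bdeg d (phi X).
Proof.
have G := bdeg_grading TM.
elim=> [|{}X Y _ EX _ EY|a b x y ab hx hy].
- by rewrite (subf0 phiB); exact: (gr0 G).
- by rewrite phiB; exact: (grB G).
rewrite phiE; elim: hy => [|X' Y' _ EX _ EY|a' b' x' y' ab' hx' hy'].
- by rewrite (subf0 (phi0B x)); exact: (gr0 G).
- by rewrite phi0B; exact: (grB G).
rewrite -/(btn i x' y') phi0E; have -> : d = b' + (a' + a - 1) by lia.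
apply: bdeg_ract => //; split => /=; last exact: (gr0 (bdeg_grading M)).
by rewrite subrK; exact: bdeg_ract.
Qed.

Definition tens_theta : ghom MB TM := ghom_inv theta_tensK tens_thetaK phi_deg.

End ThetaTensor.

Section TensUnit.
Variables (k : fieldType) (n : int) (M : grbimod k).
Local Notation R := {mpoly k[2]}.
Local Notation F := (fullR k).
Local Notation MR := (btens F M (bshift n (breg k))).

Let tn (x : M) (a : R) : MR := @tens k F M (bshift n (breg k)) x a.

Let tnE x a : tn x a = tn (ract x a) 1.
Proof. by rewrite /tn (@tens_bal _ F M (bshift n (breg k))) //= mulr1. Qed.

Definition unit_tens : ghom (bshift n M) MR.
Proof.
refine (@Ghom k (bshift n M) MR (fun x => tn x 1) _ _ _ _).
- by move=> x y; rewrite /tn tensBl.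
- by move=> a x; rewrite [RHS]tlactE.
- by move=> x a; rewrite [RHS]tractE /= -/(tn _ _) -tnE mul1r.
move=> d x hx; apply: (@TDt _ _ _ _ _ (d + n) (- n)); rewrite ?addrK //=.
by rewrite addNr -mpolyC1; exact: pdegC.
Defined.

Let mult_bal : @balanced _ F M (bshift n (breg k)) M (fun x (a : R) => ract x a).
Proof.
split=> [x y a|x a b|x a b _]; [exact: ractDl | exact: ractDr | exact: ractA].
Qed.

Let mult (X : MR) : M := @tlift _ F M (bshift n (breg k)) M (fun x (a : R) => ract x a) X.

Lemma unit_tensK : @cancel MR (bshift n M) unit_tens mult.
Proof. by move=> x; rewrite /mult /= (tliftE mult_bal) ract1. Qed.

Lemma tens_unitK : @cancel (bshift n M) MR mult unit_tens.
Proof.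
apply: (@tens_ext _ F M (bshift n (breg k)) _ (fun X => unit_tens (mult X)) id) => // [X Y|x a].
  by rewrite /mult (tliftB mult_bal) (ghomB unit_tens).
by rewrite /mult (tliftE mult_bal) [RHS](tnE x a).
Qed.

Lemma mult_deg d (X : MR) : bdeg d X -> @bdeg k (bshift n M) d (mult X).
Proof.
have G := bdeg_grading (bshift n M).
elim=> [|{}X Y _ EX _ EY|a b x y ab hx hy].
- by rewrite /mult (subf0 (tliftB mult_bal)); exact: (gr0 G).
- by rewrite /mult (tliftB mult_bal); exact: (grB G).
rewrite /mult (tliftE mult_bal) /=; have -> : d + n = (b + n) + a by lia.
exact: bdeg_ract.
Qed.

Definition tens_unit : ghom MR (bshift n M) := ghom_inv unit_tensK tens_unitK mult_deg.

End TensUnit.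

Section Sums.
Variable k : fieldType.

Definition bfst (M N : grbimod k) : ghom (bsum M N) M.
Proof. by refine (@Ghom k (bsum M N) M fst _ _ _ _) => // d x []. Defined.

Definition bsnd (M N : grbimod k) : ghom (bsum M N) N.
Proof. by refine (@Ghom k (bsum M N) N snd _ _ _ _) => // d x []. Defined.

Definition bpair (L M N : grbimod k) (f : ghom L M) (g : ghom L N) : ghom L (bsum M N).
Proof.
refine (@Ghom k L (bsum M N) (fun x => (f x, g x)) _ _ _ _).
- by move=> x y; rewrite !ghomB.
- by move=> a x; rewrite /= !ghom_lact.
- by move=> x a; rewrite /= !ghom_ract.
- by move=> d x hx; split; exact: ghom_deg.
Defined.

Definition bmap (M N M' N' : grbimod k) (f : ghom M M') (g : ghom N N') :
  ghom (bsum M N) (bsum M' N') := bpair (ghom_comp f (bfst M N)) (ghom_comp g (bsnd M N)).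

Definition bshift_map n (M N : grbimod k) (f : ghom M N) : ghom (bshift n M) (bshift n N) :=
  @Ghom k (bshift n M) (bshift n N) f (ghomB f) (ghom_lact f) (ghom_ract f)
    (fun d => @ghom_deg _ _ _ f (d + n)).

Definition ghom_sgn n (M N : grbimod k) (f : ghom M N) : ghom M N :=
  if odd `|n|%N then ghom_sub (zero_hom M N) f else f.

Lemma ghom_sgnE n (M N : grbimod k) (f : ghom M N) x : ghom_sgn n f x = sgn n (f x).
Proof. by rewrite /ghom_sgn /sgn; case: ifP => //= _; rewrite sub0r. Qed.

Lemma sgn_ghom n (M N : grbimod k) (f : ghom M N) x : f (sgn n x) = sgn n (f x).
Proof. by rewrite /sgn; case: ifP => // _; rewrite ghomN. Qed.

End Sums.

(** * The complex C (x)_R F(sigma_i^-1) in terms of the twisted double *)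

Section ThetaComplex.
Variables (k : fieldType) (i : 'I_2).

Section Object.
Variable C : cpx k.

Definition tt_ob (n : int) : grbimod k :=
  bsum (bshift (-1) (C (n + 1))) (theta i (C n)).

Definition tt_diff (n : int) : ghom (tt_ob n) (tt_ob (n + 1)) :=
  bpair (ghom_comp (bshift_map (-1) (cpx_d C (n + 1))) (bfst _ _))
    (ghom_add (ghom_comp (ghom_sgn (n + 1) (theta_unit i (C (n + 1)))) (bfst _ _))
      (ghom_comp (theta_map i (cpx_d C n)) (bsnd _ _))).

Lemma tt_dd n x : tt_diff (n + 1) (tt_diff n x) = 0.
Proof.
rewrite [LHS]surjective_pairing /= !ghom_sgnE.
rewrite -[0 in RHS]/((0, 0) : tt_ob (n + 1 + 1)); congr pair; first exact: cpx_dd.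
set u : C (n + 1 + 1) := cpx_d C (n + 1) x.1.
have -> : (cpx_d C (n + 1) ((sgn (n + 1) (theta_unit i (C (n + 1)) x.1)
      + theta_map i (cpx_d C n) x.2) : theta i (C (n + 1))).1,
    cpx_d C (n + 1) ((sgn (n + 1) (theta_unit i (C (n + 1)) x.1)
      + theta_map i (cpx_d C n) x.2) : theta i (C (n + 1))).2)
  = sgn (n + 1) (theta_unit i (C (n + 1 + 1)) u) :> theta i (C (n + 1 + 1)).
  rewrite -[LHS]/(theta_map i (cpx_d C (n + 1)) _) ghomD.
  have -> : theta_map i (cpx_d C (n + 1)) (theta_map i (cpx_d C n) x.2) = 0.
    by rewrite /= !cpx_dd.
  by rewrite addr0 sgn_ghom; congr sgn; rewrite /= ghom0.
by rewrite (sgnS (n + 1)) addNr.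
Qed.

Definition tt_cpx : cpx k := Cpx tt_dd.

End Object.

(** The homotopy is taken blockwise. The off-diagonal terms cancel because [theta_unit] commutes
    with s and its sign alternates with the degree. *)
Lemma tt_homotopic_id (C : cpx k) (w : forall n, ghom (C n) (C n)) :
  homotopic_id w ->
  @homotopic_id k (tt_cpx C)
    (fun n => bmap (bshift_map (-1) (w (n + 1))) (theta_map i (w n))).
Proof.
case=> s hs.
exists (fun n => bmap (bshift_map (-1) (s (n + 1))) (theta_map i (s n))) => n [x y].
rewrite [LHS]surjective_pairing [RHS]surjective_pairing; congr pair; first exact: hs.
have hs2 : theta_map i (w (n + 1)) y - y =
    theta_map i (cpx_d C n) (theta_map i (s n) y)
    + theta_map i (s (n + 1)) (theta_map i (cpx_d C (n + 1)) y).
  case: y => y y'.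
  by rewrite [LHS]surjective_pairing [RHS]surjective_pairing; congr pair; exact: hs.
rewrite -[LHS]/(theta_map i (w (n + 1)) y - y) hs2.
set S := theta_map i (s (n + 1)); set u := theta_unit i (C (n + 1)).
rewrite -[RHS]/((ghom_sgn (n + 1) u (s (n + 1) x) + theta_map i (cpx_d C n) (theta_map i (s n) y))
  + S (ghom_sgn (n + 1 + 1) (theta_unit i (C (n + 1 + 1))) x + theta_map i (cpx_d C (n + 1)) y)).
rewrite [S (_ + _)]ghomD !ghom_sgnE sgn_ghom (sgnS (n + 1)).
have -> : S (theta_unit i (C (n + 1 + 1)) x) = u (s (n + 1) x).
  by rewrite /S /u /= ghom0.
by rewrite [RHS]addrACA addrN add0r.
Qed.

Lemma tt_heq (C D : cpx k) : heq C D -> heq (tt_cpx C) (tt_cpx D).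
Proof.
case=> f [g [fc gc hC hD]].
have chain (A B : cpx k) (u : forall n, ghom (A n) (B n)) : chain_map u ->
    @chain_map k (tt_cpx A) (tt_cpx B)
      (fun n => bmap (bshift_map (-1) (u (n + 1))) (theta_map i (u n))).
  move=> uc n [x y].
  rewrite [LHS]surjective_pairing [RHS]surjective_pairing; congr pair; first exact: uc.
  rewrite -[LHS]/(theta_map i (u (n + 1)) (ghom_sgn (n + 1) (theta_unit i (A (n + 1))) x
    + theta_map i (cpx_d A n) y)).
  rewrite -[RHS]/(ghom_sgn (n + 1) (theta_unit i (B (n + 1))) (u (n + 1) x)
    + theta_map i (cpx_d B n) (theta_map i (u n) y)).
  rewrite ghomD !ghom_sgnE sgn_ghom; congr (sgn _ _ + _); first by rewrite /= ghom0.
  by case: y => y y' /=; rewrite !uc.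
exists (fun n => bmap (bshift_map (-1) (f (n + 1))) (theta_map i (f n))).
exists (fun n => bmap (bshift_map (-1) (g (n + 1))) (theta_map i (g n))).
split; try exact: chain.
- by case: (tt_homotopic_id hC) => s hs; exists s => n x; exact: hs.
- by case: (tt_homotopic_id hD) => s hs; exists s => n x; exact: hs.
Qed.

Lemma heq_sym (C D : cpx k) : heq C D -> heq D C.
Proof. by case=> f [g [? ? ? ?]]; exists g, f. Qed.

(** The isomorphisms are [unit_tens] and [theta_tens] on the two summands; they respect the
    differentials because (0, x) corresponds to x (x) c. *)
Lemma tcpx_rou_neg (C : cpx k) : 2%:R != 0 :> k ->
  heq (tcpx C (rou_neg k i)) (tt_cpx C).
Proof.
move=> two_neq0; apply: heq_sym.
apply: (@heq_iso k (tt_cpx C) (tcpx C (rou_neg k i))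
  (fun n => bmap (unit_tens (-1) (C (n + 1))) (theta_tens i (C n) two_neq0))
  (fun n => bmap (tens_unit (-1) (C (n + 1))) (tens_theta i (C n) two_neq0))).
- move=> n [x y]; rewrite [LHS]surjective_pairing [RHS]surjective_pairing; congr pair.
    exact: esym (tmapE _ (cpx_d C (n + 1)) (id_hom _) x _).
  rewrite -[LHS]/(theta_tens i _ two_neq0 (ghom_sgn (n + 1) (theta_unit i (C (n + 1))) x
    + theta_map i (cpx_d C n) y)).
  rewrite -[RHS]/(sgn (n + 1) (tmap (fullR k) (id_hom (C (n + 1))) (rou_map k i)
      (unit_tens (-1) (C (n + 1)) x))
    + tmap (fullR k) (cpx_d C n) (id_hom (Bbim k i)) (theta_tens i (C n) two_neq0 y)).
  rewrite ghomD !ghom_sgnE sgn_ghom; congr (sgn _ _ + _).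
    rewrite [RHS](tmapE _ (id_hom (C (n + 1))) (rou_map k i)).
    rewrite -[LHS]/(tens (fullR k) (0 : C (n + 1)) (btn i 1 1) + tens (fullR k) (x : C (n + 1)) (rou_elt k i)).
    by rewrite tens0l add0r; congr tens; exact: esym (lact1 _).
  case: y => y y'.
  rewrite -[theta_tens i _ _ (y, y')]/(tens (fullR k) y (btn i 1 1) + tens (fullR k) y' (rou_elt k i)).
  by rewrite [RHS]ghomD [X in _ = X + _]tmapE [X in _ = _ + X]tmapE.
- by move=> n [x y]; exact: (congr2 pair (@unit_tensK k (-1) (C (n + 1)) x) (theta_tensK two_neq0 y)).
- by move=> n [x y]; exact: (congr2 pair (@tens_unitK k (-1) (C (n + 1)) x) (tens_thetaK two_neq0 y)).
Qed.

End ThetaComplex.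

(** * Bimodules given by matrices *)

Section RowGrading.
Variables (V : nzRingType) (h : int -> V -> Prop) (H : is_grading h).
Variables (n : nat) (g : 'I_n -> int).

Definition row_deg (d : int) (v : 'rV[V]_n) : Prop := forall j, h (d - g j) (v 0 j).

Lemma row_deg0 d : row_deg d 0.
Proof. by move=> j; rewrite mxE; exact: (gr0 H). Qed.

Lemma row_degB d x y : row_deg d x -> row_deg d y -> row_deg d (x - y).
Proof. by move=> hx hy j; rewrite !mxE; apply: (grB H). Qed.

Lemma row_grading : is_grading row_deg.
Proof.
split=> [d|d x y|s f us hf E i si|v]; [exact: row_deg0 | exact: row_degB | |].
- apply/rowP => j; rewrite mxE.
  have inj : injective (fun d : int => d - g j) by exact: addIr.
  have us' : uniq (map (fun d => d - g j) s) by rewrite map_inj_uniq.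
  have hf' d : h d (f (d + g j) 0 j) by have := hf (d + g j) j; rewrite addrK.
  have := gr_indep H us' hf' _ (map_f _ si); rewrite subrK; apply.
  rewrite big_map; under eq_bigr do rewrite subrK.
  by have := congr1 (fun u : 'rV_n => u 0 j) E; rewrite mxE summxE.
rewrite (row_sum_delta v); apply: (homog_span_sum row_deg0 row_degB) => j.
have [s [f [us hf ->]]] := gr_span H (v 0 j).
rewrite scaler_suml; apply: (homog_span_sum row_deg0 row_degB) => d.
apply: (homog_span1 row_deg0 (d := d + g j)) => l; rewrite !mxE eqxx /=.
case: eqP => [->|_]; last by rewrite mulr0; exact: (gr0 H).
by rewrite mulr1 addrK.
Qed.

End RowGrading.

Section FreeGmod.
Variables (k : fieldType) (n : nat) (g : 'I_n -> int).
Local Notation R := {mpoly k[2]}.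

Definition rvdeg := row_deg (@pdeg k) g.

Definition rvdeg_grading : is_grading rvdeg := row_grading (pdeg_grading k) g.

Lemma rvdegZ e d (a : R) v : pdeg e a -> rvdeg d v -> rvdeg (e + d) (a *: v).
Proof. by move=> ha hv j; rewrite mxE -addrA; apply: pdegM. Qed.

Definition grow : gmod k := Gmod rvdeg_grading rvdegZ.

End FreeGmod.

Section MatrixDegree.
Variable k : fieldType.
Local Notation R := {mpoly k[2]}.

Definition mxdeg m n (e : int) (g : 'I_m -> int) (h : 'I_n -> int) (A : 'M[R]_(m, n)) :=
  forall i j, pdeg (g i + e - h j) (A i j).

Lemma pdeg_sum d (I : Type) (r : seq I) (F : I -> R) :
  (forall i, pdeg d (F i)) -> pdeg d (\sum_(i <- r) F i).
Proof. by move=> hF; elim/big_ind: _ => //; [exact: pdeg0 | exact: (homog_add (@pdeg0 k) (@pdegB k))]. Qed.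

Lemma rvdeg_mul m n e g h (A : 'M[R]_(m, n)) d v :
  mxdeg e g h A -> rvdeg g d v -> rvdeg h (d + e) (v *m A).
Proof.
move=> hA hv j; rewrite mxE; apply: pdeg_sum => i.
have -> : d + e - h j = (d - g i) + (g i + e - h j) by lia.
exact: pdegM.
Qed.

End MatrixDegree.

Section MatrixBimodule.
Variable k : fieldType.
Local Notation R := {mpoly k[2]}.

(* A graded bimodule that is free with basis e_0, ..., e_(n-1) as a left module:
   e_a has degree [mgen a] and e_a . 'X_j = \sum_b mact j a b e_b. *)
Record mbim := Mbim {
  mrk : nat;
  mgen : 'I_mrk -> int;
  mact : 'I_2 -> 'M[R]_mrk;
  mactC : mact 0 *m mact 1 = mact 1 *m mact 0;
  mact_deg : forall j, mxdeg 2 mgen mgen (mact j) }.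

Arguments mgen : clear implicits.

Section Object.
Variable M : mbim.
Local Notation n := (mrk M).
Local Notation r := (mact M).

Definition mpow (m : 'X_{1..2}) : 'M[R]_n := r 0 ^+ m 0 *m r 1 ^+ m 1.

(** The k-algebra map that sends 'X_j to the matrix of right multiplication by 'X_j. The entries of
    these matrices belong to the left copy of R, so p itself enters only through its coefficients in
    k. *)
Definition meval (p : R) : 'M[R]_n := \sum_(m <- msupp p) (p@_m)%:MP *: mpow m.

Lemma mpowD m1 m2 : mpow (m1 + m2)%MM = mpow m1 *m mpow m2.
Proof.
have C : GRing.comm (r 0) (r 1) by exact: mactC.
have Cn := commrX (m1 1) (commr_sym (commrX (m2 0) (commr_sym C))).
rewrite /mpow !mnmDE !exprD !mulmxE -!mulrA; congr (_ * _); rewrite !mulrA.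
by congr (_ * _); exact: commr_sym.
Qed.

(** Sums over the supports of different polynomials can be compared once all are indexed by one
    finite set of monomials. *)
Lemma mevalE (p : R) (i : nat) : (msize p <= i)%N ->
  meval p = \sum_(m : 'X_{1..2 < i}) (p@_m)%:MP *: mpow m.
Proof.
move=> le_pi; set I : subFinType _ := 'X_{1..2 < i}.
rewrite /meval (big_mksub I) ?msupp_uniq //=; last first.
  by move=> x /msize_mdeg_lt /leq_trans; apply.
rewrite big_rmcond //= => m /memN_msupp_eq0 ->.
by rewrite mpolyC0 scale0r.
Qed.

Lemma mevalD p q : meval (p + q) = meval p + meval q.
Proof.
pose i := maxn (msize (p + q)) (maxn (msize p) (msize q)).
rewrite !(@mevalE _ i) ?leq_max ?leqnn ?orbT // -big_split; apply: eq_bigr => m _.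
by rewrite mcoeffD mpolyCD scalerDl.
Qed.

Lemma meval0 : meval 0 = 0.
Proof. by rewrite /meval msupp0 big_nil. Qed.

Lemma meval_term c m : meval (c *: 'X_[m]) = c%:MP *: mpow m.
Proof.
have [->|c0] := eqVneq c 0; first by rewrite mpolyC0 !scale0r meval0.
have E : msupp (c *: 'X_[m] : R) =i [:: m].
  by move=> m'; rewrite (perm_mem (msuppZ _ c0)) msuppX.
rewrite /meval (perm_big [:: m]) ?big_seq1 ?mcoeffZ ?mcoeffX ?eqxx ?mulr1 //.
exact: uniq_perm.
Qed.

Lemma mevalM p q : meval (p * q) = meval p *m meval q.
Proof.
elim/mpolyind: p => [|c m p _ _ IH]; first by rewrite mul0r meval0 mul0mx.
rewrite mulrDl !mevalD mulmxDl IH; congr (_ + _) => {p IH}.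
elim/mpolyind: q => [|c' m' q _ _ IH]; first by rewrite mulr0 meval0 mulmx0.
rewrite mulrDr !mevalD mulmxDr IH; congr (_ + _).
rewrite -scalerAl -scalerAr scalerA -mpolyXD !meval_term mpowD.
by rewrite -scalemxAl -scalemxAr scalerA mpolyCM.
Qed.

Lemma mevalC c : meval c%:MP = c%:MP *: 1%:M.
Proof.
have {1}-> : c%:MP = c *: 'X_[0] :> R by rewrite mpolyX0 -mul_mpolyC mulr1.
by rewrite meval_term /mpow !mnm0E !expr0 mulmxE mulr1.
Qed.

Lemma mevalX j : meval 'X_j = r j.
Proof.
rewrite -['X_j]scale1r meval_term mpolyC1 scale1r /mpow !mnm1E.
case: j => -[|[|//]] hj; rewrite -!val_eqE /= ?expr0 ?expr1 mulmxE ?mulr1 ?mul1r.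
  by congr r; apply: val_inj.
by congr r; apply: val_inj.
Qed.

Lemma meval_deg e p : pdeg e p -> mxdeg e (mgen M) (mgen M) (meval p).
Proof.
move=> hp; have add := homog_add (@pdeg0 k) (@pdegB k).
have dM (A B : 'M[R]_n) a b : mxdeg a (mgen M) (mgen M) A ->
    mxdeg b (mgen M) (mgen M) B -> mxdeg (a + b) (mgen M) (mgen M) (A *m B).
  move=> hA hB i j; rewrite mxE; apply: pdeg_sum => l.
  have -> : mgen M i + (a + b) - mgen M j
      = (mgen M i + a - mgen M l) + (mgen M l + b - mgen M j) by lia.
  exact: pdegM.
have d1 : mxdeg 0 (mgen M) (mgen M) (1%:M : 'M[R]_n).
  move=> i j; rewrite mxE; case: eqP => [->|_]; last exact: pdeg0.
  by rewrite addr0 subrr -mpolyC1; exact: pdegC.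
have dX j c : mxdeg (2 * c)%N (mgen M) (mgen M) (r j ^+ c).
  elim: c => [|c IH]; first exact: d1.
  by rewrite exprS mulnS PoszD; apply: dM => //; exact: mact_deg.
move=> i j; rewrite /meval summxE big_seq; elim/big_ind: _ => [|x y|m hm].
- exact: pdeg0.
- exact: add.
rewrite mxE -[X in pdeg X _]add0r; apply: pdegM; first exact: pdegC.
rewrite -(hp _ hm) mdegE big_ord_recl big_ord1 mulnDr PoszD.
have -> : fintype.lift ord0 (ord0 : 'I_1) = 1 :> 'I_2 by apply: val_inj.
by apply: dM; exact: dX.
Qed.

Definition fb : grbimod k.
Proof.
refine (@Grbimod k 'rV[R]_n (fun a v => a *: v) (fun v a => v *m meval a)
  _ _ _ _ _ _ _ _ _ _ (rvdeg (mgen M)) (rvdeg_grading k (mgen M)) _ _).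
- by move=> a b x; rewrite scalerA.
- exact: scale1r.
- by move=> a x y; rewrite scalerDr.
- by move=> a b x; rewrite scalerDl.
- by move=> x a b; rewrite mevalM mulmxA.
- by move=> x; rewrite -mpolyC1 mevalC mpolyC1 scale1r mulmx1.
- by move=> x y a; rewrite mulmxDl.
- by move=> x a b; rewrite mevalD mulmxDr.
- by move=> a x b; rewrite scalemxAl.
- by move=> c x; rewrite mevalC -scalemxAr mulmx1.
- by move=> e d a x; exact: rvdegZ.
by move=> e d a x ha hx; rewrite addrC; apply: rvdeg_mul hx; exact: meval_deg.
Defined.

End Object.

Section Map.
Variables (M N : mbim) (A : 'M[R]_(mrk M, mrk N)).
Hypothesis AC : forall j, mact M j *m A = A *m mact N j.
Hypothesis Adeg : mxdeg 0 (mgen M) (mgen N) A.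

Lemma meval_intertwine p : meval M p *m A = A *m meval N p.
Proof.
elim/mpoly_alg_ind: p => [c|j|p q hp hq|p q hp hq].
- by rewrite !mevalC -scalemxAl mul1mx -scalemxAr mulmx1.
- by rewrite !mevalX.
- by rewrite !mevalD mulmxDl mulmxDr hp hq.
- by rewrite !mevalM -mulmxA hq !mulmxA hp.
Qed.

Definition fbmap : ghom (fb M) (fb N).
Proof.
refine (@Ghom k (fb M) (fb N) (fun v : 'rV[R]__ => v *m A) _ _ _ _).
- by move=> x y; rewrite mulmxBl.
- by move=> a x; rewrite /= scalemxAl.
- by move=> x a; rewrite /= -!mulmxA meval_intertwine.
- by move=> d x hx; rewrite -[d]addr0; exact: rvdeg_mul hx.
Defined.

End Map.

Record mcpx := Mcpx {
  mob : int -> mbim;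
  mdiff : forall n, 'M[R]_(mrk (mob n), mrk (mob (n + 1)));
  mdiffC : forall n j, mact (mob n) j *m mdiff n = mdiff n *m mact (mob (n + 1)) j;
  mdiff_deg : forall n, mxdeg 0 (mgen (mob n)) (mgen (mob (n + 1))) (mdiff n);
  mdiffK : forall n, mdiff n *m mdiff (n + 1) = 0 }.

Section Complex.
Variable E : mcpx.

Lemma mcpx_dd n x : fbmap (@mdiffC E (n + 1)) (@mdiff_deg E (n + 1))
  (fbmap (@mdiffC E n) (@mdiff_deg E n) x) = 0.
Proof. by rewrite /= -mulmxA mdiffK mulmx0. Qed.

Definition fb_cpx : cpx k := Cpx mcpx_dd.

End Complex.

End MatrixBimodule.

(** * Integer matrices as sparse lists *)

(* [T j c a b] is the entry c 'X_0^a 'X_1^b in column j; a matrix is the list of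
   its rows, and a row may list several terms in the same column. *)
Definition term : Type := nat * Z * nat * nat.
Definition T (j : nat) (c : Z) (a b : nat) : term := (j, c, a, b).
Arguments T j%_nat_scope c%_Z_scope a%_nat_scope b%_nat_scope.
Definition srow := seq term.
Definition smat := seq srow.

Definition tcol (t : term) : nat := t.1.1.1.
Definition tcoef (t : term) : Z := t.1.1.2.
Definition tkey (t u : term) : bool :=
  [&& eqn (tcol t) (tcol u), eqn t.1.2 u.1.2 & eqn t.2 u.2].

Definition smrow (r : srow) (B : smat) : srow :=
  flatten [seq [seq (tcol u, Z.mul (tcoef t) (tcoef u), (t.1.2 + u.1.2)%N, (t.2 + u.2)%N)
               | u <- nth [::] B (tcol t)] | t <- r].
Definition smul (A B : smat) : smat := [seq smrow r B | r <- A].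
Definition sadd (A B : smat) : smat :=
  mkseq (fun i => nth [::] A i ++ nth [::] B i) (maxn (size A) (size B)).
Definition sscale (c : Z) (A : smat) : smat :=
  [seq [seq (tcol t, Z.mul c (tcoef t), t.1.2, t.2) | t <- r] | r <- A].

(** Rows are never brought to a normal form. The coefficients of all terms with the column and
    exponents of the head must add up to 0; these terms are then removed. Each round removes at
    least the head, so the length of the row is enough fuel. *)
Fixpoint szrow (fuel : nat) (r : srow) : bool :=
  match fuel, r with
  | _, [::] => true
  | 0, _ => false
  | f.+1, t :: _ =>
    Z.eqb (foldr (fun u s => if tkey t u then Z.add (tcoef u) s else s) Z0 r) Z0
    && szrow f [seq u <- r | ~~ tkey t u]
  end.
Definition szero (A : smat) : bool := all (fun r => szrow (size r) r) A.
Definition seqm (A B : smat) : bool := szero (sadd A (sscale (Zneg xH) B)).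

Definition sdeg (e : Z) (g h : seq Z) (A : smat) : bool :=
  all (fun i => all (fun t => Z.eqb (Z.of_nat (t.1.2 + t.2).*2)
      (Z.sub (Z.add (nth Z0 g i) e) (nth Z0 h (tcol t)))) (nth [::] A i)) (iota 0 (size g)).

(** Missing rows count as zero, but stacking blocks by concatenation requires them to be present. *)
Definition pad (n : nat) (A : smat) : smat := mkseq (nth [::] A) n.
Definition shiftr (n : nat) (A : smat) : smat :=
  [seq [seq ((n + tcol t)%N, tcoef t, t.1.2, t.2) | t <- r] | r <- A].
Definition sid (off n : nat) : smat := mkseq (fun i => [:: T (off + i) 1 0 0]) n.

Section Evaluation.
Variable k : fieldType.
Local Notation R := {mpoly k[2]}.

Definition zR (c : Z) : R := (int_of_Z c)%:~R.

Lemma zR0 : zR Z0 = 0.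
Proof. by []. Qed.
Lemma zRD c d : zR (Z.add c d) = zR c + zR d.
Proof. by rewrite /zR -[Z.add c d]/(c + d) rmorphD /= intrD. Qed.
Lemma zRM c d : zR (Z.mul c d) = zR c * zR d.
Proof. by rewrite /zR -[Z.mul c d]/(c * d) rmorphM /= intrM. Qed.

Definition tev (t : term) : R := zR (tcoef t) * ('X_0 ^+ t.1.2 * 'X_1 ^+ t.2).
Definition rev (r : srow) (j : nat) : R := \sum_(t <- r | tcol t == j) tev t.
Definition mxs m n (A : smat) : 'M[R]_(m, n) :=
  \matrix_(i, j) rev (nth [::] A i) j.

Lemma rev_smrow r B n j : (size B <= n)%N ->
  rev (smrow r B) j = \sum_(l < n) rev r l * rev (nth [::] B l) j.
Proof.
move=> sB; rewrite /smrow; elim: r => [|t r IH] /=.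
  by rewrite /rev big_nil big1 // => l _; rewrite big_nil mul0r.
rewrite /rev big_cat /= -/(rev _ j) -/(rev _ j) IH.
rewrite [RHS](eq_bigr (fun l : 'I_n => (if tcol t == l then tev t * rev (nth [::] B l) j else 0)
    + rev r l * rev (nth [::] B l) j)) => [|l _]; last first.
  by rewrite {1}/rev big_cons -/(rev r l); case: eqP => _; rewrite ?mulrDl ?add0r.
rewrite big_split /=; congr (_ + _).
have -> : rev [seq (tcol u, Z.mul (tcoef t) (tcoef u), (t.1.2 + u.1.2)%N, (t.2 + u.2)%N)
    | u <- nth [::] B (tcol t)] j = tev t * rev (nth [::] B (tcol t)) j.
  rewrite /rev big_map mulr_sumr; apply: eq_bigr => u _.
  by rewrite /tev /= zRM !exprD; ring.
have [lt|ge] := ltnP (tcol t) n.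
  by rewrite (bigD1 (Ordinal lt)) //= eqxx big1 ?addr0 // => l; rewrite -val_eqE /= eq_sym => /negbTE ->.
rewrite nth_default; last exact: leq_trans ge.
rewrite /rev big_nil mulr0 big1 // => l _; case: eqP => // E.
by move: (ltn_ord l); rewrite -E ltnNge ge.
Qed.

(** [mxs] ignores rows and columns out of range, but [smul] does not: a surplus column of A would
    pick up a surplus row of B. The bound on the size of B rules this out. *)
Lemma mxs_mul m n p A B : (size B <= n)%N ->
  mxs m n A *m mxs n p B = mxs m p (smul A B).
Proof.
move=> sB; apply/matrixP => i j; rewrite !mxE.
under eq_bigr do rewrite !mxE.
have [lt|ge] := ltnP i (size A); first by rewrite (nth_map [::]) // (rev_smrow _ _ sB).
rewrite !nth_default ?size_map // /rev big_nil big1 // => l _.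
by rewrite big_nil mul0r.
Qed.

Lemma mxs_add m n A B : mxs m n A + mxs m n B = mxs m n (sadd A B).
Proof.
apply/matrixP => i j; rewrite !mxE.
have [lt|] := ltnP i (maxn (size A) (size B)); first by rewrite nth_mkseq // /rev big_cat.
rewrite geq_max => /andP[gA gB].
by rewrite !nth_default ?size_mkseq ?geq_max ?gA // /rev big_nil addr0.
Qed.

Lemma mxs_scale m n c A : zR c *: mxs m n A = mxs m n (sscale c A).
Proof.
apply/matrixP => i j; rewrite !mxE.
have [lt|ge] := ltnP i (size A); last first.
  by rewrite !nth_default ?size_map // /rev big_nil mulr0.
rewrite (nth_map [::]) // /rev big_map mulr_sumr; apply: eq_bigr => t _.
by rewrite /tev /= zRM mulrA.
Qed.

Lemma zR_foldr (P : pred term) (s : srow) : \sum_(u <- s | P u) zR (tcoef u)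
  = zR (foldr (fun u c => if P u then Z.add (tcoef u) c else c) Z0 s).
Proof.
elim: s => [|u s IH]; first by rewrite big_nil.
by rewrite big_cons /=; case: ifP => // _; rewrite zRD IH.
Qed.

Lemma szrow_rev f r j : szrow f r -> rev r j = 0.
Proof.
elim: f r => [|f IH] [|t r] //; rewrite ?/rev ?big_nil // => /andP[/Z.eqb_eq E /IH IHr].
set r' := t :: r in E IHr *.
have F : \sum_(u <- r' | tkey t u) tev u = 0.
  rewrite (eq_bigr (fun u => zR (tcoef u) * ('X_0 ^+ t.1.2 * 'X_1 ^+ t.2))); last first.
    by move=> u /and3P[_ /eqnP e1 /eqnP e2]; rewrite /tev e1 e2.
  rewrite -mulr_suml.
  by rewrite zR_foldr E zR0 mul0r.
rewrite -[LHS]/(rev r' j) /rev (bigID (tkey t)) /=.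
have -> : \sum_(u <- r' | (tcol u == j) && ~~ tkey t u) tev u = 0.
  by rewrite -[RHS]IHr /rev big_filter_cond; apply: eq_bigl => u; rewrite andbC.
rewrite addr0; have [tj|tj] := eqVneq (tcol t) j.
  rewrite -[RHS]F; apply: eq_bigl => u; rewrite -tj /tkey eqnE eq_sym.
  by case: (tcol t == tcol u).
rewrite big1 // => u /andP[/eqP uj]; rewrite /tkey eqnE uj.
by rewrite (negbTE tj).
Qed.

Lemma szero_mxs m n A : szero A -> mxs m n A = 0.
Proof.
move=> /all_nthP h; apply/matrixP => i j; rewrite !mxE.
have [lt|ge] := ltnP i (size A); first exact: szrow_rev (h [::] i lt).
by rewrite nth_default // /rev big_nil.
Qed.

Lemma seqm_mxs m n A B : seqm A B -> mxs m n A = mxs m n B.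
Proof.
move=> /(@szero_mxs m n); rewrite -mxs_add -mxs_scale.
have -> : zR (Zneg xH) = -1 by rewrite /zR /= NegzE.
by rewrite scaleN1r => /eqP; rewrite subr_eq0 => /eqP.
Qed.

Definition zgen (g : seq Z) (i : 'I_(size g)) : int := int_of_Z (nth Z0 g i).

Lemma pdeg_tev t : pdeg (2 * (t.1.2 + t.2))%N (tev t).
Proof.
have dX (j : 'I_2) c : pdeg (2 * c)%N ('X_j ^+ c : R).
  by rewrite mpolyXn => m; rewrite msuppX inE => /eqP ->; rewrite mdegMn mdeg1 mul1n.
rewrite -[X in pdeg X]add0r mulnDr PoszD; apply: pdegM; last by apply: pdegM.
by rewrite /zR -(rmorph_int (@mpolyC 2 k)); exact: pdegC.
Qed.

Lemma sdeg_mxs e g h A : sdeg e g h A ->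
  mxdeg (int_of_Z e) (@zgen g) (@zgen h) (mxs (size g) (size h) A).
Proof.
move=> /allP hA i j; rewrite mxE /rev.
have hi : (i : nat) \in iota 0 (size g) by rewrite mem_iota; exact: ltn_ord.
have /allP ht := hA _ hi; rewrite big_seq_cond.
elim/big_ind: _ => [|x y hx hy|t /andP[tr /eqP tj]]; first exact: pdeg0.
  by apply: (homog_add (@pdeg0 k) (@pdegB k)).
have /Z.eqb_eq E := ht t tr.
suff -> : zgen i + int_of_Z e - zgen j = (2 * (t.1.2 + t.2))%N by exact: pdeg_tev.
rewrite /zgen -tj; apply: (can_inj Z_of_intK).
by rewrite raddfB raddfD /= !int_of_ZK -[LHS]/(Z.sub (Z.add _ e) _) -E mul2n.
Qed.

End Evaluation.

(** * Bimodules, complexes and retractions given by lists *)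

Record lbim := LBim { lgen : seq Z; lrho0 : smat; lrho1 : smat }.
Definition lrk (M : lbim) : nat := size (lgen M).
Definition lrho (M : lbim) (j : 'I_2) : smat := if j == 0 then lrho0 M else lrho1 M.

Definition lbim_ok (M : lbim) : bool :=
  [&& (size (lrho0 M) <= lrk M)%N, (size (lrho1 M) <= lrk M)%N,
      seqm (smul (lrho0 M) (lrho1 M)) (smul (lrho1 M) (lrho0 M)),
      sdeg (Zpos 2) (lgen M) (lgen M) (lrho0 M)
    & sdeg (Zpos 2) (lgen M) (lgen M) (lrho1 M)].

Definition lhom_ok (M N : lbim) (A : smat) : bool :=
  [&& (size A <= lrk M)%N, sdeg Z0 (lgen M) (lgen N) A,
      seqm (smul (lrho0 M) A) (smul A (lrho0 N))
    & seqm (smul (lrho1 M) A) (smul A (lrho1 N))].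

Record lcpx := LCpx { lob : int -> lbim; ldif : int -> smat }.

Definition lcpx_ok (L : lcpx) (n : int) : bool :=
  [&& lbim_ok (lob L n), lhom_ok (lob L n) (lob L (n + 1)) (ldif L n)
    & szero (smul (ldif L n) (ldif L (n + 1)))].

(** Matrices act on row vectors from the right, so [smul A B] means A followed by B. The data make E
    a deformation retract of D: i followed by p is exactly the identity of E, and p followed by i
    differs from the identity of D by the homotopy h. *)
Definition lcert_ok (D E : lcpx) (p i h : int -> smat) (n : int) : bool :=
  [&& lhom_ok (lob D n) (lob E n) (p n), lhom_ok (lob E n) (lob D n) (i n),
      lhom_ok (lob D (n + 1)) (lob D n) (h n),
      seqm (smul (ldif D n) (p (n + 1))) (smul (p n) (ldif E n))
    & [&& seqm (smul (ldif E n) (i (n + 1))) (smul (i n) (ldif D n)),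
          seqm (smul (i n) (p n)) (sid 0 (lrk (lob E n)))
        & seqm (smul (p (n + 1)) (i (n + 1)))
            (sadd (sid 0 (lrk (lob D (n + 1))))
              (sadd (smul (h n) (ldif D n)) (smul (ldif D (n + 1)) (h (n + 1)))))]].

Section ListBimodules.
Variable k : fieldType.
Local Notation R := {mpoly k[2]}.

Lemma sid_mxs n : mxs k n n (sid 0 n) = 1%:M.
Proof.
apply/matrixP => i j; rewrite !mxE nth_mkseq // /rev big_mkcond big_seq1 add0n.
rewrite -[tcol _]/(i : nat) -(val_eqE i j) /=; case: eqP => // _.
by rewrite /tev /= !expr0 !mulr1.
Qed.

Section Object.
Variables (M : lbim) (ok : lbim_ok M).

Let lrho_size j : (size (lrho M j) <= lrk M)%N.
Proof. by case/and5P: ok => ? ? _ _ _; rewrite /lrho; case: ifP. Qed.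

Lemma mbim_of_C : mxs k (lrk M) (lrk M) (lrho M 0) *m mxs k (lrk M) (lrk M) (lrho M 1)
  = mxs k (lrk M) (lrk M) (lrho M 1) *m mxs k (lrk M) (lrk M) (lrho M 0).
Proof.
case/and5P: (ok) => _ _ e _ _; rewrite !mxs_mul ?lrho_size //; exact: seqm_mxs.
Qed.

Lemma mbim_of_deg j : mxdeg 2 (@zgen (lgen M)) (@zgen (lgen M))
  (mxs k (lrk M) (lrk M) (lrho M j)).
Proof.
case/and5P: (ok) => s0 s1 _ d0 d1; rewrite /lrho -[2]/(int_of_Z (Zpos 2)).
by case: ifP => _; exact: sdeg_mxs.
Qed.

Definition mbim_of : mbim k := Mbim mbim_of_C mbim_of_deg.

End Object.

Section Hom.
Variables (M N : lbim) (okM : lbim_ok M) (okN : lbim_ok N) (A : smat).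
Hypothesis okA : lhom_ok M N A.

Lemma lhom_C j : mact (mbim_of okM) j *m mxs k (lrk M) (lrk N) A
  = mxs k (lrk M) (lrk N) A *m mact (mbim_of okN) j.
Proof.
case/and4P: okA => sA _ e0 e1; case/and5P: okN => s0 s1 _ _ _.
rewrite /= !mxs_mul //; last by rewrite /lrho; case: ifP.
by rewrite /lrho; case: ifP => _; exact: seqm_mxs.
Qed.

Lemma lhom_deg : mxdeg 0 (@zgen (lgen M)) (@zgen (lgen N)) (mxs k (lrk M) (lrk N) A).
Proof. by case/and4P: okA => _ dA _ _; exact: (@sdeg_mxs k Z0). Qed.

Definition lhom : ghom (fb (mbim_of okM)) (fb (mbim_of okN)) :=
  @fbmap k (mbim_of okM) (mbim_of okN) _ lhom_C lhom_deg.

End Hom.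

Section Cpx.
Variables (L : lcpx) (ok : forall n, lcpx_ok L n).

Lemma lob_ok n : lbim_ok (lob L n). Proof. by case/and3P: (ok n). Qed.

Lemma ldif_ok n : lhom_ok (lob L n) (lob L (n + 1)) (ldif L n).
Proof. by case/and3P: (ok n). Qed.

Lemma ldif_size n : (size (ldif L n) <= lrk (lob L n))%N.
Proof. by case/and4P: (ldif_ok n). Qed.

Lemma lcpx_K n : mxs k (lrk (lob L n)) (lrk (lob L (n + 1))) (ldif L n)
  *m mxs k (lrk (lob L (n + 1))) (lrk (lob L (n + 1 + 1))) (ldif L (n + 1)) = 0.
Proof.
rewrite mxs_mul ?ldif_size //; apply: szero_mxs; by case/and3P: (ok n).
Qed.

Definition mcpx_of : mcpx k :=
  @Mcpx k (fun n => mbim_of (lob_ok n)) _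
    (fun n => lhom_C (lob_ok n) (lob_ok (n + 1)) (ldif_ok n))
    (fun n => lhom_deg (ldif_ok n)) lcpx_K.

Definition lcpx_cpx : cpx k := fb_cpx mcpx_of.

End Cpx.

Lemma heq_lcert (D E : lcpx) (okD : forall n, lcpx_ok D n) (okE : forall n, lcpx_ok E n)
    (p i h : int -> smat) :
  (forall n, lcert_ok D E p i h n) -> heq (lcpx_cpx okD) (lcpx_cpx okE).
Proof.
move=> ok.
have okp n : lhom_ok (lob D n) (lob E n) (p n) by case/and5P: (ok n).
have oki n : lhom_ok (lob E n) (lob D n) (i n) by case/and5P: (ok n).
have okh n : lhom_ok (lob D (n + 1)) (lob D n) (h n) by case/and5P: (ok n).
have sz M N A : lhom_ok M N A -> (size A <= lrk M)%N by case/and4P.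
exists (fun n => lhom (lob_ok okD n) (lob_ok okE n) (okp n)).
exists (fun n => lhom (lob_ok okE n) (lob_ok okD n) (oki n)); split.
- move=> n x; case/and5P: (ok n) => _ _ _ e _.
  rewrite /= -!mulmxA !mxs_mul ?ldif_size ?(sz _ _ _ (okp _)) //.
  by congr (_ *m _); exact: seqm_mxs.
- move=> n x; case/and5P: (ok n) => _ _ _ _ /and3P[e _ _].
  rewrite /= -!mulmxA !mxs_mul ?ldif_size ?(sz _ _ _ (oki _)) //.
  by congr (_ *m _); exact: seqm_mxs.
- exists (fun n => lhom (lob_ok okD (n + 1)) (lob_ok okD n) (okh n)) => n x.
  case/and5P: (ok n) => _ _ _ _ /and3P[_ _ e].
  rewrite /= -!mulmxA !mxs_mul ?ldif_size ?(sz _ _ _ (oki _)) ?(sz _ _ _ (okh _)) //.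
  rewrite -mulmxDr mxs_add (seqm_mxs _ _ _ e) -mxs_add sid_mxs mulmxDr mulmx1.
  by rewrite addrAC subrr add0r.
exists (fun n => zero_hom _ _) => n x /=.
rewrite -!mulmxA mxs_mul ?(sz _ _ _ (okp _)) //.
case/and5P: (ok (n + 1)) => _ _ _ _ /and3P[_ e _].
by rewrite (seqm_mxs _ _ _ e) sid_mxs mulmx1 subrr mul0mx addr0.
Qed.

End ListBimodules.

(** * The twisted complex in list form *)

Section ListTheta.
Variable i : 'I_2.

Definition lsgn (n : int) : Z := if odd `|n|%N then Zneg xH else Zpos xH.

(* The action of s_i('X_j), and the constant dem i 'X_j. *)
Definition lrefl (M : lbim) (j : 'I_2) : smat :=
  if j == i then sscale (Zneg xH) (lrho M i) else sadd (lrho0 M) (lrho1 M).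
Definition ldem (j : 'I_2) : Z := if j == i then Zpos 2 else Zneg xH.

Definition lcat2 (A B : smat) : smat := [seq ab.1 ++ ab.2 | ab <- zip A B].

(** There are three blocks: C^(n+1)(-1), then the components x and y of the twisted double of C^n.
    In the total grading their generators move by +1, -1 and +1. *)
Definition ltt_ob (L : lcpx) (n : int) : lbim :=
  let M' := lob L (n + 1) in let M := lob L n in let a := lrk M' in let m := lrk M in
  let rho j := pad a (lrho M' j)
    ++ lcat2 (shiftr a (pad m (lrefl M j))) (sscale (ldem j) (sid (a + m) m))
    ++ shiftr (a + m) (pad m (lrho M j)) in
  LBim (map (Z.add (Zpos xH)) (lgen M') ++ map (Z.add (Zneg xH)) (lgen M)
        ++ map (Z.add (Zpos xH)) (lgen M)) (rho 0) (rho 1).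

Definition ltt_dif (L : lcpx) (n : int) : smat :=
  let a := lrk (lob L (n + 1)) in let m := lrk (lob L n) in
  let b := lrk (lob L (n + 1 + 1)) in
  lcat2 (pad a (ldif L (n + 1))) (sscale (lsgn (n + 1)) (sid (b + a) a))
  ++ shiftr b (pad m (ldif L n)) ++ shiftr (b + a) (pad m (ldif L n)).

Definition ltt (L : lcpx) : lcpx := LCpx (ltt_ob L) (ltt_dif L).

Definition lin0 (L : lcpx) n : smat := sid 0 (lrk (lob L (n + 1))).
Definition lin1 (L : lcpx) n : smat := sid (lrk (lob L (n + 1))) (lrk (lob L n)).
Definition lin2 (L : lcpx) n : smat :=
  sid (lrk (lob L (n + 1)) + lrk (lob L n)) (lrk (lob L n)).
Definition lout1 (L : lcpx) n : smat :=
  nseq (lrk (lob L (n + 1))) [::] ++ sid 0 (lrk (lob L n)).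
Definition lout2 (L : lcpx) n : smat :=
  nseq (lrk (lob L (n + 1)) + lrk (lob L n)) [::] ++ sid 0 (lrk (lob L n)).

(** That the blocks fit together as in [tt_cpx] is not proved for arbitrary lists but checked for
    each complex, by means of the inclusions and projections of the blocks. The projection to the
    first block is again [lin0], as absent rows count as zero. *)
Definition ltt_ok (L : lcpx) (n : int) : bool :=
  let D := ltt L in let M := lob L n in let M' := lob L (n + 1) in
  let j0 := lin0 L n in let j1 := lin1 L n in let j2 := lin2 L n in
  let q0 := lin0 L n in let q1 := lout1 L n in let q2 := lout2 L n in
  let N := lob D n in let a := lrk M' in let m := lrk M in
  [&& [&& seqm (smul j0 q0) (sid 0 a), szero (smul j0 q1), szero (smul j0 q2),
          szero (smul j1 q0) & [&& seqm (smul j1 q1) (sid 0 m), szero (smul j1 q2),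
          szero (smul j2 q0), szero (smul j2 q1) & seqm (smul j2 q2) (sid 0 m)]],
      seqm (sadd (smul q0 j0) (sadd (smul q1 j1) (smul q2 j2))) (sid 0 (lrk N)),
      [&& sdeg (Zpos xH) (lgen M') (lgen N) j0, sdeg (Zneg xH) (lgen M) (lgen N) j1,
          sdeg (Zpos xH) (lgen M) (lgen N) j2 & [&&
          sdeg (Zneg xH) (lgen N) (lgen M') q0, sdeg (Zpos xH) (lgen N) (lgen M) q1,
          sdeg (Zneg xH) (lgen N) (lgen M) q2, (size q0 <= lrk N)%N,
          (size q1 <= lrk N)%N & (size q2 <= lrk N)%N]],
      all (fun j => [&& seqm (smul j0 (lrho N j)) (smul (lrho M' j) j0),
          seqm (smul j1 (lrho N j)) (sadd (smul (lrefl M j) j1) (sscale (ldem j) j2))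
        & seqm (smul j2 (lrho N j)) (smul (lrho M j) j2)]) [:: 0; 1]
    & [&& seqm (smul j0 (ldif D n)) (sadd (smul (ldif L (n + 1)) (lin0 L (n + 1)))
            (sscale (lsgn (n + 1)) (lin2 L (n + 1)))),
          seqm (smul j1 (ldif D n)) (smul (ldif L n) (lin1 L (n + 1)))
        & seqm (smul j2 (ldif D n)) (smul (ldif L n) (lin2 L (n + 1)))]].

Section Iso.
Variables (k : fieldType) (L : lcpx).
Hypotheses (okL : forall n, lcpx_ok L n) (okD : forall n, lcpx_ok (ltt L) n).
Hypothesis ok : forall n, ltt_ok L n.
Local Notation R := {mpoly k[2]}.
Local Notation C := (lcpx_cpx k okL).
Local Notation D := (lcpx_cpx k okD).

Lemma ghom_ract_gen (M N : grbimod k) (f : M -> N) :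
  (forall x y, f (x - y) = f x - f y) -> (forall a x, f (lact a x) = lact a (f x)) ->
  (forall j x, f (ract x 'X_j) = ract (f x) 'X_j) ->
  forall x a, f (ract x a) = ract (f x) a.
Proof.
move=> fB fl fX x a; elim/mpoly_alg_ind: a x => [c|j|p q hp hq|p q hp hq] x //.
- by rewrite -!lractC fl.
- by rewrite !ractDr (subfD fB) hp hq.
- by rewrite -!ractA hq hp.
Qed.

Lemma size_sid off n : size (sid off n) = n. Proof. exact: size_mkseq. Qed.

(** This lemma and the next isolate the matrix algebra from the dependent sizes of the list
    complexes. *)
Lemma block_ract a m N (u : 'rV[R]_a) (v w : 'rV[R]_m) (A : 'M[R]_a) (S B : 'M[R]_m)
    (c : R) (J0 : 'M[R]_(a, N)) (J1 J2 : 'M[R]_(m, N)) (X : 'M[R]_N) :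
  J0 *m X = A *m J0 -> J1 *m X = S *m J1 + c *: J2 -> J2 *m X = B *m J2 ->
  u *m A *m J0 + (v *m S *m J1 + (v *m (c *: 1%:M) + w *m B) *m J2)
  = (u *m J0 + (v *m J1 + w *m J2)) *m X.
Proof.
move=> e0 e1 e2; rewrite !mulmxDl -!mulmxA e0 e1 e2 mulmxDr -!addrA.
by rewrite -scalemxAl mul1mx.
Qed.

Lemma block_diff a m a' m' N (u : 'rV[R]_a) (v w : 'rV[R]_m) (d' : 'M[R]_(a, a'))
    (d : 'M[R]_(m, a)) (J0 : 'M[R]_(a, m')) (J1 J2 : 'M[R]_(m, m')) (X : 'M[R]_(m', N))
    (I0 : 'M[R]_(a', N)) (I1 I2 : 'M[R]_(a, N)) n :
  J0 *m X = d' *m I0 + sgn n I2 -> J1 *m X = d *m I1 -> J2 *m X = d *m I2 ->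
  u *m d' *m I0 + ((sgn n (0, u) + (v *m d, w *m d)).1 *m I1
    + (sgn n (0, u) + (v *m d, w *m d)).2 *m I2)
  = (u *m J0 + (v *m J1 + w *m J2)) *m X.
Proof.
move=> e0 e1 e2.
have -> : sgn n (0, u) + (v *m d, w *m d) = (v *m d, sgn n u + w *m d).
  rewrite /sgn; case: ifP => _; last by rewrite -[LHS]/(0 + _, u + _) add0r.
  by rewrite -[LHS]/(- 0 + _, - u + _) oppr0 add0r.
rewrite /= [in RHS]mulmxDl [in X in _ = _ + X]mulmxDl -!mulmxA e0 e1 e2.
rewrite mulmxDr mulmxDl -!addrA !mulmxA; congr (_ + _); rewrite addrCA; congr (_ + _).
by rewrite /sgn; case: ifP => _; rewrite ?mulmxN ?mulNmx.
Qed.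

Section Degree.
Variable n : int.
Local Notation M' := (lob L (n + 1)).
Local Notation M := (lob L n).
Local Notation N := (lob (ltt L) n).
Local Notation J0 := (mxs k (lrk M') (lrk N) (lin0 L n)).
Local Notation J1 := (mxs k (lrk M) (lrk N) (lin1 L n)).
Local Notation J2 := (mxs k (lrk M) (lrk N) (lin2 L n)).
Local Notation Q0 := (mxs k (lrk N) (lrk M') (lin0 L n)).
Local Notation Q1 := (mxs k (lrk N) (lrk M) (lout1 L n)).
Local Notation Q2 := (mxs k (lrk N) (lrk M) (lout2 L n)).

Definition tt_row (z : tt_ob i C n) : D n :=
  (z.1 : 'rV[R]__) *m J0 + ((z.2.1 : 'rV[R]__) *m J1 + (z.2.2 : 'rV[R]__) *m J2).

Definition row_tt (v : D n) : tt_ob i C n :=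
  ((v : 'rV[R]__) *m Q0, ((v : 'rV[R]__) *m Q1, (v : 'rV[R]__) *m Q2)).

Lemma size_lin0 : (size (lin0 L n) <= lrk M')%N. Proof. by rewrite size_sid. Qed.
Lemma size_lin1 : (size (lin1 L n) <= lrk M)%N. Proof. by rewrite size_sid. Qed.
Lemma size_lin2 : (size (lin2 L n) <= lrk M)%N. Proof. by rewrite size_sid. Qed.

Lemma tt_rowK : cancel tt_row row_tt.
Proof.
case/and5P: (ok n) => /and5P[e00 e01 e02 e10 /and5P[e11 e12 e20 e21 e22]] _.
move=> /and4P[_ _ _ /and5P[_ _ _ s0 /andP[s1 s2]]] _ _.
case=> x [y z]; rewrite /row_tt /tt_row /= !mulmxDl -!mulmxA !mxs_mul //.
rewrite (seqm_mxs _ _ _ e00) (seqm_mxs _ _ _ e11) (seqm_mxs _ _ _ e22).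
rewrite (szero_mxs _ _ _ e01) (szero_mxs _ _ _ e02) (szero_mxs _ _ _ e10).
rewrite (szero_mxs _ _ _ e12) (szero_mxs _ _ _ e20) (szero_mxs _ _ _ e21).
by rewrite !sid_mxs !mulmx1 !mulmx0 !(addr0, add0r).
Qed.

Lemma row_ttK : cancel row_tt tt_row.
Proof.
case/and5P: (ok n) => _ e _ _ _ v; rewrite /row_tt /tt_row /= -!mulmxA.
rewrite !mxs_mul ?size_lin0 ?size_lin1 ?size_lin2 //.
by rewrite -!mulmxDr !mxs_add (seqm_mxs _ _ _ e) sid_mxs mulmx1.
Qed.

Lemma tt_row_ractX j z : tt_row (ract z 'X_j) = ract (tt_row z) 'X_j.
Proof.
have jE : j \in [:: 0; 1] by case: j => -[|[|//]] ?; rewrite !inE -!val_eqE.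
case/and5P: (ok n) => _ _ _ /allP/(_ j jE) /and3P[e0 e1 e2] _.
have /and5P[s0 s1 _ _ _] := lob_ok okD n.
have sN : (size (lrho N j) <= lrk N)%N by rewrite /lrho; case: ifP.
have E0 : J0 *m mxs k (lrk N) (lrk N) (lrho N j) = mxs k (lrk M') (lrk M') (lrho M' j) *m J0.
  by rewrite !mxs_mul ?size_lin0 //; exact: seqm_mxs.
have E1 : J1 *m mxs k (lrk N) (lrk N) (lrho N j)
    = mxs k (lrk M) (lrk M) (lrefl M j) *m J1 + zR k (ldem j) *: J2.
  by rewrite mxs_scale !mxs_mul ?size_lin1 // mxs_add; exact: seqm_mxs.
have E2 : J2 *m mxs k (lrk N) (lrk N) (lrho N j) = mxs k (lrk M) (lrk M) (lrho M j) *m J2.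
  by rewrite !mxs_mul ?size_lin2 //; exact: seqm_mxs.
case: z => x [y z]; pose u : 'rV[R]__ := x; pose v : 'rV[R]__ := y; pose w : 'rV[R]__ := z.
pose mM' := meval (mbim_of k (lob_ok okL (n + 1))); pose mM := meval (mbim_of k (lob_ok okL n)).
rewrite -[LHS]/((u *m mM' 'X_j) *m J0 + ((v *m mM (refl i 'X_j)) *m J1
  + (v *m mM (dem i 'X_j) + w *m mM 'X_j) *m J2)).
rewrite -[RHS]/((u *m J0 + (v *m J1 + w *m J2)) *m meval (mbim_of k (lob_ok okD n)) 'X_j).
have rE : mM (refl i 'X_j) = mxs k (lrk M) (lrk M) (lrefl M j).
  rewrite reflX /refl_img /lrefl; case: eqP => _.
    rewrite -mulN1r -mpolyC1 -mpolyCN /mM mevalM mevalC mevalX -scalemxAl mul1mx.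
    by rewrite mpolyCN mpolyC1 -mxs_scale (_ : zR k (Zneg xH) = -1).
  by rewrite /mM mevalD !mevalX -mxs_add.
have dE : mM (dem i 'X_j) = zR k (ldem j) *: 1%:M.
  rewrite /ldem /mM; case: (eqVneq j i) => [->|ji].
    by rewrite demXX -mpolyC1 -mpolyCMn mevalC mpolyCMn mpolyC1.
  by rewrite (dem_neq k ji) -mpolyC1 -mpolyCN mevalC mpolyCN mpolyC1.
rewrite rE dE /mM' /mM !mevalX; exact: block_ract.
Qed.

Lemma tt_rowB (x y : tt_ob i C n) : tt_row (x - y) = tt_row x - tt_row y.
Proof.
case: x y => x [x1 x2] [y [y1 y2]]; rewrite /tt_row /= !mulmxBl !opprD.
by rewrite [RHS]addrACA; congr (_ + _); rewrite addrACA.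
Qed.

Lemma tt_row_lact a (x : tt_ob i C n) : tt_row (lact a x) = lact a (tt_row x).
Proof. by case: x => x [x1 x2]; rewrite /tt_row /= !scalerDr !scalemxAl. Qed.

Lemma tt_row_deg d (x : tt_ob i C n) : bdeg d x -> bdeg d (tt_row x).
Proof.
case/and5P: (ok n) => _ _ /and4P[d0 d1 d2 _] _ _; case: x => x [y z] [hx [hy hz]].
have G := bdeg_grading (D n); have add := homog_add (gr0 G) (grB G).
have c d' (A B : seq Z) J e : d' + int_of_Z e = d -> (size J <= size A)%N -> sdeg e A B J ->
    forall v : 'rV[R]_(size A), rvdeg (@zgen A) d' v -> rvdeg (@zgen B) d (v *m mxs k (size A) (size B) J).
  by move=> <- sJ dJ v hv; apply: rvdeg_mul hv; exact: sdeg_mxs.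
apply: (add); [|apply: (add)].
- by apply: (c _ _ _ _ _ _ size_lin0 d0 _ hx) => /=; lia.
- by apply: (c _ _ _ _ _ _ size_lin1 d1 _ hy) => /=; lia.
- by apply: (c _ _ _ _ _ _ size_lin2 d2 _ hz) => /=; lia.
Qed.

Definition tt_row_hom : ghom (tt_ob i C n) (D n) :=
  @Ghom k (tt_ob i C n) (D n) tt_row tt_rowB tt_row_lact
    (ghom_ract_gen tt_rowB tt_row_lact tt_row_ractX) tt_row_deg.

Lemma row_tt_deg d v : @bdeg k (D n) d v -> bdeg d (row_tt v).
Proof.
case/and5P: (ok n) => _ _ /and4P[_ _ _ /and5P[d0 d1 d2 s0 /andP[s1 s2]]] _ _ hv.
have c d' (A B : seq Z) J e : d + int_of_Z e = d' -> (size J <= size A)%N -> sdeg e A B J ->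
    forall v : 'rV[R]_(size A), rvdeg (@zgen A) d v -> rvdeg (@zgen B) d' (v *m mxs k (size A) (size B) J).
  by move=> <- sJ dJ u hu; apply: rvdeg_mul hu; exact: sdeg_mxs.
split; [|split].
- by apply: (c _ _ _ _ _ _ s0 d0 _ hv) => /=; lia.
- by apply: (c _ _ _ _ _ _ s1 d1 _ hv) => /=; lia.
- by apply: (c _ _ _ _ _ _ s2 d2 _ hv) => /=; lia.
Qed.

End Degree.

Lemma zR_lsgn n (V : lmodType R) (v : V) : zR k (lsgn n) *: v = sgn n v.
Proof. by rewrite /lsgn /sgn; case: odd; rewrite ?scale1r // /zR /= NegzE scaleN1r. Qed.

Lemma heq_ltt : heq (tt_cpx i C) D.
Proof.
pose inv n := @ghom_inv k (tt_ob i C n) (D n) (tt_row_hom n) (@row_tt n)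
  (@tt_rowK n) (@row_ttK n) (@row_tt_deg n).
apply: (@heq_iso k (tt_cpx i C) D tt_row_hom inv).
- move=> n [x [y z]]; case/and5P: (ok n) => _ _ _ _ /and3P[e0 e1 e2].
  rewrite -[LHS]/(tt_row (tt_diff i C n (x, (y, z)))).
  rewrite -[RHS]/((tt_row (n := n) (x, (y, z)) : 'rV[R]__) *m
    mxs k (lrk (lob (ltt L) n)) (lrk (lob (ltt L) (n + 1))) (ldif (ltt L) n)).
  set dD := mxs k _ _ (ldif (ltt L) n).
  set d' := mxs k (lrk (lob L (n + 1))) (lrk (lob L (n + 1 + 1))) (ldif L (n + 1)).
  set d := mxs k (lrk (lob L n)) (lrk (lob L (n + 1))) (ldif L n).
  set I0 := mxs k (lrk (lob L (n + 1 + 1))) (lrk (lob (ltt L) (n + 1))) (lin0 L (n + 1)).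
  set I1 := mxs k (lrk (lob L (n + 1))) (lrk (lob (ltt L) (n + 1))) (lin1 L (n + 1)).
  set I2 := mxs k (lrk (lob L (n + 1))) (lrk (lob (ltt L) (n + 1))) (lin2 L (n + 1)).
  have E0 : mxs k _ _ (lin0 L n) *m dD = d' *m I0 + sgn (n + 1) I2.
    rewrite -zR_lsgn mxs_scale !mxs_mul ?ldif_size ?size_lin0 // mxs_add.
    exact: seqm_mxs.
  have E1 : mxs k _ _ (lin1 L n) *m dD = d *m I1.
    by rewrite !mxs_mul ?ldif_size ?size_lin1 //; exact: seqm_mxs.
  have E2 : mxs k _ _ (lin2 L n) *m dD = d *m I2.
    by rewrite !mxs_mul ?ldif_size ?size_lin2 //; exact: seqm_mxs.
  have := block_diff (x : 'rV[R]__) (y : 'rV[R]__) (z : 'rV[R]__) E0 E1 E2.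
  by rewrite /tt_row /= ghom_sgnE.
- by move=> n; exact: tt_rowK.
- by move=> n; exact: row_ttK.
Qed.

End Iso.

End ListTheta.

(** * Reduction of the Rouquier complex *)

Section ListComplexes.

Definition getz (T : Type) (x0 : T) (s : seq T) (n : int) : T :=
  match n with 0 => nth x0 s 0 | Posz _.+1 => x0 | Negz q => nth x0 s q.+1 end.

Definition lzero : lbim := LBim [::] [::] [::].

(* The q-th entries of the lists are placed in cohomological degree - q. *)
Definition lcpx_list (obs : seq lbim) (difs : seq smat) : lcpx :=
  LCpx (getz lzero obs) (getz [::] difs).

Definition lshift (d : Z) (M : lbim) : lbim :=
  LBim (map (fun g => Z.sub g d) (lgen M)) (lrho0 M) (lrho1 M).

Definition lsum2 (M N : lbim) : lbim :=
  LBim (lgen M ++ lgen N) (pad (lrk M) (lrho0 M) ++ shiftr (lrk M) (lrho0 N))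
    (pad (lrk M) (lrho1 M) ++ shiftr (lrk M) (lrho1 N)).

Definition lsum (s : seq lbim) : lbim := foldr lsum2 lzero s.

(** A check over all degrees becomes a finite computation. With q symbolic, the lookups still reduce
    by evaluation. Nine is enough: the checks read no degree above n + 3, the lists have at most
    seven entries, and n = -(10 + q) gives n + 3 = -(7 + q), which is past their end. *)
Lemma check_int (c : int -> bool) : all (fun q => c (Negz q)) (iota 0 9) -> c 0 ->
  (forall q, c (Negz (9 + q)%N)) -> (forall q, c (Posz q.+1)) -> forall n, c n.
Proof.
move=> /allP h1 h0 h9 hp [[//|q]|q]; first exact: hp.
have [lt|ge] := ltnP q 9; first by apply: h1; rewrite mem_iota.
by rewrite -(subnKC ge).
Qed.

End ListComplexes.

Arguments lshift d%_Z_scope M.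
Arguments LBim lgen%_Z_scope lrho0 lrho1.

(* [lBst] is B_s (x)_R B_t, [lBts] is B_t (x)_R B_s, and [lBsts] is a complement of B_s in
   B_s (x)_R B_t (x)_R B_s. *)
Definition lR : lbim := LBim [:: 0]
  ([:: [:: T 0 1 1 0]])
  ([:: [:: T 0 1 0 1]]).

Definition lBs : lbim := LBim [:: (-1); 1]
  ([:: [:: T 0 (-1) 1 0; T 1 2 0 0]; [:: T 1 1 1 0]])
  ([:: [:: T 0 1 0 1; T 0 1 1 0; T 1 (-1) 0 0]; [:: T 1 1 0 1]]).

Definition lBt : lbim := LBim [:: (-1); 1]
  ([:: [:: T 0 1 0 1; T 0 1 1 0; T 1 (-1) 0 0]; [:: T 1 1 1 0]])
  ([:: [:: T 0 (-1) 0 1; T 1 2 0 0]; [:: T 1 1 0 1]]).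

Definition lBst : lbim := LBim [:: (-2); 0; 0; 2]
  ([:: [:: T 0 1 0 1; T 1 1 0 0; T 2 (-1) 0 0]; [:: T 1 1 0 1; T 1 1 1 0; T 3 (-1) 0 0]; [:: T 2
  (-1) 1 0; T 3 2 0 0]; [:: T 3 1 1 0]])
  ([:: [:: T 0 (-1) 0 1; T 0 (-1) 1 0; T 1 1 0 0; T 2 2 0 0]; [:: T 1 (-1) 0 1; T 3 2 0 0]; [:: T
  2 1 0 1; T 2 1 1 0; T 3 (-1) 0 0]; [:: T 3 1 0 1]]).

Definition lBts : lbim := LBim [:: (-2); 0; 0; 2]
  ([:: [:: T 0 (-1) 0 1; T 0 (-1) 1 0; T 1 1 0 0; T 2 2 0 0]; [:: T 1 (-1) 1 0; T 3 2 0 0]; [:: T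
  2 1 0 1; T 2 1 1 0; T 3 (-1) 0 0]; [:: T 3 1 1 0]])
  ([:: [:: T 0 1 1 0; T 1 1 0 0; T 2 (-1) 0 0]; [:: T 1 1 0 1; T 1 1 1 0; T 3 (-1) 0 0]; [:: T 2
  (-1) 0 1; T 3 2 0 0]; [:: T 3 1 0 1]]).

Definition lBsts : lbim := LBim [:: (-3); (-1); (-1); 1; 1; 3]
  ([:: [:: T 0 (-1) 0 1; T 1 (-1) 0 0; T 2 2 0 0]; [:: T 1 (-1) 0 1; T 1 (-1) 1 0; T 3 2 0 0; T 4
  1 0 0]; [:: T 2 1 0 1; T 3 1 0 0; T 4 (-1) 0 0]; [:: T 3 1 0 1; T 3 1 1 0; T 5 (-1) 0 0]; [:: T
  4 (-1) 1 0; T 5 2 0 0]; [:: T 5 1 1 0]])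
  ([:: [:: T 0 (-1) 1 0; T 1 2 0 0; T 2 (-1) 0 0]; [:: T 1 1 1 0; T 3 (-1) 0 0; T 4 1 0 0]; [:: T
  2 (-1) 0 1; T 2 (-1) 1 0; T 3 1 0 0; T 4 2 0 0]; [:: T 3 (-1) 0 1; T 5 2 0 0]; [:: T 4 1 0 1; T
  4 1 1 0; T 5 (-1) 0 0]; [:: T 5 1 0 1]]).

(* [cx n] (n = 1, ..., 6) arises from the tensor product of [cx (n - 1)] with F(sigma_i^-1) by
   splitting its terms into shifts of the six bimodules above and cancelling the isomorphisms
   between summands; [prn], [inn], [htn] are the maps to and from it and the homotopy. *)
Definition ob0 : seq lbim := [seq lsum b | b <- [::
  [:: lshift 0 lR]]].

Definition df0 : seq smat := [::].

Definition ob1 : seq lbim := [seq lsum b | b <- [::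
  [:: lshift 0 lBs];
  [:: lshift (-1) lR]]].

Definition df1 : seq smat := [::
  [::];
  [:: [:: T 1 1 0 0]]].

Definition pr1 : seq smat := [::
  [:: [:: T 0 1 0 0]; [:: T 1 1 0 0]];
  [:: [:: T 0 1 0 0]]].

Definition in1 : seq smat := [::
  [:: [:: T 0 1 0 0]; [:: T 1 1 0 0]];
  [:: [:: T 0 1 0 0]]].

Definition ht1 : seq smat := [::].

Definition ob2 : seq lbim := [seq lsum b | b <- [::
  [:: lshift 0 lBst];
  [:: lshift (-1) lBs; lshift (-1) lBt];
  [:: lshift (-2) lR]]].

Definition df2 : seq smat := [::
  [::];
  [:: [:: T 2 1 0 0]; [:: T 3 1 0 0]; [:: T 1 1 0 0]; [:: T 3 1 0 0]];
  [:: [:: T 1 1 0 0; T 3 (-1) 0 0]]].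

Definition pr2 : seq smat := [::
  [:: [:: T 0 1 0 0]; [:: T 1 1 0 0]; [:: T 2 1 0 0]; [:: T 3 1 0 0]];
  [:: [:: T 0 1 0 0]; [:: T 1 1 0 0]; [:: T 2 1 0 0]; [:: T 3 1 0 0]];
  [:: [:: T 0 1 0 0]]].

Definition in2 : seq smat := [::
  [:: [:: T 0 1 0 0]; [:: T 1 1 0 0]; [:: T 2 1 0 0]; [:: T 3 1 0 0]];
  [:: [:: T 0 1 0 0]; [:: T 1 1 0 0]; [:: T 2 1 0 0]; [:: T 3 1 0 0]];
  [:: [:: T 0 1 0 0]]].

Definition ht2 : seq smat := [::].

Definition ob3 : seq lbim := [seq lsum b | b <- [::
  [:: lshift 0 lBsts];
  [:: lshift (-1) lBst; lshift (-1) lBts];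
  [:: lshift (-2) lBt; lshift (-2) lBs];
  [:: lshift (-3) lR]]].

Definition df3 : seq smat := [::
  [::];
  [:: [:: T 2 1 0 0]; [:: T 3 1 0 0]; [:: T 4 1 0 0]; [:: T 5 1 0 0]; [:: T 1 1 0 0]; [:: T 4 1 0
  0]; [:: T 3 1 0 0]; [:: T 5 1 0 0]];
  [:: [:: T 1 1 0 0; T 6 (-1) 0 0]; [:: T 3 1 0 0; T 7 (-1) 0 0]; [:: T 2 1 0 0; T 5 (-1) 0 0];
  [:: T 3 1 0 0; T 7 (-1) 0 0]];
  [:: [:: T 1 (-1) 0 0; T 3 1 0 0]]].

Definition pr3 : seq smat := [::
  [:: [:: T 0 1 0 0]; [:: T 1 1 0 0]; [::]; [:: T 4 1 0 0]; [:: T 2 1 0 0]; [:: T 3 1 0 0]; [:: T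
  4 1 0 0]; [:: T 5 1 0 0]];
  [:: [:: T 0 1 0 0]; [:: T 1 1 0 0]; [:: T 2 1 0 0]; [:: T 3 1 0 0]; [::]; [:: T 2 1 0 0]; [:: T
  4 1 0 0]; [:: T 5 1 0 0]; [:: T 2 1 0 0]; [:: T 3 1 0 0]; [:: T 6 1 0 0]; [:: T 7 1 0 0]];
  [:: [::]; [::]; [:: T 0 1 0 0]; [:: T 1 1 0 0]; [:: T 2 1 0 0]; [:: T 3 1 0 0]];
  [:: [:: T 0 1 0 0]]].

Definition in3 : seq smat := [::
  [:: [:: T 0 1 0 0]; [:: T 1 1 0 0; T 2 1 0 0]; [:: T 2 1 0 0; T 4 1 0 0]; [:: T 2 1 1 0; T 3
  (-1) 0 0; T 5 1 0 0; T 6 1 0 0]; [:: T 2 1 0 1; T 3 1 0 0]; [:: T 2 1 1 1; T 3 (-1) 0 1; T 6 1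
  0 1; T 7 1 0 0]];
  [:: [:: T 0 1 0 0; T 4 1 0 0]; [:: T 1 1 0 0; T 4 1 1 0; T 5 (-1) 0 0; T 8 1 0 0]; [:: T 2 1 0
  0; T 4 1 0 1; T 5 1 0 0; T 8 (-1) 0 0]; [:: T 3 1 0 0; T 4 1 1 1; T 5 (-1) 0 1; T 8 1 0 1]; [::
  T 4 1 0 0; T 6 1 0 0]; [:: T 4 1 0 1; T 7 1 0 0]; [:: T 4 1 1 0; T 5 (-1) 0 0; T 8 1 0 0; T 10
  1 0 0]; [:: T 4 1 1 1; T 5 (-1) 0 1; T 8 1 0 1; T 11 1 0 0]];
  [:: [:: T 2 1 0 0]; [:: T 3 1 0 0]; [:: T 0 1 0 0; T 4 1 0 0]; [:: T 1 1 0 0; T 5 1 0 0]];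
  [:: [:: T 0 1 0 0]]].

Definition ht3 : seq smat := [::
  [::];
  [:: [::]; [:: T 4 1 0 0]; [:: T 4 (-1) 0 0]; [:: T 4 1 0 1]; [:: T 4 1 0 0]; [:: T 4 1 1 0; T 5
  (-1) 0 0; T 8 1 0 0]; [:: T 4 1 0 1; T 5 1 0 0; T 8 (-1) 0 0]; [:: T 4 1 1 1; T 5 (-1) 0 1; T 8
  1 0 1]];
  [:: [::]; [::]; [::]; [::]; [::]; [:: T 0 1 0 0]; [::]; [::]; [:: T 0 1 0 0]; [:: T 1 1 0 0]]].

Definition ob4 : seq lbim := [seq lsum b | b <- [::
  [:: lshift 1 lBsts];
  [:: lshift 0 lBst; lshift (-1) lBsts];
  [:: lshift (-2) lBts; lshift (-2) lBst];
  [:: lshift (-3) lBs; lshift (-3) lBt];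
  [:: lshift (-4) lR]]].

Definition df4 : seq smat := [::
  [::];
  [:: [:: T 2 1 0 0]; [:: T 3 1 0 0]; [:: T 4 1 0 0]; [:: T 5 1 0 0]; [:: T 0 1 1 0; T 1 (-1) 0
  0; T 2 1 0 0]; [:: T 3 1 0 0]; [:: T 2 1 0 1; T 2 1 1 0; T 4 (-1) 0 0]; [:: T 3 1 0 1; T 3 1 1
  0; T 5 (-1) 0 0]; [:: T 5 1 0 0]; [:: T 5 1 1 0]];
  [:: [:: T 1 1 0 0; T 5 (-1) 0 0]; [:: T 3 1 0 0; T 8 (-1) 0 0]; [:: T 1 1 0 1; T 1 1 1 0; T 3
  (-1) 0 0; T 7 (-1) 0 0]; [:: T 3 1 1 0; T 9 (-1) 0 0]; [:: T 0 1 0 1; T 0 1 1 0; T 2 (-1) 0 0;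
  T 6 (-1) 0 0]; [:: T 1 1 0 1; T 1 1 1 0; T 3 (-1) 0 0; T 7 (-1) 0 0]; [:: T 3 1 0 0; T 8 (-1) 0
  0]; [:: T 3 1 1 0; T 9 (-1) 0 0]];
  [:: [:: T 1 (-1) 0 0; T 6 1 0 0]; [:: T 3 (-1) 0 0; T 7 1 0 0]; [:: T 2 (-1) 0 0; T 5 1 0 0];
  [:: T 3 (-1) 0 0; T 7 1 0 0]];
  [:: [:: T 1 1 0 0; T 3 (-1) 0 0]]].

Definition pr4 : seq smat := [::
  [:: [:: T 0 1 0 0]; [:: T 0 1 1 0; T 1 (-1) 0 0; T 2 1 0 0]; [:: T 2 1 0 0]; [:: T 3 1 0 0];
  [:: T 2 1 0 1; T 2 1 1 0; T 3 (-1) 0 0; T 4 (-1) 0 0]; [:: T 3 1 0 1; T 5 (-1) 0 0]];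
  [:: [::]; [::]; [::]; [::]; [::]; [::]; [:: T 0 1 0 0]; [:: T 1 1 0 0]; [:: T 0 1 0 1; T 0 1 1
  0; T 1 (-1) 0 0; T 2 (-1) 0 0]; [:: T 1 1 0 1; T 3 (-1) 0 0]; [:: T 4 1 0 0]; [:: T 1 (-1) 0 0;
  T 6 1 0 0]; [:: T 1 1 0 0]; [:: T 1 (-1) 1 0; T 7 1 0 0]; [::]; [::]; [::]; [::]; [:: T 1 (-1)
  0 0; T 5 1 0 0]; [:: T 3 (-1) 0 0; T 8 1 0 0]; [:: T 1 (-1) 0 1; T 1 (-1) 1 0; T 3 1 0 0; T 7 1
  0 0]; [:: T 3 (-1) 1 0; T 9 1 0 0]];
  [:: [::]; [::]; [::]; [::]; [:: T 0 1 0 0]; [:: T 1 1 0 0]; [:: T 2 1 0 0]; [:: T 3 1 0 0];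
  [::]; [:: T 2 1 0 0]; [:: T 4 1 0 0]; [:: T 5 1 0 0]; [:: T 2 1 0 0]; [:: T 3 1 0 0]; [:: T 6 1
  0 0]; [:: T 7 1 0 0]];
  [:: [::]; [::]; [:: T 0 1 0 0]; [:: T 1 1 0 0]; [:: T 2 1 0 0]; [:: T 3 1 0 0]];
  [:: [:: T 0 1 0 0]]].

Definition in4 : seq smat := [::
  [:: [:: T 0 1 0 0]; [:: T 0 1 1 0; T 1 (-1) 0 0; T 2 1 0 0; T 6 1 0 0]; [:: T 2 1 0 0]; [:: T 3
  1 0 0]; [:: T 2 1 0 1; T 2 1 1 0; T 3 (-1) 0 0; T 4 (-1) 0 0; T 8 1 0 0]; [:: T 3 1 0 1; T 5
  (-1) 0 0; T 9 1 0 0]];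
  [:: [:: T 6 1 0 0]; [:: T 7 1 0 0]; [:: T 6 1 0 1; T 6 1 1 0; T 7 (-1) 0 0; T 8 (-1) 0 0; T 14
  1 0 0]; [:: T 7 1 0 1; T 9 (-1) 0 0; T 15 1 0 0]; [:: T 0 (-1) 0 0; T 10 1 0 0]; [:: T 1 (-1) 0
  0; T 12 1 0 0; T 18 1 0 0]; [:: T 2 (-1) 0 0; T 11 1 0 0; T 12 1 0 0]; [:: T 3 (-1) 0 0; T 12 1
  1 0; T 13 1 0 0]; [:: T 4 (-1) 0 0; T 12 1 0 1; T 13 (-1) 0 0; T 19 1 0 0; T 20 1 0 0]; [:: T 5
  (-1) 0 0; T 12 1 1 1; T 13 (-1) 1 0; T 20 1 1 0; T 21 1 0 0]];
  [:: [:: T 4 1 0 0; T 8 1 0 0]; [:: T 5 1 0 0; T 8 1 0 1; T 9 (-1) 0 0; T 12 1 0 0]; [:: T 6 1 0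
  0; T 8 1 1 0; T 9 1 0 0; T 12 (-1) 0 0]; [:: T 7 1 0 0; T 8 1 1 1; T 9 (-1) 1 0; T 12 1 1 0];
  [:: T 0 1 0 0; T 8 1 0 0; T 10 1 0 0]; [:: T 1 1 0 0; T 8 1 1 0; T 11 1 0 0]; [:: T 2 1 0 0; T
  8 1 0 1; T 9 (-1) 0 0; T 12 1 0 0; T 14 1 0 0]; [:: T 3 1 0 0; T 8 1 1 1; T 9 (-1) 1 0; T 12 1
  1 0; T 15 1 0 0]];
  [:: [:: T 2 1 0 0]; [:: T 3 1 0 0]; [:: T 0 1 0 0; T 4 1 0 0]; [:: T 1 1 0 0; T 5 1 0 0]];
  [:: [:: T 0 1 0 0]]].

Definition ht4 : seq smat := [::
  [::];
  [:: [::]; [:: T 0 (-1) 0 0]; [::]; [::]; [:: T 2 (-1) 0 0]; [:: T 3 (-1) 0 0]; [:: T 0 (-1) 0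
  0]; [:: T 1 (-1) 0 0]; [:: T 2 (-1) 0 0]; [:: T 3 (-1) 0 0]; [:: T 4 (-1) 0 0]; [:: T 5 (-1) 0
  0]];
  [:: [::]; [::]; [::]; [::]; [::]; [::]; [::]; [::]; [:: T 0 1 0 0]; [:: T 1 1 0 0]; [::]; [:: T
  8 (-1) 0 0]; [:: T 8 1 0 0]; [:: T 8 (-1) 1 0]; [:: T 0 1 0 0]; [:: T 1 1 0 0]; [:: T 2 1 0 0];
  [:: T 3 1 0 0]; [:: T 8 (-1) 0 0]; [:: T 8 (-1) 0 1; T 9 1 0 0; T 12 (-1) 0 0]; [:: T 8 (-1) 1
  0; T 9 (-1) 0 0; T 12 1 0 0]; [:: T 8 (-1) 1 1; T 9 1 1 0; T 12 (-1) 1 0]];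
  [:: [::]; [::]; [::]; [::]; [::]; [::]; [::]; [::]; [::]; [:: T 0 (-1) 0 0]; [::]; [::]; [:: T
  0 (-1) 0 0]; [:: T 1 (-1) 0 0]]].

Definition ob5 : seq lbim := [seq lsum b | b <- [::
  [:: lshift 2 lBsts];
  [:: lshift 0 lBsts; lshift 0 lBs; lshift 0 lBsts];
  [:: lshift (-1) lBst; lshift (-1) lBts; lshift (-2) lBsts];
  [:: lshift (-3) lBst; lshift (-3) lBts];
  [:: lshift (-4) lBt; lshift (-4) lBs];
  [:: lshift (-5) lR]]].

Definition df5 : seq smat := [::
  [::];
  [:: [:: T 0 1 0 1; T 1 1 0 0; T 2 (-1) 0 0]; [:: T 1 1 0 1; T 1 1 1 0; T 3 (-1) 0 0]; [:: T 4 1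
  0 0]; [:: T 5 1 0 0]; [:: T 4 1 0 1; T 4 1 1 0; T 5 (-1) 0 0]; [:: T 5 1 0 1]; [:: T 4 1 0 0];
  [:: T 5 1 0 0]; [:: T 0 1 0 1; T 0 1 1 0; T 2 (-1) 0 0]; [:: T 1 1 0 1; T 1 1 1 0; T 3 (-1) 0
  0; T 4 (-1) 0 0]; [:: T 2 1 1 0; T 3 (-1) 0 0]; [::]; [:: T 4 1 1 0; T 5 (-1) 0 0]];
  [:: [:: T 2 (-1) 0 0; T 6 1 0 0]; [:: T 3 (-1) 0 0; T 7 1 0 0]; [:: T 4 (-1) 0 0; T 6 1 0 1; T
  6 1 1 0; T 7 (-1) 0 0]; [:: T 5 (-1) 0 0; T 7 1 0 1]; [:: T 1 1 0 0; T 6 (-1) 0 0; T 9 (-1) 0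
  0]; [:: T 4 1 0 0; T 6 (-1) 0 1; T 12 (-1) 0 0]; [:: T 3 1 0 0; T 7 (-1) 0 0; T 11 (-1) 0 0];
  [:: T 5 1 0 0; T 7 (-1) 0 1; T 13 (-1) 0 0]; [:: T 0 1 0 1; T 0 1 1 0; T 6 (-1) 0 0; T 8 (-1) 0
  1; T 9 (-1) 0 0; T 10 1 0 0]; [:: T 1 1 0 1; T 1 1 1 0; T 6 (-1) 0 1; T 6 (-1) 1 0; T 9 (-1) 0
  1; T 9 (-1) 1 0; T 11 1 0 0]; [:: T 2 1 0 1; T 2 1 1 0; T 6 (-1) 0 1; T 7 (-1) 0 0; T 12 (-1) 0
  0]; [:: T 3 1 0 1; T 3 1 1 0; T 7 (-1) 0 1; T 7 (-1) 1 0; T 13 (-1) 0 0]; [:: T 4 1 0 1; T 4 1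
  1 0; T 6 (-1) 0 2; T 6 (-1) 1 1; T 12 (-1) 0 1; T 12 (-1) 1 0; T 13 1 0 0]; [:: T 5 1 0 1; T 5
  1 1 0; T 7 (-1) 0 2; T 7 (-1) 1 1; T 13 (-1) 0 1]];
  [:: [:: T 0 1 0 1; T 0 1 1 0; T 2 (-1) 0 0; T 5 (-1) 0 0; T 10 1 0 0]; [:: T 1 1 0 1; T 1 1 1
  0; T 3 (-1) 0 0; T 7 (-1) 0 0; T 11 1 0 0]; [:: T 3 1 0 0; T 5 (-1) 0 1; T 5 (-1) 1 0; T 7 1 0
  0; T 12 1 0 0]; [:: T 3 1 1 0; T 7 (-1) 0 1; T 13 1 0 0]; [:: T 1 1 0 0; T 4 (-1) 0 1; T 4 (-1)
  1 0; T 6 1 0 0; T 9 1 0 0]; [:: T 3 1 0 0; T 5 (-1) 0 1; T 5 (-1) 1 0; T 7 1 0 0; T 12 1 0 0];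
  [:: T 1 1 0 1; T 1 1 1 0; T 3 (-1) 0 0; T 7 (-1) 0 0; T 11 1 0 0]; [:: T 3 1 1 0; T 7 (-1) 0 1;
  T 13 1 0 0]];
  [:: [:: T 1 1 0 0; T 6 (-1) 0 0]; [:: T 3 1 0 0; T 7 (-1) 0 0]; [:: T 2 1 0 0; T 5 (-1) 0 0];
  [:: T 3 1 0 0; T 7 (-1) 0 0]];
  [:: [:: T 1 (-1) 0 0; T 3 1 0 0]]].

Definition pr5 : seq smat := [::
  [:: [:: T 0 1 0 0]; [:: T 1 1 0 0]; [:: T 0 1 0 1; T 1 1 0 0; T 2 (-1) 0 0]; [:: T 1 1 0 1; T 1
  1 1 0; T 3 (-1) 0 0; T 4 (-1) 0 0]; [:: T 4 1 0 0]; [:: T 4 1 1 0; T 5 (-1) 0 0]];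
  [:: [::]; [::]; [::]; [::]; [::]; [::]; [:: T 0 1 0 0]; [:: T 1 1 0 0; T 6 (-1) 0 0]; [:: T 6 1
  0 0]; [:: T 4 1 0 0; T 6 (-1) 0 1]; [:: T 8 1 0 0]; [:: T 9 1 0 0]; [:: T 8 1 0 1; T 9 1 0 0; T
  10 (-1) 0 0]; [:: T 9 1 0 1; T 9 1 1 0; T 11 (-1) 0 0; T 12 (-1) 0 0]; [:: T 12 1 0 0]; [:: T
  12 1 1 0; T 13 (-1) 0 0]; [:: T 2 1 0 0; T 6 (-1) 0 0]; [:: T 3 1 0 0; T 7 (-1) 0 0]; [:: T 4 1
  0 0; T 6 (-1) 0 1; T 6 (-1) 1 0; T 7 1 0 0]; [:: T 5 1 0 0; T 7 (-1) 0 1]];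
  [:: [:: T 0 1 0 0]; [:: T 1 1 0 0]; [:: T 2 1 0 0]; [:: T 3 1 0 0]; [::]; [::]; [::]; [::];
  [::]; [::]; [:: T 4 1 0 0]; [:: T 5 1 0 0]; [:: T 1 (-1) 0 0; T 4 1 0 1; T 4 1 1 0; T 5 (-1) 0
  0; T 6 (-1) 0 0]; [:: T 3 (-1) 0 0; T 5 1 1 0; T 7 (-1) 0 0]; [:: T 8 1 0 0]; [:: T 5 (-1) 0 0;
  T 9 1 0 0]; [:: T 5 1 0 0]; [:: T 5 (-1) 0 1; T 12 1 0 0]; [:: T 1 (-1) 0 0]; [:: T 3 (-1) 0
  0]; [:: T 1 (-1) 0 1; T 1 (-1) 1 0; T 3 1 0 0]; [:: T 3 (-1) 1 0]; [:: T 5 (-1) 0 0; T 10 1 0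
  0]; [:: T 7 (-1) 0 0; T 11 1 0 0]; [:: T 5 (-1) 0 1; T 5 (-1) 1 0; T 7 1 0 0; T 12 1 0 0]; [::
  T 7 (-1) 0 1; T 13 1 0 0]];
  [:: [::]; [::]; [::]; [::]; [:: T 0 1 0 0]; [:: T 1 1 0 0]; [:: T 2 1 0 0]; [:: T 3 1 0 0];
  [::]; [:: T 2 1 0 0]; [:: T 4 1 0 0]; [:: T 5 1 0 0]; [:: T 2 1 0 0]; [:: T 3 1 0 0]; [:: T 6 1
  0 0]; [:: T 7 1 0 0]];
  [:: [::]; [::]; [:: T 0 1 0 0]; [:: T 1 1 0 0]; [:: T 2 1 0 0]; [:: T 3 1 0 0]];
  [:: [:: T 0 1 0 0]]].

Definition in5 : seq smat := [::
  [:: [:: T 0 1 0 0]; [:: T 1 1 0 0]; [:: T 0 1 0 1; T 1 1 0 0; T 2 (-1) 0 0; T 6 1 0 0]; [:: T 1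
  1 0 1; T 1 1 1 0; T 3 (-1) 0 0; T 4 (-1) 0 0; T 7 1 0 0]; [:: T 4 1 0 0]; [:: T 4 1 1 0; T 5
  (-1) 0 0; T 10 1 0 0]];
  [:: [:: T 0 (-1) 0 0; T 6 1 0 0]; [:: T 1 (-1) 0 0; T 7 1 0 0; T 8 1 0 0]; [:: T 2 (-1) 0 0; T
  8 1 0 0; T 16 1 0 0]; [:: T 3 (-1) 0 0; T 8 1 1 0; T 9 (-1) 0 0; T 17 1 0 0; T 18 1 0 0]; [:: T
  4 (-1) 0 0; T 8 1 0 1; T 9 1 0 0]; [:: T 5 (-1) 0 0; T 8 1 1 1; T 9 (-1) 0 1; T 18 1 0 1; T 19
  1 0 0]; [:: T 8 1 0 0]; [:: T 8 1 1 0; T 9 (-1) 0 0; T 18 1 0 0]; [:: T 0 (-1) 0 0; T 10 1 0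
  0]; [:: T 1 (-1) 0 0; T 11 1 0 0]; [:: T 2 (-1) 0 0; T 10 1 0 1; T 11 1 0 0; T 12 (-1) 0 0; T
  20 1 0 0]; [:: T 3 (-1) 0 0; T 11 1 0 1; T 11 1 1 0; T 13 (-1) 0 0; T 14 (-1) 0 0; T 21 1 0 0];
  [:: T 4 (-1) 0 0; T 14 1 0 0]; [:: T 5 (-1) 0 0; T 14 1 1 0; T 15 (-1) 0 0; T 24 1 0 0]];
  [:: [:: T 0 1 0 0]; [:: T 1 1 0 0]; [:: T 2 1 0 0]; [:: T 3 1 0 0]; [:: T 10 1 0 0]; [:: T 11 1
  0 0]; [:: T 10 1 0 1; T 10 1 1 0; T 11 (-1) 0 0; T 12 (-1) 0 0; T 18 1 0 0]; [:: T 11 1 1 0; T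
  13 (-1) 0 0; T 19 1 0 0]; [:: T 4 (-1) 0 0; T 14 1 0 0]; [:: T 5 (-1) 0 0; T 15 1 0 0; T 16 1 0
  0]; [:: T 6 (-1) 0 0; T 16 1 0 0; T 22 1 0 0]; [:: T 7 (-1) 0 0; T 16 1 1 0; T 17 (-1) 0 0; T
  23 1 0 0; T 24 1 0 0]; [:: T 8 (-1) 0 0; T 16 1 0 1; T 17 1 0 0]; [:: T 9 (-1) 0 0; T 16 1 1 1;
  T 17 (-1) 0 1; T 24 1 0 1; T 25 1 0 0]];
  [:: [:: T 4 1 0 0; T 8 1 0 0]; [:: T 5 1 0 0; T 8 1 1 0; T 9 (-1) 0 0; T 12 1 0 0]; [:: T 6 1 0
  0; T 8 1 0 1; T 9 1 0 0; T 12 (-1) 0 0]; [:: T 7 1 0 0; T 8 1 1 1; T 9 (-1) 0 1; T 12 1 0 1];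
  [:: T 0 1 0 0; T 8 1 0 0; T 10 1 0 0]; [:: T 1 1 0 0; T 8 1 0 1; T 11 1 0 0]; [:: T 2 1 0 0; T
  8 1 1 0; T 9 (-1) 0 0; T 12 1 0 0; T 14 1 0 0]; [:: T 3 1 0 0; T 8 1 1 1; T 9 (-1) 0 1; T 12 1
  0 1; T 15 1 0 0]];
  [:: [:: T 2 1 0 0]; [:: T 3 1 0 0]; [:: T 0 1 0 0; T 4 1 0 0]; [:: T 1 1 0 0; T 5 1 0 0]];
  [:: [:: T 0 1 0 0]]].

Definition ht5 : seq smat := [::
  [::];
  [:: [::]; [::]; [:: T 0 (-1) 0 0]; [:: T 1 (-1) 0 0]; [::]; [:: T 4 (-1) 0 0]; [:: T 0 (-1) 0
  0]; [:: T 1 (-1) 0 0]; [:: T 2 (-1) 0 0]; [:: T 3 (-1) 0 0]; [:: T 4 (-1) 0 0]; [:: T 5 (-1) 0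
  0]];
  [:: [::]; [::]; [::]; [::]; [::]; [::]; [::]; [::]; [::]; [::]; [::]; [::]; [:: T 4 1 0 0]; [::
  T 5 1 0 0]; [::]; [:: T 8 1 0 0]; [::]; [::]; [::]; [::]; [:: T 4 1 0 0]; [:: T 5 1 0 0]; [:: T
  6 1 0 0]; [:: T 7 1 0 0]; [:: T 8 1 0 0]; [:: T 9 1 0 0]];
  [:: [::]; [::]; [::]; [::]; [::]; [::]; [::]; [::]; [::]; [::]; [::]; [::]; [:: T 0 (-1) 0 0];
  [:: T 1 (-1) 0 0]; [::]; [:: T 8 1 0 0]; [:: T 8 (-1) 0 0]; [:: T 8 1 0 1]; [:: T 0 (-1) 0 0];
  [:: T 1 (-1) 0 0]; [:: T 2 (-1) 0 0]; [:: T 3 (-1) 0 0]; [:: T 8 1 0 0]; [:: T 8 1 1 0; T 9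
  (-1) 0 0; T 12 1 0 0]; [:: T 8 1 0 1; T 9 1 0 0; T 12 (-1) 0 0]; [:: T 8 1 1 1; T 9 (-1) 0 1; T
  12 1 0 1]];
  [:: [::]; [::]; [::]; [::]; [::]; [::]; [::]; [::]; [::]; [:: T 0 1 0 0]; [::]; [::]; [:: T 0 1
  0 0]; [:: T 1 1 0 0]]].

Definition ob6 : seq lbim := [seq lsum b | b <- [::
  [:: lshift 3 lBsts];
  [:: lshift 1 lBsts; lshift 1 lBsts];
  [:: lshift (-1) lBs; lshift (-1) lBsts; lshift (-1) lBt; lshift (-1) lBsts];
  [:: lshift (-2) lBts; lshift (-2) lBst; lshift (-3) lBsts];
  [:: lshift (-4) lBts; lshift (-4) lBst];
  [:: lshift (-5) lBs; lshift (-5) lBt];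
  [:: lshift (-6) lR]]].

Definition df6 : seq smat := [::
  [::];
  [:: [:: T 0 1 0 1; T 0 1 1 0; T 1 (-1) 0 0]; [:: T 1 1 0 1; T 4 (-1) 0 0]; [:: T 2 1 0 1; T 2 1
  1 0; T 3 (-1) 0 0; T 4 (-1) 0 0]; [:: T 3 1 0 1; T 5 (-1) 0 0]; [::]; [::]; [:: T 0 1 0 1; T 0
  1 1 0; T 2 (-1) 0 0]; [:: T 1 1 0 1; T 1 1 1 0; T 3 (-1) 0 0; T 4 (-1) 0 0]; [:: T 2 1 1 0; T 3
  (-1) 0 0]; [::]; [:: T 4 1 1 0; T 5 (-1) 0 0]];
  [:: [:: T 4 (-1) 0 0]; [:: T 5 (-1) 0 0]; [:: T 0 1 1 0; T 1 (-1) 0 0; T 6 (-1) 1 0; T 7 1 0 0;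
  T 8 (-1) 0 0]; [:: T 4 (-1) 0 0; T 9 (-1) 0 0]; [:: T 2 1 1 0; T 3 (-1) 0 0; T 4 (-1) 0 0; T 8
  (-1) 0 1; T 8 (-1) 1 0; T 10 1 0 0]; [:: T 5 (-1) 0 0; T 9 (-1) 0 1; T 9 (-1) 1 0; T 11 1 0 0];
  [:: T 4 (-1) 0 1; T 11 (-1) 0 0]; [:: T 5 (-1) 0 1; T 11 (-1) 1 0]; [:: T 9 (-1) 0 0]; [:: T 11
  (-1) 0 0]; [:: T 0 1 0 1; T 0 1 1 0; T 2 (-1) 0 0; T 6 (-1) 0 1; T 6 (-1) 1 0; T 7 1 0 0]; [::
  T 1 1 0 1; T 1 1 1 0; T 3 (-1) 0 0; T 4 (-1) 0 0; T 7 (-1) 0 1; T 10 1 0 0]; [:: T 2 1 1 0; T 3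
  (-1) 0 0; T 8 (-1) 0 1; T 8 (-1) 1 0; T 9 1 0 0; T 10 1 0 0]; [:: T 9 (-1) 0 1; T 11 1 0 0];
  [:: T 4 1 1 0; T 5 (-1) 0 0]];
  [:: [:: T 0 (-1) 0 0; T 3 1 0 0; T 8 (-1) 0 0]; [:: T 0 (-1) 0 1; T 6 1 0 0; T 9 (-1) 0 0]; [::
  T 1 (-1) 0 0; T 5 1 0 0; T 8 (-1) 0 1; T 8 (-1) 1 0; T 9 1 0 0]; [:: T 1 (-1) 0 1; T 7 1 0 0; T
  9 (-1) 1 0]; [:: T 0 1 0 0; T 4 (-1) 0 0; T 8 1 0 0; T 12 1 0 0]; [:: T 1 1 0 0; T 5 (-1) 0 0;
  T 8 1 1 0; T 13 1 0 0]; [:: T 0 1 0 1; T 0 1 1 0; T 1 (-1) 0 0; T 6 (-1) 0 0; T 9 1 0 0; T 14 1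
  0 0]; [:: T 1 1 0 1; T 7 (-1) 0 0; T 9 1 1 0; T 15 1 0 0]; [:: T 0 1 0 0; T 2 (-1) 0 1; T 2
  (-1) 1 0; T 8 1 0 0; T 10 1 1 0; T 11 (-1) 0 0; T 12 1 0 0]; [:: T 0 1 0 1; T 0 1 1 0; T 3 (-1)
  0 1; T 3 (-1) 1 0; T 8 1 1 0; T 9 1 0 0; T 13 1 0 0]; [:: T 0 1 0 1; T 1 1 0 0; T 4 (-1) 0 1; T
  4 (-1) 1 0; T 8 1 0 1; T 8 1 1 0; T 12 1 0 1; T 12 1 1 0; T 14 (-1) 0 0]; [:: T 1 1 0 1; T 1 1
  1 0; T 5 (-1) 0 1; T 5 (-1) 1 0; T 8 1 1 1; T 8 1 2 0; T 13 1 0 1; T 13 1 1 0; T 15 (-1) 0 0];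
  [:: T 0 1 0 2; T 0 1 1 1; T 6 (-1) 0 1; T 6 (-1) 1 0; T 9 1 0 1; T 9 1 1 0; T 15 1 0 0]; [:: T
  1 1 0 2; T 1 1 1 1; T 7 (-1) 0 1; T 7 (-1) 1 0; T 9 1 1 1; T 9 1 2 0; T 15 1 1 0]];
  [:: [:: T 0 (-1) 0 1; T 0 (-1) 1 0; T 2 1 0 0; T 5 1 0 0; T 9 (-1) 0 0]; [:: T 1 (-1) 0 1; T 1
  (-1) 1 0; T 3 1 0 0; T 7 1 0 0; T 12 (-1) 0 0]; [:: T 3 (-1) 0 0; T 5 1 0 1; T 5 1 1 0; T 7
  (-1) 0 0; T 11 (-1) 0 0]; [:: T 3 (-1) 0 1; T 7 1 1 0; T 13 (-1) 0 0]; [:: T 1 (-1) 0 0; T 4 1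
  0 1; T 4 1 1 0; T 6 (-1) 0 0; T 10 (-1) 0 0]; [:: T 3 (-1) 0 0; T 5 1 0 1; T 5 1 1 0; T 7 (-1)
  0 0; T 11 (-1) 0 0]; [:: T 1 (-1) 0 1; T 1 (-1) 1 0; T 3 1 0 0; T 7 1 0 0; T 12 (-1) 0 0]; [::
  T 3 (-1) 0 1; T 7 1 1 0; T 13 (-1) 0 0]];
  [:: [:: T 1 (-1) 0 0; T 6 1 0 0]; [:: T 3 (-1) 0 0; T 7 1 0 0]; [:: T 2 (-1) 0 0; T 5 1 0 0];
  [:: T 3 (-1) 0 0; T 7 1 0 0]];
  [:: [:: T 1 1 0 0; T 3 (-1) 0 0]]].

Definition pr6 : seq smat := [::
  [:: [:: T 0 1 0 0]; [:: T 0 1 1 0; T 1 (-1) 0 0; T 2 1 0 0]; [:: T 2 1 0 0]; [:: T 3 1 0 0];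
  [:: T 2 1 0 1; T 2 1 1 0; T 3 (-1) 0 0; T 4 (-1) 0 0]; [:: T 3 1 0 1; T 5 (-1) 0 0]];
  [:: [::]; [::]; [::]; [::]; [::]; [::]; [:: T 0 1 0 0]; [:: T 0 1 1 0; T 1 (-1) 0 0; T 2 1 0
  0]; [:: T 2 1 0 0]; [:: T 3 1 0 0]; [:: T 2 1 0 1; T 2 1 1 0; T 3 (-1) 0 0; T 4 (-1) 0 0]; [::
  T 3 1 0 1; T 5 (-1) 0 0]; [:: T 2 1 0 0]; [:: T 3 1 0 0]; [:: T 6 1 0 0]; [:: T 6 1 1 0; T 7
  (-1) 0 0; T 8 1 0 0]; [:: T 8 1 0 0]; [:: T 9 1 0 0]; [:: T 8 1 0 1; T 8 1 1 0; T 9 (-1) 0 0; T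
  10 (-1) 0 0]; [:: T 9 1 0 1; T 11 (-1) 0 0]; [::]; [::]; [::]; [::]; [::]; [::]; [:: T 4 1 0
  0]; [:: T 5 1 0 0]];
  [:: [::]; [::]; [::]; [::]; [::]; [::]; [:: T 0 1 0 0]; [:: T 1 1 0 0]; [::]; [::]; [::]; [::];
  [::]; [::]; [::]; [::]; [:: T 0 (-1) 0 0]; [:: T 1 (-1) 0 0]; [:: T 2 1 0 0]; [:: T 4 1 0 0; T
  8 (-1) 0 0]; [:: T 8 1 0 0]; [:: T 5 1 0 0; T 8 (-1) 1 0]; [:: T 10 1 0 0]; [:: T 0 1 0 0; T 10
  1 1 0; T 11 (-1) 0 0; T 12 1 0 0]; [:: T 12 1 0 0]; [:: T 13 1 0 0]; [:: T 0 1 0 1; T 1 1 0 0;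
  T 12 1 0 1; T 12 1 1 0; T 13 (-1) 0 0; T 14 (-1) 0 0]; [:: T 1 1 0 1; T 1 1 1 0; T 13 1 0 1; T
  15 (-1) 0 0]; [:: T 0 (-1) 0 0]; [:: T 1 (-1) 0 0]; [:: T 0 (-1) 0 1; T 0 (-1) 1 0; T 1 1 0 0];
  [:: T 1 (-1) 0 1]; [:: T 3 1 0 0; T 8 (-1) 0 0]; [:: T 6 1 0 0; T 9 (-1) 0 0]; [:: T 5 1 0 0; T
  8 (-1) 0 1; T 8 (-1) 1 0; T 9 1 0 0]; [:: T 7 1 0 0; T 9 (-1) 1 0]; [:: T 0 1 0 0]; [:: T 0 1 0
  1; T 0 1 1 0]; [:: T 0 1 0 1; T 1 1 0 0]; [:: T 1 1 0 1; T 1 1 1 0]; [:: T 0 1 0 2; T 0 1 1 1];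
  [:: T 1 1 0 2; T 1 1 1 1]];
  [:: [::]; [::]; [::]; [::]; [:: T 0 1 0 0]; [:: T 1 1 0 0]; [:: T 2 1 0 0]; [:: T 3 1 0 0];
  [::]; [::]; [::]; [::]; [::]; [::]; [:: T 4 1 0 0]; [:: T 5 1 0 0]; [:: T 1 (-1) 0 0; T 4 1 0
  1; T 4 1 1 0; T 5 (-1) 0 0; T 6 (-1) 0 0]; [:: T 3 (-1) 0 0; T 5 1 0 1; T 7 (-1) 0 0]; [:: T 8
  1 0 0]; [:: T 5 (-1) 0 0; T 10 1 0 0]; [:: T 5 1 0 0]; [:: T 5 (-1) 1 0; T 11 1 0 0]; [:: T 1
  (-1) 0 0]; [:: T 3 (-1) 0 0]; [:: T 1 (-1) 0 1; T 1 (-1) 1 0; T 3 1 0 0]; [:: T 3 (-1) 0 1];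
  [:: T 5 (-1) 0 0; T 9 1 0 0]; [:: T 7 (-1) 0 0; T 12 1 0 0]; [:: T 5 (-1) 0 1; T 5 (-1) 1 0; T
  7 1 0 0; T 11 1 0 0]; [:: T 7 (-1) 1 0; T 13 1 0 0]];
  [:: [::]; [::]; [::]; [::]; [:: T 0 1 0 0]; [:: T 1 1 0 0]; [:: T 2 1 0 0]; [:: T 3 1 0 0];
  [::]; [:: T 2 1 0 0]; [:: T 4 1 0 0]; [:: T 5 1 0 0]; [:: T 2 1 0 0]; [:: T 3 1 0 0]; [:: T 6 1
  0 0]; [:: T 7 1 0 0]];
  [:: [::]; [::]; [:: T 0 1 0 0]; [:: T 1 1 0 0]; [:: T 2 1 0 0]; [:: T 3 1 0 0]];
  [:: [:: T 0 1 0 0]]].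

Definition in6 : seq smat := [::
  [:: [:: T 0 1 0 0]; [:: T 0 1 1 0; T 1 (-1) 0 0; T 2 1 0 0; T 6 1 0 0]; [:: T 2 1 0 0]; [:: T 3
  1 0 0]; [:: T 2 1 0 1; T 2 1 1 0; T 3 (-1) 0 0; T 4 (-1) 0 0; T 8 1 0 0]; [:: T 3 1 0 1; T 5
  (-1) 0 0; T 9 1 0 0]];
  [:: [:: T 0 (-1) 0 0; T 6 1 0 0]; [:: T 1 (-1) 0 0; T 6 1 1 0; T 7 (-1) 0 0; T 8 1 0 0; T 20 1
  0 0]; [:: T 2 (-1) 0 0; T 8 1 0 0]; [:: T 3 (-1) 0 0; T 9 1 0 0]; [:: T 4 (-1) 0 0; T 8 1 0 1;
  T 8 1 1 0; T 9 (-1) 0 0; T 10 (-1) 0 0; T 22 1 0 0]; [:: T 5 (-1) 0 0; T 9 1 0 1; T 11 (-1) 0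
  0; T 23 1 0 0]; [:: T 14 1 0 0]; [:: T 14 1 1 0; T 15 (-1) 0 0; T 16 1 0 0; T 28 1 0 0]; [:: T
  16 1 0 0]; [:: T 17 1 0 0]; [:: T 16 1 0 1; T 16 1 1 0; T 17 (-1) 0 0; T 18 (-1) 0 0; T 30 1 0
  0]; [:: T 17 1 0 1; T 19 (-1) 0 0; T 31 1 0 0]];
  [:: [:: T 6 1 0 0; T 14 1 0 1; T 14 1 1 0; T 15 (-1) 0 0; T 16 (-1) 0 0; T 28 1 0 0]; [:: T 7 1
  0 0; T 15 1 0 1; T 17 (-1) 0 0; T 29 1 0 0]; [:: T 0 1 0 0; T 8 (-1) 0 0; T 14 1 0 0; T 18 1 0
  0]; [:: T 1 1 0 0; T 9 (-1) 0 0; T 14 1 0 1; T 14 1 1 0; T 16 (-1) 0 0; T 20 1 0 0; T 28 1 0 0;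
  T 32 1 0 0]; [:: T 2 1 0 0; T 10 (-1) 0 0; T 14 1 0 1; T 15 1 0 0; T 19 1 0 0; T 20 1 0 0]; [::
  T 3 1 0 0; T 11 (-1) 0 0; T 15 1 0 1; T 15 1 1 0; T 20 1 1 0; T 21 1 0 0]; [:: T 4 1 0 0; T 12
  (-1) 0 0; T 14 1 0 2; T 14 1 1 1; T 16 (-1) 0 1; T 17 (-1) 0 0; T 20 1 0 1; T 21 (-1) 0 0; T 28
  1 0 1; T 29 1 0 0; T 33 1 0 0; T 34 1 0 0]; [:: T 5 1 0 0; T 13 (-1) 0 0; T 15 1 0 2; T 15 1 1
  1; T 17 (-1) 0 1; T 17 (-1) 1 0; T 20 1 1 1; T 21 (-1) 1 0; T 29 1 0 1; T 29 1 1 0; T 34 1 1 0;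
  T 35 1 0 0]; [:: T 15 1 0 0; T 20 1 0 0]; [:: T 15 1 0 1; T 17 (-1) 0 0; T 20 1 0 1; T 21 (-1)
  0 0; T 29 1 0 0; T 34 1 0 0]; [:: T 8 (-1) 0 0; T 14 1 0 0; T 22 1 0 0]; [:: T 9 (-1) 0 0; T 14
  1 0 1; T 14 1 1 0; T 16 (-1) 0 0; T 22 1 1 0; T 23 (-1) 0 0; T 24 1 0 0; T 28 1 0 0; T 36 1 0
  0]; [:: T 10 (-1) 0 0; T 14 1 0 1; T 15 1 0 0; T 24 1 0 0]; [:: T 11 (-1) 0 0; T 15 1 0 1; T 15
  1 1 0; T 25 1 0 0]; [:: T 12 (-1) 0 0; T 14 1 0 2; T 14 1 1 1; T 16 (-1) 0 1; T 17 (-1) 0 0; T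
  24 1 0 1; T 24 1 1 0; T 25 (-1) 0 0; T 26 (-1) 0 0; T 28 1 0 1; T 29 1 0 0; T 38 1 0 0]; [:: T
  13 (-1) 0 0; T 15 1 0 2; T 15 1 1 1; T 17 (-1) 0 1; T 17 (-1) 1 0; T 25 1 0 1; T 27 (-1) 0 0; T
  29 1 0 1; T 29 1 1 0; T 39 1 0 0]];
  [:: [:: T 4 1 0 0]; [:: T 5 1 0 0]; [:: T 6 1 0 0]; [:: T 7 1 0 0]; [:: T 0 1 0 0; T 14 1 0 0];
  [:: T 1 1 0 0; T 15 1 0 0]; [:: T 2 1 0 0; T 14 1 0 1; T 14 1 1 0; T 15 (-1) 0 0; T 16 (-1) 0
  0; T 22 1 0 0]; [:: T 3 1 0 0; T 15 1 0 1; T 17 (-1) 0 0; T 23 1 0 0]; [:: T 8 (-1) 0 0; T 18 1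
  0 0]; [:: T 9 (-1) 0 0; T 20 1 0 0; T 26 1 0 0]; [:: T 10 (-1) 0 0; T 19 1 0 0; T 20 1 0 0];
  [:: T 11 (-1) 0 0; T 20 1 1 0; T 21 1 0 0]; [:: T 12 (-1) 0 0; T 20 1 0 1; T 21 (-1) 0 0; T 27
  1 0 0; T 28 1 0 0]; [:: T 13 (-1) 0 0; T 20 1 1 1; T 21 (-1) 1 0; T 28 1 1 0; T 29 1 0 0]];
  [:: [:: T 4 1 0 0; T 8 1 0 0]; [:: T 5 1 0 0; T 8 1 0 1; T 9 (-1) 0 0; T 12 1 0 0]; [:: T 6 1 0
  0; T 8 1 1 0; T 9 1 0 0; T 12 (-1) 0 0]; [:: T 7 1 0 0; T 8 1 1 1; T 9 (-1) 1 0; T 12 1 1 0];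
  [:: T 0 1 0 0; T 8 1 0 0; T 10 1 0 0]; [:: T 1 1 0 0; T 8 1 1 0; T 11 1 0 0]; [:: T 2 1 0 0; T
  8 1 0 1; T 9 (-1) 0 0; T 12 1 0 0; T 14 1 0 0]; [:: T 3 1 0 0; T 8 1 1 1; T 9 (-1) 1 0; T 12 1
  1 0; T 15 1 0 0]];
  [:: [:: T 2 1 0 0]; [:: T 3 1 0 0]; [:: T 0 1 0 0; T 4 1 0 0]; [:: T 1 1 0 0; T 5 1 0 0]];
  [:: [:: T 0 1 0 0]]].

Definition ht6 : seq smat := [::
  [::];
  [:: [::]; [:: T 0 (-1) 0 0]; [::]; [::]; [:: T 2 (-1) 0 0]; [:: T 3 (-1) 0 0]; [:: T 0 (-1) 0
  0]; [:: T 1 (-1) 0 0]; [:: T 2 (-1) 0 0]; [:: T 3 (-1) 0 0]; [:: T 4 (-1) 0 0]; [:: T 5 (-1) 0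
  0]];
  [:: [::]; [::]; [::]; [::]; [::]; [::]; [::]; [:: T 0 1 0 0]; [::]; [::]; [:: T 2 1 0 0]; [:: T
  3 1 0 0]; [:: T 14 (-1) 0 0]; [:: T 15 (-1) 0 0]; [::]; [:: T 8 1 0 0]; [::]; [::]; [:: T 10 1
  0 0]; [:: T 11 1 0 0]; [:: T 0 1 0 0]; [:: T 1 1 0 0]; [:: T 2 1 0 0]; [:: T 3 1 0 0]; [:: T 4
  1 0 0]; [:: T 5 1 0 0]; [:: T 14 (-1) 0 1; T 14 (-1) 1 0; T 15 1 0 0; T 16 1 0 0; T 28 (-1) 0
  0]; [:: T 15 (-1) 0 1; T 17 1 0 0; T 29 (-1) 0 0]; [:: T 8 1 0 0]; [:: T 9 1 0 0]; [:: T 10 1 0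
  0]; [:: T 11 1 0 0]; [:: T 12 1 0 0]; [:: T 13 1 0 0]];
  [:: [::]; [::]; [::]; [::]; [::]; [::]; [::]; [::]; [::]; [::]; [::]; [::]; [::]; [::]; [::];
  [::]; [:: T 0 (-1) 0 0]; [:: T 1 (-1) 0 0]; [::]; [::]; [::]; [::]; [::]; [:: T 8 (-1) 0 0];
  [::]; [::]; [:: T 10 (-1) 0 0]; [:: T 11 (-1) 0 0]; [:: T 0 (-1) 0 0]; [:: T 1 (-1) 0 0]; [:: T
  2 (-1) 0 0]; [:: T 3 (-1) 0 0]; [::]; [::]; [::]; [::]; [:: T 8 (-1) 0 0]; [:: T 9 (-1) 0 0];
  [:: T 10 (-1) 0 0]; [:: T 11 (-1) 0 0]; [:: T 12 (-1) 0 0]; [:: T 13 (-1) 0 0]];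
  [:: [::]; [::]; [::]; [::]; [::]; [::]; [::]; [::]; [::]; [::]; [::]; [::]; [::]; [::]; [::];
  [::]; [:: T 0 1 0 0]; [:: T 1 1 0 0]; [::]; [:: T 8 (-1) 0 0]; [:: T 8 1 0 0]; [:: T 8 (-1) 1
  0]; [:: T 0 1 0 0]; [:: T 1 1 0 0]; [:: T 2 1 0 0]; [:: T 3 1 0 0]; [:: T 8 (-1) 0 0]; [:: T 8
  (-1) 0 1; T 9 1 0 0; T 12 (-1) 0 0]; [:: T 8 (-1) 1 0; T 9 (-1) 0 0; T 12 1 0 0]; [:: T 8 (-1)
  1 1; T 9 1 1 0; T 12 (-1) 1 0]];
  [:: [::]; [::]; [::]; [::]; [::]; [::]; [::]; [::]; [::]; [:: T 0 (-1) 0 0]; [::]; [::]; [:: T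
  0 (-1) 0 0]; [:: T 1 (-1) 0 0]]].

Definition cx0 := lcpx_list ob0 df0.
Definition cx1 := lcpx_list ob1 df1.
Definition cx2 := lcpx_list ob2 df2.
Definition cx3 := lcpx_list ob3 df3.
Definition cx4 := lcpx_list ob4 df4.
Definition cx5 := lcpx_list ob5 df5.
Definition cx6 := lcpx_list ob6 df6.

Ltac check_int := apply: check_int; [| | move=> q | move=> q]; vm_compute; reflexivity.

Lemma cx0_ok n : lcpx_ok cx0 n. Proof. by move: n; check_int. Qed.
Lemma cx1_ok n : lcpx_ok cx1 n. Proof. by move: n; check_int. Qed.
Lemma cx2_ok n : lcpx_ok cx2 n. Proof. by move: n; check_int. Qed.
Lemma cx3_ok n : lcpx_ok cx3 n. Proof. by move: n; check_int. Qed.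
Lemma cx4_ok n : lcpx_ok cx4 n. Proof. by move: n; check_int. Qed.
Lemma cx5_ok n : lcpx_ok cx5 n. Proof. by move: n; check_int. Qed.
Lemma cx6_ok n : lcpx_ok cx6 n. Proof. by move: n; check_int. Qed.

Definition stage_ok (i : 'I_2) (L E : lcpx) (p s h : seq smat) (n : int) : bool :=
  [&& lcpx_ok (ltt i L) n, ltt_ok i L n
    & lcert_ok (ltt i L) E (getz [::] p) (getz [::] s) (getz [::] h) n].

Lemma stage1 n : stage_ok 0 cx0 cx1 pr1 in1 ht1 n. Proof. by move: n; check_int. Qed.
Lemma stage2 n : stage_ok 1 cx1 cx2 pr2 in2 ht2 n. Proof. by move: n; check_int. Qed.
Lemma stage3 n : stage_ok 0 cx2 cx3 pr3 in3 ht3 n. Proof. by move: n; check_int. Qed.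
Lemma stage4 n : stage_ok 1 cx3 cx4 pr4 in4 ht4 n. Proof. by move: n; check_int. Qed.
Lemma stage5 n : stage_ok 0 cx4 cx5 pr5 in5 ht5 n. Proof. by move: n; check_int. Qed.
Lemma stage6 n : stage_ok 1 cx5 cx6 pr6 in6 ht6 n. Proof. by move: n; check_int. Qed.

(** * Homotopy equivalence of the Rouquier complex with the reduced complex *)

Section Rouquier.
Variable k : fieldType.
Hypothesis two_neq0 : 2%:R != 0 :> k.
Local Notation R := {mpoly k[2]}.

(** C is known only up to homotopy, and [tt_heq] is what allows it to be replaced by its reduced
    form L before the next factor is tensored on. *)
Lemma heq_stage (i : 'I_2) (C : cpx k) (L E : lcpx) (okL : forall n, lcpx_ok L n)
    (okE : forall n, lcpx_ok E n) p s h :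
  (forall n, stage_ok i L E p s h n) -> heq C (lcpx_cpx k okL) ->
  heq (tcpx C (rou_neg k i)) (lcpx_cpx k okE).
Proof.
move=> ok CL.
have okD n : lcpx_ok (ltt i L) n by case/and3P: (ok n).
apply: heq_trans (tcpx_rou_neg i C two_neq0) _.
apply: heq_trans (tt_heq i CL) _.
apply: heq_trans (heq_ltt k okL okD (i := i) _) _ => [n|]; first by case/and3P: (ok n).
apply: (@heq_lcert k _ _ okD okE (getz [::] p) (getz [::] s) (getz [::] h)) => n.
by case/and3P: (ok n).
Qed.

Local Notation M0 := (mbim_of k (lob_ok cx0_ok 0)).

Lemma meval_unit (p : R) : meval M0 p = p%:M.
Proof.
elim/mpoly_alg_ind: p => [c|j|p q hp hq|p q hp hq].
- by rewrite mevalC scalemx1.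
- rewrite mevalX; apply/matrixP => a b; rewrite !mxE [a]ord1 [b]ord1 eqxx mulr1n.
  case: j => -[|[|//]] hj; rewrite /rev /= big_mkcond big_seq1 /= /tev /=.
    by rewrite expr0 expr1 mulr1 mul1r; congr ('X__); apply: val_inj.
  by rewrite expr0 expr1 !mul1r; congr ('X__); apply: val_inj.
- by rewrite mevalD hp hq raddfD.
- by rewrite mevalM hp hq -scalar_mxM.
Qed.

Definition unit_row : ghom (breg k) (fb M0).
Proof.
refine (@Ghom k (breg k) (fb M0) (fun a : R => const_mx a) _ _ _ _).
- by move=> x y; apply/matrixP => a b; rewrite !mxE.
- by move=> a x; apply/matrixP => c d; rewrite !mxE.
- move=> x a; rewrite /= meval_unit; apply/matrixP => c d.
  by rewrite mul_mx_scalar !mxE mulrC.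
move=> d x hx j; rewrite mxE [j]ord1 /=.
by rewrite /zgen /= subr0.
Defined.

Lemma unit_rowK : cancel unit_row (fun v : 'rV[R]_1 => v 0 0).
Proof. by move=> a; rewrite /= mxE. Qed.

Lemma row_unitK : cancel (fun v : 'rV[R]_1 => v 0 0) unit_row.
Proof. by move=> v; apply/matrixP => i j; rewrite mxE !ord1. Qed.

(** The types of both terms depend on whether n is 0. The case distinction is made inside an
    existence statement, and the maps are chosen for all n afterwards. *)
Lemma unit_cx0_iso n : exists fg : ghom (cpx_unit k n) (fb (mbim_of k (lob_ok cx0_ok n)))
    * ghom (fb (mbim_of k (lob_ok cx0_ok n))) (cpx_unit k n),
  cancel fg.1 fg.2 /\ cancel fg.2 fg.1.
Proof.
have [->|n0] := eqVneq n 0.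
  have gdeg d x : @bdeg k (fb M0) d x -> @bdeg k (breg k) d ((x : 'rV[R]_1) 0 0).
    by move=> /(_ 0); rewrite /zgen /= subr0.
  exists (unit_row, ghom_inv unit_rowK row_unitK gdeg).
  by split; [exact: unit_rowK | exact: row_unitK].
exists (zero_hom _ _, zero_hom _ _); split => x /=.
  by move: x; rewrite /cpx_unit /= (negbTE n0) => x; rewrite [x]thinmx0.
have r0 : mrk (mbim_of k (lob_ok cx0_ok n)) = 0%N.
  by case: (n) n0 => [[|m]|[|m]] // _; exact: erefl.
move: x; rewrite /=; move: r0; rewrite /=; set r := lrk _ => r0.
by move: (r) r0 => _ -> x; rewrite [x]thinmx0.
Qed.

Lemma heq_unit : heq (cpx_unit k) (lcpx_cpx k cx0_ok).
Proof.
pose fg n := sval (cid (unit_cx0_iso n)); have fgK n := svalP (cid (unit_cx0_iso n)).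
apply: (@heq_iso k (cpx_unit k) (lcpx_cpx k cx0_ok) (fun n => (fg n).1) (fun n => (fg n).2)).
- move=> n x; rewrite ghom0; apply: esym; rewrite /= szero_mxs ?mulmx0 //.
  by case: (n) => [[|m]|[|m]]; exact: erefl.
- by move=> n; case: (fgK n).
- by move=> n; case: (fgK n).
Qed.

Lemma heq_rouquier :
  heq (rouquier_neg k (flatten (nseq 3 [:: 0; 1]))) (lcpx_cpx k cx6_ok).
Proof.
have h1 := @heq_stage 0 _ cx0 cx1 cx0_ok cx1_ok pr1 in1 ht1 stage1 heq_unit.
have h2 := @heq_stage 1 _ cx1 cx2 cx1_ok cx2_ok pr2 in2 ht2 stage2 h1.
have h3 := @heq_stage 0 _ cx2 cx3 cx2_ok cx3_ok pr3 in3 ht3 stage3 h2.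
have h4 := @heq_stage 1 _ cx3 cx4 cx3_ok cx4_ok pr4 in4 ht4 stage4 h3.
have h5 := @heq_stage 0 _ cx4 cx5 cx4_ok cx5_ok pr5 in5 ht5 stage5 h4.
have h6 := @heq_stage 1 _ cx5 cx6 cx5_ok cx6_ok pr6 in6 ht6 stage6 h5.
exact: h6.
Qed.

End Rouquier.

(** * The Koszul resolution of R *)

Section PolyGrading.
Variables (A : nzRingType) (h : int -> A -> Prop) (H : is_grading h).

Definition poly_deg (d : int) (p : {poly A}) : Prop := forall i, h (d - i.*2%:Z) p`_i.

Lemma poly_deg0 d : poly_deg d 0.
Proof. by move=> i; rewrite coef0; exact: (gr0 H). Qed.

Lemma poly_degB d p q : poly_deg d p -> poly_deg d q -> poly_deg d (p - q).
Proof. by move=> hp hq i; rewrite coefB; apply: (grB H). Qed.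

Lemma poly_degC d a : h d a -> poly_deg d a%:P.
Proof.
by move=> ha i; rewrite coefC; case: eqP => [->|_]; [rewrite subr0 | exact: (gr0 H)].
Qed.

Lemma poly_grading : is_grading poly_deg.
Proof.
split=> [d|d p q|s f us hf E i si|p]; [exact: poly_deg0 | exact: poly_degB | |].
- apply/polyP => j; rewrite coef0.
  have inj : injective (fun d : int => d - j.*2%:Z) by exact: addIr.
  have us' : uniq (map (fun d : int => d - j.*2%:Z) s) by rewrite map_inj_uniq.
  have hf' d : h d (f (d + j.*2%:Z))`_j by have := hf (d + j.*2%:Z) j; rewrite addrK.
  have := gr_indep H us' hf' _ (map_f _ si); rewrite subrK; apply.
  rewrite big_map; under eq_bigr do rewrite subrK.
  by have := congr1 (fun u : {poly A} => u`_j) E; rewrite coef0 coef_sum.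
rewrite -[p]coefK poly_def; apply: (homog_span_sum poly_deg0 poly_degB) => j.
have [s [f [us hf ->]]] := gr_span H p`_j.
rewrite scaler_suml; apply: (homog_span_sum poly_deg0 poly_degB) => d.
apply: (homog_span1 poly_deg0 (d := d + j.*2%:Z)) => l; rewrite coefZ coefXn.
case: eqP => [->|_]; last by rewrite mulr0; exact: (gr0 H).
by rewrite mulr1 addrK.
Qed.

Hypothesis hM : forall d e a b, h d a -> h e b -> h (d + e) (a * b).

Lemma poly_degM d e p q : poly_deg d p -> poly_deg e q -> poly_deg (d + e) (p * q).
Proof.
move=> hp hq i; rewrite coefM; elim/big_ind: _ => [|x y hx hy|j _].
- exact: (gr0 H).
- exact: (homog_add (gr0 H) (grB H)).
have -> : d + e - i.*2%:Z = (d - j.*2%:Z) + (e - (i - j).*2%:Z).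
  by have := ltn_ord j; lia.
exact: hM.
Qed.

Lemma poly_degX : h 0 1 -> poly_deg 2 'X.
Proof.
by move=> h1 i; rewrite coefX; case: eqP => [->|_] //; exact: (gr0 H).
Qed.

End PolyGrading.

Section PolyAction.
Variables (A : nzRingType) (M : zmodType) (act : A -> M -> M) (D : M -> M).
Hypothesis actDl : forall a b x, act (a + b) x = act a x + act b x.
Hypothesis actDr : forall a x y, act a (x + y) = act a x + act a y.
Hypothesis DD : forall x y, D (x + y) = D x + D y.
Hypothesis actC : forall a x, act a (D x) = D (act a x).

(** The variable acts by D. Used twice, with the commuting operators x |-> x alpha - alpha x for the
    two roots, this yields the action of R (x)_k R on a bimodule. *)
Definition pact (p : {poly A}) (x : M) : M := \sum_(i < size p) act p`_i (iter i D x).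

Let act0 x : act 0 x = 0.
Proof. by apply: (addrI (act 0 x)); rewrite -actDl !addr0. Qed.
Let actr0 a : act a 0 = 0.
Proof. by apply: (addrI (act a 0)); rewrite -actDr !addr0. Qed.
Let D0 : D 0 = 0.
Proof. by apply: (addrI (D 0)); rewrite -DD !addr0. Qed.

Lemma pactE n (p : {poly A}) x : (size p <= n)%N -> pact p x = \sum_(i < n) act p`_i (iter i D x).
Proof.
move=> sp; rewrite /pact (big_ord_widen n (fun i => act p`_i (iter i D x)) sp) big_mkcond.
by apply: eq_bigr => i _; case: ltnP => // hi; rewrite nth_default.
Qed.

Lemma pactDl (p q : {poly A}) x : pact (p + q) x = pact p x + pact q x.
Proof.
rewrite (pactE _ (size_polyD p q)) (pactE _ (leq_maxl (size p) (size q))).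
rewrite (pactE _ (leq_maxr (size p) (size q))).
by rewrite -big_split; apply: eq_bigr => i _; rewrite coefD actDl.
Qed.

Lemma pactDr p x y : pact p (x + y) = pact p x + pact p y.
Proof.
rewrite /pact -big_split; apply: eq_bigr => i _ /=; rewrite -actDr; congr act.
by elim: (i : nat) => //= j ->.
Qed.

Lemma pactC a x : pact a%:P x = act a x.
Proof. by rewrite (@pactE 1) ?size_polyC_leq1 // big_ord1 coefC. Qed.

Lemma pactMX p x : pact (p * 'X) x = pact p (D x).
Proof.
rewrite (@pactE (size p).+1) ?(leq_trans (size_polyMleq _ _)) ?size_polyX ?addn2 //.
rewrite big_ord_recl coefMX act0 add0r; apply: eq_bigr => i _.
by rewrite coefMX lift0 iterSr.
Qed.

Lemma pactD_D p x : pact p (D x) = D (pact p x).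
Proof.
rewrite /pact (big_morph D DD D0); apply: eq_bigr => i _.
by rewrite -actC -iterS iterSr.
Qed.

Hypothesis actM : forall a b x, act (a * b) x = act a (act b x).

Lemma pactZ a p x : pact (a%:P * p) x = act a (pact p x).
Proof.
rewrite (@pactE (size p)); last by rewrite mul_polyC size_scale_leq.
rewrite /pact (big_morph (act a) (actDr a) (actr0 a)).
by apply: eq_bigr => i _; rewrite coefCM actM.
Qed.

Lemma pact_D' D' p x : (forall x y, D' (x + y) = D' x + D' y) ->
  (forall a x, act a (D' x) = D' (act a x)) -> (forall x, D (D' x) = D' (D x)) ->
  pact p (D' x) = D' (pact p x).
Proof.
move=> DD' actD' DC.
have D'0 : D' 0 = 0 by apply: (addrI (D' 0)); rewrite -DD' !addr0.
rewrite /pact (big_morph D' DD' D'0); apply: eq_bigr => i _; rewrite -actD'; congr act.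
by elim: (i : nat) => //= j ->.
Qed.

Lemma pactM (p q : {poly A}) x : (forall a b : A, a * b = b * a) -> pact (p * q) x = pact p (pact q x).
Proof.
move=> AC; elim/poly_ind: p x => [|p a IH] x.
  by rewrite mul0r /pact size_poly0 !big_ord0.
by rewrite mulrDl -mulrA -(commr_polyX q) mulrA !pactDl !pactMX pactZ pactC IH pactD_D.
Qed.

Lemma pact_deg h g d e p x : is_grading h -> is_grading g ->
  (forall d e a x, h d a -> g e x -> g (d + e) (act a x)) ->
  (forall d x, g d x -> g (d + 2) (D x)) ->
  poly_deg h d p -> g e x -> g (d + e) (pact p x).
Proof.
move=> H G ha hD hp hx; rewrite /pact; elim/big_ind: _ => [|y z hy hz|i _].
- exact: (gr0 G).
- exact: (homog_add (gr0 G) (grB G)).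
have -> : d + e = (d - i.*2%:Z) + (e + i.*2%:Z) by lia.
apply: (ha) => //; elim: (i : nat) => [|j IH]; first by rewrite addr0.
have -> : e + j.+1.*2%:Z = e + j.*2%:Z + 2 by lia.
exact: hD.
Qed.

End PolyAction.

(** * The Koszul complex over R (x)_k R *)

Section Koszul.
Variable k : fieldType.
Local Notation R := {mpoly k[2]}.
Local Notation S := {poly {poly R}}.

(* R (x)_k R as the polynomial ring over the left copy of R in the variables
   [zvar j] = 1 (x) 'X_j - 'X_j (x) 1. *)
Definition zvar (j : 'I_2) : S := if j == 0 then 'X%:P else 'X.

Definition lem (a : R) : S := a%:P%:P.

Lemma lemM a b : lem (a * b) = lem a * lem b.
Proof. by rewrite /lem (polyCM a b) (polyCM a%:P b%:P). Qed.
Lemma lemD a b : lem (a + b) = lem a + lem b.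
Proof. by rewrite /lem (polyCD a b) (polyCD a%:P b%:P). Qed.
Lemma lem1 : lem 1 = 1. Proof. by []. Qed.

(** The right copy of R inside S: 1 (x) alpha_j is alpha_j (x) 1 plus the j-th variable. *)
Definition rem (a : R) : S :=
  mmap (polyC \o polyC \o @mpolyC 2 k) (fun j => ('X_j)%:P%:P + zvar j) a.

Lemma remC c : rem c%:MP = lem c%:MP.
Proof. by rewrite /rem mmapC. Qed.

Lemma remX j : rem 'X_j = lem 'X_j + zvar j.
Proof. by rewrite /rem mmapX mmap1U. Qed.

Lemma remD a b : rem (a + b) = rem a + rem b.
Proof. exact: raddfD. Qed.

Lemma remM a b : rem (a * b) = rem a * rem b.
Proof. exact: rmorphM. Qed.

Definition sgdeg : int -> S -> Prop := poly_deg (poly_deg (@pdeg k)).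

Lemma sgdeg_grading : is_grading sgdeg.
Proof. exact: (poly_grading (poly_grading (pdeg_grading k))). Qed.

Lemma sgdegM d e p q : sgdeg d p -> sgdeg e q -> sgdeg (d + e) (p * q).
Proof.
apply: (poly_degM (poly_grading (pdeg_grading k))) => {}d {}e a b.
by apply: (poly_degM (pdeg_grading k)); exact: pdegM.
Qed.

Lemma sgdegC d a : pdeg d a -> sgdeg d (lem a).
Proof.
move=> ha; apply: (poly_degC (poly_grading (pdeg_grading k))).
exact: (poly_degC (pdeg_grading k)).
Qed.

Lemma pdeg1 : pdeg 0 (1 : R).
Proof. by rewrite -mpolyC1; exact: pdegC. Qed.

Lemma sgdeg_zvar j : sgdeg 2 (zvar j).
Proof.
rewrite /zvar; case: ifP => _.
  apply: (poly_degC (poly_grading (pdeg_grading k))).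
  by apply: (poly_degX (pdeg_grading k)); exact: pdeg1.
apply: (poly_degX (poly_grading (pdeg_grading k))).
by apply: (poly_degC (pdeg_grading k)); exact: pdeg1.
Qed.

Lemma sgdeg_rem d a : pdeg d a -> sgdeg d (rem a).
Proof.
move=> ha; have G := sgdeg_grading; have add := homog_add (gr0 G) (grB G).
have dX j c : sgdeg (2 * c)%N (rem 'X_j ^+ c).
  elim: c => [|c IH]; first by rewrite expr0 -lem1; apply: sgdegC; exact: pdeg1.
  rewrite exprS mulnS PoszD; apply: sgdegM => //; rewrite remX; apply: (add).
    by apply: sgdegC; exact: pdegX.
  exact: sgdeg_zvar.
rewrite [a]mpolyE /rem raddf_sum /= -/(rem _) big_seq.
elim/big_ind: _ => [|x y|m hm]; [exact: (gr0 G) | exact: add |].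
rewrite -/(rem _) -mul_mpolyC remM remC -[d]add0r; apply: sgdegM.
  by apply: sgdegC; exact: pdegC.
rewrite mpolyXE_id /rem rmorph_prod /= -(ha _ hm) mdegE big_ord_recl big_ord1 mulnDr PoszD.
rewrite big_ord_recl big_ord1 !rmorphXn -!/(rem _) /=.
by apply: sgdegM; exact: dX.
Qed.

Definition krk (n : nat) : nat := nth 0%N [:: 1; 2; 1]%N n.

(** With matrices acting on row vectors, the complex is S -> S^2 -> S, given by the row (z_1, - z_0)
    followed by the column (z_0, z_1). *)
Definition kos (n : nat) (i j : nat) : S :=
  match n with
  | 0 => if i is 0 then zvar 0 else zvar 1
  | 1 => if j is 0 then zvar 1 else - zvar 0
  | _ => 0
  end.

Definition kosmx n : 'M[S]_(krk n.+1, krk n) := \matrix_(i, j) kos n i j.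

Lemma kosmxK n : kosmx n.+1 *m kosmx n = 0.
Proof.
apply/matrixP => i j; rewrite !mxE.
case: n i j => [|n] i j; last by rewrite big1 // => l _; rewrite !mxE mul0r.
by rewrite big_ord_recl big_ord1 !mxE /= mulNr [zvar 1 * _]mulrC subrr.
Qed.

Lemma sgdeg_kos n i j : sgdeg 2 (kos n i j).
Proof.
have G := sgdeg_grading; case: n => [|[|n]] /=; last exact: (gr0 G).
  by case: i => [|i]; exact: sgdeg_zvar.
by case: j => [|j]; [|apply: (homog_opp (gr0 G) (grB G))]; exact: sgdeg_zvar.
Qed.

(** The generators of the n-th term lie in degree 2n, which makes the differential homogeneous of
    degree 0. *)
Definition kobj (n : nat) : grbimod k.
Proof.
refine (@Grbimod k 'rV[S]_(krk n) (fun a v => lem a *: v) (fun v a => rem a *: v)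
  _ _ _ _ _ _ _ _ _ _ (row_deg sgdeg (fun=> n.*2%:Z))
  (row_grading sgdeg_grading (fun=> n.*2%:Z)) _ _).
- by move=> a b x; rewrite lemM -scalerA.
- by move=> x; rewrite lem1 scale1r.
- by move=> a x y; exact: scalerDr.
- by move=> a b x; rewrite lemD -scalerDl.
- by move=> x a b; rewrite [a * b]mulrC remM -scalerA.
- by move=> x; rewrite -mpolyC1 remC mpolyC1 lem1 scale1r.
- by move=> x y a; exact: scalerDr.
- by move=> x a b; rewrite remD -scalerDl.
- by move=> a x b; rewrite (scalerA (rem b)) (scalerA (lem a)) [rem b * _]mulrC.
- by move=> c x; rewrite remC.
- by move=> e d a x ha hx j; rewrite mxE -addrA; apply: sgdegM; [exact: sgdegC | exact: hx].
by move=> e d a x ha hx j; rewrite mxE -addrA; apply: sgdegM; [exact: sgdeg_rem | exact: hx].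
Defined.

Definition kdiff n : ghom (kobj n.+1) (kobj n).
Proof.
refine (@Ghom k (kobj n.+1) (kobj n) (fun v : 'rV[S]__ => v *m kosmx n) _ _ _ _).
- by move=> x y; rewrite mulmxBl.
- by move=> a x; rewrite /= scalemxAl.
- by move=> x a; rewrite /= scalemxAl.
move=> d x hx j; rewrite mxE; have G := sgdeg_grading.
elim/big_ind: _ => [|y z|i _]; [exact: (gr0 G) | exact: (homog_add (gr0 G) (grB G)) |].
have -> : d - n.*2%:Z = (d - n.+1.*2%:Z) + 2 by lia.
by rewrite mxE; apply: sgdegM; [exact: hx | exact: sgdeg_kos].
Defined.

(** Setting both variables to 0 is the multiplication map R (x)_k R -> R. *)
Definition kau (p : S) : R := (p.[0]).[0].

Lemma kauB p q : kau (p - q) = kau p - kau q.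
Proof. by rewrite /kau (hornerD p) (hornerN q) (hornerD p.[0]) (hornerN q.[0]). Qed.
Lemma kauD p q : kau (p + q) = kau p + kau q.
Proof. by rewrite /kau (hornerD p) (hornerD p.[0]). Qed.
Lemma kauM p q : kau (p * q) = kau p * kau q.
Proof. by rewrite /kau (hornerM p) (hornerM p.[0]). Qed.
Lemma kau_lem a : kau (lem a) = a.
Proof. by rewrite /kau /lem (hornerC a%:P) hornerC. Qed.
Lemma kau_zvar j : kau (zvar j) = 0.
Proof. by rewrite /kau /zvar; case: ifP => _; rewrite ?hornerC hornerX // horner0. Qed.

Lemma kau_rem (a : R) : kau (rem a) = a.
Proof.
elim/mpoly_alg_ind: a => [c|j|p q hp hq|p q hp hq].
- by rewrite remC kau_lem.
- by rewrite remX kauD kau_lem kau_zvar addr0.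
- by rewrite remD kauD; congr (_ + _).
- by rewrite remM kauM; congr (_ * _).
Qed.

Definition kaug : ghom (kobj 0) (breg k).
Proof.
refine (@Ghom k (kobj 0) (breg k) (fun v : 'rV[S]_1 => kau (v 0 0)) _ _ _ _).
- by move=> x y; rewrite mxE [X in kau (_ + X)]mxE kauB.
- by move=> a x; rewrite mxE kauM kau_lem.
- by move=> x a; rewrite mxE kauM kau_rem mulrC.
move=> d x hx; have := hx 0 0%N 0%N.
by rewrite !subr0 /kau !horner_coef0.
Defined.

Lemma kaug_surj r : exists p, kaug p = r.
Proof. by exists (const_mx (lem r) : 'rV[S]_1); rewrite /= mxE kau_lem. Qed.

Lemma zvar0E : zvar 0 = 'X%:P. Proof. by []. Qed.
Lemma zvar1E : zvar 1 = 'X. Proof. by []. Qed.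

Lemma root0_mulX (A : comNzRingType) (p : {poly A}) : p.[0] = 0 -> exists q, p = q * 'X.
Proof.
move=> p0; have /factor_theorem[q ->] : root p 0 by apply/rootP.
by exists q; rewrite polyC0 subr0.
Qed.

(** If p vanishes at z_0 = z_1 = 0, its value at z_1 = 0 is divisible by z_0, and the difference of
    p and that value is divisible by z_1. *)
Lemma kexact0 p : kaug p = 0 <-> exists q, p = kdiff 0 q.
Proof.
split=> [|[q ->]]; last first.
  rewrite /= mxE big_ord_recl big_ord1 kauD !kauM [X in _ * kau X + _]mxE [X in _ + _ * kau X]mxE.
  by rewrite /= !kau_zvar !mulr0 addr0.
rewrite /= /kau => /root0_mulX[q0 E0].
have /root0_mulX[q1 E1] : ((p : 'rV[S]_1) 0 0 - ((p : 'rV[S]_1) 0 0).[0]%:P).[0] = 0.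
  by rewrite !hornerE subrr.
exists (\row_j (if j == 0 :> 'I_2 then q0%:P else q1)).
apply/rowP => j; rewrite [j]ord1 mxE big_ord_recl big_ord1 !mxE /= zvar0E zvar1E.
by rewrite -polyCM -E0 -E1 addrC subrK.
Qed.

(** At 'X = 0 the relation becomes p0(0) a = 0, so 'X divides p0; cancelling 'X then determines p1.
    This is exactness of the Koszul complex on a and 'X. *)
Lemma syzygyX (A : idomainType) (a : A) (p0 p1 : {poly A}) : a != 0 ->
  p0 * a%:P + p1 * 'X = 0 -> exists q, p0 = q * 'X /\ p1 = q * - a%:P.
Proof.
move=> a0 E; have /root0_mulX[q Eq] : p0.[0] = 0.
  have := congr1 (horner^~ 0) E; rewrite !hornerE ?mulr0 ?addr0 => /eqP.
  by rewrite mulf_eq0 (negbTE a0) orbF => /eqP.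
exists q; split=> //; have X0 : 'X != 0 :> {poly A} by rewrite polyX_eq0.
apply: (mulIf X0); rewrite mulrN mulNr; apply/eqP; rewrite -addr_eq0 addrC.
by rewrite mulrAC -Eq E.
Qed.

Lemma kexactS n p : kdiff n p = 0 <-> exists q, p = kdiff n.+1 q.
Proof.
split=> [|[q ->]]; last by rewrite /= -mulmxA kosmxK mulmx0.
case: n p => [|[|n]] p /= E.
- have := congr1 (fun v : 'rV[S]_1 => v 0 0) E.
  rewrite !mxE big_ord_recl big_ord1 !mxE /= zvar0E zvar1E => {}E.
  pose p0 := (p : 'rV[S]_2) 0 0; pose p1 := (p : 'rV[S]_2) 0 1.
  have {}E : p0 * 'X%:P + p1 * 'X = 0.
    by rewrite -[RHS]E; congr (_ * _ + _ * _); congr ((p : 'rV[S]_2) _ _); apply: val_inj.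
  have [|q [E0 E1]] := syzygyX _ E; first by rewrite polyX_eq0.
  exists (const_mx q : 'rV[S]_1); apply/rowP => j.
  rewrite mxE big_ord1 [const_mx _ _ _]mxE [kosmx _ _ _]mxE.
  case: j => -[|[|j]] hj /=; last by case: (notF hj).
    by rewrite zvar1E -[RHS]E0; congr ((p : 'rV[S]_2) _ _); apply: val_inj.
  by rewrite zvar0E -[RHS]E1; congr ((p : 'rV[S]_2) _ _); apply: val_inj.
- exists 0; rewrite mul0mx; apply/rowP => j; rewrite [j]ord1 mxE.
  have := congr1 (fun v : 'rV[S]_2 => v 0 0) E; rewrite !mxE big_ord1 !mxE /= zvar1E => /eqP.
  by rewrite mulf_eq0 polyX_eq0 orbF => /eqP.
- by exists 0; rewrite mul0mx; case: n p {E} => [|n] p; rewrite [p]thinmx0.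
Qed.

End Koszul.

(** * The action of R (x)_k R on bimodules and maps out of the Koszul terms *)

Section KoszulMaps.
Variable k : fieldType.
Local Notation R := {mpoly k[2]}.
Local Notation S := {poly {poly R}}.

Section Action.
Variable M : grbimod k.

Definition bD (j : 'I_2) (x : M) : M := ract x 'X_j - lact 'X_j x.

Lemma bDD j x y : bD j (x + y) = bD j x + bD j y.
Proof. by rewrite /bD ractDl lactDr opprD addrACA. Qed.

Lemma lact_bD j a x : lact a (bD j x) = bD j (lact a x).
Proof. by rewrite /bD lactBr lractA !lactA mulrC. Qed.

Lemma ract_bD j a x : ract (bD j x) a = bD j (ract x a).
Proof. by rewrite /bD ractBl -lractA !ractA mulrC. Qed.

Lemma bDB j x y : bD j (x - y) = bD j x - bD j y.
Proof. by apply/eqP; rewrite eq_sym subr_eq -bDD subrK. Qed.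

Lemma bDC i j x : bD i (bD j x) = bD j (bD i x).
Proof.
by rewrite -[LHS]/(ract (bD j x) 'X_i - lact 'X_i (bD j x)) ract_bD lact_bD -bDB.
Qed.

Lemma bdeg_bD j d x : bdeg d x -> bdeg (d + 2) (bD j x).
Proof.
move=> hx; rewrite addrC; apply: (grB (bdeg_grading M)).
  by apply: bdeg_ract => //; exact: pdegX.
by apply: bdeg_lact => //; exact: pdegX.
Qed.

Let act1 : {poly R} -> M -> M := pact (@lact k M) (bD 0).

Let act1Dl a b x : act1 (a + b) x = act1 a x + act1 b x.
Proof. by apply: pactDl; exact: lactDl. Qed.
Let act1Dr a x y : act1 a (x + y) = act1 a x + act1 a y.
Proof. by apply: pactDr; [exact: lactDr | exact: bDD]. Qed.
Let act1M a b x : act1 (a * b) x = act1 a (act1 b x).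
Proof.
apply: pactM.
- exact: lactDl. - exact: lactDr. - exact: bDD. - exact: lact_bD.
- by move=> *; rewrite lactA.
- exact: mulrC.
Qed.
Let act1D a x : act1 a (bD 1 x) = bD 1 (act1 a x).
Proof.
apply: pact_D'; [exact: bDD | exact: lact_bD | exact: bDC].
Qed.

(* R (x)_k R acts on M; the variable [zvar j] acts by x |-> x 'X_j - 'X_j x. *)
Definition sact : S -> M -> M := pact act1 (bD 1).

Lemma sactDl p q x : sact (p + q) x = sact p x + sact q x.
Proof. by apply: pactDl; exact: act1Dl. Qed.
Lemma sactDr p x y : sact p (x + y) = sact p x + sact p y.
Proof. by apply: pactDr; [exact: act1Dr | exact: bDD]. Qed.
Lemma sactM p q x : sact (p * q) x = sact p (sact q x).
Proof.
apply: pactM; [exact: act1Dl | exact: act1Dr | exact: bDD | exact: act1D | exact: act1M |].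
exact: mulrC.
Qed.
Lemma sact_lem a x : sact (lem a) x = lact a x.
Proof.
rewrite /sact /lem pactC; last exact: act1Dl.
by rewrite /act1 pactC //; exact: lactDl.
Qed.
Lemma sact1 x : sact 1 x = x.
Proof. by rewrite -lem1 sact_lem lact1. Qed.
Lemma sact0 x : sact 0 x = 0.
Proof. by apply: (addrI (sact 0 x)); rewrite -sactDl !addr0. Qed.
Lemma sactr0 p : sact p 0 = 0.
Proof. by apply: (addrI (sact p 0)); rewrite -sactDr !addr0. Qed.
Lemma sactN p x : sact (- p) x = - sact p x.
Proof. by apply: (addrI (sact p x)); rewrite -sactDl !subrr sact0. Qed.
Lemma sact_zvar j x : sact (zvar k j) x = bD j x.
Proof.
rewrite /sact /zvar; case: ifP => [/eqP ->|j0].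
  rewrite pactC; last exact: act1Dl.
  rewrite -['X]mul1r /act1 pactMX; last exact: lactDl.
  by rewrite -polyC1 pactC ?lact1 //; exact: lactDl.
rewrite -['X]mul1r pactMX; last exact: act1Dl.
rewrite -polyC1 pactC; last exact: act1Dl.
rewrite /act1 -polyC1 pactC ?lact1; last exact: lactDl.
by case: j j0 => -[|[|//]] hj //= _; congr bD; apply: val_inj.
Qed.

Lemma sact_deg d e p x : sgdeg d p -> bdeg e x -> bdeg (d + e) (sact p x).
Proof.
apply: pact_deg; first exact: (poly_grading (pdeg_grading k)).
- exact: bdeg_grading.
- move=> {}d {}e a {}x; apply: pact_deg; [exact: pdeg_grading | exact: bdeg_grading | |].
    by move=> *; exact: bdeg_lact.
  by move=> *; exact: bdeg_bD.
by move=> *; exact: bdeg_bD.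
Qed.

Lemma sact_rem a x : sact (rem a) x = ract x a.
Proof.
elim/mpoly_alg_ind: a x => [c|j|p q hp hq|p q hp hq] x.
- by rewrite remC sact_lem lractC.
- by rewrite remX sactDl sact_lem sact_zvar /bD addrC subrK.
- rewrite remD sactDl ractDr; congr (_ + _); [exact: hp | exact: hq].
- rewrite remM sactM [p * q]mulrC -ractA -hq; exact: hp.
Qed.

Lemma sact_sum p (I : Type) (r : seq I) (F : I -> M) :
  sact p (\sum_(i <- r) F i) = \sum_(i <- r) sact p (F i).
Proof. by apply: big_morph; [exact: sactDr | exact: sactr0]. Qed.

(** The left copy of R and the two variables generate S, so a map compatible with them is determined
    by the image of 1. *)
Lemma sact_uniq (F : S -> M) : (forall p q, F (p + q) = F p + F q) ->
  (forall a p, F (lem a * p) = lact a (F p)) ->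
  (forall j p, F (zvar k j * p) = bD j (F p)) -> forall p, F p = sact p (F 1).
Proof.
move=> FD Fl Fz.
have F0 : F 0 = 0 by apply: (addrI (F 0)); rewrite -FD !addr0.
have Fc c : F (lem c) = sact (lem c) (F 1).
  by rewrite sact_lem -Fl mulr1.
have F1 (a : {poly R}) : F a%:P = sact a%:P (F 1).
  elim/poly_ind: a => [|a c IH].
    by rewrite polyC0 [LHS]F0 sact0.
  rewrite (polyCD (a * 'X)) [LHS]FD sactDl; congr (_ + _); last exact: Fc.
  rewrite (polyCM a) [a%:P * _]mulrC -(zvar0E k) [LHS]Fz sactM sact_zvar; congr bD.
  exact: IH.
elim/poly_ind => [|p c IH]; first by rewrite [LHS]F0 sact0.
rewrite [LHS]FD sactDl; congr (_ + _); last exact: F1.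
rewrite [p * _]mulrC -(zvar1E k) [LHS]Fz sactM sact_zvar; congr bD; exact: IH.
Qed.

Section Generators.
Variable n : nat.
Local Notation c := (krk n).

Definition kgen (j : 'I_c) : kobj k n := (delta_mx 0 j : 'rV[S]_c).

Lemma kgen_deg j : bdeg n.*2%:Z (kgen j).
Proof.
move=> i; rewrite mxE eqxx subrr /=; case: eqP => _; last exact: (gr0 (sgdeg_grading k)).
by rewrite -(lem1 k); apply: sgdegC; exact: pdeg1.
Qed.

Lemma kgen_uniq (u : kobj k n -> M) : (forall x y, u (x - y) = u x - u y) ->
  (forall a x, u (lact a x) = lact a (u x)) ->
  (forall x a, u (ract x a) = ract (u x) a) ->
  forall v, u v = \sum_j sact ((v : 'rV[S]_c) 0 j) (u (kgen j)).
Proof.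
move=> uB ul ur v; rewrite {1}[v : 'rV[S]_c]row_sum_delta (subf_sum uB).
apply: eq_bigr => j _; set w : kobj k n := delta_mx 0 j.
have F1 : u (kgen j) = u ((1 : S) *: (w : 'rV[S]_c)) by rewrite scale1r.
rewrite F1; apply: (sact_uniq (F := fun p => u (p *: (w : 'rV[S]_c)))) => [p q|a p|i p].
- by rewrite scalerDl (subfD uB).
- by rewrite -scalerA -ul.
rewrite -scalerA; set x := p *: _; rewrite /bD -ul -ur -uB; congr u.
rewrite -[RHS]/(rem 'X_i *: (x : 'rV[S]_c) - lem 'X_i *: (x : 'rV[S]_c)) remX.
by rewrite -scalerBl addrC addKr.
Qed.

Variable m : 'I_c -> M.

Definition kmap_fun (v : kobj k n) : M := \sum_j sact ((v : 'rV[S]_c) 0 j) (m j).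

Lemma kmapB x y : kmap_fun (x - y) = kmap_fun x - kmap_fun y.
Proof.
rewrite /kmap_fun -sumrB; apply: eq_bigr => j _.
by rewrite !mxE sactDl sactN.
Qed.

Lemma kmap_lact a x : kmap_fun (lact a x) = lact a (kmap_fun x).
Proof.
rewrite -sact_lem /kmap_fun sact_sum; apply: eq_bigr => j _.
by rewrite mxE sactM.
Qed.

Lemma kmap_ract x a : kmap_fun (ract x a) = ract (kmap_fun x) a.
Proof.
rewrite -sact_rem /kmap_fun sact_sum; apply: eq_bigr => j _.
by rewrite mxE sactM.
Qed.

Lemma kmap_deg d l x : (forall j, bdeg (n.*2%:Z + l) (m j)) -> bdeg d x -> bdeg (d + l) (kmap_fun x).
Proof.
move=> hm hx; have G := bdeg_grading M; apply: (homog_sum (gr0 G) (grB G)) => j.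
have -> : d + l = (d - n.*2%:Z) + (n.*2%:Z + l) by lia.
by apply: sact_deg; [exact: hx | exact: hm].
Qed.

Lemma kmap_gen j : kmap_fun (kgen j) = m j.
Proof.
rewrite /kmap_fun (bigD1 j) //= big1 => [|i /negbTE ij]; rewrite mxE eqxx.
  by rewrite eqxx sact1 addr0.
by rewrite ij sact0.
Qed.

End Generators.

End Action.

Lemma ghom_gcomp (M N : grbimod k) (f : ghom M N) x d :
  f (gcomp (bdeg_grading M) x d) = gcomp (bdeg_grading N) (f x) d.
Proof.
apply/esym/(@gcompP _ _ (bdeg_grading N) _ (gsupp (bdeg_grading M) x)
  (fun d => f (gcomp (bdeg_grading M) x d))).
- exact: gsupp_uniq.
- by move=> i; apply: ghom_deg; exact: gcomp_homog.
- by move=> i /gcomp_out ->; rewrite ghom0.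
- by rewrite {1}[x](gcomp_sum (bdeg_grading M)) ghom_sum.
Qed.

(** A preimage of the image of a generator need not be homogeneous, but its component of degree 2n
    is still a preimage because f preserves degrees. Sending the generators to these components
    defines the lift. *)
Lemma kobj_projective n : projective (kobj k n).
Proof.
move=> M N f g fs.
have ex j : exists y, bdeg n.*2%:Z y /\ f y = g (kgen j).
  have [x hx] := fs (g (kgen j)); exists (gcomp (bdeg_grading M) x n.*2%:Z).
  split; first exact: gcomp_homog.
  by rewrite ghom_gcomp hx (gcomp1 _ _ (ghom_deg g (@kgen_deg n j))) eqxx.
have [m hm] := choice ex.
have md d x : @bdeg k (kobj k n) d x -> bdeg d (kmap_fun m x).
  by move=> hx; rewrite -[d]addr0; apply: kmap_deg => // j; rewrite addr0; case: (hm j).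
pose h := @Ghom k (kobj k n) M _ (kmapB m) (kmap_lact m) (kmap_ract m) md.
exists h => p; rewrite -[LHS]/(ghom_comp f h p).
rewrite (kgen_uniq (ghomB (ghom_comp f h)) (ghom_lact (ghom_comp f h)) (ghom_ract (ghom_comp f h)) p).
rewrite (kgen_uniq (ghomB g) (ghom_lact g) (ghom_ract g) p).
by apply: eq_bigr => j _ /=; rewrite kmap_gen; case: (hm j) => _ ->.
Qed.

Definition koszul : resolution k :=
  @Resolution k (kobj k) (kdiff k) (kaug k) kobj_projective (@kaug_surj k)
    (@kexact0 k) (@kexactS k).

End KoszulMaps.

(** * Kernels of bimodule maps and the comparison of projective resolutions *)

Section KernelBimodule.
Variables (k : fieldType) (M N : grbimod k) (f : ghom M N).

Definition ker_pred : {pred M} := fun x => `[< f x = 0 >].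

Lemma ker_pred_closed : zmod_closed ker_pred.
Proof.
split=> [|x y /asboolP hx /asboolP hy]; apply/asboolP; first exact: ghom0.
by rewrite ghomB hx hy subrr.
Qed.

HB.instance Definition _ := GRing.isZmodClosed.Build M ker_pred ker_pred_closed.

Record ker_sub : Type := KerSub { ker_val : M; _ : ker_val \in ker_pred }.
HB.instance Definition _ := [isSub for ker_val].
HB.instance Definition _ := [Choice of ker_sub by <:].
HB.instance Definition _ := [SubChoice_isSubZmodule of ker_sub by <:].

Lemma ker_valP (x : ker_sub) : f (ker_val x) = 0.
Proof. by case: x => y /= /asboolP. Qed.

Lemma ker_valD (x y : ker_sub) : ker_val (x + y) = ker_val x + ker_val y.
Proof. exact: (raddfD (val : ker_sub -> M)). Qed.

Lemma ker_valE x (hx : x \in ker_pred) : ker_val (KerSub hx) = x.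
Proof. by []. Qed.
Lemma ker_ext (x y : ker_sub) : ker_val x = ker_val y -> x = y.
Proof. exact: val_inj. Qed.

Lemma ker_lact_subproof a (x : ker_sub) : lact a (ker_val x) \in ker_pred.
Proof. by apply/asboolP; rewrite ghom_lact ker_valP lact0r. Qed.
Lemma ker_ract_subproof (x : ker_sub) a : ract (ker_val x) a \in ker_pred.
Proof. by apply/asboolP; rewrite ghom_ract ker_valP ract0l. Qed.

Lemma ker_grading : is_grading (fun d (x : ker_sub) => bdeg d (val x)).
Proof.
have G := bdeg_grading M.
split=> [d|d x y hx hy|s g us hg E i si|x].
- by rewrite raddf0; exact: (gr0 G).
- by rewrite raddfB; exact: (grB G).
- apply: val_inj; rewrite raddf0 -[LHS]/((val \o g) i).
  apply: (gr_indep G us) si => //.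
  by have := congr1 val E; rewrite raddf_sum raddf0.
have hker d : gcomp (bdeg_grading M) (val x) d \in ker_pred.
  apply/asboolP; rewrite ghom_gcomp ker_valP.
  by rewrite (gcomp1 _ _ (gr0 (bdeg_grading N) 0)) if_same.
exists (gsupp (bdeg_grading M) (val x)), (fun d => KerSub (hker d)); split.
- exact: gsupp_uniq.
- by move=> d; exact: gcomp_homog.
- by apply: val_inj; rewrite raddf_sum /=; exact: gcomp_sum.
Qed.

Definition bker : grbimod k.
Proof.
refine (@Grbimod k ker_sub (fun a x => KerSub (ker_lact_subproof a x))
  (fun x a => KerSub (ker_ract_subproof x a)) _ _ _ _ _ _ _ _ _ _ _ ker_grading _ _);
  try by [].
- by move=> a b x; apply: ker_ext; rewrite /= lactA.
- by move=> x; apply: ker_ext; rewrite /= lact1.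
- by move=> a x y; apply: ker_ext; rewrite !(ker_valD, ker_valE) lactDr.
- by move=> a b x; apply: ker_ext; rewrite !(ker_valD, ker_valE) lactDl.
- by move=> x a b; apply: ker_ext; rewrite /= ractA.
- by move=> x; apply: ker_ext; rewrite /= ract1.
- by move=> x y a; apply: ker_ext; rewrite !(ker_valD, ker_valE) ractDl.
- by move=> x a b; apply: ker_ext; rewrite !(ker_valD, ker_valE) ractDr.
- by move=> a x b; apply: ker_ext; rewrite /= lractA.
- by move=> c x; apply: ker_ext; rewrite /= lractC.
- by move=> e d a x ha hx; exact: bdeg_lact.
- by move=> e d a x ha hx; exact: bdeg_ract.
Defined.

Definition bker_val : ghom bker M.
Proof. by refine (@Ghom k bker M (fun x : ker_sub => val x) _ _ _ _). Defined.

End KernelBimodule.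

Section Comparison.
Variable k : fieldType.

(* Projectivity gives a section of the projection from the pullback of f and g. *)
Lemma projective_lift (P L M N : grbimod k) (f : ghom M N) (e : ghom N L) (g : ghom P N) :
  projective P -> (forall y, e y = 0 -> exists x, y = f x) ->
  (forall p, e (g p) = 0) -> exists h : ghom P M, forall p, f (h p) = g p.
Proof.
move=> hP ex eg.
pose u : ghom (bsum P M) N := ghom_sub (ghom_comp g (bfst P M)) (ghom_comp f (bsnd P M)).
pose w : ghom (bker u) P := ghom_comp (bfst P M) (bker_val u).
have ws y : exists x, w x = y.
  have [x hx] := ex _ (eg y).
  have hu : ((y, x) : bsum P M) \in ker_pred u by apply/asboolP; rewrite /= hx subrr.
  by exists (KerSub hu).
have [h hh] := hP _ _ w (id_hom P) ws.
exists (ghom_comp (bsnd P M) (ghom_comp (bker_val u) h)) => p /=.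
have /eqP := ker_valP (h p); rewrite /= subr_eq0 => /eqP <-.
by congr (g _); exact: (hh p).
Qed.

Section Lift.
Variables P Q : resolution k.

(** Two consecutive maps and their compatibility are kept together, since constructing the next map
    uses the commutation of the current square. *)
Definition lift_state n := {fg : ghom (P n) (Q n) * ghom (P n.+1) (Q n.+1) |
  forall x, res_d Q n (fg.2 x) = fg.1 (res_d P n x)}.

Lemma lift_init : exists s : lift_state 0, forall x, res_aug Q ((sval s).1 x) = res_aug P x.
Proof.
have [f0 hf0] := @res_proj k P 0 _ _ (res_aug Q) (res_aug P) (@res_aug_surj k Q).
have [|f1 hf1] := @projective_lift _ _ _ _ (res_d Q 0) (res_aug Q)
  (ghom_comp f0 (res_d P 0)) (@res_proj k P 1) (fun y => proj1 (@res_exact0 k Q y)).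
  by move=> p; rewrite /= hf0; apply/res_exact0; exists p.
by exists (exist _ (f0, f1) hf1).
Qed.

Lemma lift_step n (s : lift_state n) : exists s' : lift_state n.+1, (sval s').1 = (sval s).2.
Proof.
case: s => -[f g] /= hfg.
have [|h hh] := @projective_lift _ _ _ _ (res_d Q n.+1) (res_d Q n)
  (ghom_comp g (res_d P n.+1)) (@res_proj k P n.+2) (fun y => proj1 (@res_exactS k Q n y)).
  move=> p; rewrite /= hfg; have /res_exactS -> : exists q, res_d P n.+1 p = res_d P n.+1 q by exists p.
  exact: ghom0.
by exists (exist _ (g, h) hh).
Qed.

Lemma res_lift : exists f : forall n, ghom (P n) (Q n),
  (forall x, res_aug Q (f 0%N x) = res_aug P x) /\
  forall n x, res_d Q n (f n.+1 x) = f n (res_d P n x).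
Proof.
have [s0 hs0] := lift_init.
pose st := nat_rect lift_state s0 (fun n s => sval (cid (lift_step s))).
exists (fun n => (sval (st n)).1); split=> // n x.
have -> : (sval (st n.+1)).1 = (sval (st n)).2 by exact: svalP (cid (lift_step (st n))).
exact: (svalP (st n)).
Qed.

Lemma res_homotopy (e : forall n, ghom (P n) (Q n)) :
  (forall x, res_aug Q (e 0%N x) = 0) ->
  (forall n x, res_d Q n (e n.+1 x) = e n (res_d P n x)) ->
  exists h : forall n, ghom (P n) (Q n.+1),
    (forall x, res_d Q 0 (h 0%N x) = e 0%N x) /\
    forall n x, res_d Q n.+1 (h n.+1 x) + h n (res_d P n x) = e n.+1 x.
Proof.
move=> e0 eS.
(* Only the homotopy identity on boundaries is carried along. There the term with the previous h
   vanishes, and this already makes e - h d land in the cycles at the next step. *)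
pose st n := {h : ghom (P n) (Q n.+1) |
  forall x, res_d Q n (h (res_d P n x)) = e n (res_d P n x)}.
have dd n x : res_d P n (res_d P n.+1 x) = 0 by apply/res_exactS; exists x.
have [h0 hh0] := @projective_lift _ _ _ _ (res_d Q 0) (res_aug Q) (e 0%N)
  (@res_proj k P 0) (fun y => proj1 (@res_exact0 k Q y)) e0.
have step n (s : st n) : exists s' : st n.+1, forall x,
    res_d Q n.+1 (sval s' x) + sval s (res_d P n x) = e n.+1 x.
  case: s => h hh /=.
  have [|h' hh'] := @projective_lift _ _ _ _ (res_d Q n.+1) (res_d Q n)
    (ghom_sub (e n.+1) (ghom_comp h (res_d P n))) (@res_proj k P n.+1)
    (fun y => proj1 (@res_exactS k Q n y)).
    by move=> p; rewrite /= ghomB eS hh subrr.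
  have s'P x : res_d Q n.+1 (h' (res_d P n.+1 x)) = e n.+1 (res_d P n.+1 x).
    by rewrite hh' /= dd ghom0 subr0.
  by exists (exist _ h' s'P) => x /=; rewrite hh' /= subrK.
have s0P x : res_d Q 0 (h0 (res_d P 0 x)) = e 0%N (res_d P 0 x) by exact: hh0.
pose s := nat_rect st (exist _ h0 s0P) (fun n t => sval (cid (step n t))).
exists (fun n => sval (s n)); split=> // n x.
exact: (svalP (cid (step n (s n)))).
Qed.

End Lift.

Lemma res_lift_unique (P : resolution k) (f : forall n, ghom (P n) (P n)) :
  (forall x, res_aug P (f 0%N x) = res_aug P x) ->
  (forall n x, res_d P n (f n.+1 x) = f n (res_d P n x)) ->
  exists h : forall n, ghom (P n) (P n.+1),
    (forall x, res_d P 0 (h 0%N x) = f 0%N x - x) /\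
    forall n x, res_d P n.+1 (h n.+1 x) + h n (res_d P n x) = f n.+1 x - x.
Proof.
move=> f0 fS; apply: (res_homotopy (e := fun n => ghom_sub (f n) (id_hom (P n)))) => [x|n x] /=.
  by rewrite ghomB f0 subrr.
by rewrite ghomB fS.
Qed.

End Comparison.

(** * Hochschild cohomology through the Koszul resolution *)

Section KoszulCochains.
Variables (k : fieldType) (M : grbimod k).
Local Notation R := {mpoly k[2]}.
Local Notation S := {poly {poly R}}.

(** The dual of the Koszul differential; a cochain is recorded by its values on the generators. *)
Definition kcob n (y : 'I_(krk n) -> M) (i : 'I_(krk n.+1)) : M :=
  \sum_(j < krk n) sact (kos k n i j) (y j).

Definition kbd n : ('I_(krk n) -> M) -> Prop :=
  match n with
  | 0 => fun z => forall j, z j = 0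
  | m.+1 => fun z => exists y : 'I_(krk m) -> M, forall i, z i = kcob y i
  end.

Lemma kcobB n (y y' : 'I_(krk n) -> M) i :
  kcob (fun j => y j - y' j) i = kcob y i - kcob y' i.
Proof.
rewrite /kcob -sumrB; apply: eq_bigr => j _; apply/eqP.
by rewrite eq_sym subr_eq -sactDr subrK.
Qed.

Lemma sactC p q (x : M) : sact p (sact q x) = sact q (sact p x).
Proof. by rewrite -!sactM mulrC. Qed.

Lemma kcob_sact n p (y : 'I_(krk n) -> M) i :
  kcob (fun j => sact p (y j)) i = sact p (kcob y i).
Proof. by rewrite /kcob sact_sum; apply: eq_bigr => j _; exact: sactC. Qed.

Lemma kbd_eq n (z z' : 'I_(krk n) -> M) : z =1 z' -> kbd z -> kbd z'.
Proof.
case: n z z' => [|n] z z' e /=; first by move=> h j; rewrite -e.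
by case=> y hy; exists y => i; rewrite -e.
Qed.

Lemma kbdB n (z z' : 'I_(krk n) -> M) : kbd z -> kbd z' -> kbd (fun j => z j - z' j).
Proof.
case: n z z' => [|n] z z' /= hz hz'; first by move=> j; rewrite hz hz' subrr.
case: hz hz' => y hy [y' hy']; exists (fun j => y j - y' j) => i.
by rewrite kcobB hy hy'.
Qed.

Lemma kbd0 n : kbd (fun _ : 'I_(krk n) => 0 : M).
Proof.
case: n => [|n] //=; exists (fun=> 0) => i.
by rewrite /kcob big1 // => j _; exact: sactr0.
Qed.

Lemma kbdD n (z z' : 'I_(krk n) -> M) : kbd z -> kbd z' -> kbd (fun j => z j + z' j).
Proof.
move=> hz hz'; apply: kbd_eq (kbdB hz (kbdB (kbd0 n) hz')) => j /=.
by rewrite sub0r opprK.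
Qed.

Lemma kbd_sact n p (z : 'I_(krk n) -> M) : kbd z -> kbd (fun j => sact p (z j)).
Proof.
case: n z => [|n] z /=; first by move=> h j; rewrite h sactr0.
by case=> y hy; exists (fun j => sact p (y j)) => i; rewrite kcob_sact hy.
Qed.

Lemma krk_gt2 n : krk n.+3 = 0%N. Proof. by rewrite /krk /= nth_nil. Qed.

(* The augmentation ideal of R (x) R acts by null-homotopic maps on the Koszul complex. *)
Lemma kbd_bD n (z : 'I_(krk n) -> M) i : (forall l, kcob z l = 0) -> kbd (fun j => bD i (z j)).
Proof.
case: n z => [|[|[|n]]] z hz.
- move=> j; have {hz} := hz i; rewrite /kcob big_ord1 [j]ord1 => E.
  rewrite -[LHS]sact_zvar -[RHS]E; congr sact.
  by case: i {E} => -[|[|//]] hi /=; congr zvar; apply: val_inj.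
(* The primitive is the contraction of z in direction i. Its coboundary is D_j(z i), and the cocycle
   condition D_1(z 0) = D_0(z 1) turns this into D_i(z j). *)
- exists (fun _ : 'I_1 => z i) => j; rewrite /kcob big_ord1.
  have E : bD 1 (z 0) = bD 0 (z 1).
    have := hz ord0; rewrite /kcob big_ord_recl big_ord1 /= sactN !sact_zvar.
    by move/eqP; rewrite subr_eq0 => /eqP ->; congr (bD _ (z _)); apply: val_inj.
  have -> : sact (kos k 0 j 0) (z i) = bD j (z i).
    by rewrite -[RHS]sact_zvar; congr sact; case: j => -[|[|//]] hj /=; congr zvar; apply: val_inj.
  have o2 (l : 'I_2) : l = 0 \/ l = 1 by case: l => -[|[|//]] hl; [left | right]; exact: val_inj.
  by case: (o2 i) => ->; case: (o2 j) => ->.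
(* In top degree the coboundary of (y_0, y_1) is D_1(y_0) - D_0(y_1). Hence z 0 goes into slot 0
   when i = 1, and - z 0 into slot 1 when i = 0. *)
- exists (fun l : 'I_2 => if i == 1 then (if l == 0 then z 0 else 0)
    else (if l == 0 then 0 else - z 0)) => j.
  rewrite /kcob big_ord_recl big_ord1 /= [j]ord1 sactN !sact_zvar.
  have N x : bD 0 (- x) = - bD 0 x :> M.
    by apply: (addrI (bD 0 x)); rewrite -bDD !subrr /bD ract0l lact0r subr0.
  have Z l : bD l 0 = 0 :> M by rewrite /bD ract0l lact0r subr0.
  case: i => -[|[|//]] hi; rewrite -(val_eqE _ (1 : 'I_2)) /=.
    by rewrite Z N opprK add0r; congr bD; apply: val_inj.
  by rewrite Z subr0; congr bD; apply: val_inj.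
by exists (fun=> 0) => -[j hj]; exfalso; move: hj; rewrite krk_gt2.
Qed.

Lemma kcob_ract n (z : 'I_(krk n) -> M) a l :
  kcob (fun j => ract (z j) a) l = ract (kcob z l) a.
Proof.
by rewrite -sact_rem -kcob_sact; apply: eq_bigr => j _; rewrite sact_rem.
Qed.

(** For a product, z p q - q p z = (z p q - q z p) + q (z p - p z), and z p is again a cocycle; on
    variables this is [kbd_bD]. It reconciles the right module structure of HH with left-linear maps
    on cochains. *)
Lemma kbd_central n (z : 'I_(krk n) -> M) a : (forall l, kcob z l = 0) ->
  kbd (fun j => ract (z j) a - lact a (z j)).
Proof.
elim/mpoly_alg_ind: a z => [c|j|p q hp hq|p q hp hq] z hz.
- by apply: kbd_eq (kbd0 n) => j /=; rewrite lractC subrr.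
- exact: kbd_bD.
- apply: kbd_eq (kbdD (hp z hz) (hq z hz)) => j /=.
  by rewrite ractDr lactDl opprD addrACA.
have hzp l : kcob (fun j => ract (z j) p) l = 0 by rewrite kcob_ract hz ract0l.
apply: kbd_eq (kbdD (hq _ hzp) (kbd_sact (lem q) (hp z hz))) => j /=.
by rewrite sact_lem lactBr !ractA lactA addrA subrK [q * p]mulrC.
Qed.

End KoszulCochains.

(** * Cocycles on an arbitrary resolution and their values on Koszul generators *)

Section Cocycles.
Variables (k : fieldType) (P : resolution k) (M : grbimod k).
Local Notation R := {mpoly k[2]}.

Section HomSpan.
Variable Q : grbimod k.
Variables (u : Q -> rmod M) (hu : homog_span (@hom_deg k Q M) u).

Lemma hom_span_lact a x : u (lact a x) = lact a (u x : M).
Proof.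
case: hu => s [F [us hF ->]]; rewrite !fct_sumE.
rewrite (big_morph (lact a : M -> M) (lactDr a) (lact0r M a)).
by apply: eq_bigr => i _; case: (hF i).
Qed.

Lemma hom_span_ract x a : u (ract x a) = ract (u x : M) a.
Proof.
case: hu => s [F [us hF ->]]; rewrite !fct_sumE.
rewrite (big_morph (fun y : M => ract y a) (fun y z => ractDl y z a) (ract0l M a)).
by apply: eq_bigr => i _; case: (hF i).
Qed.

Lemma hom_span_pre (Q' : grbimod k) (f : ghom Q' Q) :
  homog_span (@hom_deg k Q' M) (fun x => u (f x)).
Proof.
case: hu => s [F [us hF ->]]; exists s, (fun i x => F i (f x)); split=> // [i|].
  case: (hF i) => F1 F2 F3 F4.
  split=> [x y|a x|x a|d x hx]; rewrite ?ghomB ?ghom_lact ?ghom_ract ?F1 ?F2 ?F3 //.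
  by apply: F4; exact: ghom_deg.
by apply/funext => x; rewrite !fct_sumE.
Qed.

End HomSpan.

Lemma kmap_hom_deg n (m : 'I_(krk n) -> M) l : (forall j, bdeg (n.*2%:Z + l) (m j)) ->
  @hom_deg k (kobj k n) M l (kmap_fun m).
Proof.
by move=> hm; split; [exact: kmapB | exact: kmap_lact | exact: kmap_ract |];
  move=> d x; exact: kmap_deg.
Qed.

(** A map out of a Koszul term is homogeneous when its values on the generators are; in general each
    value is split into its finitely many homogeneous components, one generator at a time. *)
Lemma kmap_span n (m : 'I_(krk n) -> M) : homog_span (@hom_deg k (kobj k n) M) (kmap_fun m).
Proof.
have H := hom_deg_pregrading (kobj k n) M; have H0 := pg0 H; have HB := pgB H.
pose Y j (x : M) (i : 'I_(krk n)) : M := if i == j then x else 0.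
have -> : kmap_fun m = \sum_j \sum_(d <- gsupp (bdeg_grading M) (m j))
    (kmap_fun (Y j (gcomp (bdeg_grading M) (m j) d)) : kobj k n -> rmod M).
  apply/funext => v; rewrite fct_sumE; apply: eq_bigr => j _; rewrite fct_sumE.
  rewrite {1}[m j](gcomp_sum (bdeg_grading M)) sact_sum; apply: eq_bigr => d _.
  rewrite /kmap_fun (bigD1 j) //= big1 => [|i /negbTE ij].
    by rewrite /Y eqxx addr0.
  by rewrite /Y ij sactr0.
apply: (homog_span_sum H0 HB) => j; apply: (homog_span_sum H0 HB) => d.
apply: (homog_span1 H0 (d := d - n.*2%:Z)); apply: kmap_hom_deg => i.
rewrite addrC subrK /Y; case: ifP => _; [exact: gcomp_homog | exact: (gr0 (bdeg_grading M))].
Qed.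

Variables (c : forall n, ghom (koszul k n) (P n)) (c' : forall n, ghom (P n) (koszul k n)).
Hypothesis cd : forall n x, res_d P n (c n.+1 x) = c n (res_d (koszul k) n x).
Hypothesis cd' : forall n x, res_d (koszul k) n (c' n.+1 x) = c' n (res_d P n x).
Variable h : forall n, ghom (P n) (P n.+1).
Hypothesis h0 : forall x, res_d P 0 (h 0%N x) = c 0%N (c' 0%N x) - x.
Hypothesis hS : forall n x,
  res_d P n.+1 (h n.+1 x) + h n (res_d P n x) = c n.+1 (c' n.+1 x) - x.
Variable h' : forall n, ghom (koszul k n) (koszul k n.+1).
Hypothesis h0' : forall x, res_d (koszul k) 0 (h' 0%N x) = c' 0%N (c 0%N x) - x.
Hypothesis hS' : forall n x,
  res_d (koszul k) n.+1 (h' n.+1 x) + h' n (res_d (koszul k) n x) = c' n.+1 (c n.+1 x) - x.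

(** The restriction of a cochain along the comparison map c, read off on the generators. *)
Definition ev n (u : P n -> rmod M) (j : 'I_(krk n)) : M := u (c n (kgen k j)).

Lemma kdiff_gen n (v : kobj k n -> M) i : (forall x y, v (x - y) = v x - v y) ->
  (forall a x, v (lact a x) = lact a (v x)) ->
  (forall x a, v (ract x a) = ract (v x) a) ->
  v (kdiff k n (kgen k i)) = kcob (fun j => v (kgen k j)) i.
Proof.
move=> vB vl vr; rewrite (kgen_uniq vB vl vr); apply: eq_bigr => j _; congr sact.
rewrite /= mxE (bigD1 i) //= big1 => [|l /negbTE li]; rewrite !mxE ?eqxx /=.
  by rewrite mul1r addr0.
by rewrite li mul0r.
Qed.

Lemma kcob_ev n u i : cocycles P n M u -> kcob (ev u) i = 0.
Proof.
case=> su zu; rewrite -(@kdiff_gen n (fun x => u (c n x))) => [|x y|a x|x a].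
- by rewrite -[kdiff k n _]/(res_d (koszul k) n _) -cd zu.
- by rewrite ghomB (hom_spanB _ _ su).
- by rewrite ghom_lact hom_span_lact.
- by rewrite ghom_ract hom_span_ract.
Qed.

Lemma kbd_ev n u : coboundaries P n M u -> kbd (ev u).
Proof.
rewrite /=; case: n u => [|n] u /=; first by move=> ->.
case=> g sg ->; exists (ev g) => i; rewrite /ev cd.
rewrite (@kdiff_gen n (fun x => g (c n x))) // => [x y|a x|x a].
- by rewrite ghomB (hom_spanB _ _ sg).
- by rewrite ghom_lact hom_span_lact.
- by rewrite ghom_ract hom_span_ract.
Qed.

(** In positive degree, if u c is the coboundary of y, then u c c' is that of y c'. The homotopy h
    from c c' to the identity supplies the difference to u, so y c' - u h is a primitive of u. In
    degree 0 the same homotopy gives u = u c c' = 0. *)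
Lemma ev_kbd n u : cocycles P n M u -> kbd (ev u) -> coboundaries P n M u.
Proof.
case: n u => [|n] u [su zu] /=.
  move=> e0; apply/funext => p.
  have : u (c 0%N (c' 0%N p)) - u p = 0 by rewrite -(hom_spanB _ _ su) -h0 zu.
  rewrite (@kgen_uniq _ _ _ (fun x => u (c 0%N x))) => [|x y|a x|x a].
  - rewrite big1 => [|j _]; last by rewrite [X in sact _ X]e0 sactr0.
    by move/eqP; rewrite sub0r oppr_eq0 => /eqP.
  - by rewrite ghomB (hom_spanB _ _ su).
  - by rewrite ghom_lact hom_span_lact.
  - by rewrite ghom_ract hom_span_ract.
case=> y hy; have sy := kmap_span y.
exists (fun p => kmap_fun y (c' n p) - u (h n p)).
  have H := hom_deg_pregrading (P n) M.
  by apply: (homog_spanB (pg0 H) (pgB H)); [exact: (hom_span_pre sy) | exact: (hom_span_pre su)].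
have ug x : u (c n.+1 x) = kmap_fun y (kdiff k n x).
  rewrite (@kgen_uniq _ _ _ (fun x => u (c n.+1 x))) => [|x1 x2|a x1|x1 a]; last 3 first.
  - by rewrite ghomB (hom_spanB _ _ su).
  - by rewrite ghom_lact hom_span_lact.
  - by rewrite ghom_ract hom_span_ract.
  rewrite (@kgen_uniq _ _ _ (fun x => kmap_fun y (kdiff k n x))) => [|x1 x2|a x1|x1 a].
  - apply: eq_bigr => j _; congr sact; rewrite -[LHS]/(ev u j) hy.
    rewrite (kdiff_gen _ (kmapB y) (kmap_lact y) (kmap_ract y)).
    by apply: eq_bigr => l _; rewrite kmap_gen.
  - by rewrite ghomB kmapB.
  - by rewrite ghom_lact kmap_lact.
  - by rewrite ghom_ract kmap_ract.
apply/funext => p; rewrite -cd' -[res_d (koszul k) n _]/(kdiff k n _) -ug.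
have -> : u (c n.+1 (c' n.+1 p)) = u (res_d P n.+1 (h n.+1 p) + h n (res_d P n p) + p).
  by rewrite hS subrK.
rewrite !(subfD (fun x y => hom_spanB x y su)) zu add0r.
by rewrite addrC addrA addNr add0r.
Qed.

(** The lift is the Koszul cochain z composed with c'. Evaluating it gives z composed with c' c,
    which is cohomologous to z through h'. *)
Lemma ev_lift n (z : 'I_(krk n) -> M) : (forall i, kcob z i = 0) ->
  exists u, [/\ cocycles P n M u, kbd (fun j => ev u j - z j)
    & forall l, (forall j, bdeg (n.*2%:Z + l) (z j)) -> hom_deg l u].
Proof.
move=> hz; pose v := kmap_fun z; have sv := kmap_span z.
have vd x : v (kdiff k n x) = 0.
  rewrite (@kgen_uniq _ _ _ (fun x => v (kdiff k n x))) => [|x1 x2|a x1|x1 a].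
  - rewrite big1 // => j _; rewrite [X in sact _ X](_ : _ = 0) ?sactr0 //.
    rewrite [LHS](kdiff_gen _ (kmapB z) (kmap_lact z) (kmap_ract z)).
    by rewrite -[RHS](hz j); apply: eq_bigr => l _; rewrite kmap_gen.
  - by rewrite ghomB [v _]kmapB.
  - by rewrite ghom_lact [v _]kmap_lact.
  - by rewrite ghom_ract [v _]kmap_ract.
exists (fun p => v (c' n p)); split.
- split; first exact: (hom_span_pre sv).
  by move=> q; rewrite -cd'; exact: vd.
- have E j : ev (fun p => v (c' n p)) j - z j = v (c' n (c n (kgen k j)) - kgen k j).
    by rewrite [v _]kmapB /ev -/v; congr (_ - _); rewrite [v _]kmap_gen.
  apply: (@kbd_eq k M n (fun j => v (c' n (c n (kgen k j)) - kgen k j))) => [j|]; first by rewrite E.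
  case: n z hz @v sv vd E => [|n] z hz v sv vd E /=.
    by move=> j; rewrite -h0'; exact: vd.
  exists (fun l => v (h' n (kgen k l))) => i; rewrite -hS' -[v _]/(kmap_fun z _) (subfD (kmapB z)).
  have -> : kmap_fun z (res_d (koszul k) n.+1 (h' n.+1 (kgen k i))) = 0 by exact: vd.
  rewrite add0r [LHS](@kdiff_gen n (fun x => v (h' n x))) // => [x y|a x|x a].
  - by rewrite ghomB [v _]kmapB.
  - by rewrite ghom_lact [v _]kmap_lact.
  - by rewrite ghom_ract [v _]kmap_ract.
move=> l hl; have [u1 u2 u3 u4] := kmap_hom_deg hl.
split=> [x y|a x|x a|d x hx]; rewrite /v ?ghomB ?ghom_lact ?ghom_ract ?u1 ?u2 ?u3 //.
by apply: u4; exact: ghom_deg.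
Qed.

(** The Koszul terms vanish from degree 3 on, so every cocycle there evaluates to a coboundary. *)
Lemma HH_gt2 n : gtrivial (HH P n.+3 M).
Proof.
move=> x; rewrite -[x]repK -[0](cls0 (cocycles P n.+3 M) (coboundaries P n.+3 M)).
apply/(cls_eq _ (rep_mem x) (sm0 _)); rewrite subr0; apply: ev_kbd; first exact: rep_mem.
by exists (fun=> 0) => -[j hj]; exfalso; move: hj; rewrite krk_gt2.
Qed.

End Cocycles.

(** In terms of representatives, this says that evaluation along c is an isomorphism from HH^n(M) to
    Koszul cohomology: the first two clauses make it well defined, the third injective, the fourth
    surjective with control of degrees. *)
Definition koszul_model (k : fieldType) (P : resolution k)
    (c : forall n, ghom (koszul k n) (P n)) : Prop :=
  forall (M : grbimod k) n,
  [/\ forall u : P n -> rmod M, cocycles P n M u -> forall i, kcob (ev c u) i = 0,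
      forall u : P n -> rmod M, coboundaries P n M u -> kbd (ev c u),
      forall u : P n -> rmod M, cocycles P n M u -> kbd (ev c u) -> coboundaries P n M u
    & forall z : 'I_(krk n) -> M, (forall i, kcob z i = 0) ->
      exists u : P n -> rmod M, [/\ cocycles P n M u, kbd (fun j => ev c u j - z j)
        & forall l, (forall j, bdeg (n.*2%:Z + l) (z j)) -> hom_deg l u]].

Lemma koszul_model_ex (k : fieldType) (P : resolution k) :
  (exists c, @koszul_model k P c) /\ forall n M, gtrivial (HH P n.+3 M).
Proof.
have [c [c0 cS]] := res_lift (koszul k) P.
have [c' [c0' cS']] := res_lift P (koszul k).
have [h [h0 hS]] : exists h : forall n, ghom (P n) (P n.+1),
    (forall x, res_d P 0 (h 0%N x) = c 0%N (c' 0%N x) - x) /\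
    forall n x, res_d P n.+1 (h n.+1 x) + h n (res_d P n x) = c n.+1 (c' n.+1 x) - x.
  apply: (@res_lift_unique k P (fun n => ghom_comp (c n) (c' n))) => [x|n x] /=.
    by rewrite c0 c0'.
  by rewrite cS cS'.
have [h' [h0' hS']] : exists h : forall n, ghom (koszul k n) (koszul k n.+1),
    (forall x, res_d (koszul k) 0 (h 0%N x) = c' 0%N (c 0%N x) - x) /\
    forall n x, res_d (koszul k) n.+1 (h n.+1 x) + h n (res_d (koszul k) n x)
      = c' n.+1 (c n.+1 x) - x.
  apply: (@res_lift_unique k (koszul k) (fun n => ghom_comp (c' n) (c n))) => [x|n x].
    by rewrite [LHS]c0' c0.
  by rewrite [LHS]cS' [in LHS]cS.
split; last by move=> n M; exact: (HH_gt2 cS' h0 hS).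
exists c => M n; split=> u.
- by move=> hu i; exact: kcob_ev.
- exact: kbd_ev.
- exact: (ev_kbd cS' h0 hS).
- exact: (ev_lift cS' h0' hS').
Qed.

Lemma ghom_sact (k : fieldType) (M N : grbimod k) (f : ghom M N) p x :
  f (sact p x) = sact p (f x).
Proof.
rewrite -[in RHS](sact1 x); apply: (@sact_uniq k N (fun p => f (sact p x)))
  => [q r|a q|j q].
- by rewrite sactDl ghomD.
- by rewrite sactM sact_lem ghom_lact.
- by rewrite sactM sact_zvar /bD ghomB ghom_lact ghom_ract.
Qed.

Lemma kcobD (k : fieldType) (M : grbimod k) n (y y' : 'I_(krk n) -> M) i :
  kcob (fun j => y j + y' j) i = kcob y i + kcob y' i.
Proof. by rewrite /kcob -big_split; apply: eq_bigr => j _; exact: sactDr. Qed.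

Lemma kcob_lact (k : fieldType) (M : grbimod k) n a (y : 'I_(krk n) -> M) i :
  kcob (fun j => lact a (y j)) i = lact a (kcob y i).
Proof. by rewrite -sact_lem -kcob_sact; apply: eq_bigr => j _; rewrite sact_lem. Qed.

Lemma kbd_lact (k : fieldType) (M : grbimod k) n a (z : 'I_(krk n) -> M) :
  kbd z -> kbd (fun j => lact a (z j)).
Proof. by move/(kbd_sact (lem a)); apply: kbd_eq => j; rewrite sact_lem. Qed.

(** * Transfer of the cohomology to a complex of free modules *)

Section Reduction.
Variables (k : fieldType) (P : resolution k) (c : forall n, ghom (koszul k n) (P n)).
Hypothesis cP : koszul_model c.
Variables (C : cpx k) (n : nat) (G : int -> gmod k).
Local Notation R := {mpoly k[2]}.
Local Notation K t := ('I_(krk n) -> C t).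
Variables (dG : forall t, G t -> G (t + 1)) (N : k).
Variables (pi : forall t, K t -> G t) (io : forall t, G t -> K t).
Variable eta : forall t, K (t + 1) -> K t.
Local Notation dK z := (fun j => cpx_d C _ (z j)).
Arguments pi {t}.
Arguments io {t}.

Hypothesis N0 : N != 0.
Hypothesis piB : forall t (z z' : K t), pi (fun j => z j - z' j) = pi z - pi z'.
Hypothesis piZ : forall t a (z : K t), pi (fun j => lact a (z j)) = a *: pi z.
Hypothesis pi_deg : forall t l (z : K t),
  (forall j, bdeg (n.*2%:Z + l) (z j)) -> gdeg l (pi z).
Hypothesis pi_kbd : forall t (z : K t), kbd z -> pi z = 0.
Hypothesis io0 : forall t j, io (0 : G t) j = 0.
Hypothesis io_coc : forall t (g : G t) i, kcob (io g) i = 0.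
Hypothesis io_deg : forall t l (g : G t), gdeg l g -> forall j, bdeg (n.*2%:Z + l) (io g j).
Hypothesis pi_io : forall t (g : G t), pi (io g) = N%:MP *: g.
Hypothesis eta_coc : forall t (z : K (t + 1)) i, kcob (eta z) i = 0.
Hypothesis eta_kbd : forall t (z : K (t + 1)) j, kbd z -> eta z j = 0.
Hypothesis pi_d : forall t (z : K t), (forall i, kcob z i = 0) -> pi (dK z) = dG (pi z).
Hypothesis io_d : forall t (g : G t), kbd (fun j => cpx_d C t (io g j) - io (dG g) j).
Hypothesis homotopy : forall t (z : K (t + 1)), (forall i, kcob z i = 0) ->
  kbd (fun j => lact N%:MP (z j)
    - (io (pi z) j + eta (dK z) j + cpx_d C t (eta z j))).

Let coc t (u : P n -> rmod (C t)) : cocycles P n (C t) u -> forall i, kcob (ev c u) i = 0.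
Proof. by have [h _ _ _] := cP (C t) n; exact: h. Qed.

Lemma pi_eq t (z z' : K t) : kbd (fun j => z j - z' j) -> pi z = pi z'.
Proof. by move=> /pi_kbd; rewrite piB => /eqP; rewrite subr_eq0 => /eqP. Qed.

Lemma pi_cls t (u v : P n -> rmod (C t)) : coboundaries P n (C t) (u - v) ->
  pi (ev c u) = pi (ev c v).
Proof. by move=> b; apply: pi_eq; have [_ h _ _] := cP (C t) n; exact: h b. Qed.

Lemma rep_cls t (u : P n -> rmod (C t)) : cocycles P n (C t) u ->
  coboundaries P n (C t) (rep (cls (cocycles P n (C t)) (coboundaries P n (C t)) u) - u).
Proof. by move=> hu; apply/(cls_eq _ (rep_mem _) hu); rewrite repK. Qed.

Lemma kbd_kdif t (z : K t) : kbd z -> kbd (dK z).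
Proof.
case: n z => [|m] z /=; first by move=> h j; rewrite h ghom0.
case=> y hy; exists (fun j => cpx_d C t (y j)) => i; rewrite hy /kcob ghom_sum.
by apply: eq_bigr => j _; rewrite ghom_sact.
Qed.

Lemma piD t (z z' : K t) : pi (fun j => z j + z' j) = pi z + pi z'.
Proof.
have := piB (fun j => z j + z' j) z'.
have -> : (fun j => z j + z' j - z' j) = z by apply/funext => j; rewrite addrK.
by move/eqP; rewrite eq_sym subr_eq => /eqP.
Qed.

Variables (t : int) (W : gmod k) (f : G (t + 1) -> W).
Hypothesis fL : forall a x y, f (a *: x + y) = a *: f x + f y.
Hypothesis fdeg : forall d x, gdeg d x -> gdeg d (f x).
Hypothesis f_ker : forall g, dG g = 0 -> (f g = 0 <-> exists g' : G t, g = dG g').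
Hypothesis f_surj : forall d w, gdeg d w -> exists g, [/\ gdeg d g, dG g = 0 & f g = w].

(** [pi] kills Koszul coboundaries and commutes with the differentials on cocycles, so it descends
    to HH. Up to the invertible factor N, [io] is its inverse and [eta] the homotopy. The map f then
    presents the cohomology of G in degree t + 1 as W. *)
Lemma giso_reduction : giso (HHH P C n (t + 1)) W.
Proof.
pose F (x : HH P n (C (t + 1))) : W := f (pi (ev c (rep x))).
have kerE (x : HH P n (C (t + 1))) : gker (HHmap P n (cpx_d C (t + 1))) x ->
    kbd (dK (ev c (rep x))).
  rewrite /= /HHmap_fun -[X in _ = X](cls0 (cocycles P n _) (coboundaries P n _)).
  move/(cls_eq _ (post_coc _ (rep_mem x)) (sm0 _)); rewrite subr0 => b.
  by have [_ h _ _] := cP (C (t + 1 + 1)) n; exact: h b.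
apply: (@giso_gsubquot k _ _ _ _ _ W F).
- move=> a x y _ _; rewrite /F -fL; congr (f _).
  have ry := rep_mem y; have rx := rep_mem x.
  rewrite (@pi_cls _ _ (a *: rep x + rep y)); last first.
    have {1}-> : a *: x + y = cls (cocycles P n _) (coboundaries P n _) (a *: rep x + rep y).
      by rewrite clsD ?clsZ ?repK //; exact: smZ.
    by apply: rep_cls; apply: smD => //; exact: smZ.
  rewrite -piZ -piD; apply: pi_eq.
  (* Scalars act on HH from the right, whereas [piZ] concerns the left action; on a cocycle the two
     differ by a coboundary. *)
  apply: kbd_eq (kbd_central a (coc rx)) => j.
  by rewrite /ev /= opprD addrACA subrr addr0.
- move=> x /kerE hx; set z := ev c (rep x).
  have zc : forall i, kcob z i = 0 by exact: (coc (rep_mem x)).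
  split=> [/(f_ker _).1|].
    case=> [|g' zg]; first by rewrite -pi_d ?pi_kbd.
    (* Since pi z = dG g', N z is cohomologous to io (dG g') + d (eta z), hence to d (io g' + eta
       z). The term eta (d z) is 0 because d z is a Koszul coboundary. *)
    pose s j := lact N^-1%:MP (io g' j + eta z j).
    have sc i : kcob s i = 0 by rewrite kcob_lact kcobD io_coc eta_coc addr0 lact0r.
    have [_ _ hcob hlift] := cP (C t) n.
    have [u [hu us _]] := hlift s sc.
    apply/gim_cpx_to; exists (cls (cocycles P n _) (coboundaries P n _) u).
    rewrite HHmap_cls // -[LHS]repK; apply/cls_eq; [exact: rep_mem | exact: post_coc |].
    have [_ _ hcob' _] := cP (C (t + 1)) n; apply: hcob'.
      by apply: smB; [exact: rep_mem | exact: post_coc].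
    have h1 := kbdB (homotopy zc) (io_d g').
    apply: kbd_eq (kbdB (kbd_lact N^-1%:MP h1) (kbd_kdif us)) => j.
    have alg (V : zmodType) (p q r v : V) : p - (q + r) - (v - q) = p - (v + r).
      by rewrite -!addrA opprB !opprD addrACA addNr add0r [- r + _]addrC.
    rewrite zg (eta_kbd j hx) addr0 alg -ghomD lactBr lactA -mpolyCM mulVf // lact1 -ghom_lact.
    by rewrite ghomB opprB addrA subrK.
  move/gim_cpx_to=> [y xy].
  have E : pi z = dG (pi (ev c (rep y))).
    rewrite -pi_d; last exact: (coc (rep_mem y)).
    apply: (@pi_cls _ (rep x) (post (cpx_d C t) (rep y))); rewrite xy.
    exact: (rep_cls (post_coc _ (rep_mem y))).
  apply/f_ker; last by exists (pi (ev c (rep y))).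
  by rewrite -pi_d ?pi_kbd.
- move=> d x _ [u [hu du ->]]; apply: fdeg; rewrite (pi_cls (rep_cls hu)).
  apply: pi_deg => j; case: du => _ _ _ u4; apply: u4; apply: ghom_deg; exact: kgen_deg.
- move=> d w hw; have [g [gd dg <-]] := f_surj hw.
  pose s j := lact N^-1%:MP (io g j).
  have sc i : kcob s i = 0 by rewrite kcob_lact io_coc lact0r.
  have [_ _ _ hlift] := cP (C (t + 1)) n.
  have [u [hu us ud]] := hlift s sc.
  exists (cls (cocycles P n _) (coboundaries P n _) u); split.
  - rewrite /= HHmapE // -[RHS](cls0 (cocycles P n _) (coboundaries P n _)).
    apply/cls_eq; [exact: post_coc | exact: sm0 | rewrite subr0].
    have [_ _ hcob _] := cP (C (t + 1 + 1)) n; apply: hcob; first exact: post_coc.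
    apply: kbd_eq (kbdD (kbd_kdif us) (kbd_lact N^-1%:MP (io_d g))) => j.
    by rewrite dg io0 subr0 ghomB -ghom_lact subrK.
  - exists u; split=> //; apply: ud => j; rewrite -[_ + d]add0r.
    by apply: bdeg_lact; [exact: pdegC | exact: io_deg].
  rewrite /F (pi_cls (rep_cls hu)) (pi_eq us) piZ pi_io scalerA -mpolyCM mulVf //.
  by rewrite scale1r.
Qed.

End Reduction.

(** * Contraction certificates in list form *)

Definition krkp (n : nat) : nat := if n is m.+1 then krk m else 0.

(** The variable z_j acts by right minus left multiplication by alpha_j; on a left free bimodule
    this is the matrix of 'X_j minus a scalar matrix. *)
Definition lzvar (M : lbim) (j : nat) : smat :=
  if j is 0 then sadd (lrho0 M) (mkseq (fun i => [:: T i (-1) 1 0]) (lrk M))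
  else sadd (lrho1 M) (mkseq (fun i => [:: T i (-1) 0 1]) (lrk M)).

Definition lkos (M : lbim) (n i j : nat) : smat :=
  match n with
  | 0 => lzvar M i
  | 1 => if j is 0 then lzvar M 1 else sscale (Zneg xH) (lzvar M 0)
  | _ => [::]
  end.

Definition lkosp (M : lbim) (n i j : nat) : smat := if n is m.+1 then lkos M m i j else [::].

Definition ssum (r : nat) (F : nat -> smat) : smat :=
  foldr (fun i A => sadd (F i) A) [::] (iota 0 r).

(* Let K^n_t be the n-th Koszul cochains of the t-th term. In degree t a certificate holds
   the generators and the differential of a complex G of free modules, blocks of maps
   kc_pi : K^n_t -> G_t and kc_io : G_t -> K^n_t, a homotopy kc_eta : K^n_(t+1) -> K^n_t and a
   Koszul contraction kc_kp : K^(n+1)_t -> K^n_t, kc_km : K^n_t -> K^(n-1)_t, with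
     N = pi io + d eta + eta d + (Koszul d) kp + km (Koszul d)
   (maps composed from left to right). Up to the Koszul boundaries given by
   kc_w : K^(n+1)_t -> G_(t+1) and kc_y : G_t -> K^(n-1)_(t+1), pi and io are chain maps.
   The integer N clears denominators. *)
Record kcert := KCert {
  kc_gen : seq Z;
  kc_dif : smat;
  kc_pi : seq smat;
  kc_io : seq smat;
  kc_eta : seq (seq smat);
  kc_kp : seq (seq smat);
  kc_km : seq (seq smat);
  kc_w : seq smat;
  kc_y : seq smat }.

Definition snth2 (s : seq (seq smat)) i j : smat := nth [::] (nth [::] s i) j.

(** The conjuncts say in turn: degrees are right; io lands in cocycles; pi io = N; pi kills
    coboundaries and eta lands in cocycles; eta kills coboundaries; pi and io are chain maps up to
    the terms from w and y; the homotopy identity holds. The last is imposed in degree t + 1, so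
    that no index t - 1 occurs. *)
Definition kcert_ok (n : nat) (N : Z) (L : lcpx) (ct : int -> kcert) (t : int) : bool :=
  let r := krk n in let r' := krk n.+1 in let r0 := krkp n in
  let M := lob L t in let M' := lob L (t + 1) in let A := ct t in let B := ct (t + 1) in
  let m := lrk M in let m' := lrk M' in
  let g := size (kc_gen A) in let g' := size (kc_gen B) in
  let d := ldif L t in let d' := ldif L (t + 1) in
  let P := nth [::] (kc_pi A) in let P' := nth [::] (kc_pi B) in
  let I := nth [::] (kc_io A) in let I' := nth [::] (kc_io B) in
  let E := snth2 (kc_eta A) in let E' := snth2 (kc_eta B) in
  let forl s (F : nat -> bool) := all F (iota 0 s) in
  [&& forl r (fun c => sdeg (Z.opp (Z.of_nat n.*2)) (lgen M) (kc_gen A) (P c)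
        && sdeg (Z.of_nat n.*2) (kc_gen A) (lgen M) (I c)),
      forl r' (fun i => szero (ssum r (fun c => smul (I c) (pad m (lkos M n i c))))),
      seqm (ssum r (fun c => smul (I c) (pad m (P c)))) (sscale N (sid 0 g)),
      forl r0 (fun j => szero (ssum r (fun c => smul (lkosp M n c j) (pad m (P c)))))
        && forl r' (fun i => forl r (fun c =>
             szero (ssum r (fun e => smul (E c e) (pad m (lkos M n i e))))))
    & [&& forl r0 (fun j => forl r (fun c =>
             szero (ssum r (fun e => smul (lkosp M' n e j) (pad m' (E e c)))))),
          forl r (fun c => seqm (smul d (pad m' (P' c)))
             (sadd (smul (P c) (pad g (kc_dif A)))
                (ssum r' (fun i => smul (lkos M n i c) (pad m (nth [::] (kc_w A) i)))))),
          forl r (fun c => seqm (smul (I c) (pad m d))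
             (sadd (smul (kc_dif A) (pad g' (I' c)))
                (ssum r0 (fun j => smul (nth [::] (kc_y A) j) (pad m' (lkosp M' n c j))))))
        & forl r (fun c => forl r (fun e => seqm
             (if c == e then sscale N (sid 0 m') else [::])
             (sadd (smul (P' c) (pad g' (I' e)))
               (sadd (sadd (smul d' (pad (lrk (lob L (t + 1 + 1))) (E' c e)))
                        (smul (E c e) (pad m d)))
                 (sadd (ssum r' (fun i => smul (lkos M' n i c)
                          (pad m' (snth2 (kc_kp B) i e))))
                   (ssum r0 (fun j => smul (snth2 (kc_km B) c j)
                          (pad m' (lkosp M' n e j)))))))))]].

Section ListReduction.
Variable k : fieldType.
Local Notation R := {mpoly k[2]}.

Lemma pad_mxs m n A : mxs k m n (pad m A) = mxs k m n A.
Proof. by apply/matrixP => i j; rewrite !mxE nth_mkseq. Qed.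

Lemma mxs_mulp m n p A B : mxs k m n A *m mxs k n p B = mxs k m p (smul A (pad n B)).
Proof. by rewrite -(pad_mxs n p B) mxs_mul ?size_mkseq. Qed.

Lemma mxs_nil m n : mxs k m n [::] = 0.
Proof. exact: szero_mxs. Qed.

Lemma mxs_ssum m n r F : mxs k m n (ssum r F) = \sum_(i < r) mxs k m n (F i).
Proof.
rewrite -(big_mkord predT (fun i => mxs k m n (F i))) /index_iota subn0 /ssum.
elim: (iota 0 r) => [|i s IH]; first by rewrite big_nil mxs_nil.
by rewrite big_cons -mxs_add IH.
Qed.

Lemma mxs_ssum0 m n r F : szero (ssum r F) -> \sum_(i < r) mxs k m n (F i) = 0.
Proof. by move=> h; rewrite -mxs_ssum szero_mxs. Qed.

Lemma forl_ord s (F : nat -> bool) : all F (iota 0 s) -> forall i : 'I_s, F i.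
Proof. by move=> /allP h i; apply: h; rewrite mem_iota; exact: ltn_ord. Qed.

Section Object.
Variables (M : lbim) (ok : lbim_ok M).
Local Notation B := (fb (mbim_of k ok)).
Local Notation rv := 'rV[R]_(lrk M).

Lemma mxs_lzvar j : mxs k (lrk M) (lrk M) (lzvar M j)
  = mxs k (lrk M) (lrk M) (if j is 0 then lrho0 M else lrho1 M)
    - (if j is 0 then 'X_0 else 'X_1)%:M.
Proof.
have h a b : mxs k (lrk M) (lrk M) (mkseq (fun i => [:: T i (-1) a b]) (lrk M))
    = - ('X_0 ^+ a * 'X_1 ^+ b)%:M.
  apply/matrixP => i l; rewrite !mxE nth_mkseq // /rev big_mkcond big_seq1 -(val_eqE i l).
  rewrite -[tcol _]/(i : nat) /=; case: eqP => _; last by rewrite oppr0.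
  by rewrite /tev /zR /= NegzE mulr1n mulN1r.
by case: j => [|j]; rewrite -mxs_add h ?expr0 ?expr1 ?mulr1 ?mul1r.
Qed.

Lemma sact_lzvar j (v : B) : sact (if j is 0 then zvar k 0 else zvar k 1) v
  = (v : rv) *m mxs k _ _ (lzvar M j) :> rv.
Proof.
rewrite mxs_lzvar mulmxBr mul_mx_scalar; case: j => [|j].
  by rewrite [LHS]sact_zvar /bD /= mevalX.
by rewrite [LHS]sact_zvar /bD /= mevalX.
Qed.

Lemma sact_kos n i j (v : B) : sact (kos k n i j) v = (v : rv) *m mxs k _ _ (lkos M n i j) :> rv.
Proof.
case: n => [|[|n]]; first exact: (sact_lzvar i v); last first.
  by rewrite mxs_nil mulmx0; exact: (@sact0 k B v).
case: j => [|j]; first exact: (sact_lzvar 1 v).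
rewrite [LHS]sactN [X in - X](sact_lzvar 0 v) -mxs_scale.
have -> : zR k (Zneg xH) = -1 by rewrite /zR /= NegzE.
by rewrite scaleN1r mulmxN.
Qed.

Lemma kcob_lkos n (z : 'I_(krk n) -> B) i :
  kcob z i = \sum_(c < krk n) (z c : rv) *m mxs k _ _ (lkos M n i c) :> rv.
Proof. by apply: eq_bigr => c _; exact: sact_kos. Qed.

Lemma kbd_lkos n (z : 'I_(krk n) -> B) : kbd z <-> exists y : 'I_(krkp n) -> rv,
  forall c, z c = \sum_(j < krkp n) y j *m mxs k _ _ (lkosp M n c j) :> rv.
Proof.
case: n z => [|n] z /=; split.
- by move=> h; exists (fun=> 0) => c; rewrite big_ord0; exact: h.
- by case=> y h c; rewrite h big_ord0.
- by case=> y h; exists y => c; rewrite h kcob_lkos.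
by case=> y h; exists y => c; rewrite h kcob_lkos.
Qed.

End Object.

Section Certificate.
Variables (P : resolution k) (c : forall n, ghom (koszul k n) (P n)).
Hypothesis cP : koszul_model c.
Variables (n : nat) (N : Z) (L : lcpx) (okL : forall t, lcpx_ok L t) (ct : int -> kcert).
Hypothesis ok : forall t, kcert_ok n N L ct t.
Hypothesis N0 : (int_of_Z N)%:~R != 0 :> k.
Local Notation m t := (lrk (lob L t)).
Local Notation gn t := (size (kc_gen (ct t))).
Local Notation C := (lcpx_cpx k okL).
Local Notation rv t := 'rV[R]_(m t).
Local Notation Pm t c := (mxs k (m t) (gn t) (nth [::] (kc_pi (ct t)) c)).
Local Notation Im t c := (mxs k (gn t) (m t) (nth [::] (kc_io (ct t)) c)).
Local Notation Em t c e := (mxs k (m (t + 1)) (m t) (snth2 (kc_eta (ct t)) c e)).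
Local Notation dm t := (mxs k (m t) (m (t + 1)) (ldif L t)).
Local Notation Gm t := (mxs k (gn t) (gn (t + 1)) (kc_dif (ct t))).
Local Notation Dm t i c := (mxs k (m t) (m t) (lkos (lob L t) n i c)).
Local Notation Dpm t i c := (mxs k (m t) (m t) (lkosp (lob L t) n i c)).
Local Notation K t := ('I_(krk n) -> C t).

Definition lG (t : int) : gmod k := grow k (@zgen (kc_gen (ct t))).

Definition ldG t (g : lG t) : lG (t + 1) := (g : 'rV[R]_(gn t)) *m Gm t.
Definition lpi t (z : K t) : lG t := \sum_(c < krk n) (z c : rv t) *m Pm t c.
Definition lio t (g : lG t) : K t := fun c => (g : 'rV[R]_(gn t)) *m Im t c.
Definition leta t (z : K (t + 1)) : K t :=
  fun e => \sum_(c < krk n) (z c : rv (t + 1)) *m Em t c e : rv t.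

Lemma lpiB t (z z' : K t) : lpi (fun j => z j - z' j) = lpi z - lpi z'.
Proof. by rewrite /lpi -sumrB; apply: eq_bigr => j _; rewrite mulmxBl. Qed.

Lemma lpiZ t a (z : K t) : lpi (fun j => lact a (z j)) = a *: lpi z.
Proof. by rewrite /lpi scaler_sumr; apply: eq_bigr => j _; rewrite scalemxAl. Qed.

Lemma lpi_deg t l (z : K t) : (forall j, bdeg (n.*2%:Z + l) (z j)) -> gdeg l (lpi z).
Proof.
move=> hz; apply: (homog_sum (@row_deg0 _ _ (pdeg_grading k) _ _) (@row_degB _ _ (pdeg_grading k) _ _)) => e.
case/and5P: (ok t) => /forl_ord/(_ e)/andP[/(@sdeg_mxs k) dP _] _ _ _ _.
have E : int_of_Z (Z.opp (Z.of_nat n.*2)) = - n.*2%:Z.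
  by apply: (can_inj Z_of_intK); rewrite int_of_ZK raddfN.
by have := rvdeg_mul dP (hz e); rewrite E [n.*2%:Z + l]addrC addrK.
Qed.

Lemma lio_deg t l (g : lG t) : gdeg l g -> forall j, bdeg (n.*2%:Z + l) (lio g j).
Proof.
move=> hg e; case/and5P: (ok t) => /forl_ord/(_ e)/andP[_ /(@sdeg_mxs k) dI] _ _ _ _.
by have := rvdeg_mul dI hg; rewrite -[Z.of_nat _]/(Z_of_int n.*2) Z_of_intK [l + _]addrC.
Qed.

Lemma lpi_kbd t (z : K t) : kbd z -> lpi z = 0.
Proof.
move=> /(@kbd_lkos _ (lob_ok okL t))[y hy]; rewrite /lpi.
under eq_bigr do rewrite hy mulmx_suml.
rewrite exchange_big big1 // => j _; under eq_bigr do rewrite -mulmxA mxs_mulp.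
case/and5P: (ok t) => _ _ _ /andP[/forl_ord/(_ j) h _] _.
by rewrite -mulmx_sumr (mxs_ssum0 _ _ h) mulmx0.
Qed.

Lemma lio0 t j : lio (0 : lG t) j = 0.
Proof. exact: mul0mx. Qed.

Lemma lio_coc t (g : lG t) i : kcob (lio g) i = 0.
Proof.
rewrite [LHS](@kcob_lkos _ (lob_ok okL t)); under eq_bigr do rewrite -mulmxA mxs_mulp.
case/and5P: (ok t) => _ /forl_ord/(_ i) h _ _ _.
by rewrite -mulmx_sumr (mxs_ssum0 _ _ h) mulmx0.
Qed.

Lemma scale_sid_mxs r : mxs k r r (sscale N (sid 0 r)) = (zR k N)%:M.
Proof. by rewrite -mxs_scale sid_mxs scalemx1. Qed.

Lemma lpi_io t (g : lG t) : lpi (lio g) = (int_of_Z N)%:~R%:MP *: g.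
Proof.
rewrite /lpi /lio; under eq_bigr do rewrite -mulmxA mxs_mulp.
case/and5P: (ok t) => _ _ h _ _.
rewrite -mulmx_sumr -(mxs_ssum _ _ _ (fun c => smul (nth [::] (kc_io (ct t)) c) (pad (m t) (nth [::] (kc_pi (ct t)) c)))) (seqm_mxs _ _ _ h) scale_sid_mxs mul_mx_scalar.
by rewrite rmorph_int.
Qed.

Lemma leta_coc t (z : K (t + 1)) i : kcob (leta z) i = 0.
Proof.
rewrite [LHS](@kcob_lkos _ (lob_ok okL t)); under eq_bigr do rewrite mulmx_suml.
rewrite exchange_big big1 // => j _; under eq_bigr do rewrite -mulmxA mxs_mulp.
case/and5P: (ok t) => _ _ _ /andP[_ /forl_ord/(_ i)/forl_ord/(_ j) h] _.
by rewrite -mulmx_sumr (mxs_ssum0 _ _ h) mulmx0.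
Qed.

Lemma leta_kbd t (z : K (t + 1)) j : kbd z -> leta z j = 0.
Proof.
move=> /(@kbd_lkos _ (lob_ok okL (t + 1)))[y hy]; rewrite /leta.
under eq_bigr do rewrite hy mulmx_suml.
rewrite exchange_big big1 // => i _; under eq_bigr do rewrite -mulmxA mxs_mulp.
case/and5P: (ok t) => _ _ _ _ /and4P[/forl_ord/(_ i)/forl_ord/(_ j) h _ _ _].
by rewrite -mulmx_sumr (mxs_ssum0 _ _ h) mulmx0.
Qed.

(** Whatever factors through the Koszul coboundary vanishes on cocycles; this disposes of the terms
    with [kc_w] and [kc_kp]. *)
Lemma lkcob_mul t (z : K t) p (A : nat -> smat) : (forall i, kcob z i = 0) ->
  \sum_(c < krk n) (z c : rv t) *m (\sum_(i < krk n.+1) mxs k (m t) p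
    (smul (lkos (lob L t) n i c) (pad (m t) (A i)))) = 0.
Proof.
move=> hz; under eq_bigr do rewrite mulmx_sumr.
rewrite exchange_big big1 // => i _; under eq_bigr do rewrite -mxs_mulp mulmxA.
by rewrite -mulmx_suml -(@kcob_lkos _ (lob_ok okL t)) hz mul0mx.
Qed.

Lemma lpi_d t (z : K t) : (forall i, kcob z i = 0) ->
  lpi (fun j => cpx_d C t (z j)) = ldG (lpi z).
Proof.
move=> hz; rewrite /lpi /ldG mulmx_suml /=.
transitivity (\sum_(c < krk n) ((z c : rv t) *m Pm t c *m Gm t
  + (z c : rv t) *m (\sum_(i < krk n.+1) mxs k (m t) (gn (t + 1))
      (smul (lkos (lob L t) n i c) (pad (m t) (nth [::] (kc_w (ct t)) i)))))).
  apply: eq_bigr => c0 _; rewrite -!mulmxA -mulmxDr !mxs_mulp; congr (_ *m _).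
  case/and5P: (ok t) => _ _ _ _ /and4P[_ /forl_ord/(_ c0) h _ _].
  by rewrite (seqm_mxs _ _ _ h) -mxs_add mxs_ssum.
rewrite big_split /= -[RHS]addr0; congr (_ + _).
exact: (@lkcob_mul t z _ (nth [::] (kc_w (ct t)))).
Qed.

Lemma lio_d t (g : lG t) : kbd (fun j => cpx_d C t (lio g j) - lio (ldG g) j).
Proof.
apply/(@kbd_lkos _ (lob_ok okL (t + 1))).
exists (fun j => (g : 'rV[R]_(gn t)) *m mxs k _ _ (nth [::] (kc_y (ct t)) j)) => e.
rewrite /lio /ldG /= -!mulmxA -mulmxBr !mxs_mulp.
case/and5P: (ok t) => _ _ _ _ /and4P[_ _ /forl_ord/(_ e) h _].
rewrite (seqm_mxs _ _ _ h) -mxs_add addrAC subrr add0r mxs_ssum mulmx_sumr.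
by apply: eq_bigr => j _; rewrite -mulmxA mxs_mulp.
Qed.

(** Once the [kc_kp] terms have vanished on the cocycle z, the remaining discrepancy is the [kc_km]
    term, which is a Koszul coboundary. *)
Lemma lhomotopy t (z : K (t + 1)) : (forall i, kcob z i = 0) ->
  kbd (fun j => lact (int_of_Z N)%:~R%:MP (z j)
    - (lio (lpi z) j + leta (fun j => cpx_d C (t + 1) (z j)) j + cpx_d C t (leta z j))).
Proof.
move=> hz; apply/(@kbd_lkos _ (lob_ok okL (t + 1))).
exists (fun j => \sum_(c < krk n) (z c : rv (t + 1))
  *m mxs k _ _ (snth2 (kc_km (ct (t + 1))) c j)) => e.
have E1 : lact (int_of_Z N)%:~R%:MP (z e)
    = \sum_(c < krk n) (z c : rv (t + 1)) *m mxs k (m (t + 1)) (m (t + 1))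
        (if (c : nat) == e then sscale N (sid 0 (m (t + 1))) else [::]) :> rv (t + 1).
  rewrite (bigD1 e) //= eqxx big1 => [|i]; last first.
    by rewrite -val_eqE /= => /negbTE ->; rewrite mxs_nil mulmx0.
  by rewrite scale_sid_mxs mul_mx_scalar addr0 rmorph_int.
rewrite [X in X - _]E1.
rewrite (eq_bigr (fun c0 : 'I_(krk n) => (z c0 : rv (t + 1)) *m Pm (t + 1) c0 *m Im (t + 1) e
   + (((z c0 : rv (t + 1)) *m dm (t + 1) *m Em (t + 1) c0 e
   + (z c0 : rv (t + 1)) *m Em t c0 e *m dm t)
   + ((z c0 : rv (t + 1)) *m (\sum_(i < krk n.+1) mxs k (m (t + 1)) (m (t + 1))
       (smul (lkos (lob L (t + 1)) n i c0)
         (pad (m (t + 1)) (snth2 (kc_kp (ct (t + 1))) i e))))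
   + \sum_(j < krkp n) (z c0 : rv (t + 1)) *m mxs k (m (t + 1)) (m (t + 1)) (snth2 (kc_km (ct (t + 1))) c0 j)
        *m Dpm (t + 1) e j)))); last first.
  move=> c0 _.
  case/and5P: (ok t) => _ _ _ _ /and4P[_ _ _ /forl_ord/(_ c0)/forl_ord/(_ e) h].
  rewrite (seqm_mxs _ _ _ h) -!mxs_add !mxs_ssum -!mulmxA !mxs_mulp !mulmxDr; congr (_ + (_ + (_ + _))).
  rewrite mulmx_sumr; apply: eq_bigr => j _; by rewrite -mulmxA mxs_mulp.
rewrite !big_split /= (@lkcob_mul (t + 1) z _ (fun i => snth2 (kc_kp (ct (t + 1))) i e)) // add0r.
have alg (V : zmodType) (p q r v : V) : p + ((q + r) + v) - (p + q + r) = v.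
  by rewrite !addrA [X in X - _]addrC addrK.
rewrite /lio /lpi /leta /= !mulmx_suml alg exchange_big.
by apply: eq_bigr => j _; rewrite mulmx_suml.
Qed.

(** The degree j, the generators and the differentials are given through equations so that literals
    can be used: [size] of a literal list then computes, and a concrete j need not be syntactically
    of the form t + 1. *)
Lemma giso_kcert (t j : int) (W : gmod k) (g0 g1 g2 : seq Z) (d0 d1 : smat)
    (f : 'rV[R]_(size g1) -> W) :
  j = t + 1 -> kc_gen (ct t) = g0 -> kc_gen (ct j) = g1 -> kc_gen (ct (j + 1)) = g2 ->
  kc_dif (ct t) = d0 -> kc_dif (ct j) = d1 ->
  (forall a x y, f (a *: x + y) = a *: f x + f y) ->
  (forall d x, rvdeg (@zgen g1) d x -> gdeg d (f x)) ->
  (forall v, v *m mxs k _ (size g2) d1 = 0 ->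
    (f v = 0 <-> exists u, v = u *m mxs k (size g0) _ d0)) ->
  (forall d w, gdeg d w -> exists v, [/\ rvdeg (@zgen g1) d v,
    v *m mxs k _ (size g2) d1 = 0 & f v = w]) ->
  giso (HHH P C n j) W.
Proof.
move=> jE; subst j => e0 e1 e2 e3 e4; subst g0 g1 g2 d0 d1 => fL fd fk fs.
exact: (@giso_reduction k P c cP C n lG ldG _ lpi lio leta N0 lpiB lpiZ lpi_deg
  lpi_kbd lio0 lio_coc lio_deg lpi_io leta_coc leta_kbd lpi_d lio_d lhomotopy t W f fL fd fk fs).
Qed.

Lemma gtrivial_kcert (t j : int) (g0 g1 g2 : seq Z) (d0 d1 : smat) :
  j = t + 1 -> kc_gen (ct t) = g0 -> kc_gen (ct j) = g1 -> kc_gen (ct (j + 1)) = g2 ->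
  kc_dif (ct t) = d0 -> kc_dif (ct j) = d1 ->
  (forall v : 'rV[R]_(size g1), v *m mxs k _ (size g2) d1 = 0 ->
    exists u, v = u *m mxs k (size g0) _ d0) ->
  gtrivial (HHH P C n j).
Proof.
move=> jE e0 e1 e2 e3 e4 ex; pose W : gmod k := grow k (fun _ : 'I_0 => 0).
have W0 : gtrivial W by move=> x; exact: thinmx0.
suff h : giso (HHH P C n j) W by exact: giso_gtrivial h W0.
apply: (giso_kcert (f := fun _ => 0 : W) jE e0 e1 e2 e3 e4) => [a x y|d x _|v hv|d w _].
- by rewrite scaler0 addr0.
- exact: (gr0 (gdeg_grading W)).
- by split=> // _; exact: ex.
exists 0; split; [exact: (@row_deg0 _ _ (pdeg_grading k)) | exact: mul0mx | by rewrite [w]W0].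
Qed.

End Certificate.

End ListReduction.

Arguments KCert kc_gen%_Z_scope kc_dif kc_pi kc_io kc_eta kc_kp kc_km kc_w kc_y.

(* The entries below were found by Gaussian elimination over the rationals. *)
Definition kcert0 : seq kcert := [::
  KCert [:: 0] [::] ([:: [:: [::]; [::]; [::]; [::]; [::]; [:: T 0 9 0 0]]]) ([:: [:: [:: T 5 1 0
  0]]]) [::] ([:: [:: [:: [::]; [:: T 0 (-9) 0 0]; [::]; [:: T 0 (-3) 0 1; T 0 (-6) 1 0; T 1 3 0
  0; T 2 3 0 0]; [:: T 0 (-3) 0 1; T 0 (-6) 1 0; T 1 3 0 0; T 2 (-6) 0 0]; [:: T 0 1 0 2; T 0
  (-2) 1 1; T 0 (-8) 2 0; T 1 (-1) 0 1; T 1 4 1 0; T 2 (-1) 0 1; T 2 (-8) 1 0; T 3 3 0 0; T 4 6 0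
  0]]]; [:: [:: [::]; [::]; [::]; [::]; [::]; [:: T 0 2 0 2; T 0 2 1 1; T 0 (-4) 2 0; T 1 (-2) 0
  1; T 1 2 1 0; T 2 (-2) 0 1; T 2 (-4) 1 0; T 3 6 0 0; T 4 3 0 0]]]]) [::] [::] [::];
  KCert [::] [::] [::] [::] [::] ([:: [:: [:: [::]; [:: T 0 (-9) 0 0]; [::]; [:: T 0 (-3) 0 1; T
  0 (-6) 1 0; T 1 3 0 0; T 2 3 0 0]; [:: T 0 (-3) 0 1; T 0 (-6) 1 0; T 1 3 0 0; T 2 (-6) 0 0];
  [:: T 0 1 0 2; T 0 (-2) 1 1; T 0 (-8) 2 0; T 1 (-1) 0 1; T 1 4 1 0; T 2 (-1) 0 1; T 2 (-8) 1 0;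
  T 3 3 0 0; T 4 6 0 0]; [::]; [:: T 6 (-9) 0 0]; [::]; [:: T 6 (-3) 0 1; T 6 (-6) 1 0; T 7 3 0
  0; T 8 3 0 0]; [:: T 6 (-3) 0 1; T 6 (-6) 1 0; T 7 3 0 0; T 8 (-6) 0 0]; [:: T 6 1 0 2; T 6
  (-2) 1 1; T 6 (-8) 2 0; T 7 (-1) 0 1; T 7 4 1 0; T 8 (-1) 0 1; T 8 (-8) 1 0; T 9 3 0 0; T 10 6
  0 0]]]; [:: [:: [::]; [::]; [::]; [::]; [::]; [:: T 0 2 0 2; T 0 2 1 1; T 0 (-4) 2 0; T 1 (-2)
  0 1; T 1 2 1 0; T 2 (-2) 0 1; T 2 (-4) 1 0; T 3 6 0 0; T 4 3 0 0]; [::]; [::]; [::]; [::];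
  [::]; [:: T 6 2 0 2; T 6 2 1 1; T 6 (-4) 2 0; T 7 (-2) 0 1; T 7 2 1 0; T 8 (-2) 0 1; T 8 (-4) 1
  0; T 9 6 0 0; T 10 3 0 0]]]]) [::] ([:: [:: [::]; [::]; [::]; [::]; [::]; [:: T 0 (-3) 0 0];
  [::]; [::]; [::]; [::]; [::]; [:: T 0 (-6) 0 0]]; [:: [::]; [::]; [::]; [::]; [::]; [:: T 0
  (-6) 0 0]; [::]; [::]; [::]; [::]; [::]; [:: T 0 (-3) 0 0]]]) [::];
  KCert [::] [::] [::] [::] ([:: [:: [:: [::]; [::]; [::]; [::]; [::]; [:: T 1 (-9) 0 0]; [::];
  [::]; [::]; [::]; [::]; [:: T 9 (-9) 0 0]]]]) ([:: [:: [:: [::]; [::]; [::]; [:: T 2 (-9) 0 0];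
  [::]; [:: T 2 (-3) 0 1; T 2 (-6) 1 0; T 3 3 0 0; T 4 3 0 0]; [:: T 2 (-3) 0 1; T 2 (-6) 1 0; T
  3 3 0 0; T 4 (-6) 0 0]; [:: T 1 (-3) 0 0; T 2 1 0 2; T 2 (-2) 1 1; T 2 (-8) 2 0; T 3 (-1) 0 1;
  T 3 4 1 0; T 4 (-1) 0 1; T 4 (-8) 1 0; T 5 3 0 0; T 6 6 0 0; T 9 (-3) 0 0]; [::]; [:: T 8 (-9)
  0 0]; [::]; [:: T 10 (-9) 0 0]; [::]; [:: T 10 (-3) 0 1; T 10 (-6) 1 0; T 11 3 0 0; T 12 3 0
  0]; [:: T 10 (-3) 0 1; T 10 (-6) 1 0; T 11 3 0 0; T 12 (-6) 0 0]; [:: T 1 (-6) 0 0; T 9 3 0 0;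
  T 10 1 0 2; T 10 (-2) 1 1; T 10 (-8) 2 0; T 11 (-1) 0 1; T 11 4 1 0; T 12 (-1) 0 1; T 12 (-8) 1
  0; T 13 3 0 0; T 14 6 0 0]]]; [:: [:: [::]; [:: T 0 (-9) 0 0]; [::]; [::]; [::]; [::]; [::];
  [:: T 1 (-6) 0 0; T 2 2 0 2; T 2 2 1 1; T 2 (-4) 2 0; T 3 (-2) 0 1; T 3 2 1 0; T 4 (-2) 0 1; T
  4 (-4) 1 0; T 5 6 0 0; T 6 3 0 0; T 9 3 0 0]; [::]; [::]; [::]; [::]; [::]; [::]; [::]; [:: T 1
  (-3) 0 0; T 9 6 0 0; T 10 2 0 2; T 10 2 1 1; T 10 (-4) 2 0; T 11 (-2) 0 1; T 11 2 1 0; T 12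
  (-2) 0 1; T 12 (-4) 1 0; T 13 6 0 0; T 14 3 0 0]]]]) [::] [::] [::];
  KCert [::] [::] [::] [::] ([:: [:: [:: [::]; [::]; [::]; [::]; [::]; [::]; [::]; [:: T 3 9 0
  0]; [::]; [::]; [::]; [::]; [::]; [::]; [::]; [:: T 3 9 0 0; T 7 9 0 0]]]]) ([:: [:: [:: [::];
  [:: T 0 9 0 0]; [::]; [:: T 0 12 1 0; T 1 6 0 0; T 2 3 0 0]; [::]; [:: T 4 9 0 0]; [::]; [:: T
  4 (-3) 0 1; T 5 3 0 0; T 6 6 0 0]; [::]; [:: T 8 (-9) 0 0]; [::]; [:: T 8 (-3) 0 1; T 8 (-6) 1
  0; T 9 3 0 0; T 10 3 0 0]; [:: T 8 (-3) 0 1; T 8 (-6) 1 0; T 9 3 0 0; T 10 (-6) 0 0]; [:: T 3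
  (-3) 0 0; T 7 (-3) 0 0; T 8 1 0 2; T 8 (-2) 1 1; T 8 (-8) 2 0; T 9 (-1) 0 1; T 9 4 1 0; T 10
  (-1) 0 1; T 10 (-8) 1 0; T 11 3 0 0; T 12 6 0 0]]]; [:: [:: [::]; [::]; [::]; [:: T 0 6 1 0; T
  1 3 0 0; T 2 6 0 0]; [::]; [::]; [::]; [:: T 4 (-6) 0 1; T 5 6 0 0; T 6 3 0 0]; [::]; [::];
  [::]; [::]; [::]; [:: T 3 3 0 0; T 7 3 0 0; T 8 2 0 2; T 8 2 1 1; T 8 (-4) 2 0; T 9 (-2) 0 1; T
  9 2 1 0; T 10 (-2) 0 1; T 10 (-4) 1 0; T 11 6 0 0; T 12 3 0 0]]]]) [::] [::] [::];
  KCert [::] [::] [::] [::] ([:: [:: [:: [::]; [::]; [::]; [::]; [::]; [::]; [::]; [::]; [::];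
  [::]; [::]; [::]; [::]; [:: T 3 (-9) 0 0]]]]) ([:: [:: [:: [::]; [:: T 0 9 0 0]; [::]; [:: T 0
  12 1 0; T 1 6 0 0; T 2 3 0 0]; [::]; [:: T 4 9 0 0]; [::]; [:: T 4 (-3) 0 1; T 5 3 0 0; T 6 6 0
  0]]]; [:: [:: [::]; [::]; [::]; [:: T 0 6 1 0; T 1 3 0 0; T 2 6 0 0]; [::]; [::]; [::]; [:: T 4
  (-6) 0 1; T 5 6 0 0; T 6 3 0 0]]]]) [::] [::] [::];
  KCert [::] [::] [::] [::] ([:: [:: [:: [::]; [::]; [::]; [::]; [::]; [::]; [::]; [:: T 3 9 0
  0]]]]) ([:: [:: [:: [::]; [::]; [::]; [:: T 2 (-9) 0 0]]]; [:: [:: [::]; [:: T 0 (-9) 0 0]]]])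
  [::] [::] [::];
  KCert [::] [::] [::] [::] ([:: [:: [:: [::]; [:: T 0 9 0 0]]]]) [::] [::] [::] [::]].

Definition kcert1 : seq kcert := [::
  KCert [:: (-6); (-4)] [::] ([:: [:: [::]; [:: T 0 (-9) 0 0]; [::]; [:: T 0 3 0 1; T 0 (-3) 1 0;
  T 1 (-9) 0 0]; [:: T 0 (-15) 0 1; T 0 (-12) 1 0; T 1 9 0 0]; [:: T 0 (-1) 0 2; T 0 (-19) 1 1; T
  0 (-16) 2 0; T 1 3 0 1; T 1 6 1 0]]; [:: [::]; [::]; [:: T 0 9 0 0]; [::]; [:: T 1 9 0 0]; [::
  T 0 (-2) 0 2; T 0 (-8) 1 1; T 0 (-8) 2 0; T 1 6 0 1; T 1 3 1 0]]]) ([:: [:: [:: T 0 3 0 1; T 0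
  6 1 0; T 2 (-9) 0 0]; [:: T 0 4 0 2; T 0 10 1 1; T 0 4 2 0; T 2 (-6) 0 1; T 2 (-12) 1 0]]; [::
  [:: T 0 3 0 1; T 0 6 1 0; T 1 (-9) 0 0; T 2 9 0 0]; [:: T 0 4 0 2; T 0 10 1 1; T 0 4 2 0; T 1
  (-12) 0 1; T 1 (-6) 1 0; T 3 18 0 0; T 4 9 0 0]]]) [::] ([:: [:: [:: [::]; [:: T 0 54 0 0]; [::
  T 0 27 0 0]; [:: T 0 18 0 1; T 0 63 1 0; T 2 (-27) 0 0]; [:: T 0 18 0 1; T 0 (-18) 1 0; T 2 54
  0 0]; [:: T 0 18 0 2; T 0 63 1 1; T 2 (-27) 0 1]]; [:: [::]; [:: T 0 (-27) 0 0]; [:: T 0 (-54)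
  0 0]; [:: T 0 18 0 1; T 0 (-18) 1 0; T 1 (-54) 0 0]; [:: T 0 (-63) 0 1; T 0 (-18) 1 0; T 1 27 0
  0]; [:: T 0 18 0 2; T 0 (-18) 1 1; T 1 (-54) 0 1; T 3 81 0 0]]]]) ([:: [:: [:: [::]; [:: T 0
  (-81) 0 0]; [::]; [:: T 0 (-27) 0 1; T 0 (-54) 1 0; T 1 27 0 0; T 2 27 0 0]; [:: T 0 (-27) 0 1;
  T 0 (-54) 1 0; T 1 27 0 0; T 2 (-54) 0 0]; [:: T 0 9 0 2; T 0 (-18) 1 1; T 0 (-72) 2 0; T 1
  (-9) 0 1; T 1 36 1 0; T 2 (-9) 0 1; T 2 (-72) 1 0; T 3 27 0 0; T 4 54 0 0]]]; [:: [:: [::];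
  [::]; [::]; [::]; [::]; [:: T 0 18 0 2; T 0 18 1 1; T 0 (-36) 2 0; T 1 (-18) 0 1; T 1 18 1 0; T
  2 (-18) 0 1; T 2 (-36) 1 0; T 3 54 0 0; T 4 27 0 0]]]]) [::] [::];
  KCert [:: (-4); (-4)] [::] ([:: [:: [::]; [:: T 0 (-9) 0 0]; [::]; [:: T 0 (-27) 0 1; T 0 (-27)
  1 0]; [:: T 0 15 0 1; T 0 12 1 0]; [:: T 0 9 0 2; T 0 9 1 1]; [::]; [:: T 1 9 0 0]; [::]; [::];
  [:: T 1 12 0 1; T 1 15 1 0]; [:: T 1 18 1 1; T 1 18 2 0]]; [:: [::]; [::]; [:: T 0 9 0 0];
  [::]; [:: T 0 30 0 1; T 0 24 1 0]; [:: T 0 18 0 2; T 0 18 1 1]; [::]; [::]; [:: T 1 (-9) 0 0];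
  [::]; [:: T 1 (-3) 0 1; T 1 3 1 0]; [:: T 1 9 1 1; T 1 9 2 0]]]) ([:: [:: [:: T 0 3 0 1; T 0 6
  1 0; T 2 (-9) 0 0]; [:: T 6 (-3) 0 1; T 6 (-6) 1 0; T 8 9 0 0]]; [:: [:: T 0 3 0 1; T 0 6 1 0;
  T 1 (-9) 0 0; T 2 9 0 0]; [:: T 6 (-3) 0 1; T 6 (-6) 1 0; T 7 9 0 0; T 8 (-9) 0 0]]]) [::] ([::
  [:: [:: [::]; [:: T 0 54 0 0]; [:: T 0 27 0 0]; [:: T 0 18 0 1; T 0 63 1 0; T 2 (-27) 0 0]; [::
  T 0 18 0 1; T 0 (-18) 1 0; T 2 54 0 0]; [:: T 0 18 0 2; T 0 63 1 1; T 2 (-27) 0 1]; [::]; [:: T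
  6 54 0 0]; [:: T 6 27 0 0]; [:: T 6 18 0 1; T 6 63 1 0; T 8 (-27) 0 0]; [:: T 6 18 0 1; T 6
  (-18) 1 0; T 8 54 0 0]; [:: T 6 18 0 2; T 6 63 1 1; T 8 (-27) 0 1]]; [:: [::]; [:: T 0 (-27) 0
  0]; [:: T 0 (-54) 0 0]; [:: T 0 18 0 1; T 0 (-18) 1 0; T 1 (-54) 0 0]; [:: T 0 (-63) 0 1; T 0
  (-18) 1 0; T 1 27 0 0]; [:: T 0 18 0 2; T 0 (-18) 1 1; T 1 (-54) 0 1; T 3 81 0 0]; [::]; [:: T
  6 (-27) 0 0]; [:: T 6 (-54) 0 0]; [:: T 6 18 0 1; T 6 (-18) 1 0; T 7 (-54) 0 0]; [:: T 6 (-63)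
  0 1; T 6 (-18) 1 0; T 7 27 0 0]; [:: T 6 18 0 2; T 6 (-18) 1 1; T 7 (-54) 0 1; T 9 81 0 0]]]])
  ([:: [:: [:: [::]; [:: T 0 (-81) 0 0]; [::]; [:: T 0 (-81) 0 1; T 0 (-162) 1 0; T 1 81 0 0; T 2
  (-81) 0 0]; [:: T 0 27 0 1; T 0 54 1 0; T 1 (-27) 0 0; T 2 54 0 0]; [:: T 0 27 0 2; T 0 54 1 1;
  T 1 (-27) 0 1; T 2 27 0 1; T 3 27 0 0; T 4 54 0 0]; [::]; [:: T 6 (-81) 0 0]; [::]; [::]; [:: T
  6 (-54) 0 1; T 6 (-108) 1 0; T 7 54 0 0; T 8 (-27) 0 0]; [:: T 6 (-54) 1 1; T 6 (-108) 2 0; T 7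
  54 1 0; T 8 (-54) 1 0; T 9 27 0 0; T 10 54 0 0]]]; [:: [:: [::]; [::]; [::]; [::]; [:: T 0 54 0
  1; T 0 108 1 0; T 1 (-54) 0 0; T 2 108 0 0]; [:: T 0 54 0 2; T 0 108 1 1; T 1 (-54) 0 1; T 2 54
  0 1; T 3 54 0 0; T 4 27 0 0]; [::]; [::]; [::]; [::]; [:: T 6 (-27) 0 1; T 6 (-54) 1 0; T 7 27
  0 0; T 8 27 0 0]; [:: T 6 (-27) 1 1; T 6 (-54) 2 0; T 7 27 1 0; T 8 (-27) 1 0; T 9 54 0 0; T 10
  27 0 0]]]]) ([:: [:: [::]; [:: T 0 6 0 0]; [:: T 0 3 0 0]; [:: T 0 (-2) 0 1; T 0 2 1 0; T 1 6 0
  0]; [:: T 0 10 0 1; T 0 8 1 0; T 1 (-3) 0 0]; [:: T 0 10 1 1; T 0 8 2 0; T 1 (-3) 1 0]; [::];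
  [:: T 0 3 0 0]; [:: T 0 6 0 0]; [:: T 0 (-1) 0 1; T 0 1 1 0; T 1 3 0 0]; [:: T 0 5 0 1; T 0 4 1
  0; T 1 3 0 0]; [:: T 0 (-1) 0 2; T 0 1 1 1; T 1 3 0 1]]]) ([:: [:: [:: T 0 (-3) 0 1; T 0 (-6) 1
  0; T 1 6 0 0; T 2 (-3) 0 0]; [:: T 0 3 0 1; T 0 6 1 0; T 1 (-3) 0 0; T 2 (-3) 0 0]]]);
  KCert [:: (-2); 0; (-2)] ([:: [:: T 0 1 0 1; T 1 (-1) 1 0]; [:: T 1 1 1 1; T 1 1 2 0]]) ([::
  [:: [::]; [:: T 0 (-9) 0 1; T 0 (-9) 1 0; T 1 (-9) 0 0]; [::]; [:: T 0 9 0 0]; [::]; [:: T 0 27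
  0 1; T 0 27 1 0; T 1 27 0 0]; [:: T 0 (-15) 0 1; T 0 (-12) 1 0; T 1 (-27) 0 0]; [:: T 0 (-9) 0
  2; T 0 (-9) 1 1; T 1 (-9) 0 1; T 1 (-18) 1 0]; [::]; [:: T 1 (-18) 0 0]; [::]; [:: T 2 (-9) 0
  0]; [::]; [:: T 2 (-18) 0 1; T 2 (-18) 1 0]; [:: T 2 6 0 1; T 2 3 1 0]; [:: T 2 6 0 2; T 2 (-6)
  2 0]]; [:: [::]; [:: T 0 (-18) 0 1; T 0 (-18) 1 0; T 1 (-18) 0 0]; [::]; [::]; [:: T 0 (-9) 0
  0]; [::]; [:: T 0 (-30) 0 1; T 0 (-24) 1 0; T 1 (-27) 0 0]; [:: T 0 (-18) 0 2; T 0 (-18) 1 1; T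
  1 (-18) 0 1; T 1 (-9) 1 0]; [::]; [:: T 1 (-9) 0 0]; [::]; [::]; [:: T 2 9 0 0]; [::]; [:: T 2
  21 0 1; T 2 15 1 0]; [:: T 2 12 0 2; T 2 9 1 1; T 2 (-3) 2 0]]]) ([:: [:: [:: T 2 (-3) 0 1; T 2
  (-6) 1 0; T 4 9 0 0]; [:: T 0 6 0 1; T 0 12 1 0; T 1 (-9) 0 0; T 2 3 0 2; T 2 9 1 1; T 2 6 2 0;
  T 4 (-9) 0 1; T 4 (-9) 1 0]; [:: T 10 3 0 1; T 10 6 1 0; T 12 (-9) 0 0]]; [:: [:: T 2 (-3) 0 1;
  T 2 (-6) 1 0; T 3 9 0 0; T 4 (-9) 0 0]; [:: T 0 (-3) 0 1; T 0 (-6) 1 0; T 2 3 0 2; T 2 9 1 1; T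
  2 6 2 0; T 3 (-9) 0 1; T 3 (-9) 1 0; T 4 9 0 1; T 4 9 1 0]; [:: T 10 3 0 1; T 10 6 1 0; T 11
  (-9) 0 0; T 12 9 0 0]]]) ([:: [:: [:: [::]; [::]; [::]; [:: T 0 162 0 0]; [:: T 0 (-162) 0 0];
  [:: T 0 (-54) 0 1; T 0 (-108) 1 0]; [::]; [::]; [::]; [:: T 8 (-81) 0 0]; [:: T 8 81 0 0]; [::
  T 8 27 0 1; T 8 54 1 0]]; [:: [::]; [::]; [::]; [:: T 0 (-81) 0 0]; [:: T 0 81 0 0]; [:: T 0 27
  0 1; T 0 54 1 0]; [::]; [::]; [::]; [:: T 8 162 0 0]; [:: T 8 (-162) 0 0]; [:: T 8 (-54) 0 1; T
  8 (-108) 1 0]]]; [:: [:: [::]; [::]; [::]; [::]; [:: T 0 (-162) 0 0]; [:: T 0 (-108) 0 1; T 0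
  (-54) 1 0]; [::]; [::]; [::]; [::]; [:: T 8 81 0 0]; [:: T 8 54 0 1; T 8 27 1 0]]; [:: [::];
  [::]; [::]; [::]; [:: T 0 81 0 0]; [:: T 0 54 0 1; T 0 27 1 0]; [::]; [::]; [::]; [::]; [:: T 8
  (-162) 0 0]; [:: T 8 (-108) 0 1; T 8 (-54) 1 0]]]]) ([:: [:: [:: [::]; [:: T 0 81 0 0]; [::];
  [:: T 2 54 0 0]; [:: T 2 27 0 0]; [:: T 0 108 0 0; T 2 18 0 1; T 2 63 1 0; T 4 (-27) 0 0; T 8
  27 0 0]; [:: T 0 (-54) 0 0; T 2 18 0 1; T 2 (-18) 1 0; T 4 54 0 0; T 8 (-54) 0 0]; [:: T 0
  (-54) 1 0; T 2 18 0 2; T 2 63 1 1; T 4 (-27) 0 1; T 8 (-27) 0 1; T 8 (-27) 1 0]; [::]; [::];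
  [::]; [:: T 10 54 0 0]; [:: T 10 27 0 0]; [:: T 0 54 0 0; T 8 54 0 0; T 10 18 0 1; T 10 63 1 0;
  T 12 (-27) 0 0]; [:: T 0 54 0 0; T 8 (-27) 0 0; T 10 18 0 1; T 10 (-18) 1 0; T 12 54 0 0]; [::
  T 0 54 0 1; T 8 (-27) 1 0; T 10 18 0 2; T 10 63 1 1; T 12 (-27) 0 1]]; [:: [::]; [:: T 0 (-81)
  0 0]; [::]; [:: T 2 (-27) 0 0]; [:: T 2 (-54) 0 0]; [:: T 0 (-54) 0 0; T 2 18 0 1; T 2 (-18) 1
  0; T 3 (-54) 0 0; T 8 (-54) 0 0]; [:: T 0 27 0 0; T 2 (-63) 0 1; T 2 (-18) 1 0; T 3 27 0 0; T 8
  108 0 0]; [:: T 0 27 1 0; T 2 18 0 2; T 2 (-18) 1 1; T 3 (-54) 0 1; T 5 81 0 0; T 8 54 0 1; T 8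
  54 1 0]; [::]; [:: T 8 81 0 0]; [::]; [:: T 10 (-27) 0 0]; [:: T 10 (-54) 0 0]; [:: T 0 (-27) 0
  0; T 8 (-108) 0 0; T 10 18 0 1; T 10 (-18) 1 0; T 11 (-54) 0 0]; [:: T 0 (-27) 0 0; T 8 54 0 0;
  T 10 (-63) 0 1; T 10 (-18) 1 0; T 11 27 0 0]; [:: T 0 (-27) 0 1; T 8 54 1 0; T 10 18 0 2; T 10
  (-18) 1 1; T 11 (-54) 0 1; T 13 81 0 0]]]]) ([:: [:: [:: [::]; [::]; [::]; [:: T 2 (-81) 0 0];
  [::]; [:: T 0 162 0 0; T 8 81 0 0]; [:: T 0 (-162) 0 0; T 2 (-54) 0 1; T 2 (-108) 1 0; T 3 54 0
  0; T 4 (-27) 0 0; T 8 (-81) 0 0]; [:: T 0 (-54) 0 1; T 0 (-108) 1 0; T 2 (-54) 1 1; T 2 (-108)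
  2 0; T 3 54 1 0; T 4 (-54) 1 0; T 5 27 0 0; T 6 54 0 0; T 8 (-27) 0 1; T 8 (-54) 1 0]; [::];
  [:: T 2 (-54) 0 1; T 2 (-108) 1 0; T 3 (-54) 0 0; T 4 (-54) 0 0; T 8 81 0 0]; [::]; [:: T 10
  (-81) 0 0]; [::]; [:: T 0 81 0 0; T 3 (-108) 0 0; T 4 (-27) 0 0; T 8 162 0 0; T 10 (-54) 0 1; T
  10 (-108) 1 0; T 11 54 0 0; T 12 (-27) 0 0]; [:: T 0 (-81) 0 0; T 3 108 0 0; T 4 27 0 0; T 8
  (-162) 0 0]; [:: T 0 (-27) 0 1; T 0 (-54) 1 0; T 3 36 0 1; T 3 72 1 0; T 4 9 0 1; T 4 18 1 0; T
  8 (-54) 0 1; T 8 (-108) 1 0; T 10 18 0 2; T 10 18 1 1; T 10 (-36) 2 0; T 11 (-18) 0 1; T 11 18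
  1 0; T 12 9 0 1; T 12 (-36) 1 0; T 13 27 0 0; T 14 54 0 0]]]; [:: [:: [::]; [:: T 0 (-81) 0 0];
  [::]; [::]; [::]; [::]; [:: T 0 (-162) 0 0; T 2 (-27) 0 1; T 2 (-54) 1 0; T 3 27 0 0; T 4 27 0
  0; T 8 (-81) 0 0]; [:: T 0 (-108) 0 1; T 0 (-54) 1 0; T 2 (-27) 1 1; T 2 (-54) 2 0; T 3 27 1 0;
  T 4 (-27) 1 0; T 5 54 0 0; T 6 27 0 0; T 8 (-54) 0 1; T 8 (-27) 1 0]; [::]; [:: T 2 (-27) 0 1;
  T 2 (-54) 1 0; T 3 (-27) 0 0; T 4 (-27) 0 0; T 8 81 0 0]; [::]; [::]; [::]; [::]; [:: T 0 (-81)
  0 0; T 3 108 0 0; T 4 27 0 0; T 8 (-162) 0 0; T 10 27 0 1; T 10 54 1 0; T 11 (-27) 0 0; T 12 54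
  0 0]; [:: T 0 (-54) 0 1; T 0 (-27) 1 0; T 3 72 0 1; T 3 36 1 0; T 4 18 0 1; T 4 9 1 0; T 8
  (-108) 0 1; T 8 (-54) 1 0; T 10 36 0 2; T 10 63 1 1; T 10 (-18) 2 0; T 11 (-36) 0 1; T 11 9 1
  0; T 12 18 0 1; T 12 (-18) 1 0; T 13 54 0 0; T 14 27 0 0]]]]) ([:: [:: [::]; [:: T 0 15 0 1; T
  0 12 1 0]; [::]; [:: T 0 6 0 0; T 1 3 0 0]; [:: T 0 3 0 0; T 1 (-3) 0 0]; [:: T 0 18 0 1; T 0
  18 1 0]; [:: T 1 3 0 1; T 1 6 1 0]; [:: T 1 9 1 1; T 1 9 2 0]; [::]; [::]; [::]; [:: T 0 3 0 0;
  T 1 6 0 0]; [:: T 0 6 0 0; T 1 3 0 0]; [:: T 0 9 0 1; T 0 9 1 0]; [:: T 0 15 0 1; T 0 12 1 0; T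
  1 9 0 1; T 1 9 1 0]; [:: T 0 9 0 2; T 0 9 1 1; T 1 9 1 1; T 1 9 2 0]]]) ([:: [:: [:: T 0 3 0 1;
  T 0 6 1 0; T 1 (-6) 0 0; T 2 3 0 0; T 7 3 0 0; T 8 (-6) 0 0]; [:: T 0 (-3) 1 1; T 0 (-6) 2 0; T
  1 3 0 1; T 1 6 1 0; T 2 (-3) 1 0; T 3 3 0 0; T 4 6 0 0; T 7 (-3) 0 1; T 7 (-3) 1 0; T 8 6 0 1;
  T 8 6 1 0]; [:: T 0 (-3) 0 1; T 0 (-6) 1 0; T 1 3 0 0; T 2 3 0 0; T 6 3 0 1; T 6 6 1 0; T 7
  (-6) 0 0; T 8 3 0 0]]]);
  KCert [:: 0; 0] ([:: [:: T 2 1 1 0]; [:: T 2 1 0 1]]) ([:: [:: [::]; [::]; [::]; [::]; [::];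
  [:: T 0 (-18) 0 0; T 1 (-18) 0 0]; [::]; [:: T 0 6 0 1; T 0 (-6) 1 0; T 1 6 0 1; T 1 (-6) 1 0];
  [::]; [:: T 0 (-9) 0 0]; [::]; [:: T 0 (-18) 1 0; T 1 (-18) 1 0]; [:: T 0 (-12) 0 1; T 0 3 1 0;
  T 1 18 1 0]; [:: T 0 (-12) 1 1; T 0 (-6) 2 0; T 1 6 1 1; T 1 12 2 0]]; [:: [::]; [::]; [::];
  [::]; [::]; [::]; [:: T 0 9 0 0; T 1 9 0 0]; [:: T 0 12 0 1; T 0 (-3) 1 0; T 1 12 0 1; T 1 (-3)
  1 0]; [::]; [::]; [:: T 0 9 0 0]; [::]; [:: T 0 3 0 1; T 0 15 1 0; T 1 18 1 0]; [:: T 0 3 1 1;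
  T 0 (-3) 2 0; T 1 12 1 1; T 1 6 2 0]]]) ([:: [:: [:: T 0 (-6) 0 1; T 0 (-12) 1 0; T 2 9 0 0; T
  8 3 0 1; T 8 6 1 0; T 10 (-9) 0 0]; [:: T 4 3 0 1; T 4 (-3) 1 0; T 6 (-9) 0 0; T 8 (-3) 0 1; T
  8 (-6) 1 0; T 10 9 0 0]]; [:: [:: T 0 (-6) 0 1; T 0 6 1 0; T 1 9 0 0; T 8 3 0 1; T 8 6 1 0; T 9
  (-9) 0 0; T 10 9 0 0]; [:: T 4 (-6) 0 1; T 4 (-3) 1 0; T 5 9 0 0; T 6 9 0 0; T 8 (-3) 0 1; T 8
  (-6) 1 0; T 9 9 0 0; T 10 (-9) 0 0]]]) ([:: [:: [:: [::]; [::]; [::]; [::]; [::]; [:: T 2 81 0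
  0]; [:: T 2 (-81) 0 0]; [:: T 2 (-27) 0 1; T 2 (-54) 1 0]; [::]; [:: T 0 (-108) 0 1; T 0 (-216)
  1 0; T 2 162 0 0]; [::]; [::]; [::]; [:: T 0 (-108) 0 1; T 0 (-216) 1 0; T 2 243 0 0; T 4 (-27)
  0 1; T 4 27 1 0; T 6 (-81) 0 0]; [:: T 0 108 0 1; T 0 216 1 0; T 2 (-243) 0 0; T 4 27 0 1; T 4
  (-27) 1 0; T 6 81 0 0]; [:: T 0 36 0 2; T 0 144 1 1; T 0 144 2 0; T 2 (-81) 0 1; T 2 (-162) 1
  0; T 4 9 0 2; T 4 9 1 1; T 4 (-18) 2 0; T 6 27 0 1; T 6 54 1 0]]; [:: [::]; [::]; [::]; [::];
  [::]; [:: T 2 (-162) 0 0]; [:: T 2 162 0 0]; [:: T 2 54 0 1; T 2 108 1 0]; [::]; [:: T 0 (-108)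
  0 1; T 0 108 1 0; T 1 162 0 0]; [::]; [::]; [::]; [:: T 0 (-108) 0 1; T 0 108 1 0; T 1 162 0 0;
  T 2 (-162) 0 0; T 4 54 0 1; T 4 27 1 0; T 5 (-81) 0 0]; [:: T 0 108 0 1; T 0 (-108) 1 0; T 1
  (-162) 0 0; T 2 162 0 0; T 4 (-54) 0 1; T 4 (-27) 1 0; T 5 81 0 0]; [:: T 0 36 0 2; T 0 36 1 1;
  T 0 (-72) 2 0; T 1 (-54) 0 1; T 1 (-108) 1 0; T 2 54 0 1; T 2 108 1 0; T 4 (-18) 0 2; T 4 (-45)
  1 1; T 4 (-18) 2 0; T 5 27 0 1; T 5 54 1 0]]]; [:: [:: [::]; [::]; [::]; [::]; [::]; [::]; [::
  T 2 (-81) 0 0]; [:: T 2 (-54) 0 1; T 2 (-27) 1 0]; [::]; [:: T 0 (-54) 0 1; T 0 (-108) 1 0; T 2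
  81 0 0]; [::]; [::]; [::]; [::]; [:: T 0 108 0 1; T 0 216 1 0; T 2 (-243) 0 0; T 4 27 0 1; T 4
  (-27) 1 0; T 6 81 0 0]; [:: T 0 72 0 2; T 0 180 1 1; T 0 72 2 0; T 2 (-162) 0 1; T 2 (-81) 1 0;
  T 4 18 0 2; T 4 (-9) 1 1; T 4 (-9) 2 0; T 6 54 0 1; T 6 27 1 0]]; [:: [::]; [::]; [::]; [::];
  [::]; [::]; [:: T 2 162 0 0]; [:: T 2 108 0 1; T 2 54 1 0]; [::]; [:: T 0 (-54) 0 1; T 0 54 1
  0; T 1 81 0 0]; [::]; [::]; [::]; [::]; [:: T 0 108 0 1; T 0 (-108) 1 0; T 1 (-162) 0 0; T 2
  162 0 0; T 4 (-54) 0 1; T 4 (-27) 1 0; T 5 81 0 0]; [:: T 0 72 0 2; T 0 (-36) 1 1; T 0 (-36) 2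
  0; T 1 (-108) 0 1; T 1 (-54) 1 0; T 2 108 0 1; T 2 54 1 0; T 4 (-36) 0 2; T 4 (-36) 1 1; T 4
  (-9) 2 0; T 5 54 0 1; T 5 27 1 0]]]]) ([:: [:: [:: [::]; [:: T 0 54 0 0]; [:: T 0 (-27) 0 0];
  [:: T 0 27 0 1; T 0 108 1 0; T 2 (-81) 0 0]; [::]; [:: T 4 27 0 0]; [:: T 4 27 0 0]; [:: T 4 27
  0 1]; [::]; [:: T 8 54 0 0]; [:: T 8 27 0 0]; [:: T 0 (-72) 0 1; T 0 (-144) 1 0; T 2 135 0 0; T
  4 (-9) 0 1; T 4 9 1 0; T 6 (-27) 0 0; T 8 18 0 1; T 8 63 1 0; T 10 (-27) 0 0]; [:: T 0 90 0 1;
  T 0 180 1 0; T 2 (-189) 0 0; T 4 18 0 1; T 4 (-18) 1 0; T 6 54 0 0; T 8 18 0 1; T 8 (-18) 1 0;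
  T 10 54 0 0]; [:: T 0 36 1 1; T 0 72 2 0; T 2 (-27) 0 1; T 2 (-81) 1 0; T 4 9 0 2; T 4 (-9) 2
  0; T 6 27 0 1; T 6 27 1 0; T 8 18 0 2; T 8 63 1 1; T 10 (-27) 0 1]]; [:: [::]; [:: T 0 (-27) 0
  0]; [:: T 0 (-27) 0 0]; [:: T 0 27 0 1; T 0 (-54) 1 0; T 1 (-81) 0 0; T 2 81 0 0]; [::]; [:: T
  4 (-54) 0 0]; [:: T 4 27 0 0]; [:: T 4 (-54) 0 1; T 5 81 0 0]; [::]; [:: T 8 (-27) 0 0]; [:: T
  8 (-54) 0 0]; [:: T 0 (-72) 0 1; T 0 72 1 0; T 1 108 0 0; T 2 (-54) 0 0; T 4 18 0 1; T 4 9 1 0;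
  T 5 (-27) 0 0; T 8 18 0 1; T 8 (-18) 1 0; T 9 (-54) 0 0]; [:: T 0 90 0 1; T 0 (-90) 1 0; T 1
  (-135) 0 0; T 2 108 0 0; T 4 (-36) 0 1; T 4 (-18) 1 0; T 5 54 0 0; T 8 (-63) 0 1; T 8 (-18) 1
  0; T 9 27 0 0]; [:: T 0 36 1 1; T 0 (-36) 2 0; T 1 (-54) 1 0; T 2 54 0 1; T 2 54 1 0; T 4 (-18)
  0 2; T 4 (-27) 1 1; T 4 (-9) 2 0; T 5 27 0 1; T 5 27 1 0; T 8 18 0 2; T 8 (-18) 1 1; T 9 (-54)
  0 1; T 11 81 0 0]]]]) ([:: [:: [:: [::]; [:: T 0 81 0 0]; [::]; [:: T 0 108 1 0; T 1 54 0 0; T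
  2 27 0 0]; [::]; [:: T 4 81 0 0]; [::]; [:: T 4 (-27) 0 1; T 5 27 0 0; T 6 54 0 0]; [::]; [:: T
  8 (-81) 0 0]; [::]; [:: T 2 81 0 0; T 4 81 1 0; T 5 81 0 0]; [:: T 2 (-81) 0 0; T 4 (-81) 1 0;
  T 5 (-81) 0 0; T 8 (-54) 0 1; T 8 (-108) 1 0; T 9 54 0 0; T 10 (-27) 0 0]; [:: T 2 (-27) 0 1; T
  2 (-54) 1 0; T 4 (-27) 1 1; T 4 (-54) 2 0; T 5 (-27) 0 1; T 5 (-54) 1 0; T 8 (-54) 1 1; T 8
  (-108) 2 0; T 9 54 1 0; T 10 (-54) 1 0; T 11 27 0 0; T 12 54 0 0]]]; [:: [:: [::]; [::]; [::];
  [:: T 0 54 1 0; T 1 27 0 0; T 2 54 0 0]; [::]; [::]; [::]; [:: T 4 (-54) 0 1; T 5 54 0 0; T 6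
  27 0 0]; [::]; [::]; [::]; [::]; [:: T 2 (-81) 0 0; T 4 (-81) 1 0; T 5 (-81) 0 0; T 8 (-27) 0
  1; T 8 (-54) 1 0; T 9 27 0 0; T 10 27 0 0]; [:: T 2 (-54) 0 1; T 2 (-27) 1 0; T 4 (-54) 1 1; T
  4 (-27) 2 0; T 5 (-54) 0 1; T 5 (-27) 1 0; T 8 (-27) 1 1; T 8 (-54) 2 0; T 9 27 1 0; T 10 (-27)
  1 0; T 11 54 0 0; T 12 27 0 0]]]]) ([:: [:: [::]; [:: T 0 6 0 0]; [:: T 0 (-3) 0 0]; [:: T 0 15
  0 1; T 0 18 1 0; T 1 9 0 0]; [::]; [:: T 0 (-6) 0 0; T 2 (-6) 0 0]; [:: T 0 3 0 0; T 2 3 0 0];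
  [:: T 0 (-24) 0 1; T 0 (-18) 1 0; T 1 (-18) 0 0; T 2 (-6) 0 1]; [::]; [:: T 2 3 0 0]; [:: T 2
  (-3) 0 0]; [:: T 0 3 0 1; T 0 3 1 0; T 1 9 0 0; T 2 6 0 1; T 2 6 1 0]; [:: T 0 (-6) 0 1; T 0
  (-6) 1 0; T 1 (-9) 0 0; T 2 (-9) 0 1; T 2 (-6) 1 0]; [:: T 0 (-15) 0 2; T 0 (-33) 1 1; T 0
  (-18) 2 0; T 1 (-9) 0 1; T 1 (-18) 1 0; T 2 (-6) 0 2; T 2 (-3) 1 1; T 2 3 2 0]]]) ([:: [:: [::
  T 0 (-9) 0 0; T 2 3 0 1; T 2 6 1 0; T 3 3 0 0; T 4 3 0 0; T 8 (-9) 0 0; T 11 3 0 0; T 12 (-6) 0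
  0]; [:: T 0 9 0 0; T 2 (-3) 0 1; T 2 (-6) 1 0; T 3 3 0 0; T 4 (-6) 0 0; T 8 9 0 0; T 10 3 0 1;
  T 10 6 1 0; T 11 (-6) 0 0; T 12 12 0 0]]]);
  KCert [:: 2] ([:: [:: T 0 1 0 1; T 1 (-1) 1 0]]) ([:: [:: [::]; [:: T 0 9 0 0]; [::]; [:: T 0
  18 1 0]; [::]; [:: T 0 36 0 0]; [::]; [:: T 0 18 1 0]]; [:: [::]; [:: T 0 (-9) 0 0]; [::]; [::
  T 0 9 1 0]; [::]; [:: T 0 18 0 0]; [:: T 0 (-27) 0 0]; [:: T 0 9 1 0]]]) ([:: [:: [:: T 0 6 0
  1; T 0 12 1 0; T 2 (-9) 0 0]]; [:: [:: T 0 6 0 1; T 0 (-6) 1 0; T 1 (-9) 0 0]]]) ([:: [:: [::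
  [::]; [::]; [::]; [::]; [::]; [::]; [::]; [::]; [::]; [::]; [::]; [:: T 2 (-81) 0 0]; [:: T 2
  81 0 0]; [:: T 2 27 0 1; T 2 54 1 0]]; [:: [::]; [::]; [::]; [::]; [::]; [::]; [::]; [::];
  [::]; [::]; [::]; [:: T 2 162 0 0]; [:: T 2 (-162) 0 0]; [:: T 2 (-54) 0 1; T 2 (-108) 1 0]]];
  [:: [:: [::]; [::]; [::]; [::]; [::]; [::]; [::]; [::]; [::]; [::]; [::]; [::]; [:: T 2 81 0
  0]; [:: T 2 54 0 1; T 2 27 1 0]]; [:: [::]; [::]; [::]; [::]; [::]; [::]; [::]; [::]; [::];
  [::]; [::]; [::]; [:: T 2 (-162) 0 0]; [:: T 2 (-108) 0 1; T 2 (-54) 1 0]]]]) ([:: [:: [::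
  [::]; [:: T 0 54 0 0]; [:: T 0 (-27) 0 0]; [:: T 0 (-27) 0 1]; [::]; [:: T 4 27 0 0]; [:: T 4
  27 0 0]; [:: T 2 (-81) 0 0; T 4 27 1 0; T 6 (-81) 0 0]]; [:: [::]; [:: T 0 (-27) 0 0]; [:: T 0
  (-27) 0 0]; [:: T 0 (-27) 0 1; T 2 81 0 0]; [::]; [:: T 4 (-54) 0 0]; [:: T 4 27 0 0]; [:: T 2
  162 0 0; T 4 27 1 0]]]]) ([:: [:: [:: [::]; [:: T 0 81 0 0]; [::]; [:: T 0 108 1 0; T 1 54 0 0;
  T 2 27 0 0]; [::]; [:: T 0 216 0 0; T 4 54 0 0]; [::]; [:: T 0 108 1 0; T 5 27 0 0; T 6 54 0
  0]]]; [:: [:: [::]; [::]; [::]; [:: T 0 54 1 0; T 1 27 0 0; T 2 54 0 0]; [::]; [:: T 0 108 0 0;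
  T 4 27 0 0]; [:: T 0 (-162) 0 0]; [:: T 0 54 1 0; T 5 54 0 0; T 6 27 0 0]]]]) ([:: [:: [::];
  [:: T 0 (-6) 0 0; T 1 (-12) 0 0]; [:: T 0 3 0 0; T 1 6 0 0]; [:: T 0 (-9) 0 1; T 0 3 1 0; T 1
  (-6) 0 1; T 1 3 1 0]; [::]; [:: T 0 12 0 0; T 1 6 0 0]; [:: T 0 (-6) 0 0; T 1 (-3) 0 0]; [:: T
  0 (-18) 0 1; T 0 3 1 0; T 1 (-6) 0 1; T 1 21 1 0]]]) ([:: [:: [:: T 0 6 1 0; T 1 3 0 0; T 2
  (-3) 0 0; T 4 3 1 0; T 5 (-3) 0 0; T 6 3 0 0; T 8 3 0 1; T 8 6 1 0; T 9 3 0 0; T 10 3 0 0]]]);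
  KCert [::] [::] [::] [::] ([:: [:: [:: [::]; [::]; [::]; [::]; [::]; [:: T 0 216 0 0; T 2 27 0
  0]; [::]; [:: T 0 108 1 0; T 2 (-27) 0 1]]; [:: [::]; [::]; [::]; [::]; [::]; [:: T 0 (-108) 0
  0; T 2 (-54) 0 0]; [::]; [:: T 0 (-54) 1 0; T 2 54 0 1]]]; [:: [:: [::]; [::]; [::]; [::];
  [::]; [:: T 0 108 0 0; T 2 (-27) 0 0]; [:: T 0 (-162) 0 0]; [:: T 0 54 1 0; T 2 (-54) 0 1]];
  [:: [::]; [::]; [::]; [::]; [::]; [:: T 0 (-54) 0 0; T 2 54 0 0]; [:: T 0 81 0 0]; [:: T 0
  (-27) 1 0; T 2 108 0 1]]]]) ([:: [:: [:: [::]; [:: T 0 (-81) 0 0]; [::]; [:: T 0 (-108) 0 0; T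
  2 27 0 0]]; [:: [::]; [::]; [::]; [:: T 0 54 0 0; T 2 27 0 0]]]]) ([:: [:: [:: [::]; [:: T 0 54
  0 0; T 2 27 0 0]; [::]; [:: T 0 54 0 0; T 2 27 0 0]]]; [:: [:: [::]; [:: T 0 27 0 0; T 2 54 0
  0]; [::]; [:: T 0 27 0 0; T 2 54 0 0]]]]) ([:: [:: [::]; [:: T 0 9 0 0]; [::]; [:: T 0 18 0
  0]]]) [::];
  KCert [::] [::] [::] [::] ([:: [:: [:: [::]; [:: T 0 (-27) 0 0]; [::]; [:: T 0 (-108) 0 0]];
  [:: [::]; [:: T 0 54 0 0]; [::]; [:: T 0 54 0 0]]]; [:: [:: [::]; [:: T 0 (-54) 0 0]; [::]; [::
  T 0 (-54) 0 0]]; [:: [::]; [:: T 0 108 0 0]; [::]; [:: T 0 27 0 0]]]]) [::] [::] [::] [::]].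

Definition kcert2 : seq kcert := [::
  KCert [:: (-10)] [::] ([:: [:: [:: T 0 1 0 0]; [:: T 0 1 0 1; T 0 1 1 0]; [:: T 0 1 0 1; T 0 1
  1 0]; [:: T 0 1 1 1; T 0 1 2 0]; [:: T 0 1 0 2; T 0 1 1 1]; [:: T 0 1 1 2; T 0 1 2 1]]]) ([::
  [:: [:: T 0 9 0 0]]]) [::] [::] ([:: [:: [:: [::]; [:: T 0 6 0 0]; [:: T 0 3 0 0]; [:: T 0 2 0
  1; T 0 7 1 0; T 2 (-3) 0 0]; [:: T 0 2 0 1; T 0 (-2) 1 0; T 2 6 0 0]; [:: T 0 2 0 2; T 0 7 1 1;
  T 2 (-3) 0 1]]; [:: [::]; [:: T 0 (-3) 0 0]; [:: T 0 (-6) 0 0]; [:: T 0 2 0 1; T 0 (-2) 1 0; T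
  1 (-6) 0 0]; [:: T 0 (-7) 0 1; T 0 (-2) 1 0; T 1 3 0 0]; [:: T 0 2 0 2; T 0 (-2) 1 1; T 1 (-6)
  0 1; T 3 9 0 0]]]]) [::] [::];
  KCert [:: (-8); (-8)] [::] ([:: [:: [:: T 0 1 0 0]; [:: T 0 1 0 1; T 0 1 1 0]; [:: T 0 1 0 1; T
  0 1 1 0]; [:: T 0 1 1 1; T 0 1 2 0]; [:: T 0 1 0 2; T 0 1 1 1]; [:: T 0 1 1 2; T 0 1 2 1]; [::
  T 1 (-1) 0 0]; [:: T 1 (-1) 0 1; T 1 (-1) 1 0]; [:: T 1 (-1) 0 1; T 1 (-1) 1 0]; [:: T 1 (-1) 1
  1; T 1 (-1) 2 0]; [:: T 1 (-1) 0 2; T 1 (-1) 1 1]; [:: T 1 (-1) 1 2; T 1 (-1) 2 1]]]) ([:: [::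
  [:: T 0 9 0 0]; [:: T 6 (-9) 0 0]]]) [::] [::] ([:: [:: [:: [::]; [:: T 0 6 0 0]; [:: T 0 3 0
  0]; [:: T 0 2 0 1; T 0 7 1 0; T 2 (-3) 0 0]; [:: T 0 2 0 1; T 0 (-2) 1 0; T 2 6 0 0]; [:: T 0 2
  0 2; T 0 7 1 1; T 2 (-3) 0 1]; [::]; [:: T 6 6 0 0]; [:: T 6 3 0 0]; [:: T 6 2 0 1; T 6 7 1 0;
  T 8 (-3) 0 0]; [:: T 6 2 0 1; T 6 (-2) 1 0; T 8 6 0 0]; [:: T 6 2 0 2; T 6 7 1 1; T 8 (-3) 0
  1]]; [:: [::]; [:: T 0 (-3) 0 0]; [:: T 0 (-6) 0 0]; [:: T 0 2 0 1; T 0 (-2) 1 0; T 1 (-6) 0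
  0]; [:: T 0 (-7) 0 1; T 0 (-2) 1 0; T 1 3 0 0]; [:: T 0 2 0 2; T 0 (-2) 1 1; T 1 (-6) 0 1; T 3
  9 0 0]; [::]; [:: T 6 (-3) 0 0]; [:: T 6 (-6) 0 0]; [:: T 6 2 0 1; T 6 (-2) 1 0; T 7 (-6) 0 0];
  [:: T 6 (-7) 0 1; T 6 (-2) 1 0; T 7 3 0 0]; [:: T 6 2 0 2; T 6 (-2) 1 1; T 7 (-6) 0 1; T 9 9 0
  0]]]]) [::] ([:: [:: [:: T 0 (-6) 0 0]; [:: T 0 3 0 0]]; [:: [:: T 0 3 0 0]; [:: T 0 (-6) 0
  0]]]);
  KCert [:: (-6); (-4); (-6)] ([:: [:: T 0 1 0 1; T 1 (-1) 1 0]; [:: T 0 1 0 2; T 0 1 1 1]]) ([::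
  [:: [:: T 1 (-1) 0 0]; [:: T 1 (-1) 1 0]; [:: T 0 (-1) 0 0]; [:: T 0 (-1) 0 1; T 0 (-1) 1 0];
  [:: T 0 (-1) 0 1; T 0 (-1) 1 0]; [:: T 0 (-1) 1 1; T 0 (-1) 2 0]; [:: T 0 (-1) 0 2; T 0 (-1) 1
  1]; [:: T 0 (-1) 1 2; T 0 (-1) 2 1]; [:: T 0 (-1) 0 1; T 0 (-1) 1 0; T 1 1 0 0]; [:: T 0 (-1) 0
  2; T 0 (-1) 1 1; T 1 1 0 1]; [:: T 2 1 0 0]; [:: T 2 1 0 1; T 2 1 1 0]; [:: T 2 1 0 1; T 2 1 1
  0]; [:: T 2 1 1 1; T 2 1 2 0]; [:: T 2 1 0 2; T 2 1 1 1]; [:: T 2 1 1 2; T 2 1 2 1]]]) ([:: [::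
  [:: T 2 (-9) 0 0]; [:: T 2 (-9) 0 1; T 2 (-9) 1 0; T 8 9 0 0]; [:: T 10 9 0 0]]]) [::] [::]
  ([:: [:: [:: [:: T 2 6 0 0]; [:: T 0 (-9) 0 0; T 2 6 1 0]; [::]; [:: T 2 6 0 0]; [:: T 2 3 0
  0]; [:: T 2 2 0 1; T 2 7 1 0; T 4 (-3) 0 0]; [:: T 2 2 0 1; T 2 (-2) 1 0; T 4 6 0 0]; [:: T 2 2
  0 2; T 2 7 1 1; T 4 (-3) 0 1]; [::]; [::]; [::]; [:: T 10 6 0 0]; [:: T 10 3 0 0]; [:: T 10 2 0
  1; T 10 7 1 0; T 12 (-3) 0 0]; [:: T 10 2 0 1; T 10 (-2) 1 0; T 12 6 0 0]; [:: T 10 2 0 2; T 10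
  7 1 1; T 12 (-3) 0 1]]; [:: [:: T 2 (-3) 0 0]; [:: T 2 (-3) 1 0]; [::]; [:: T 2 (-3) 0 0]; [::
  T 2 (-6) 0 0]; [:: T 2 2 0 1; T 2 (-2) 1 0; T 3 (-6) 0 0]; [:: T 2 (-7) 0 1; T 2 (-2) 1 0; T 3
  3 0 0]; [:: T 2 2 0 2; T 2 (-2) 1 1; T 3 (-6) 0 1; T 5 9 0 0]; [::]; [:: T 8 9 0 0]; [::]; [::
  T 10 (-3) 0 0]; [:: T 10 (-6) 0 0]; [:: T 10 2 0 1; T 10 (-2) 1 0; T 11 (-6) 0 0]; [:: T 10
  (-7) 0 1; T 10 (-2) 1 0; T 11 3 0 0]; [:: T 10 2 0 2; T 10 (-2) 1 1; T 11 (-6) 0 1; T 13 9 0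
  0]]]]) [::] ([:: [:: [:: T 0 6 0 0; T 6 (-3) 0 0]; [:: T 0 6 0 1; T 0 6 1 0; T 6 (-5) 0 1; T 6
  (-10) 1 0; T 8 3 0 0]; [:: T 0 (-3) 0 0; T 6 6 0 0]]; [:: [:: T 0 (-3) 0 0; T 6 (-3) 0 0]; [::
  T 0 (-3) 0 1; T 0 (-3) 1 0; T 6 (-5) 0 1; T 6 (-1) 1 0; T 7 6 0 0]; [:: T 0 6 0 0; T 6 (-3) 0
  0]]]);
  KCert [:: (-4); (-4)] ([:: [:: T 2 1 1 0]; [:: T 2 1 0 1]]) ([:: [:: [::]; [::]; [::]; [::];
  [:: T 0 1 0 0; T 1 1 0 0]; [:: T 0 1 1 0; T 1 1 1 0]; [:: T 0 1 0 1; T 1 1 0 1]; [:: T 0 1 1 1;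
  T 1 1 1 1]; [:: T 0 1 0 0]; [:: T 0 1 0 1; T 0 1 1 0]; [:: T 0 1 0 1; T 0 1 1 0]; [:: T 0 1 1
  1; T 0 1 2 0]; [:: T 0 1 0 2; T 0 1 1 1]; [:: T 0 1 1 2; T 0 1 2 1]]]) ([:: [:: [:: T 0 9 0 0;
  T 8 9 0 0]; [:: T 4 9 0 0; T 8 (-9) 0 0]]]) ([:: [:: [:: [:: T 0 (-9) 0 0]; [:: T 0 (-9) 1
  0]]]]) [::] ([:: [:: [:: [::]; [:: T 0 6 0 0]; [:: T 0 (-3) 0 0]; [:: T 0 (-3) 0 1]; [::]; [::
  T 4 3 0 0]; [:: T 4 3 0 0]; [:: T 4 3 1 0; T 6 (-9) 0 0]; [::]; [:: T 8 6 0 0]; [:: T 8 3 0 0];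
  [:: T 8 2 0 1; T 8 7 1 0; T 10 (-3) 0 0]; [:: T 8 2 0 1; T 8 (-2) 1 0; T 10 6 0 0]; [:: T 8 2 0
  2; T 8 7 1 1; T 10 (-3) 0 1]]; [:: [::]; [:: T 0 (-3) 0 0]; [:: T 0 (-3) 0 0]; [:: T 0 (-3) 0
  1; T 2 9 0 0]; [::]; [:: T 4 (-6) 0 0]; [:: T 4 3 0 0]; [:: T 4 3 1 0]; [::]; [:: T 8 (-3) 0
  0]; [:: T 8 (-6) 0 0]; [:: T 8 2 0 1; T 8 (-2) 1 0; T 9 (-6) 0 0]; [:: T 8 (-7) 0 1; T 8 (-2) 1
  0; T 9 3 0 0]; [:: T 8 2 0 2; T 8 (-2) 1 1; T 9 (-6) 0 1; T 11 9 0 0]]]]) [::] ([:: [:: [:: T 2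
  6 0 0; T 10 (-3) 0 0]; [:: T 2 (-3) 0 0; T 10 6 0 0]]; [:: [:: T 2 (-3) 0 0; T 10 (-3) 0 0];
  [:: T 2 6 0 0; T 10 (-3) 0 0]]]);
  KCert [:: (-2); (-2)] ([:: [::]; [:: T 0 1 0 1; T 1 (-1) 1 0]]) ([:: [:: [:: T 1 (-1) 0 0]; [::
  T 1 (-1) 0 1]; [:: T 1 (-1) 1 0]; [:: T 1 (-1) 1 1]; [:: T 0 1 0 0; T 1 (-1) 0 0]; [:: T 0 1 1
  0; T 1 (-1) 1 0]; [:: T 0 1 0 1; T 1 (-1) 0 1]; [:: T 0 1 1 1; T 1 (-1) 1 1]]]) ([:: [:: [:: T
  0 (-9) 0 0; T 4 9 0 0]; [:: T 0 (-9) 0 0]]]) [::] [::] ([:: [:: [:: [::]; [:: T 0 6 0 0]; [:: T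
  0 (-3) 0 0]; [:: T 0 (-3) 0 1]; [::]; [:: T 4 3 0 0]; [:: T 4 3 0 0]; [:: T 4 3 1 0; T 6 (-9) 0
  0]]; [:: [::]; [:: T 0 (-3) 0 0]; [:: T 0 (-3) 0 0]; [:: T 0 (-3) 0 1; T 2 9 0 0]; [::]; [:: T
  4 (-6) 0 0]; [:: T 4 3 0 0]; [:: T 4 3 1 0]]]]) [::] ([:: [:: [:: T 0 (-3) 0 0; T 4 (-6) 0 0; T
  8 3 0 0]; [:: T 0 3 0 0; T 4 (-3) 0 0; T 8 6 0 0]]; [:: [:: T 0 6 0 0; T 4 3 0 0; T 8 3 0 0];
  [:: T 0 3 0 0; T 4 6 0 0; T 8 (-3) 0 0]]]);
  KCert [:: 0; 0] ([:: [:: T 0 1 1 0]; [:: T 0 1 0 1]]) ([:: [:: [:: T 1 1 0 0]; [:: T 1 1 1 0];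
  [:: T 0 1 0 0]; [:: T 0 1 0 1]]]) ([:: [:: [:: T 2 9 0 0]; [:: T 0 9 0 0]]]) [::] [::] ([:: [::
  [:: [::]; [:: T 0 (-9) 0 0]]; [:: [::]; [::]; [::]; [:: T 2 9 0 0]]]]) [::] ([:: [:: [:: T 0 3
  0 0; T 4 3 0 0]; [:: T 0 (-6) 0 0; T 4 3 0 0]]; [:: [:: T 0 3 0 0; T 4 (-6) 0 0]; [:: T 0 3 0
  0; T 4 3 0 0]]]);
  KCert [:: 2] ([:: [:: T 0 1 0 1; T 1 (-1) 1 0]]) ([:: [:: [:: T 0 (-1) 0 0]]]) ([:: [:: [:: T 0
  (-9) 0 0]]]) [::] [::] [::] [::] ([:: [:: [:: T 0 9 0 0]]; [:: [:: T 2 9 0 0]]])].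

Definition kc0 : kcert := KCert [::] [::] [::] [::] [::] [::] [::] [::] [::].
Definition kcert_at (s : seq kcert) : int -> kcert := getz kc0 s.

Lemma kcert0_ok t : kcert_ok 0 9 cx6 (kcert_at kcert0) t. Proof. by move: t; check_int. Qed.
Lemma kcert1_ok t : kcert_ok 1 81 cx6 (kcert_at kcert1) t. Proof. by move: t; check_int. Qed.
Lemma kcert2_ok t : kcert_ok 2 9 cx6 (kcert_at kcert2) t. Proof. by move: t; check_int. Qed.

(** * The cohomology groups *)

Section TwoVariables.
Variable k : fieldType.
Local Notation R := {mpoly k[2]}.
Local Notation s := ('X_0 : R).
Local Notation t := ('X_1 : R).

(** Reduction modulo 'X_j, realised as a substitution inside R. *)
Definition mkill (j : 'I_2) (p : R) : R := p \mPo [tuple (if i == j then 0 else 'X_i) | i < 2].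

Lemma mkillX j i : mkill j 'X_i = if i == j then 0 else 'X_i.
Proof. by rewrite /mkill comp_mpolyXU -tnth_nth tnth_mktuple. Qed.

Lemma mkillM j p q : mkill j (p * q) = mkill j p * mkill j q.
Proof. exact: rmorphM. Qed.

Lemma mkillD j p q : mkill j (p + q) = mkill j p + mkill j q.
Proof. exact: rmorphD. Qed.

Lemma mkillC j c : mkill j c%:MP = c%:MP.
Proof. exact: comp_mpolyC. Qed.

Lemma mkill_split j p : exists q, p = mkill j p + q * 'X_j.
Proof.
elim/mpoly_alg_ind: p => [c|i|p q [u hu] [v hv]|p q [u hu] [v hv]].
- by exists 0; rewrite mkillC mul0r addr0.
- rewrite mkillX; case: eqP => [->|_]; first by exists 1; rewrite add0r mul1r.
  by exists 0; rewrite mul0r addr0.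
- by exists (u + v); rewrite mkillD {1}hu {1}hv mulrDl addrACA.
exists (mkill j p * v + u * q); rewrite mkillM.
transitivity ((mkill j p + u * 'X_j) * q); first by rewrite -hu.
transitivity (mkill j p * (mkill j q + v * 'X_j) + u * 'X_j * q); last by ring.
by rewrite -hv; ring.
Qed.

(** Setting 'X_j to 0 leaves 'X_i times the reduction of p equal to 0, so 'X_j divides p. This is
    regularity of the pair of variables. *)
Lemma mdvd_var (i j : 'I_2) (p q : R) : i != j -> p * 'X_i = q * 'X_j ->
  exists e, p = e * 'X_j /\ q = e * 'X_i.
Proof.
move=> ij E; have [e he] := mkill_split j p.
have : mkill j (p * 'X_i) = 0 by rewrite E mkillM mkillX eqxx mulr0.
rewrite mkillM mkillX (negbTE ij) => /eqP; rewrite mulf_eq0 (negbTE (@mpolyX_neq0 k 2 i)) orbF => /eqP p0.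
rewrite p0 add0r in he; exists e; split=> //.
by apply: (mulIf (@mpolyX_neq0 k 2 j)); rewrite -E he mulrAC.
Qed.

Lemma X1_neq0 : t != 0. Proof. exact: mpolyX_neq0. Qed.
Lemma X0_neq0 : s != 0. Proof. exact: mpolyX_neq0. Qed.

Lemma sum_vars_neq0 : s + t != 0.
Proof.
apply/eqP => /(congr1 (mkill 1)); rewrite mkillD !mkillX /= addr0.
by rewrite -(mpolyC0 2 k) mkillC mpolyC0 => /eqP; rewrite (negbTE X0_neq0).
Qed.

Lemma rev_nil j : rev k [::] j = 0.
Proof. by rewrite /rev big_nil. Qed.

Lemma rev_cons u r j : rev k (u :: r) j = (if tcol u == j then tev k u else 0) + rev k r j.
Proof. by rewrite /rev big_cons; case: ifP; rewrite ?add0r. Qed.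

Lemma row1_mul n A (v : 'rV[R]_1) l : (v *m mxs k 1 n A) 0 l = v 0 0 * rev k (nth [::] A 0) l.
Proof. by rewrite mxE big_ord1 !mxE. Qed.

Lemma row2_mul n A (v : 'rV[R]_2) l : (v *m mxs k 2 n A) 0 l
  = v 0 0 * rev k (nth [::] A 0) l + v 0 1 * rev k (nth [::] A 1) l.
Proof.
rewrite mxE big_ord_recl big_ord1 !mxE; congr (_ + v _ _ * _).
exact: val_inj.
Qed.

Lemma row3_mul n A (v : 'rV[R]_3) l : (v *m mxs k 3 n A) 0 l
  = v 0 0 * rev k (nth [::] A 0) l + v 0 1 * rev k (nth [::] A 1) l
    + v 0 2 * rev k (nth [::] A 2) l.
Proof.
rewrite mxE !big_ord_recl big_ord0 !mxE /= addr0 addrA.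
by congr (_ + v _ _ * _ + v _ _ * _); exact: val_inj.
Qed.

Lemma row1P (v w : 'rV[R]_1) : v 0 0 = w 0 0 -> v = w.
Proof. by move=> h; apply/rowP => i; rewrite [i]ord1. Qed.

Lemma row2P (v w : 'rV[R]_2) : v 0 0 = w 0 0 -> v 0 1 = w 0 1 -> v = w.
Proof.
move=> h0 h1; apply/rowP => -[[|[|//]] hi].
  by rewrite (_ : Ordinal hi = 0) //; exact: val_inj.
by rewrite (_ : Ordinal hi = 1) //; exact: val_inj.
Qed.

Lemma row3P (v w : 'rV[R]_3) : v 0 0 = w 0 0 -> v 0 1 = w 0 1 -> v 0 2 = w 0 2 -> v = w.
Proof.
move=> h0 h1 h2; apply/rowP => -[[|[|[|//]]] hi].
- by rewrite (_ : Ordinal hi = 0) //; exact: val_inj.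
- by rewrite (_ : Ordinal hi = 1) //; exact: val_inj.
by rewrite (_ : Ordinal hi = 2) //; exact: val_inj.
Qed.

End TwoVariables.

Section GradedQuotients.
Variables (k : fieldType) (V : gmod k) (n : nat) (r : 'I_n -> V) (e : 'I_n -> int).
Hypothesis hr : forall i, gdeg (e i) (r i).
Local Notation R := {mpoly k[2]}.

Definition gqcls (x : V) : gquot hr := cls (gtot V) (gspan hr) x.

Lemma gqcls_linear a x y : gqcls (a *: x + y) = a *: gqcls x + gqcls y.
Proof. by rewrite /gqcls clsD // clsZ. Qed.

Lemma gqclsZ a x : gqcls (a *: x) = a *: gqcls x.
Proof. by rewrite /gqcls clsZ. Qed.

Lemma gqcls_eq0 x : gqcls x = 0 <-> exists c : 'I_n -> R, x = \sum_i c i *: r i.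
Proof.
rewrite /gqcls -(cls0 (gtot V) (gspan hr)); split.
  by move/(cls_eq _ (I : gtot V x) (I : gtot V 0)); rewrite subr0.
by move=> h; apply/(cls_eq _ (I : gtot V x) (I : gtot V 0)); rewrite subr0.
Qed.

Lemma gqcls_deg d x : gdeg d x -> gdeg d (gqcls x).
Proof. by move=> hx; exists x. Qed.

Lemma gqcls_surj d w : gdeg d w -> exists2 x, gdeg d x & gqcls x = w.
Proof. by case=> x [_ dx ->]; exists x. Qed.

End GradedQuotients.

Section Groups.
Variables (k : fieldType) (P : resolution k) (c : forall n, ghom (koszul k n) (P n)).
Hypotheses (cP : koszul_model c) (char0 : [pchar k] =i pred0).
Local Notation R := {mpoly k[2]}.
Local Notation s := ('X_0 : R).
Local Notation t := ('X_1 : R).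
Local Notation C := (lcpx_cpx k cx6_ok).

Lemma natr_neq0 n : (n.+1%:R : k) != 0.
Proof. by move/pcharf0P: char0 => ->. Qed.

(** [natr_neq0] takes the predecessor: 8 and 80 express that the denominators 9 and 81 are nonzero
    in k. *)
Definition giso_kcert0 t j W g0 g1 g2 d0 d1 f := @giso_kcert k P c cP 0 9 cx6 cx6_ok (kcert_at kcert0)
  kcert0_ok (natr_neq0 8) t j W g0 g1 g2 d0 d1 f.
Definition giso_kcert1 t j W g0 g1 g2 d0 d1 f := @giso_kcert k P c cP 1 81 cx6 cx6_ok (kcert_at kcert1)
  kcert1_ok (natr_neq0 80) t j W g0 g1 g2 d0 d1 f.
Definition giso_kcert2 t j W g0 g1 g2 d0 d1 f := @giso_kcert k P c cP 2 9 cx6 cx6_ok (kcert_at kcert2)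
  kcert2_ok (natr_neq0 8) t j W g0 g1 g2 d0 d1 f.

Arguments giso_kcert0 t j W (g0 g1 g2)%_Z_scope d0 d1 f.
Arguments giso_kcert1 t j W (g0 g1 g2)%_Z_scope d0 d1 f.
Arguments giso_kcert2 t j W (g0 g1 g2)%_Z_scope d0 d1 f.

Lemma zR1 : zR k (Zpos xH) = 1. Proof. by []. Qed.
Lemma zRN1 : zR k (Zneg xH) = -1. Proof. by rewrite /zR /= NegzE. Qed.

Lemma rev_consT j c0 a b r l : rev k (T j c0 a b :: r) l
  = (if j == l then zR k c0 * ('X_0 ^+ a * 'X_1 ^+ b) else 0) + rev k r l.
Proof. exact: rev_cons. Qed.

Definition revE := (rev_consT, rev_nil, zR1, zRN1, expr0, expr1, mul1r, mulr1, mulN1r, addr0, add0r,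
  mulr0).


Definition rowl n (l : seq R) : 'rV[R]_n := \row_i nth 0 l i.

Lemma sum2 (V : zmodType) (F : 'I_2 -> V) : \sum_i F i = F 0 + F 1.
Proof. by rewrite big_ord_recl big_ord1; congr (_ + F _); exact: val_inj. Qed.

Lemma gres_eq0 (x : R) : gqcls (@gens_k_deg k) x = 0 <-> exists a b, x = a * s + b * t.
Proof.
split=> [/gqcls_eq0[d ->]|[a [b ->]]]; first by exists (d 0), (d 1); rewrite sum2.
apply/gqcls_eq0; exists (fun i => if i == 0 then a else b); exact/esym/sum2.
Qed.

Lemma gcoker1_eq0 (x y : R) : gqcls (@rels1_deg k) (x, y) = 0 <->
  exists a b, x = a * t /\ y = - (a * s) + b * (s * t + s ^+ 2).
Proof.
split=> [/gqcls_eq0[d]|[a [b [-> ->]]]].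
  rewrite sum2 => -[-> ->]; exists (d 0), (d 1); split.
    by rewrite -[RHS]addr0; congr (_ + _); exact: mulr0.
  by congr (_ + _); exact: mulrN.
apply/gqcls_eq0; exists (fun i => if i == 0 then a else b); rewrite sum2; congr pair.
  by rewrite -[LHS]addr0; congr (_ + _); exact/esym/mulr0.
by congr (_ + _); exact/esym/mulrN.
Qed.

Lemma gcoker2_eq0 (x y : R) : gqcls (@rels2_deg k) (x, y) = 0 <->
  exists a b, x = a * t + b * (s * t + t ^+ 2) /\ y = - (a * s).
Proof.
split=> [/gqcls_eq0[d]|[a [b [-> ->]]]].
  rewrite sum2 => -[-> ->]; exists (d 0), (d 1); split=> //.
  by rewrite -[RHS]addr0; congr (_ + _); [exact: mulrN | exact: mulr0].
apply/gqcls_eq0; exists (fun i => if i == 0 then a else b); rewrite sum2; congr pair.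
by rewrite -[LHS]addr0; congr (_ + _); apply/esym; [exact: mulrN | exact: mulr0].
Qed.

(** For n = 1, degrees -4, -3, -2 contain the Koszul complex R(-2) -> R^2 -> R(2) on alpha_s,
    alpha_t, which resolves k(2) and ends in the third coordinate here. The other two coordinates
    map injectively, since alpha_t and alpha_s (alpha_s + alpha_t) are nonzero. *)
Lemma HHH1_m2 : giso (HHH P C 1 (-2)) (gshift 2 (gresidue k)).
Proof.
refine (@giso_kcert1 (-3) (-2) (gshift 2 (gresidue k)) [:: 0; 0] [:: -2; 0; -2] [:: -4; -4]
  [:: [:: T 2 1 1 0]; [:: T 2 1 0 1]] [:: [:: T 0 1 0 1; T 1 (-1) 1 0]; [:: T 1 1 1 1; T 1 1 2 0]]
  (fun v => gqcls (@gens_k_deg k) (v 0 2)) _ _ _ _ _ _ _ _ _ _) => //.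
- by move=> a x y; rewrite !mxE [LHS]gqcls_linear.
- by move=> d v hv; apply: gqcls_deg; exact: (hv 2).
- move=> v hv.
  have e0 := congr1 (fun w : 'rV[R]_2 => w 0 0) hv.
  have e1 := congr1 (fun w : 'rV[R]_2 => w 0 1) hv.
  rewrite row3_mul !revE /= mxE in e0; rewrite row3_mul !revE /= mxE in e1.
  have v0 : v 0 0 = 0 by move/eqP: e0; rewrite mulf_eq0 (negbTE (X1_neq0 k)) orbF => /eqP.
  have v1 : v 0 1 = 0.
    move/eqP: e1; rewrite v0 mul0r add0r expr2 -mulrDr [t + s]addrC !mulf_eq0.
    by rewrite (negbTE (X0_neq0 k)) (negbTE (sum_vars_neq0 k)) !orbF => /eqP.
  rewrite gres_eq0; split=> [[a [b E]]|[u ->]].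
    by exists (rowl 2 [:: a; b]); apply: row3P; rewrite row2_mul !mxE !revE /=.
  by exists (u 0 0), (u 0 1); rewrite row2_mul !revE.
move=> d w /gqcls_surj[x hx <-]; exists (rowl 3 [:: 0; 0; x]); split.
- move=> j; rewrite mxE; case: j => -[|[|[|//]]] hj /=; try exact: pdeg0.
  exact: hx.
- by apply: row2P; rewrite row3_mul !mxE /= !mul0r !addr0 !revE.
by rewrite mxE.
Qed.

(** For n = 2 there are two Koszul resolutions. The one of k(2) occupies degrees -6 to -4 and ends
    in the first coordinate here; the second coordinate begins the one of k(6), so a cycle has no
    such component. *)
Lemma HHH2_m4 : giso (HHH P C 2 (-4)) (gshift 2 (gresidue k)).
Proof.
refine (@giso_kcert2 (-5) (-4) (gshift 2 (gresidue k)) [:: 0; 0] [:: -2; -2] [:: -4; -4]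
  [:: [:: T 0 1 1 0]; [:: T 0 1 0 1]] [:: [::]; [:: T 0 1 0 1; T 1 (-1) 1 0]]
  (fun v => gqcls (@gens_k_deg k) (v 0 0)) _ _ _ _ _ _ _ _ _ _) => //.
- by move=> a x y; rewrite !mxE [LHS]gqcls_linear.
- by move=> d v hv; apply: gqcls_deg; exact: (hv 0).
- move=> v hv.
  have e0 := congr1 (fun w : 'rV[R]_2 => w 0 0) hv.
  rewrite row2_mul !revE /= mxE in e0.
  have v1 : v 0 1 = 0 by move/eqP: e0; rewrite mulf_eq0 (negbTE (X1_neq0 k)) orbF => /eqP.
  rewrite gres_eq0; split=> [[a [b E]]|[u ->]].
    by exists (rowl 2 [:: a; b]); apply: row2P; rewrite row2_mul !mxE !revE /=.
  by exists (u 0 0), (u 0 1); rewrite row2_mul !revE.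
move=> d w /gqcls_surj[x hx <-]; exists (rowl 2 [:: x; 0]); split.
- by move=> j; rewrite mxE; case: j => -[|[|//]] hj /=; [exact: hx | exact: pdeg0].
- by apply: row2P; rewrite row2_mul !mxE /= !mul0r !revE.
by rewrite mxE.
Qed.

(** The Koszul resolution of k(6) ends here in the third coordinate; the other two map injectively,
    since alpha_s and alpha_t (alpha_s + alpha_t) are nonzero. *)
Lemma HHH2_m2 : giso (HHH P C 2 (-2)) (gshift 6 (gresidue k)).
Proof.
refine (@giso_kcert2 (-3) (-2) (gshift 6 (gresidue k)) [:: -4; -4] [:: -6; -4; -6] [:: -8; -8]
  [:: [:: T 2 1 1 0]; [:: T 2 1 0 1]] [:: [:: T 0 1 0 1; T 1 (-1) 1 0]; [:: T 0 1 0 2; T 0 1 1 1]]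
  (fun v => gqcls (@gens_k_deg k) (v 0 2)) _ _ _ _ _ _ _ _ _ _) => //.
- by move=> a x y; rewrite !mxE [LHS]gqcls_linear.
- by move=> d v hv; apply: gqcls_deg; exact: (hv 2).
- move=> v hv.
  have e0 := congr1 (fun w : 'rV[R]_2 => w 0 0) hv.
  have e1 := congr1 (fun w : 'rV[R]_2 => w 0 1) hv.
  rewrite row3_mul !revE /= mxE in e0; rewrite row3_mul !revE /= mxE in e1.
  have v0 : v 0 0 = 0.
    by move/eqP: e1; rewrite mulrN oppr_eq0 mulf_eq0 (negbTE (X0_neq0 k)) orbF => /eqP.
  have v1 : v 0 1 = 0.
    move/eqP: e0; rewrite v0 mul0r add0r expr2 -mulrDl [t + s]addrC !mulf_eq0.
    by rewrite (negbTE (X1_neq0 k)) (negbTE (sum_vars_neq0 k)) !orbF => /eqP.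
  rewrite gres_eq0; split=> [[a [b E]]|[u ->]].
    by exists (rowl 2 [:: a; b]); apply: row3P; rewrite row2_mul !mxE !revE /=.
  by exists (u 0 0), (u 0 1); rewrite row2_mul !revE.
move=> d w /gqcls_surj[x hx <-]; exists (rowl 3 [:: 0; 0; x]); split.
- move=> j; rewrite mxE; case: j => -[|[|[|//]]] hj /=; try exact: pdeg0.
  exact: hx.
- by apply: row2P; rewrite row3_mul !mxE /= !mul0r !addr0 !revE.
by rewrite mxE.
Qed.

(** The outgoing differential is 0, so the group is the cokernel of the incoming one, whose third
    row is zero and hence missing from the list. *)
Lemma HHH1_m1 : giso (HHH P C 1 (-1)) (gshift 4 (gcoker1 k)).
Proof.
refine (@giso_kcert1 (-2) (-1) (gshift 4 (gcoker1 k)) [:: -2; 0; -2] [:: -4; -4] [:: -6; -4]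
  [:: [:: T 0 1 0 1; T 1 (-1) 1 0]; [:: T 1 1 1 1; T 1 1 2 0]] [::]
  (fun v => gqcls (@rels1_deg k) (v 0 0, v 0 1)) _ _ _ _ _ _ _ _ _ _) => //.
- by move=> a x y; rewrite !mxE [LHS](@gqcls_linear _ _ _ _ _ (@rels1_deg k) a (_, _) (_, _)).
- by move=> d v hv; apply: gqcls_deg; split; [exact: (hv 0) | exact: (hv 1)].
- move=> v _; rewrite gcoker1_eq0; split=> [[a [b [E0 E1]]]|[u ->]].
    by exists (rowl 3 [:: a; b; 0]); apply: row2P; rewrite row3_mul !mxE !revE /= ?E0 ?E1; ring.
  by exists (u 0 0), (u 0 1); rewrite !row3_mul !revE /=; split; ring.
move=> d w /gqcls_surj[x hx <-]; exists (rowl 2 [:: x.1; x.2]); split.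
- by move=> j; rewrite mxE; case: j => -[|[|//]] hj /=; case: hx.
- by rewrite mxs_nil mulmx0.
by rewrite !mxE /= -surjective_pairing.
Qed.

Lemma HHH2_m1 : giso (HHH P C 2 (-1)) (gshift 8 (gcoker2 k)).
Proof.
refine (@giso_kcert2 (-2) (-1) (gshift 8 (gcoker2 k)) [:: -6; -4; -6] [:: -8; -8] [:: -10]
  [:: [:: T 0 1 0 1; T 1 (-1) 1 0]; [:: T 0 1 0 2; T 0 1 1 1]] [::]
  (fun v => gqcls (@rels2_deg k) (v 0 0, v 0 1)) _ _ _ _ _ _ _ _ _ _) => //.
- by move=> a x y; rewrite !mxE [LHS](@gqcls_linear _ _ _ _ _ (@rels2_deg k) a (_, _) (_, _)).
- by move=> d v hv; apply: gqcls_deg; split; [exact: (hv 0) | exact: (hv 1)].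
- move=> v _; rewrite gcoker2_eq0; split=> [[a [b [E0 E1]]]|[u ->]].
    by exists (rowl 3 [:: a; b; 0]); apply: row2P; rewrite row3_mul !mxE !revE /= ?E0 ?E1; ring.
  by exists (u 0 0), (u 0 1); rewrite !row3_mul !revE /=; split; ring.
move=> d w /gqcls_surj[x hx <-]; exists (rowl 2 [:: x.1; x.2]); split.
- by move=> j; rewrite mxE; case: j => -[|[|//]] hj /=; case: hx.
- by rewrite mxs_nil mulmx0.
by rewrite !mxE /= -surjective_pairing.
Qed.

Lemma HHH0_0 : giso (HHH P C 0 0) (gfree k).
Proof.
refine (@giso_kcert0 (-1) 0 (gfree k) [::] [:: 0] [::] [::] [::]
  (fun v => v 0 0) _ _ _ _ _ _ _ _ _ _) => //.
- by move=> a x y; rewrite !mxE.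
- by move=> d v hv; have := hv 0; rewrite subr0.
- move=> v _; split=> [v0|[u ->]]; last by rewrite mxs_nil mulmx0 mxE.
  by exists 0; rewrite mul0mx; apply: row1P; rewrite v0 mxE.
move=> d w hw; exists (rowl 1 [:: w]); split; rewrite ?mxE //.
  by move=> j; rewrite mxE [j]ord1 /= subr0.
exact: thinmx0.
Qed.

Lemma HHH1_0 : giso (HHH P C 1 0) (gsum (gshift 6 (gfree k)) (gshift 4 (gfree k))).
Proof.
refine (@giso_kcert1 (-1) 0 (gsum (gshift 6 (gfree k)) (gshift 4 (gfree k))) [:: -4; -4] [:: -6; -4] [::]
  [::] [::] (fun v => (v 0 0, v 0 1)) _ _ _ _ _ _ _ _ _ _) => //.
- by move=> a x y; rewrite !mxE.
- by move=> d v hv; split; [exact: (hv 0) | exact: (hv 1)].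
- move=> v _; split=> [[v0 v1]|[u ->]]; last by rewrite mxs_nil mulmx0 !mxE.
  by exists 0; rewrite mul0mx; apply: row2P; rewrite ?v0 ?v1 mxE.
move=> d w hw; exists (rowl 2 [:: w.1; w.2]); split.
- by move=> j; rewrite mxE; case: j => -[|[|//]] hj /=; case: hw.
- exact: thinmx0.
by rewrite !mxE /= -surjective_pairing.
Qed.

Lemma HHH2_0 : giso (HHH P C 2 0) (gshift 10 (gfree k)).
Proof.
refine (@giso_kcert2 (-1) 0 (gshift 10 (gfree k)) [:: -8; -8] [:: -10] [::] [::] [::]
  (fun v => v 0 0) _ _ _ _ _ _ _ _ _ _) => //.
- by move=> a x y; rewrite !mxE.
- by move=> d v hv; exact: (hv 0).
- move=> v _; split=> [v0|[u ->]]; last by rewrite mxs_nil mulmx0 mxE.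
  by exists 0; rewrite mul0mx; apply: row1P; rewrite v0 mxE.
move=> d w hw; exists (rowl 1 [:: w]); split; rewrite ?mxE //.
  by move=> j; rewrite mxE [j]ord1.
exact: thinmx0.
Qed.

Lemma gtrivial_nogen n N (ct : int -> kcert) (okc : forall t, kcert_ok n N cx6 ct t) j :
  (int_of_Z N)%:~R != 0 :> k -> kc_gen (ct j) = [::] -> gtrivial (HHH P C n j).
Proof.
move=> N0 g1; refine (@gtrivial_kcert k P c cP n N cx6 cx6_ok ct okc N0 (j - 1) j
  _ [::] _ _ _ _ erefl g1 erefl erefl erefl _); first by rewrite subrK.
by move=> v _; exists 0; rewrite mul0mx; exact: thinmx0.
Qed.

Definition gtrivial_kcert1 t j g0 g1 g2 d0 d1 := @gtrivial_kcert k P c cP 1 81 cx6 cx6_ok (kcert_at kcert1)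
  kcert1_ok (natr_neq0 80) t j g0 g1 g2 d0 d1.
Definition gtrivial_kcert2 t j g0 g1 g2 d0 d1 := @gtrivial_kcert k P c cP 2 9 cx6 cx6_ok (kcert_at kcert2)
  kcert2_ok (natr_neq0 8) t j g0 g1 g2 d0 d1.
Arguments gtrivial_kcert1 t j (g0 g1 g2)%_Z_scope d0 d1.
Arguments gtrivial_kcert2 t j (g0 g1 g2)%_Z_scope d0 d1.

Lemma var_syzygy (x y : R) : x * s + y * t = 0 -> exists e, x = e * t /\ y = - (e * s).
Proof.
move=> h; have E : x * s = - y * t by apply/eqP; rewrite mulNr -addr_eq0 h.
by have [e [-> Ey]] := @mdvd_var k 0 1 x (- y) isT E; exists e; rewrite -Ey opprK.
Qed.

(** This is exactness in the middle of the Koszul complex on alpha_s, alpha_t. *)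
Lemma HHH1_m3 : gtrivial (HHH P C 1 (-3)).
Proof.
apply: (@gtrivial_kcert1 (-4) (-3) [:: 2] [:: 0; 0] [:: -2; 0; -2] [:: [:: T 0 1 0 1; T 1 (-1) 1 0]]
  [:: [:: T 2 1 1 0]; [:: T 2 1 0 1]]) => // v hv.
have := congr1 (fun w : 'rV[R]_3 => w 0 2) hv.
rewrite row2_mul !revE /= mxE => /var_syzygy[e [E0 E1]].
by exists (rowl 1 [:: e]); apply: row2P; rewrite row1_mul !mxE !revE /= ?E0 ?E1 ?mulrN.
Qed.

Lemma HHH1_m4 : gtrivial (HHH P C 1 (-4)).
Proof.
apply: (@gtrivial_kcert1 (-5) (-4) [::] [:: 2] [:: 0; 0] [::] [:: [:: T 0 1 0 1; T 1 (-1) 1 0]]) => // v hv.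
have := congr1 (fun w : 'rV[R]_2 => w 0 0) hv.
rewrite row1_mul !revE /= mxE => /eqP; rewrite mulf_eq0 (negbTE (X1_neq0 k)) orbF => /eqP v0.
by exists 0; rewrite mul0mx; apply: row1P; rewrite v0 mxE.
Qed.

Lemma HHH2_m3 : gtrivial (HHH P C 2 (-3)).
Proof.
apply: (@gtrivial_kcert2 (-4) (-3) [:: -2; -2] [:: -4; -4] [:: -6; -4; -6]
  [:: [::]; [:: T 0 1 0 1; T 1 (-1) 1 0]] [:: [:: T 2 1 1 0]; [:: T 2 1 0 1]]) => // v hv.
have := congr1 (fun w : 'rV[R]_3 => w 0 2) hv.
rewrite row2_mul !revE /= mxE => /var_syzygy[e [E0 E1]].
by exists (rowl 2 [:: 0; e]); apply: row2P; rewrite row2_mul !mxE !revE /= ?E0 ?E1 ?mulrN.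
Qed.

Lemma HHH2_m5 : gtrivial (HHH P C 2 (-5)).
Proof.
apply: (@gtrivial_kcert2 (-6) (-5) [:: 2] [:: 0; 0] [:: -2; -2] [:: [:: T 0 1 0 1; T 1 (-1) 1 0]]
  [:: [:: T 0 1 1 0]; [:: T 0 1 0 1]]) => // v hv.
have := congr1 (fun w : 'rV[R]_2 => w 0 0) hv.
rewrite row2_mul !revE /= mxE => /var_syzygy[e [E0 E1]].
by exists (rowl 1 [:: e]); apply: row2P; rewrite row1_mul !mxE !revE /= ?E0 ?E1 ?mulrN.
Qed.

Lemma HHH2_m6 : gtrivial (HHH P C 2 (-6)).
Proof.
apply: (@gtrivial_kcert2 (-7) (-6) [::] [:: 2] [:: 0; 0] [::] [:: [:: T 0 1 0 1; T 1 (-1) 1 0]]) => // v hv.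
have := congr1 (fun w : 'rV[R]_2 => w 0 0) hv.
rewrite row1_mul !revE /= mxE => /eqP; rewrite mulf_eq0 (negbTE (X1_neq0 k)) orbF => /eqP v0.
by exists 0; rewrite mul0mx; apply: row1P; rewrite v0 mxE.
Qed.

Lemma HHH0_triv j : j != 0 -> gtrivial (HHH P C 0 j).
Proof.
move=> j0; apply: (gtrivial_nogen kcert0_ok (natr_neq0 8)).
by case: j j0 => [[|j]|[|[|[|[|[|[|[|j]]]]]]]].
Qed.

Lemma HHH1_triv j : j \notin [:: 0; -1; -2] -> gtrivial (HHH P C 1 j).
Proof.
case: (eqVneq j (-3)) => [-> _|j3]; first exact: HHH1_m3.
case: (eqVneq j (-4)) => [-> _|j4 jn]; first exact: HHH1_m4.
apply: (gtrivial_nogen kcert1_ok (natr_neq0 80)).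
by move: j3 j4 jn; case: j => [[|j]|[|[|[|[|[|[|[|j]]]]]]]].
Qed.

Lemma HHH2_triv j : j \notin [:: 0; -1; -2; -4] -> gtrivial (HHH P C 2 j).
Proof.
case: (eqVneq j (-3)) => [-> _|j3]; first exact: HHH2_m3.
case: (eqVneq j (-5)) => [-> _|j5]; first exact: HHH2_m5.
case: (eqVneq j (-6)) => [-> _|j6 jn]; first exact: HHH2_m6.
apply: (gtrivial_nogen kcert2_ok (natr_neq0 8)).
by move: j3 j5 j6 jn; case: j => [[|j]|[|[|[|[|[|[|[|j]]]]]]]].
Qed.

End Groups.

Lemma HHH_gt2 (k : fieldType) (P : resolution k) (C : cpx k) n j :
  (forall n M, gtrivial (HH P n.+3 M)) -> (2 < n)%N -> gtrivial (HHH P C n j).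
Proof.
move=> h; case: n => [|[|[|n]]] // _ x; rewrite -[x]repK -[RHS](cls0 (gker _) (gim _)).
by rewrite [rep x]h.
Qed.

(** * Poincare series *)

Section HomogeneousPolynomials.
Variable k : fieldType.
Local Notation R := {mpoly k[2]}.

Lemma pdegXn (i : 'I_2) n : pdeg (2 * n)%N ('X_i ^+ n : R).
Proof. by rewrite mpolyXn => m; rewrite msuppX inE => /eqP ->; rewrite mdegMn mdeg1 mul1n. Qed.

Lemma pdegD d (p q : R) : pdeg d p -> pdeg d q -> pdeg d (p + q).
Proof. exact: (homog_add (@pdeg0 k) (@pdegB k)). Qed.

Lemma pdeg_eq0 (d : int) (p : R) : (forall n : nat, d <> (2 * n)%N) -> pdeg d p -> p = 0.
Proof.
move=> hd hp; apply/mpolyP => m; rewrite mcoeff0; apply: memN_msupp_eq0.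
by apply/negP => /hp E; case: (hd (mdeg m) (esym E)).
Qed.

(** A monomial of total exponent n is either 'X_i ^ n or divisible by 'X_j. *)
Lemma homog_split (i j : 'I_2) n (p : R) : i != j -> pdeg (2 * n)%N p ->
  exists c q, p = c%:MP * 'X_i ^+ n + 'X_j * q /\ pdeg ((2 * n)%N%:Z - 2) q.
Proof.
move=> ij hp; rewrite [p]mpolyE big_seq; elim/big_ind: _ => [|x y|m mp].
- by exists 0, 0; rewrite mpolyC0 mul0r mulr0 addr0; split=> //; exact: pdeg0.
- move=> [c [q [-> hq]]] [d [q' [-> hq']]]; exists (c + d), (q + q').
  by rewrite mpolyCD mulrDl mulrDr addrACA; split=> //; exact: pdegD.
have dm : mdeg m = n by have := hp m mp; lia.
have em : mdeg m = (m i + m j)%N.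
  rewrite mdegE big_ord_recl big_ord1; move: ij.
  by case: i => -[|[|//]] hi; case: j => -[|[|//]] hj //= _; [|rewrite addnC];
    congr (m _ + m _)%N; exact: val_inj.
case: (posnP (m j)) => [mj|mj].
  exists p@_m, 0; rewrite mulr0 addr0; split; last exact: pdeg0.
  rewrite mul_mpolyC mpolyXn; congr (_ *: 'X_[_]); apply/mnmP => l.
  rewrite mulmnE mnm1E; have [<-|il] := eqVneq i l; first by rewrite mul1n; lia.
  suff -> : l = j by rewrite mj mul0n.
  by apply: val_inj; move: ij il; rewrite -!val_eqE /=; have := ltn_ord i;
    have := ltn_ord j; have := ltn_ord l; lia.
have jm : (U_(j) <= m)%MM by rewrite lep1mP -lt0n.
exists 0, (p@_m *: 'X_[m - U_(j)]); rewrite mpolyC0 mul0r add0r -scalerAr -mpolyXD; split.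
  by rewrite addmC submK.
have -> : (2 * n)%N%:Z - 2 = (2 * mdeg (m - U_(j)))%N.
  by have := congr1 (@mdeg 2) (submK jm); rewrite mdegD mdeg1 dm => <-; lia.
by apply: pdegZ; exact: pdegXm.
Qed.

Lemma homog_const (p : R) : pdeg 0 p -> exists c, p = c%:MP.
Proof.
move=> hp; have [||c [q [-> hq]]] := @homog_split 0 1 0 p => //.
by exists c; rewrite expr0 mulr1 (pdeg_eq0 _ hq) ?mulr0 ?addr0 // => n; lia.
Qed.

(** Modulo 'X_i + 'X_j the variable 'X_i becomes - 'X_j. The part divisible by 'X_i is thus handled
    by induction on n, and its leading constant returns with the opposite sign. *)
Lemma homog_split_sum (i j : 'I_2) n (p : R) : i != j -> pdeg (2 * n)%N p ->
  exists c q, p = c%:MP * 'X_j ^+ n + ('X_i + 'X_j) * q.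
Proof.
move=> ij; elim: n p => [|n IH] p hp.
  by have [c ->] := homog_const hp; exists c, 0; rewrite expr0 mulr1 mulr0 addr0.
have ji : j != i by rewrite eq_sym.
have [c [q [-> hq]]] := homog_split ji hp.
have [|d [r ->]] := IH q.
  by have <- : (2 * n.+1)%N%:Z - 2 = (2 * n)%N by lia.
exists (c - d), (d%:MP * 'X_j ^+ n + 'X_i * r); rewrite mpolyCB exprS; ring.
Qed.

End HomogeneousPolynomials.

Definition has_series (k : fieldType) (V : gmod k) (f : qseries) : Prop :=
  forall d, exists2 m : nat, has_dim V d m & f d = m%:Z.

Section Dimensions.
Variable k : fieldType.
Local Notation R := {mpoly k[2]}.

Lemma has_dim0 (V : gmod k) d : (forall x : V, gdeg d x -> x = 0) -> has_dim V d 0.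
Proof.
move=> h; exists (fun=> 0); split=> [[]//|c _ [] //|x /h ->].
by exists (fun=> 0); rewrite big_ord0.
Qed.

Lemma even_int_case (d : int) : (exists n : nat, d = (2 * n)%N) \/ forall n : nat, d <> (2 * n)%N.
Proof.
case: d => d; last by right.
have [o|e] := boolP (odd d); last by left; exists d./2; have := odd_double_half d; lia.
by right=> n E; have := odd_double_half d; rewrite o; lia.
Qed.

Lemma qgeom_even n : qgeom (2 * n)%N = 1.
Proof. by rewrite /qgeom oddM. Qed.

Lemma qgeom2_even n : qgeom2 (2 * n)%N = n.+1.
Proof. by rewrite /qgeom2 oddM mul2n doubleK natz. Qed.

Lemma odd_of_not_even (d : int) : (forall n : nat, d <> (2 * n)%N) ->
  forall m : nat, d = m -> odd m.
Proof. by move=> h m dm; apply/negPn/negP => e; apply: (h m./2); have := odd_double_half m; lia. Qed.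

Lemma qgeom_odd (d : int) : (forall n : nat, d <> (2 * n)%N) -> qgeom d = 0.
Proof. by move/odd_of_not_even; case: d => // m /(_ m erefl) o; rewrite /qgeom o. Qed.

Lemma qgeom2_odd (d : int) : (forall n : nat, d <> (2 * n)%N) -> qgeom2 d = 0.
Proof. by move/odd_of_not_even; case: d => // m /(_ m erefl) o; rewrite /qgeom2 o. Qed.

Lemma has_series_giso (V W : gmod k) f : giso V W -> has_series W f -> has_series V f.
Proof. by move=> VW h d; have [m hm fm] := h d; exists m => //; exact: giso_has_dim VW hm. Qed.

Lemma has_series_shift (V : gmod k) f e : has_series V f -> has_series (gshift e V) (qX (- e) f).
Proof. by move=> h d; rewrite /qX opprK; exact: h. Qed.

Lemma has_series_sum (V W : gmod k) f g : has_series V f -> has_series W g ->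
  has_series (gsum V W) (f + g).
Proof.
move=> hV hW d; have [m [b [bd bf bs]] fm] := hV d; have [n [c [cd cf cs]] gn] := hW d.
exists (m + n)%N; last by rewrite fctE fm gn.
exists (fun i => match fintype.split i with inl i => (b i, 0) | inr j => (0, c j) end).
have sl (j : 'I_m) : fintype.split (fintype.lshift n j) = inl j by exact: (unsplitK (inl j)).
have sr (j : 'I_n) : fintype.split (rshift m j) = inr j by exact: (unsplitK (inr j)).
have E (x : 'I_(m + n) -> k) : \sum_i (x i)%:MP *: (match fintype.split i with inl i => (b i, 0)
      | inr j => (0, c j) end : gsum V W)
    = (\sum_i (x (fintype.lshift n i))%:MP *: b i, \sum_j (x (rshift m j))%:MP *: c j).
  rewrite big_split_ord /=; under eq_bigr do rewrite sl.
  under [X in _ + X]eq_bigr do rewrite sr.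
  rewrite [LHS]surjective_pairing (raddfD fst) (raddfD snd) /= !(raddf_sum fst) !(raddf_sum snd) /=.
  congr pair.
    by rewrite [X in _ + X]big1 ?addr0 // => j _; exact: scaler0.
  by rewrite [X in X + _]big1 ?add0r // => j _; exact: scaler0.
split=> [i|x|[v w] [/= /bs[x ->] /cs[y ->]]].
- case: (fintype.split i) => l; split; try exact: (gr0 (gdeg_grading _)); [exact: bd | exact: cd].
- rewrite E => -[/bf h1 /cf h2] i; rewrite -[i]splitK; case: (fintype.split i) => l /=; [exact: h1 | exact: h2].
exists (fun i => match fintype.split i with inl i => x i | inr j => y j end); rewrite E.
congr pair; apply: eq_bigr => i _; by rewrite ?sl ?sr.
Qed.

Lemma has_series_free : has_series (gfree k) qgeom2.
Proof.
move=> d; have [[n ->]|hd] := even_int_case d; last first.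
  by exists 0%N; [apply: has_dim0 => x; exact: pdeg_eq0 | exact: qgeom2_odd].
exists n.+1; last exact: qgeom2_even.
pose mm (i : 'I_n.+1) : 'X_{1..2} := [multinom (if l == 0%R then i : nat else (n - i)%N) | l < 2].
have mm0 i : mm i 0 = i by rewrite mnmE.
have mmd i : mdeg (mm i) = n.
  by rewrite mdegE big_ord_recl big_ord1 !mnmE /=; have := ltn_ord i; lia.
have E (c : 'I_n.+1 -> k) m : (\sum_i (c i)%:MP *: ('X_[mm i] : gfree k) : R)@_m
    = \sum_i c i * (mm i == m)%:R.
  rewrite raddf_sum; apply: eq_bigr => i _.
  rewrite -[LHS]/(((c i)%:MP * 'X_[mm i] : R)@_m).
  by rewrite mul_mpolyC mcoeffZ mcoeffX.
exists (fun i => 'X_[mm i]); split=> [i|c c0 i|x hx].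
- by have := @pdegXm k (mm i); rewrite mmd.
- have := E c (mm i); rewrite c0 mcoeff0 (bigD1 i) //= eqxx mulr1 big1 ?addr0 // => j ji.
  case: eqP => [/(congr1 (fun m : 'X_{1..2} => m 0))|_]; last by rewrite mulr0.
  by rewrite !mm0 => /val_inj E'; rewrite E' eqxx in ji.
exists (fun i => (x : R)@_(mm i)); apply/mpolyP => m; rewrite E.
have [dm|dm] := eqVneq (mdeg m) n; last first.
  rewrite big1 => [|i _].
    by apply: memN_msupp_eq0; apply: contra dm => /hx h; apply/eqP; lia.
  by case: eqP => [e|_]; [rewrite -e mmd eqxx in dm | rewrite mulr0].
have em : mdeg m = (m 0%R + m 1%R)%N.
  by rewrite mdegE big_ord_recl big_ord1; congr (_ + m _)%N; exact: val_inj.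
have lt : (m 0%R < n.+1)%N by lia.
have mE : mm (Ordinal lt) = m.
  apply/mnmP => -[[|[|//]] hl]; rewrite mnmE -val_eqE /=.
    by congr (m _); exact: val_inj.
  by rewrite (_ : Ordinal hl = 1); [lia | exact: val_inj].
rewrite (bigD1 (Ordinal lt)) //= mE eqxx mulr1 big1 ?addr0 // => j ji.
case: eqP => [e|_]; last by rewrite mulr0.
by case/eqP: ji; apply: val_inj; rewrite /= -e mm0.
Qed.

Lemma const_var_ideal (c : k) (a b : R) : c%:MP = a * 'X_0 + b * 'X_1 -> c = 0.
Proof.
move=> /(congr1 (fun p => mkill 0 (mkill 1 p))).
rewrite !mkillC mkillD !mkillM mkillD !mkillM !mkillX /=.
rewrite [mkill 0 (0 : R)](_ : _ = 0) ?mulr0 ?addr0; last by rewrite -(mpolyC0 2 k) mkillC.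
by move/eqP; rewrite mpolyC_eq0 => /eqP.
Qed.

Lemma has_series_residue : has_series (gresidue k) q1.
Proof.
move=> d; rewrite /q1; have [->|d0] := eqVneq d 0.
  exists 1%N => //; exists (fun=> gqcls (@gens_k_deg k) 1); split=> [_|c|x].
  - by apply: gqcls_deg; exact: pdegC.
  - rewrite big_ord1 -gqclsZ => /gres_eq0[a [b E]] i; rewrite [i]ord1.
    by apply: (@const_var_ideal _ a b); rewrite -E; exact/esym/mulr1.
  - case/gqcls_surj=> z /homog_const[c ->] <-; exists (fun=> c).
    by rewrite big_ord1 -gqclsZ; congr gqcls; exact/esym/mulr1.
exists 0%N => //; apply: has_dim0 => x /gqcls_surj[z hz <-]; apply/gres_eq0.
have [[n dn]|hd] := even_int_case d; last first.
  by rewrite (pdeg_eq0 hd hz); exists 0, 0; rewrite !mul0r addr0.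
case: n dn d0 => [-> //|n] dn _; rewrite dn in hz.
have [//|c [q [-> _]]] := @homog_split k 0 1 _ _ _ hz.
by exists (c%:MP * 'X_0 ^+ n), q; rewrite exprSr mulrA ['X_1 * q]mulrC.
Qed.

End Dimensions.

(** * Dimensions of the two cokernels *)

Section CokernelDimension.
Variables (k : fieldType) (i j : 'I_2) (W : gmod k).
Local Notation R := {mpoly k[2]}.
Local Notation x := ('X_i : R).
Local Notation y := ('X_j : R).
(** The map q presents W as R^2 modulo (y, - x) and (0, x (x + y)). Exchanging the variables and the
    two coordinates brings both cokernels into this form. *)
Variable q : R -> R -> W.
Hypothesis ij : i != j.
Hypothesis qL : forall a u v u' v', q (a * u + u') (a * v + v') = a *: q u v + q u' v'.
Hypothesis q0 : forall u v, q u v = 0 <->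
  exists a b, u = a * y /\ v = - (a * x) + b * (x * (x + y)).
Hypothesis q_deg : forall d u v, pdeg d u -> pdeg d v -> gdeg d (q u v).
Hypothesis q_surj : forall d w, gdeg d w -> exists u v, [/\ pdeg d u, pdeg d v & q u v = w].

Let qD u v u' v' : q (u + u') (v + v') = q u v + q u' v'.
Proof. by have := qL 1 u v u' v'; rewrite !mul1r scale1r. Qed.

Let q00 : q 0 0 = 0.
Proof. by apply/q0; exists 0, 0; rewrite !mul0r oppr0 addr0. Qed.

Let qZ a u v : a *: q u v = q (a * u) (a * v).
Proof. by have := qL a u v 0 0; rewrite !addr0 q00 addr0. Qed.

Let ji : j != i. Proof. by rewrite eq_sym. Qed.

Let kj : mkill j y = 0. Proof. by rewrite mkillX eqxx. Qed.
Let ki : mkill i x = 0. Proof. by rewrite mkillX eqxx. Qed.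
Let kji : mkill j x = x. Proof. by rewrite mkillX (negbTE ij). Qed.
Let kij : mkill i y = y. Proof. by rewrite mkillX (negbTE ji). Qed.

Let killXn l (u : R) n : mkill l (u ^+ n) = mkill l u ^+ n.
Proof. exact: rmorphXn. Qed.

Let CXn_eq0 (c : k) l n : c%:MP * 'X_l ^+ n = 0 :> R -> c = 0.
Proof.
move/eqP; rewrite mulf_eq0 expf_eq0 (negbTE (@mpolyX_neq0 k 2 l)) andbF orbF.
by rewrite mpolyC_eq0 => /eqP.
Qed.

(* c y^n is not divisible by x + y, as the substitution x = - y shows. *)
Let CXn_dvd (c : k) n b : c%:MP * y ^+ n = b * (x + y) :> R -> c = 0.
Proof.
pose g (p : R) := p \mPo [tuple (if l == i then - y else 'X_l) | l < 2].
have gX l : g 'X_l = if l == i then - y else 'X_l by rewrite /g comp_mpolyXU -tnth_nth tnth_mktuple.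
have gM p r : g (p * r) = g p * g r by exact: rmorphM.
have gD p r : g (p + r) = g p + g r by exact: rmorphD.
have gXn p m : g (p ^+ m) = g p ^+ m by exact: rmorphXn.
have gC e : g e%:MP = e%:MP by exact: comp_mpolyC.
move=> /(congr1 g); rewrite !gM gC gXn gD !gX eqxx (negbTE ji) addNr mulr0.
exact: CXn_eq0.
Qed.

Lemma coker_dim0 : has_dim W 0 2.
Proof.
exists (fun l => if l == 0 then q 1 0 else q 0 1); split=> [l|c|w].
- by case: ifP => _; apply: q_deg; (exact: pdeg0 || exact: pdegC).
- rewrite sum2 !qZ -qD !mulr1 !mulr0 add0r addr0 => /q0[a [b [E0 E1]]].
  have c0 : c 0 = 0.
    have /(congr1 (mkill j)) := E0; rewrite mkillM kj mulr0 mkillC.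
    by move/eqP; rewrite mpolyC_eq0 => /eqP.
  have a0 : a = 0.
    by move/eqP: E0; rewrite c0 mpolyC0 eq_sym mulf_eq0 (negbTE (@mpolyX_neq0 k 2 j)) orbF => /eqP.
  have c1 : c 1 = 0.
    have /(congr1 (mkill i)) := E1; rewrite a0 mul0r oppr0 add0r.
    rewrite !mkillM ki mul0r mulr0 mkillC; by move/eqP; rewrite mpolyC_eq0 => /eqP.
  by case=> -[|[|//]] hl; [rewrite -c0 | rewrite -c1]; congr c; exact: val_inj.
case/q_surj=> u [v [/homog_const[a ->] /homog_const[b ->] <-]].
exists (fun l => if l == 0 then a else b).
by rewrite sum2 !qZ -qD !mulr1 !mulr0 add0r addr0.
Qed.

(** Modulo (y, - x), the multiples of y in the first coordinate move to the second, and only c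
    x^(n+1) stays. In the second coordinate, division by x (x + y) leaves y^(n+1) and x y^n. *)
Lemma coker_dimS n : has_dim W (2 * n.+1)%N 3.
Proof.
pose b (l : 'I_3) := if l == 0 then q (x ^+ n.+1) 0
  else if l == 1 then q 0 (y ^+ n.+1) else q 0 (x * y ^+ n).
have E (c : 'I_3 -> k) : \sum_l (c l)%:MP *: b l
    = q ((c 0)%:MP * x ^+ n.+1) ((c 1)%:MP * y ^+ n.+1 + (c 2)%:MP * (x * y ^+ n)).
  rewrite big_ord_recl sum2 /b /= !qZ -!qD !mulr0 [0 + 0]addr0 [X in q X _]addr0 add0r.
  by congr (q _ (_%:MP * _ + _%:MP * _)); congr c; exact: val_inj.
exists b; split=> [l|c|w].
- rewrite /b; case: ifP => _; [|case: ifP => _]; apply: q_deg; try exact: pdeg0.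
  + exact: pdegXn.
  + exact: pdegXn.
  + have -> : (2 * n.+1)%N%:Z = 2 + (2 * n)%N by lia.
    by apply: (@pdegM _ 2 (2 * n)%N); [exact: pdegX | exact: pdegXn].
- rewrite E => /q0[a [d [E0 E1]]].
  have c0 : c 0 = 0.
    apply: (@CXn_eq0 _ i n.+1); have := congr1 (mkill j) E0.
    by rewrite !mkillM mkillC killXn kj kji mulr0.
  have a0 : a = 0.
    by move/eqP: E0; rewrite c0 mpolyC0 mul0r eq_sym mulf_eq0 (negbTE (@mpolyX_neq0 k 2 j)) orbF => /eqP.
  rewrite a0 mul0r oppr0 add0r in E1.
  have c1 : c 1 = 0.
    apply: (@CXn_eq0 _ j n.+1); have := congr1 (mkill i) E1.
    by rewrite mkillD !mkillM !mkillC killXn kij ki !mul0r !mulr0 addr0.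
  have c2 : c 2 = 0.
    apply: (@CXn_dvd _ n d); apply: (mulfI (@mpolyX_neq0 k 2 i)).
    by rewrite mulrCA -[LHS]add0r -[X in X + _](mul0r (y ^+ n.+1)) -mpolyC0 -c1 E1 mulrCA.
  by case=> -[|[|[|//]]] hl; [rewrite -c0 | rewrite -c1 | rewrite -c2]; congr c; exact: val_inj.
case/q_surj=> u [v [hu hv <-]].
have [c0 [u' [uE hu']]] := homog_split ij hu.
have hv' : pdeg (2 * n.+1)%N (v + x * u').
  apply: pdegD hv _; rewrite -[_%:Z](subrK 2) addrC.
  by apply: (@pdegM _ 2 _ _ _ _ hu'); exact: pdegX.
have [c1 [v1 [v1E hv1]]] := homog_split ji hv'.
have hv1' : pdeg (2 * n)%N v1 by have <- : (2 * n.+1)%N%:Z - 2 = (2 * n)%N by lia.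
have [c2 [v2 v2E]] := homog_split_sum ij hv1'.
exists (fun l => if l == 0 then c0 else if l == 1 then c1 else c2).
rewrite E /=; apply/eqP; rewrite -subr_eq0; apply/eqP.
rewrite -scaleN1r qZ -qD; apply/q0; exists u', v2; split; first by rewrite uE; ring.
have -> : v = c1%:MP * y ^+ n.+1 + x * v1 - x * u' by rewrite -v1E addrK.
by rewrite v2E; ring.
Qed.

Let qE d : (qgeom *+ 2 + qX 2 qgeom) d = qgeom d + qgeom d + qgeom (d - 2).
Proof. by rewrite mulr2n. Qed.

(** The dimensions in degrees 0, 2, 4, ... are 2, 3, 3, ..., the coefficients of (2 + Q^2) / (1 -
    Q^2). *)
Lemma coker_series : has_series W (qgeom *+ 2 + qX 2 qgeom).
Proof.
move=> d; have [[n dn]|hd] := even_int_case d; last first.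
  exists 0%N.
    apply: has_dim0 => w /q_surj[u [v [hu hv <-]]].
    by rewrite (pdeg_eq0 hd hu) (pdeg_eq0 hd hv).
  rewrite qE (qgeom_odd hd) qgeom_odd // => n E.
  by apply: (hd n.+1); lia.
rewrite dn; case: n {dn} => [|n].
  by exists 2%N; [exact: coker_dim0 | rewrite qE].
exists 3%N; first exact: coker_dimS.
have E : (2 * n.+1)%N%:Z - 2 = (2 * n)%N by lia.
by rewrite qE E !qgeom_even.
Qed.

End CokernelDimension.

Section CokernelSeries.
Variable k : fieldType.
Local Notation R := {mpoly k[2]}.

Lemma has_series_coker1 : has_series (gcoker1 k) (qgeom *+ 2 + qX 2 qgeom).
Proof.
apply: (@coker_series k 0 1 _ (fun u v => gqcls (@rels1_deg k) (u, v))) => //.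
- by move=> a u v u' v'; exact: (gqcls_linear (@rels1_deg k) a (u, v) (u', v')).
- move=> u v; split=> [/gcoker1_eq0|] [a [b [-> ->]]]; last apply/gcoker1_eq0;
    by exists a, b; split=> //; ring.
- by move=> d u v hu hv; apply: gqcls_deg.
by move=> d w /gqcls_surj[[u v] [hu hv] <-]; exists u, v.
Qed.

Lemma has_series_coker2 : has_series (gcoker2 k) (qgeom *+ 2 + qX 2 qgeom).
Proof.
apply: (@coker_series k 1 0 _ (fun u v => gqcls (@rels2_deg k) (v, u))) => //.
- by move=> a u v u' v'; exact: (gqcls_linear (@rels2_deg k) a (v, u) (v', u')).
(* The exchange reverses the sign of the first relation, which is absorbed into its coefficient. *)
- move=> u v; split=> [/gcoker2_eq0|] [a [b [-> ->]]]; last apply/gcoker2_eq0;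
    by exists (- a), b; split; ring.
- by move=> d u v hu hv; apply: gqcls_deg.
by move=> d w /gqcls_surj[[u v] [hu hv] <-]; exists v, u.
Qed.

End CokernelSeries.

Theorem mainTheorem10 (k : fieldType) (char0 : [pchar k] =i pred0)
    (P : resolution k) :
  let F : cpx k := rouquier_neg k (flatten (nseq 3 [:: 0; 1])) in
  let H : nat -> int -> gmod k := HHH P F in
  let R := gfree k in
  [/\ giso (H 0%N 0) R /\ (forall j, j != 0 -> gtrivial (H 0%N j)),
      [/\ giso (H 1%N 0) (gsum (gshift 6 R) (gshift 4 R)),
          giso (H 1%N (-1)) (gshift 4 (gcoker1 k)),
          giso (H 1%N (-2)) (gshift 2 (gresidue k))
        & forall j, j \notin [:: 0; -1; -2] -> gtrivial (H 1%N j)],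
      [/\ giso (H 2%N 0) (gshift 10 R),
          giso (H 2%N (-1)) (gshift 8 (gcoker2 k)),
          giso (H 2%N (-2)) (gshift 6 (gresidue k)),
          giso (H 2%N (-4)) (gshift 2 (gresidue k))
        & forall j, j \notin [:: 0; -1; -2; -4] -> gtrivial (H 2%N j)],
      forall n j, (2 < n)%N -> gtrivial (H n j)
    & has_poincare H
        (AT 0 0 qgeom2
         + AT 1 (-2) (qX (-2) q1)
         + AT 1 (-1) (qX (-4) (qgeom *+ 2 + qX 2 qgeom))
         + AT 1 0 (qX (-6) qgeom2 + qX (-4) qgeom2)
         + AT 2 (-4) (qX (-2) q1)
         + AT 2 (-2) (qX (-6) q1)
         + AT 2 (-1) (qX (-8) (qgeom *+ 2 + qX 2 qgeom))
         + AT 2 0 (qX (-10) qgeom2))].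
Proof.
move=> F H R.
have [[c cP] HH3] := koszul_model_ex P.
have FC n j : giso (H n j) (HHH P (lcpx_cpx k cx6_ok) n j).
  exact/giso_HHH_heq/heq_rouquier/(natr_neq0 char0 1).
have H00 : giso (H 0%N 0) R by exact: giso_trans (FC _ _) (HHH0_0 cP char0).
have H0 j : j != 0 -> gtrivial (H 0%N j).
  by move=> hj; apply: giso_gtrivial (FC _ _) (HHH0_triv cP char0 hj).
have H10 := giso_trans (FC _ _) (HHH1_0 cP char0).
have H11 := giso_trans (FC _ _) (HHH1_m1 cP char0).
have H12 := giso_trans (FC _ _) (HHH1_m2 cP char0).
have H1 j : j \notin [:: 0; -1; -2] -> gtrivial (H 1%N j).
  by move=> hj; apply: giso_gtrivial (FC _ _) (HHH1_triv cP char0 hj).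
have H20 := giso_trans (FC _ _) (HHH2_0 cP char0).
have H21 := giso_trans (FC _ _) (HHH2_m1 cP char0).
have H22 := giso_trans (FC _ _) (HHH2_m2 cP char0).
have H24 := giso_trans (FC _ _) (HHH2_m4 cP char0).
have H2 j : j \notin [:: 0; -1; -2; -4] -> gtrivial (H 2%N j).
  by move=> hj; apply: giso_gtrivial (FC _ _) (HHH2_triv cP char0 hj).
have H3 n j : (2 < n)%N -> gtrivial (H n j) by exact: HHH_gt2.
split=> //.
set S := (X in has_poincare _ X).
suff hS a t : has_series (H a t) (S a t) by move=> a t; exact: hS.
have triv (V : gmod k) f : gtrivial V -> f = 0 -> has_series V f.
  by move=> hV -> d; exists 0%N => //; exact: gtrivial_has_dim.
have sres e := has_series_shift e (@has_series_residue k).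
have sfree e := has_series_shift e (@has_series_free k).
case: a => [|[|[|a]]].
- have S0 : S 0%N t = if t == 0 then qgeom2 else 0.
    (* The summands with another power of A evaluate to 0, leaving a sum padded with literal
       zeros. *)
    have -> : S 0%N t = (if t == 0 then qgeom2 else 0) + 0 + 0 + 0 + 0 + 0 + 0 + 0 by [].
    by rewrite !addr0.
  have [t0|t0] := eqVneq t 0.
    rewrite S0 t0; exact: has_series_giso H00 (@has_series_free k).
  by apply: triv; [exact: H0 | rewrite S0 (negbTE t0)].
- have S1 : S 1%N t = (if t == -2 then qX (-2) q1 else 0)
      + (if t == -1 then qX (-4) (qgeom *+ 2 + qX 2 qgeom) else 0)
      + (if t == 0 then qX (-6) qgeom2 + qX (-4) qgeom2 else 0).
    rewrite -[RHS]addr0 -[RHS]addr0 -[RHS]addr0 -[RHS]addr0.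
    by rewrite -[if t == -2 then _ else _]add0r.
  have [t0|t0] := eqVneq t 0.
    rewrite S1 t0 /= !add0r.
    exact: has_series_giso H10 (has_series_sum (sfree 6) (sfree 4)).
  have [t1|t1] := eqVneq t (-1).
    rewrite S1 t1 /= !add0r addr0.
    exact: has_series_giso H11 (has_series_shift 4 (@has_series_coker1 k)).
  have [t2|t2] := eqVneq t (-2).
    rewrite S1 t2 /= !addr0; exact: has_series_giso H12 (sres 2).
  apply: triv; last by rewrite S1 (negbTE t0) (negbTE t1) (negbTE t2) !addr0.
  by apply: H1; rewrite !inE !negb_or t0 t1 t2.
- have S2 : S 2%N t = (if t == -4 then qX (-2) q1 else 0) + (if t == -2 then qX (-6) q1 else 0)
      + (if t == -1 then qX (-8) (qgeom *+ 2 + qX 2 qgeom) else 0)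
      + (if t == 0 then qX (-10) qgeom2 else 0).
    rewrite -[if t == -4 then _ else _]add0r -[X in X + (if t == -4 then _ else _)]addr0.
    by rewrite -[X in X + (if t == -4 then _ else _)]addr0 -[X in X + (if t == -4 then _ else _)]addr0.
  have [t0|t0] := eqVneq t 0.
    rewrite S2 t0 /= !add0r; exact: has_series_giso H20 (sfree 10).
  have [t1|t1] := eqVneq t (-1).
    rewrite S2 t1 /= !add0r addr0.
    exact: has_series_giso H21 (has_series_shift 8 (@has_series_coker2 k)).
  have [t2|t2] := eqVneq t (-2).
    rewrite S2 t2 /= !addr0 add0r; exact: has_series_giso H22 (sres 6).
  have [t4|t4] := eqVneq t (-4).
    rewrite S2 t4 /= !addr0; exact: has_series_giso H24 (sres 2).
  apply: triv; last by rewrite S2 (negbTE t0) (negbTE t1) (negbTE t2) (negbTE t4) !addr0.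
  by apply: H2; rewrite !inE !negb_or t0 t1 t2 t4.
apply: triv; first exact: H3.
have -> : S a.+3 t = 0 + 0 + 0 + 0 + 0 + 0 + 0 + 0 by [].
by rewrite !addr0.
Qed.
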